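(* Let $f:(R,\mathfrak{m},k)\rightarrow (S,\mathfrak{n},l)$ be a local homomorphism of noetherian local rings, and let $M$ be a non-zero finitely generated $S$-module, regarded as an $R$-module via $f$, such that $\operatorname{id}_{R}(M)\leq \operatorname{edim}(R)-\operatorname{edim}(S)$. Then the following assertions hold: (i) $M$ is an injective $S$-module, i.e. $M\cong E_{S}(l)^{\operatorname{type}_{S}(M)}$. (ii) $f$ is an exceptional complete intersection map. (iii) $\operatorname{id}_{R}(M)=\operatorname{edim}(R)-\operatorname{edim}(S)=\operatorname{fd}_{R}(S)$. In particular, if $M$ is injective as an $R$-module, then $\operatorname{edim}(R)=\operatorname{edim}(S)$ and $f$ is flat.
   Context: All rings are commutative with unity. For a local ring, the notation $(R,\mathfrak{m},k)$ records the maximal ideal $\mathfrak{m}$ and residue field $k=R/\mathfrak{m}$. A ring homomorphism $f:(R,\mathfrak{m})\to(S,\mathfrak{n})$ of local rings is local if $f(\mathfrak{m})\subseteq\mathfrak{n}$. $\operatorname{id}$ and $\operatorname{fd}$ denote injective and flat dimension, $\dim$ is Krull dimension, and $\operatorname{edim}(R)$ is the minimal number of generators of $\mathfrak{m}$. $E_S(l)$ is the injective envelope of $l$ over $S$, and $\operatorname{type}_S(M)=\operatorname{rank}_l \operatorname{Ext}^{d}_S(l,M)$, where $d=\operatorname{depth}_S(\mathfrak{n},M)=\inf\{i:\operatorname{Ext}^i_S(l,M)\neq 0\}$. Cohen factorization: every local homomorphism $f:(R,\mathfrak{m})\to S$ of noetherian local rings admits a factorization of the composite $R\xrightarrow{f}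 S\to\widehat{S}$ (with $\widehat{S}$ the completion of $S$ at its maximal ideal) as $R\xrightarrow{\dot f}R'\xrightarrow{f'}\widehat{S}$, where $R'$ is a noetherian local ring, $\dot f$ and $f'$ are local, $\dot f$ is flat with regular closed fiber $R'/\mathfrak{m}R'$, and $f'$ is surjective. The map $f$ is a complete intersection map if there is a Cohen factorization such that $\operatorname{Ker}(f')$ is generated by a (possibly empty) regular sequence on $R'$ (this is independent of the chosen Cohen factorization). For a complete intersection map $f$ one has $\operatorname{edim}(R)-\dim(R)\leq\operatorname{edim}(S)-\dim(S)$; $f$ is an exceptional complete intersection map if it is a complete intersection map and equality holds here. *)

(* Defs.v *)
From HB Require Import structures.
From mathcomp Require Import all_boot all_order all_algebra.
From mathcomp Require Import sesquilinear.
From mathcomp Require Import boolp classical_sets constructive_ereal.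

Set Implicit Arguments.
Unset Strict Implicit.
Unset Printing Implicit Defensive.

Import Order.TTheory GRing.Theory Num.Theory.

Local Open Scope classical_set_scope.
Local Open Scope ring_scope.

(* Dimensions take values in \bar int, so that they may be infinite and so    *)
(* that edim R - edim S is a genuine, possibly negative, difference.          *)
Definition nat_inf (A : set nat) : \bar int :=
  infimum +oo%E [set (i%:Z)%:E | i in A].
Definition nat_sup (A : set nat) : \bar int :=
  supremum -oo%E [set (i%:Z)%:E | i in A].

Section Modules.
Variable R : comNzRingType.

Definition submodule (M : lmodType R) (N : set M) : Prop :=
  N 0 /\ forall (a : R) (x y : M), N x -> N y -> N (a *: x + y).

Definition mspan (M : lmodType R) (A : set M) : set M :=
  smallest (@submodule M) A.

Definition fin_gen (M : lmodType R) : Prop :=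
  exists s : seq M, mspan [set` s] = setT.

Definition nonzero_module (M : lmodType R) : Prop := exists x : M, x != 0.

Definition mod_iso (M N : lmodType R) : Prop :=
  exists h : {linear M -> N}, bijective h.

End Modules.

Section Ideals.
Variable R : comNzRingType.

Definition ideal (I : set R) : Prop := submodule (I : set R^o).

Definition ideal_gen (A : set R) : set R := mspan (A : set R^o).

Definition prime_ideal (P : set R) : Prop :=
  [/\ ideal P, ~ P 1 & forall x y, P (x * y) -> P x \/ P y].

Definition maximal_ideal (I : set R) : Prop :=
  [/\ ideal I, ~ I 1 & forall J, ideal J -> ~ J 1 -> I `<=` J -> J = I].

Definition ideal_pow (I : set R) (i : nat) : set R :=
  iter i (fun J => ideal_gen [set x * y | x in I & y in J]) setT.

Definition noetherian : Prop :=
  forall I : set R, ideal I -> exists s : seq R, I = ideal_gen [set` s].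

Definition krull_dim : \bar int :=
  nat_sup [set n | exists P : nat -> set R,
    (forall i, (i <= n)%N -> prime_ideal (P i)) /\
    (forall i, (i < n)%N -> P i `<` P i.+1)].

Definition noetherian_local (m : set R) : Prop :=
  [/\ noetherian, maximal_ideal m & forall I, maximal_ideal I -> I = m].

(* edim R, for R local with maximal ideal m *)
Definition edim (m : set R) : \bar int :=
  nat_inf [set n | exists s : seq R, size s = n /\ m = ideal_gen [set` s]].

Definition regular_local (m : set R) : Prop :=
  noetherian_local m /\ edim m = krull_dim.

Definition regular_sequence (s : seq R) : Prop :=
  ~ ideal_gen [set` s] 1 /\
  forall i, (i < size s)%N -> forall y,
    ideal_gen [set` take i s] (s`_i * y) -> ideal_gen [set` take i s] y.

End Ideals.

Arguments krull_dim R : clear implicits.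
Arguments noetherian R : clear implicits.

Section RingMorphisms.
Variables R S : comNzRingType.

Definition kernel (f : {rmorphism R -> S}) : set R := [set x | f x = 0].

(* S is the quotient of R by I, with projection f *)
Definition is_quotient (I : set R) (f : {rmorphism R -> S}) : Prop :=
  (forall y, exists x, f x = y) /\ kernel f = I.

Definition local_hom (m : set R) (n : set S) (f : {rmorphism R -> S}) : Prop :=
  f @` m `<=` n.

End RingMorphisms.

(* (Sh, c) is the n-adic completion of S, i.e. the inverse limit of the tower *)
(* Q i = S / n^(i+1); the index is shifted as S / n^0 is the zero ring.       *)
Definition is_completion (S Sh : comNzRingType) (n : set S)
    (c : {rmorphism S -> Sh}) : Prop :=
  exists (Q : nat -> comNzRingType)
    (p : forall i, {rmorphism S -> Q i})
    (t : forall i, {rmorphism Q i.+1 -> Q i})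
    (q : forall i, {rmorphism Sh -> Q i}),
  [/\ forall i, is_quotient (ideal_pow n i.+1) (p i),
      forall i x, t i (p i.+1 x) = p i x,
      forall i x, t i (q i.+1 x) = q i x,
      forall i x, q i (c x) = p i x &
      forall y : (forall i, Q i), (forall i, t i (y i.+1) = y i) ->
        exists! x : Sh, forall i, q i x = y i].

(* Restriction of scalars: the S-module M viewed as an R-module through f.    *)
Definition restrict (R S : comNzRingType) (f : {rmorphism R -> S})
  (M : lmodType S) : Type := M.

Section Restrict.
Variables (R S : comNzRingType) (f : {rmorphism R -> S}) (M : lmodType S).

HB.instance Definition _ := GRing.Zmodule.on (restrict f M).

Definition restrict_scale (a : R) (x : restrict f M) : restrict f M :=
  f a *: (x : M).

Fact restrict_scaleA a b x :
  restrict_scale a (restrict_scale b x) = restrict_scale (a * b) x.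
Proof. by rewrite /restrict_scale scalerA rmorphM. Qed.

Fact restrict_scale1 : left_id 1 restrict_scale.
Proof. by move=> x; rewrite /restrict_scale rmorph1 scale1r. Qed.

Fact restrict_scaleDr : right_distributive restrict_scale +%R.
Proof. by move=> a x y; rewrite /restrict_scale; exact: scalerDr. Qed.

Fact restrict_scaleDl x : {morph restrict_scale^~ x : a b / a + b}.
Proof. by move=> a b; rewrite /restrict_scale rmorphD; exact: scalerDl. Qed.

HB.instance Definition _ := GRing.Zmodule_isLmodule.Build R (restrict f M)
  restrict_scaleA restrict_scale1 restrict_scaleDr restrict_scaleDl.

End Restrict.

Section Homological.
Variable R : comNzRingType.

Definition injective_module (J : lmodType R) : Prop :=
  forall (A B : lmodType R) (u : {linear A -> B}) (v : {linear A -> J}),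
    injective u -> exists w : {linear B -> J}, forall a, w (u a) = v a.

(* (T, t) is a tensor product of M and A over R *)
Definition is_tensor (M A T : lmodType R) (t : {bilinear M -> A -> T}) : Prop :=
  forall (P : lmodType R) (g : {bilinear M -> A -> P}),
    (exists h : {linear T -> P}, forall x a, h (t x a) = g x a) /\
    (forall h h' : {linear T -> P},
       (forall x a, h (t x a) = g x a) -> (forall x a, h' (t x a) = g x a) ->
       h =1 h').

(* h below is the map M (x) u *)
Definition flat (M : lmodType R) : Prop :=
  forall (A B : lmodType R) (u : {linear A -> B}), injective u ->
  forall (TA TB : lmodType R)
    (tA : {bilinear M -> A -> TA}) (tB : {bilinear M -> B -> TB}),
  is_tensor tA -> is_tensor tB ->
  forall h : {linear TA -> TB}, (forall x a, h (tA x a) = tB x (u a)) ->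
  injective h.

Definition injective_resolution (M : lmodType R) (I : nat -> lmodType R)
    (e : {linear M -> I 0%N}) (d : forall i, {linear I i -> I i.+1}) : Prop :=
  [/\ forall i, injective_module (I i),
      injective e,
      forall x, d 0%N x = 0 <-> exists y, e y = x &
      forall i x, d i.+1 x = 0 <-> exists y, d i y = x].

Definition flat_resolution (M : lmodType R) (F : nat -> lmodType R)
    (e : {linear F 0%N -> M}) (d : forall i, {linear F i.+1 -> F i}) : Prop :=
  [/\ forall i, flat (F i),
      forall y, exists x, e x = y,
      forall x, e x = 0 <-> exists y, d 0%N y = x &
      forall i x, d i x = 0 <-> exists y, d i.+1 y = x].

(* Following the usual convention for non-zero modules; the zero module gets  *)
(* dimension 0 here.                                                          *)
Definition inj_dim (M : lmodType R) : \bar int :=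
  nat_inf [set n | exists (I : nat -> lmodType R) (e : {linear M -> I 0%N})
    (d : forall i, {linear I i -> I i.+1}),
    injective_resolution e d /\
    forall i, (n < i)%N -> forall x : I i, x = 0].

Definition flat_dim (M : lmodType R) : \bar int :=
  nat_inf [set n | exists (F : nat -> lmodType R) (e : {linear F 0%N -> M})
    (d : forall i, {linear F i.+1 -> F i}),
    flat_resolution e d /\
    forall i, (n < i)%N -> forall x : F i, x = 0].

(* Degree i cocycles and coboundaries of the complex Hom(N, I).               *)
Definition cocycle (N : lmodType R) (I : nat -> lmodType R)
    (d : forall i, {linear I i -> I i.+1}) (i : nat)
    (phi : {linear N -> I i}) : Prop :=
  forall x, d i (phi x) = 0.

Definition coboundary (N : lmodType R) (I : nat -> lmodType R)
    (d : forall i, {linear I i -> I i.+1}) (i : nat) :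
    {linear N -> I i} -> Prop :=
  match i with
  | 0%N => fun phi => forall x, phi x = 0
  | j.+1 => fun phi => exists psi : {linear N -> I j},
              forall x, phi x = d j (psi x)
  end.

(* E is (isomorphic to) Ext^i_R(N, M): for some injective resolution I of M,  *)
(* q is an R-linear surjection from the degree i cocycles of Hom(N, I) onto E *)
(* whose kernel consists of the coboundaries.                                 *)
Definition is_Ext (i : nat) (N M E : lmodType R) : Prop :=
  exists (I : nat -> lmodType R) (e : {linear M -> I 0%N})
    (d : forall i, {linear I i -> I i.+1}) (q : {linear N -> I i} -> E),
  [/\ injective_resolution e d,
      forall (a : R) (phi psi chi : {linear N -> I i}),
        cocycle d phi -> cocycle d psi ->
        (forall x, chi x = a *: phi x + psi x) ->
        q chi = a *: q phi + q psi,
      forall y, exists phi, cocycle d phi /\ q phi = y &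
      forall phi, cocycle d phi -> (q phi = 0 <-> coboundary d phi)].

Definition injective_envelope (L E : lmodType R) (j : {linear L -> E}) : Prop :=
  [/\ injective_module E, injective j &
      forall N : set E, submodule N -> (exists x, N x /\ x != 0) ->
        exists y, N (j y) /\ j y != 0].

End Homological.

Section LocalInvariants.
Variables (S : comNzRingType) (l : fieldType) (pl : {rmorphism S -> l}).

(* In this section pl is the projection of the local ring S onto its residue  *)
(* field l.                                                                   *)
Definition residue_module : lmodType S := restrict pl l^o.

Definition depth (M : lmodType S) : \bar int :=
  nat_inf [set i | exists E, is_Ext i residue_module M E /\ nonzero_module E].

(* The l-vector space Ext^d(l, M) has rank r iff it is S-isomorphic to l^r.   *)
Definition has_type (M : lmodType S) (r : nat) : Prop :=
  exists d : nat, depth M = (d%:Z)%:E /\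
    is_Ext d residue_module M (restrict pl 'rV[l]_r).

End LocalInvariants.

Section CompleteIntersection.
Variables (R S : comNzRingType) (m : set R) (n : set S).

Definition cohen_factorization (Sh R' : comNzRingType) (nh : set Sh)
    (m' : set R') (g : {rmorphism R -> Sh})
    (f1 : {rmorphism R -> R'}) (f2 : {rmorphism R' -> Sh}) : Prop :=
  [/\ noetherian_local m',
      local_hom m m' f1 /\ local_hom m' nh f2,
      forall x, f2 (f1 x) = g x,
      flat (restrict f1 R'^o) /\
        (exists (Q : comNzRingType) (p : {rmorphism R' -> Q}) (mQ : set Q),
           is_quotient (ideal_gen (f1 @` m)) p /\ regular_local mQ) &
      forall y, exists x, f2 x = y].

Definition ci_map (f : {rmorphism R -> S}) : Prop :=
  exists (Sh : comNzRingType) (nh : set Sh) (c : {rmorphism S -> Sh})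
    (R' : comNzRingType) (m' : set R')
    (f1 : {rmorphism R -> R'}) (f2 : {rmorphism R' -> Sh}),
  [/\ is_completion n c, noetherian_local nh,
      cohen_factorization nh m' (c \o f) f1 f2 &
      exists s : seq R', regular_sequence s /\ kernel f2 = ideal_gen [set` s]].

Definition exceptional_ci_map (f : {rmorphism R -> S}) : Prop :=
  ci_map f /\ (edim m - krull_dim R = edim n - krull_dim S)%E.

End CompleteIntersection.

(* Main.v *)
(* Put r = edim R, e = edim S and d = r - e. Let R[Y_1, ..., Y_e] act on S by *)
(* sending the Y_j to generators of n. Each of r minimal generators x_a of m  *)
(* satisfies a relation x_a - sum_j s_aj Y_j acting as 0 on M, and these r    *)
(* elements are independent modulo the square of (m, Y). Multiplication by    *)
(* their Koszul cochains embeds Ext^1_S(l, M) into an Ext over R[Y] in degree *)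
(* r + 1 = d + e + 1, which vanishes as id_R M <= d; the same applies to a    *)
(* quotient of M with non-zero socle, and this makes n nilpotent and then M   *)
(* injective over S, so that Matlis theory gives (i). The same cochains show  *)
(* that no smaller d is possible, and duality into an injective cogenerator   *)
(* of R exchanges id_R M and fd_R S, which is (iii).                          *)
(* For (ii), S is complete since n is nilpotent. Completing a huge polynomial *)
(* ring modulo relations lifting a tower of generators of l over k gives a    *)
(* flat local R -> L with regular closed fibre of dimension e and L -> S      *)
(* surjective. The r relations z lifted to L already generate the kernel: the *)
(* argument above applies to L/(z) -> S, over which M is faithful. Finally R  *)
(* has a regular sequence of length d, so L has one of length d + e = r, all  *)
(* of whose members have a power in (z); this makes the Koszul complex of the *)
(* r elements z exact below degree r, and therefore z regular. Comparing      *)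
(* chains of primes gives dim R = d and dim S = 0, so edim R - dim R and      *)
(* edim S - dim S are both e.                                                 *)

Require Import Defs.
From HB Require Import structures.
From mathcomp Require Import all_boot all_order all_algebra.
From mathcomp Require Import sesquilinear ring.
From mathcomp Require Import boolp classical_sets functions constructive_ereal.
From mathcomp Require finmap.
From mathcomp Require multinomials.monalg.
From mathcomp Require wochoice.
Import Defs.

Set Implicit Arguments.
Unset Strict Implicit.
Unset Printing Implicit Defensive.

Import Order.TTheory GRing.Theory Num.Theory.

Local Open Scope classical_set_scope.
Local Open Scope ring_scope.

(** * Submodules, quotients and homomorphisms *)

(** Let r and e be the embedding dimensions of R and S, and d = r - e, so that id_R M <= d. Let A =
    R[Y_1, ..., Y_e] map to S with the Y_j going to generators of n, and put q = (m, Y). The Ext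
    modules of A/q into M vanish above degree d + e = r, and the r minimal generators of m together
    with the Y_j are independent in q/q^2 ([tower_ex]). Under such independence [koszul_lift] turns
    the Koszul product of a family of linear forms on q into a Koszul coboundary as soon as the
    relevant Ext vanishes. Over S the generators of m are combinations of the generators of n, and
    [kos_elim] strips them off. A linear form n -> M placed in degree r thus becomes multiplication
    by an element, that is Ext^1_S(l, M) = 0 ([local_ext_from]). The same device applied to a socle
    element shows that it would vanish if id_R M were below d ([local_ext_lower]).

    The vanishing of Ext^1_S(l, -) holds for every S-module of injective dimension at most d over R.
    Some finitely generated quotient of M of this kind has a non-zero socle ([fg_nonzero_socle]),
    and this forces n to be nilpotent ([ext_from_nilpotent]). Then M is injective and faithful over
    S, and is a sum of copies of one injective hull ([matlis_structure]). If J is an injective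
    cogenerator of R, then Hom_R(S, J) and M are injective cogenerators of S, hence summands of
    powers of each other, and duality gives id_R M = fd_R S ([fdle_iff]).

    For the complete intersection property, [gonflement] enlarges A to a flat noetherian local ring
    L with maximal ideal qL that maps onto S; its closed fibre over R is regular of dimension e.
    Faithfulness of M over L/(z) identifies the kernel of L -> S with an ideal (z) generated by r
    elements ([kernel_presentation]). Since R has a regular sequence of length d
    ([regular_sequence_ex]), L has one of length d + e = r, and its members have powers in (z)
    because n is nilpotent. So the Koszul complex of z is exact below the top degree
    ([koszul_vanish]) and z is regular ([exact_regular]). Going down and Krull's height theorem give
    dim R = d ([krull_dim_base]), while dim S = 0. *)

Section LinOf.
Variables (R : comNzRingType) (A B : lmodType R) (f : A -> B).
Hypothesis fl : forall a x y, f (a *: x + y) = a *: f x + f y.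

(** The dummy argument gives [linof_fun tt] a head constant of its own to carry the linear
    structure, whatever term [f] is. *)
Definition linof_fun (_ : unit) := f.

Definition linof : {linear A -> B} :=
  HB.pack (linof_fun tt) (GRing.isLinear.Build R A B *:%R (linof_fun tt) fl).

Lemma linofE x : linof x = f x. Proof. by []. Qed.
End LinOf.

(** * Subquotients of abelian groups, modules and rings *)

Section SubquotientZmodule.
Variable V : zmodType.

Record zdat := ZDat {
  zC : set V;
  zN : set V;
  zC0 : zC 0;
  zCB : forall x y, zC x -> zC y -> zC (x - y);
  zN0 : zN 0;
  zNB : forall x y, zN x -> zN y -> zN (x - y);
  zNC : zN `<=` zC }.

Variable D : zdat.

Definition zrep (x : V) : V := xget 0 [set y | zN D (x - y)].

Lemma zrepP x : zN D (x - zrep x).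
Proof. by rewrite /zrep; case: xgetP => // /(_ x); rewrite /= subrr => /(_ (zN0 D)). Qed.

Lemma zNN x : zN D x -> zN D (- x).
Proof. by move=> h; rewrite -sub0r; apply: zNB => //; apply: zN0. Qed.

Lemma zND x y : zN D x -> zN D y -> zN D (x + y).
Proof. by move=> h h'; rewrite -[y]opprK; apply: zNB => //; apply: zNN. Qed.

Lemma zCN x : zC D x -> zC D (- x).
Proof. by move=> h; rewrite -sub0r; apply: zCB => //; apply: zC0. Qed.

Lemma zCD x y : zC D x -> zC D y -> zC D (x + y).
Proof. by move=> h h'; rewrite -[y]opprK; apply: zCB => //; apply: zCN. Qed.

Lemma zrep_eq x y : zN D (x - y) -> zrep x = zrep y.
Proof.
move=> h; rewrite /zrep; congr xget; apply/seteqP; split=> t /= ht.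
  by rewrite -(subrKA x) addrC; apply: zND => //; rewrite -opprB; apply: zNN.
by rewrite -(subrKA y); apply: zND.
Qed.

Lemma zrepC x : zC D x -> zC D (zrep x).
Proof.
move=> h; rewrite -[zrep x](subKr x); apply: zCB => //.
by apply: zNC; apply: zrepP.
Qed.

Lemma zrepK x : zrep (zrep x) = zrep x.
Proof. by apply/esym/zrep_eq/zrepP. Qed.

Definition zsq := {x : V | `[< zC D x /\ zrep x = x >]}.
HB.instance Definition _ := [Choice of zsq by <:].

Definition zpr0 : zsq.
Proof.
exists (zrep 0); apply/asboolP; split; last exact: zrepK.
by apply: zrepC; apply: zC0.
Defined.

(** Total on V for convenience; outside C the value is the default [zpr0], and the lemmas below only
    speak of C. *)
Definition zpr (x : V) : zsq := insubd zpr0 (zrep x).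

Lemma val_zpr x : zC D x -> val (zpr x) = zrep x.
Proof.
move=> h; rewrite /zpr insubdK // unfold_in; apply/asboolP.
by split; [exact: zrepC | exact: zrepK].
Qed.

Lemma zvalC (u : zsq) : zC D (val u).
Proof. by case: u => x /= /asboolP[]. Qed.

Lemma zvalK (u : zsq) : zpr (val u) = u.
Proof.
apply: val_inj; rewrite val_zpr; last exact: zvalC.
by case: u => x /= /asboolP[].
Qed.

Lemma zprE x y : zC D x -> zC D y -> (zpr x = zpr y <-> zN D (x - y)).
Proof.
move=> hx hy; split=> [/(congr1 val)|h]; last first.
  by apply: val_inj; rewrite !val_zpr //; apply: zrep_eq.
rewrite !val_zpr // => h; rewrite -(subrKA (zrep x)); apply: zND.
  exact: zrepP.
by rewrite h -opprB; apply: zNN; apply: zrepP.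
Qed.

Lemma zpr_val x : zC D x -> zN D (val (zpr x) - x).
Proof. by move=> h; rewrite val_zpr // -opprB; apply: zNN; apply: zrepP. Qed.

Definition zadd (u v : zsq) := zpr (val u + val v).
Definition zopp (u : zsq) := zpr (- val u).

Lemma zprD x y : zC D x -> zC D y -> zpr (x + y) = zadd (zpr x) (zpr y).
Proof.
move=> hx hy; apply/zprE; [exact: zCD| by apply: zCD; exact: zvalC|].
rewrite -opprB; apply: zNN.
have -> : val (zpr x) + val (zpr y) - (x + y) =
  (val (zpr x) - x) + (val (zpr y) - y) by rewrite opprD addrACA.
by apply: zND; apply: zpr_val.
Qed.

Lemma zprN x : zC D x -> zpr (- x) = zopp (zpr x).
Proof.
move=> hx; apply/zprE; [exact: zCN| by apply: zCN; exact: zvalC|].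
by rewrite opprK addrC; apply: zpr_val.
Qed.

Lemma zsqP (u : zsq) : exists2 x, zC D x & u = zpr x.
Proof. by exists (val u); [exact: zvalC | rewrite zvalK]. Qed.

Fact zaddA : associative zadd.
Proof.
move=> u v w; have [x hx ->] := zsqP u; have [y hy ->] := zsqP v.
have [z hz ->] := zsqP w.
by rewrite -!zprD ?addrA //; apply: zCD.
Qed.

Fact zaddC : commutative zadd.
Proof. by move=> u v; rewrite /zadd addrC. Qed.

Fact zadd0 : left_id (zpr 0) zadd.
Proof.
move=> u; have [x hx ->] := zsqP u.
by rewrite -zprD ?add0r //; apply: zC0.
Qed.

Fact zaddN : left_inverse (zpr 0) zopp zadd.
Proof.
move=> u; have [x hx ->] := zsqP u.
by rewrite -zprN // -zprD ?addNr //; apply: zCN.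
Qed.

HB.instance Definition _ := GRing.isZmodule.Build zsq zaddA zaddC zadd0 zaddN.

Lemma zpr_eq0 x : zC D x -> (zpr x = 0 <-> zN D x).
Proof. by move=> h; rewrite -[X in zN D X]subr0; apply: zprE => //; apply: zC0. Qed.

End SubquotientZmodule.

Section SubmoduleTheory.
Variables (R : comNzRingType) (V : lmodType R).
Implicit Types (C N : set V).

Lemma sub0m N : submodule N -> N 0. Proof. by case. Qed.

Lemma submD N x y : submodule N -> N x -> N y -> N (x + y).
Proof. by move=> [_ h] hx hy; rewrite -[x]scale1r; apply: h. Qed.

Lemma submZ N a x : submodule N -> N x -> N (a *: x).
Proof. by move=> [h0 h] hx; rewrite -[_ *: _]addr0; apply: h. Qed.

Lemma submN N x : submodule N -> N x -> N (- x).
Proof. by move=> h hx; rewrite -scaleN1r; apply: submZ. Qed.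

Lemma submB N x y : submodule N -> N x -> N y -> N (x - y).
Proof. by move=> h hx hy; apply: submD => //; apply: submN. Qed.

Lemma subm_sum N (I : Type) (r : seq I) (P : pred I) (F : I -> V) :
  submodule N -> (forall i, P i -> N (F i)) -> N (\sum_(i <- r | P i) F i).
Proof.
move=> h hF; elim/big_ind: _ => //; first exact: sub0m.
by move=> x y; apply: submD.
Qed.

Lemma subm_ext N x y : submodule N -> N (x - y) -> N y -> N x.
Proof. by move=> h hxy hy; rewrite -(subrK y x); apply: submD. Qed.

Lemma submodule_set0 : submodule [set (0 : V)].
Proof. by split=> // a x y /= -> ->; rewrite scaler0 addr0. Qed.

Lemma submodule_setT : submodule [set: V]. Proof. by []. Qed.

Lemma submoduleI C N : submodule C -> submodule N -> submodule (C `&` N).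
Proof. by move=> [c0 c] [n0 n]; split=> // a x y [? ?] [? ?]; split; [exact: c|exact: n]. Qed.

Definition subm_add C N : set V := [set x + y | x in C & y in N].

Lemma submodule_add C N : submodule C -> submodule N -> submodule (subm_add C N).
Proof.
move=> hC hN; split; first by exists 0; [exact: sub0m | exists 0; [exact: sub0m | rewrite addr0]].
move=> a _ _ [x hx [y hy <-]] [z hz [t ht <-]].
exists (a *: x + z); first by case: hC => _; apply.
by exists (a *: y + t); [case: hN => _; apply|rewrite scalerDr addrACA].
Qed.

Lemma subm_addl C N : submodule N -> C `<=` subm_add C N.
Proof. by move=> hN x hx; exists x => //; exists 0; [exact: sub0m|rewrite addr0]. Qed.

Lemma subm_addr C N : submodule C -> N `<=` subm_add C N.
Proof. by move=> hC x hx; exists 0; [exact: sub0m|exists x => //; rewrite add0r]. Qed.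

Lemma mspan_sub (A N : set V) : submodule N -> A `<=` N -> mspan A `<=` N.
Proof. by move=> hN hA x; apply. Qed.

Lemma sub_mspan (A : set V) : A `<=` mspan A.
Proof. by move=> x hx N [_]; apply. Qed.

Lemma mspan_in (A : set V) x : A x -> mspan A x.
Proof. exact: sub_mspan. Qed.

Lemma mspan_mem (s : seq V) (x : V) : x \in s -> mspan [set` s] x.
Proof. by move=> h; apply: mspan_in. Qed.

Lemma submodule_mspan (A : set V) : submodule (mspan A).
Proof.
split=> [N [[h0 _] _]|a x y hx hy N hN] //.
have [[_ h] _] := hN; apply: h; [exact: hx|exact: hy].
Qed.

Lemma mspanS (A B : set V) : A `<=` B -> mspan A `<=` mspan B.
Proof. by move=> h; apply: mspan_sub; [exact: submodule_mspan|move=> x /h; exact: sub_mspan]. Qed.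

Lemma mspan_seq (s : seq V) x : mspan [set` s] x <->
  exists c : nat -> R, x = \sum_(i < size s) c i *: s`_i.
Proof.
split; last first.
  move=> [c ->]; apply: (@subm_sum (mspan _)); first exact: submodule_mspan.
  move=> i _; apply: (@submZ (mspan [set` s])); first exact: submodule_mspan.
  by apply: sub_mspan; exact/mem_nth/ltn_ord.
move: x; apply: (@mspan_sub _ [set x | exists c : nat -> R, x = \sum_(i < size s) c i *: s`_i]).
  split; first by exists (fun=> 0); rewrite big1 // => i _; rewrite scale0r.
  move=> a _ _ [c ->] [d ->]; exists (fun i => a * c i + d i).
  rewrite scaler_sumr -big_split; apply: eq_bigr => i _ /=.
  by rewrite scalerDl scalerA.
move=> y /= hy; exists (fun i => (i == index y s)%:R).
have hi : (index y s < size s)%N by rewrite index_mem.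
rewrite (bigD1 (Ordinal hi)) //= eqxx scale1r nth_index // big1 ?addr0 // => i.
by rewrite -val_eqE /= => /negbTE ->; rewrite scale0r.
Qed.

End SubmoduleTheory.

Section SubquotientModule.
Variables (R : comNzRingType) (V : lmodType R).

Record mdat := MDat {
  mC : set V; mN : set V;
  mCs : submodule mC; mNs : submodule mN; mNC : mN `<=` mC }.

Definition mdat_z (D : mdat) : zdat V := @ZDat V (mC D) (mN D)
  (sub0m (mCs D)) (fun x y => @submB R V (mC D) x y (mCs D))
  (sub0m (mNs D)) (fun x y => @submB R V (mN D) x y (mNs D)) (@mNC D).

Variable D : mdat.
Definition msq := zsq (mdat_z D).
HB.instance Definition _ := GRing.Zmodule.on msq.

Definition mscale (a : R) (u : msq) : msq := zpr (mdat_z D) (a *: val u).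

Lemma zprZ a x : mC D x -> zpr (mdat_z D) (a *: x) = mscale a (zpr (mdat_z D) x).
Proof.
move=> hx; apply/zprE => /=.
- by apply: submZ => //; apply: mCs.
- by apply: submZ; [exact: mCs|exact: (zvalC (zpr (mdat_z D) x))].
rewrite -opprB -scalerBr; apply: submN; [exact: mNs|].
by apply: submZ; [exact: mNs|exact: (@zpr_val _ (mdat_z D))].
Qed.

Fact mscaleA a b u : mscale a (mscale b u) = mscale (a * b) u.
Proof.
have [x hx ->] := zsqP u.
by rewrite -!zprZ ?scalerA //; apply: submZ => //; apply: mCs.
Qed.

Fact mscale1 : left_id 1 mscale.
Proof. by move=> u; have [x hx ->] := zsqP u; rewrite -!zprZ ?scale1r. Qed.

Fact mscaleDr : right_distributive mscale +%R.
Proof.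
move=> a u v; have [x hx ->] := zsqP u; have [y hy ->] := zsqP v.
have hZ z : mC D z -> mC D (a *: z) by apply: submZ; apply: mCs.
have -> : zpr (mdat_z D) x + zpr (mdat_z D) y = zpr (mdat_z D) (x + y) :> msq.
  by rewrite zprD.
rewrite -!zprZ //; last exact: (submD (mCs D) hx hy).
by rewrite scalerDr [LHS]zprD //; apply: hZ.
Qed.

Fact mscaleDl u : {morph mscale^~ u : a b / a + b}.
Proof.
move=> a b; have [x hx ->] := zsqP u.
by rewrite -!zprZ // scalerDl [LHS]zprD //; apply: submZ => //; exact: mCs.
Qed.

HB.instance Definition _ := GRing.Zmodule_isLmodule.Build R msq
  mscaleA mscale1 mscaleDr mscaleDl.

End SubquotientModule.

(** One statement serves both quotients (C the whole module) and submodules (N = 0). *)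
Lemma subquot_mod (R : comNzRingType) (V : lmodType R) (C N : set V) :
  submodule C -> submodule N -> N `<=` C ->
  exists (Q : lmodType R) (p : V -> Q),
    [/\ forall a x y, C x -> C y -> p (a *: x + y) = a *: p x + p y,
        forall q, exists2 x, C x & p x = q &
        forall x, C x -> (p x = 0 <-> N x)].
Proof.
move=> hC hN hNC; pose D := MDat hC hN hNC.
exists (msq D : lmodType R), (zpr (mdat_z D)); split.
- move=> a x y hx hy; rewrite [LHS]zprD //; last exact: (submZ a hC).
  by rewrite zprZ.
- by move=> q; have [x hx ->] := zsqP q; exists x.
- by move=> x hx; apply: (@zpr_eq0 _ (mdat_z D)).
Qed.

Section SubquotientRing.
Variable V : comNzRingType.

Record rdat := RDat {
  rC : set V; rN : set V;
  rCB : forall x y, rC x -> rC y -> rC (x - y);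
  rC1 : rC 1;
  rCM : forall x y, rC x -> rC y -> rC (x * y);
  rN0 : rN 0;
  rNB : forall x y, rN x -> rN y -> rN (x - y);
  rNM : forall x y, rC x -> rN y -> rN (x * y);
  rN1 : ~ rN 1;
  rNC : rN `<=` rC }.

Definition rdat_z (D : rdat) : zdat V := @ZDat V (rC D) (rN D)
  (@rNC D 0 (rN0 D)) (@rCB D) (@rN0 D) (@rNB D) (@rNC D).

Variable D : rdat.
Definition rsq := zsq (rdat_z D).
HB.instance Definition _ := GRing.Zmodule.on rsq.

Definition rmul (u v : rsq) : rsq := zpr (rdat_z D) (val u * val v).
Local Notation pr := (zpr (rdat_z D)).

Lemma zprM x y : rC D x -> rC D y -> pr (x * y) = rmul (pr x) (pr y).
Proof.
move=> hx hy.
have hx' := @zvalC _ _ (pr x); have hy' := @zvalC _ _ (pr y).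
apply/zprE; [exact: rCM| exact: rCM|].
have -> : x * y - val (pr x) * val (pr y) =
  y * (x - val (pr x)) - val (pr x) * (val (pr y) - y) by ring.
apply: rNB; apply: rNM => //; last exact: (@zpr_val _ (rdat_z D)).
by rewrite -opprB -sub0r; apply: rNB; [exact: rN0|exact: (@zpr_val _ (rdat_z D))].
Qed.

Fact rmulA : associative rmul.
Proof.
move=> u v w; have [x hx ->] := zsqP u; have [y hy ->] := zsqP v.
have [z hz ->] := zsqP w.
by rewrite -!zprM ?mulrA //; apply: rCM.
Qed.

Fact rmulC : commutative rmul.
Proof. by move=> u v; rewrite /rmul mulrC. Qed.

Fact rmul1 : left_id (pr 1) rmul.
Proof.
move=> u; have [x hx ->] := zsqP u.
by rewrite -zprM ?mul1r //; apply: rC1.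
Qed.

Fact rmulDl : left_distributive rmul +%R.
Proof.
move=> u v w; have [x hx ->] := zsqP u; have [y hy ->] := zsqP v.
have [z hz ->] := zsqP w.
have hxy : rC D (x + y) by apply: (zCD (D := rdat_z D)).
have hxz := rCM hx hz; have hyz := rCM hy hz.
have -> : pr x + pr y = pr (x + y) :> rsq by rewrite zprD.
by rewrite -!zprM // mulrDl [LHS]zprD.
Qed.

Fact rone_neq0 : pr 1 != 0.
Proof.
apply/eqP => /(@zpr_eq0 _ (rdat_z D)) => /(_ (rC1 D)).
exact: rN1.
Qed.

HB.instance Definition _ := GRing.Zmodule_isComNzRing.Build rsq
  rmulA rmulC rmul1 rmulDl rone_neq0.

End SubquotientRing.

(** Besides quotient rings this covers inverse limits, with C the compatible sequences in a power of
    a ring and N the null ones. *)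
Lemma subquot_ring (V : comNzRingType) (C N : set V) :
  (forall x y, C x -> C y -> C (x - y)) -> C 1 ->
  (forall x y, C x -> C y -> C (x * y)) ->
  N 0 -> (forall x y, N x -> N y -> N (x - y)) ->
  (forall x y, C x -> N y -> N (x * y)) -> ~ N 1 -> N `<=` C ->
  exists (Q : comNzRingType) (p : V -> Q),
    [/\ forall x y, C x -> C y -> p (x - y) = p x - p y,
        p 1 = 1, forall x y, C x -> C y -> p (x * y) = p x * p y,
        forall q, exists2 x, C x & p x = q &
        forall x, C x -> (p x = 0 <-> N x)].
Proof.
move=> h1 h2 h3 h4 h5 h6 h7 h8; pose D := RDat h1 h2 h3 h4 h5 h6 h7 h8.
exists (rsq D : comNzRingType), (zpr (rdat_z D)); split => //.
- move=> x y hx hy; rewrite [LHS]zprD //; last exact: (zCN (D := rdat_z D)).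
  by congr (_ + _); rewrite zprN.
- by move=> x y hx hy; rewrite zprM.
- by move=> q; have [x hx ->] := zsqP q; exists x.
- by move=> x hx; apply: (@zpr_eq0 _ (rdat_z D)).
Qed.

(** * Short exact sequences, injective modules and Baer's criterion *)

Section ExactSequences.
Variable R : comNzRingType.
Implicit Types A B I N Z : lmodType R.

Definition ses N I Z (e : {linear N -> I}) (p : {linear I -> Z}) : Prop :=
  [/\ injective e, forall y, exists x, p x = y &
      forall x, p x = 0 <-> exists y, e y = x].

Lemma inj_lin A B (u : {linear A -> B}) :
  (forall x, u x = 0 -> x = 0) -> injective u.
Proof.
by move=> h x y exy; apply/eqP; rewrite -subr_eq0; apply/eqP/h; rewrite linearB exy subrr.
Qed.

Lemma inj_lin0 A B (u : {linear A -> B}) x : injective u -> u x = 0 -> x = 0.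
Proof. by move=> h ux; apply: h; rewrite linear0. Qed.

Lemma submodule_ker A B (u : {linear A -> B}) : submodule [set x | u x = 0].
Proof. by split=> [|a x y /= hx hy]; rewrite /= ?linear0 // linearP hx hy scaler0 addr0. Qed.

Lemma submodule_im A B (u : {linear A -> B}) : submodule [set x | exists y, u y = x].
Proof.
split=> [|a _ _ [x <-] [y <-]]; first by exists 0; rewrite linear0.
by exists (a *: x + y); rewrite linearP.
Qed.

Lemma submodule_preim A B (u : {linear A -> B}) (N : set B) :
  submodule N -> submodule [set x | N (u x)].
Proof.
move=> [h0 h]; split=> [|a x y /= hx hy]; first by rewrite /= linear0.
by rewrite linearP; apply: h.
Qed.

Lemma quot_ex A (N : set A) : submodule N ->
  exists (Q : lmodType R) (p : {linear A -> Q}),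
    (forall y, exists x, p x = y) /\ (forall x, p x = 0 <-> N x).
Proof.
move=> hN.
have [//|//|Q [p [pl ps pk]]] := @subquot_mod R A setT N _ hN _.
exists Q, (linof (fun a x y => pl a x y Logic.I Logic.I)).
split=> [y|x]; last exact: pk.
by have [x _ <-] := ps y; exists x.
Qed.

Lemma sub_ex A (N : set A) : submodule N ->
  exists (B : lmodType R) (u : {linear B -> A}),
    injective u /\ (forall x, N x <-> exists y, u y = x).
Proof.
move=> hN.
have [|Q [p [pl ps pk]]] := subquot_mod hN (@submodule_set0 R A).
  by move=> _ ->; exact: sub0m.
have [g hg] := @choice _ _ (fun q x => N x /\ p x = q) (fun q => let: ex_intro2 x hx h := ps q in ex_intro _ x (conj hx h)).
have pinj x y : N x -> N y -> p x = p y -> x = y.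
  move=> hx hy e; apply/eqP; rewrite -subr_eq0; apply/eqP.
  apply/(pk _ (submB hN hx hy)).
  by rewrite -scaleN1r addrC pl // e scaleN1r addNr.
have gl a x y : g (a *: x + y) = a *: g x + g y.
  have [[h1 h1'] [h2 h2']] := (hg x, hg y); have [h3 h3'] := hg (a *: x + y).
  by apply: pinj => //; [case: hN => _; apply|rewrite h3' pl // h1' h2'].
exists Q, (linof gl); split.
  by move=> x y; rewrite !linofE => e; have [_ <-] := hg x; have [_ <-] := hg y; rewrite e.
move=> x; split=> [hx|[y <-]]; last by case: (hg y).
by exists (p x); rewrite linofE; apply: pinj => //; case: (hg (p x)).
Qed.

Lemma coker_ex N I (e : {linear N -> I}) : injective e ->
  exists (Z : lmodType R) (p : {linear I -> Z}), ses e p.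
Proof.
by move=> he; have [Z [p [p1 p2]]] := quot_ex (submodule_im e); exists Z, p.
Qed.

Lemma ker_ex I Z (p : {linear I -> Z}) : (forall y, exists x, p x = y) ->
  exists (N : lmodType R) (e : {linear N -> I}), ses e p.
Proof.
move=> hp; have [N [e [e1 e2]]] := sub_ex (submodule_ker p).
by exists N, e; split.
Qed.

Lemma fact_surj I Z B (p : {linear I -> Z}) (g : {linear I -> B}) :
  (forall y, exists x, p x = y) -> (forall x, p x = 0 -> g x = 0) ->
  exists h : {linear Z -> B}, forall x, h (p x) = g x.
Proof.
move=> ps hg; have [s hs] := choice ps.
have E x y : p x = p y -> g x = g y.
  move=> e; apply/eqP; rewrite -subr_eq0 -linearB; apply/eqP/hg.
  by rewrite linearB e subrr.
have hl a x y : g (s (a *: x + y)) = a *: g (s x) + g (s y).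
  by rewrite -linearP; apply: E; rewrite linearP !hs.
by exists (linof hl) => x; rewrite linofE; apply: E; rewrite hs.
Qed.

Lemma fact_inj N I B (e : {linear N -> I}) (g : {linear B -> I}) :
  injective e -> (forall z, exists y, e y = g z) ->
  exists h : {linear B -> N}, forall z, e (h z) = g z.
Proof.
move=> ei hg; have [s hs] := choice hg.
have hl a x y : s (a *: x + y) = a *: s x + s y.
  by apply: ei; rewrite linearP !hs linearP.
by exists (linof hl).
Qed.

Lemma im_fact A B (u : {linear A -> B}) :
  exists (Z : lmodType R) (p : {linear A -> Z}) (e : {linear Z -> B}),
   [/\ forall y, exists x, p x = y, injective e & forall x, e (p x) = u x].
Proof.
have [Z [e [e1 e2]]] := sub_ex (submodule_im u).
have [z|p hp] := @fact_inj _ _ _ e u e1; first by apply/e2; exists z.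
exists Z, p, e; split=> // y.
have /e2[x ex] : exists y', e y' = e y by exists y.
by exists x; apply: e1; rewrite hp.
Qed.

Section Prod.
Variables (A B C : lmodType R).
Lemma prod_inl_lin a (x y : A) : ((a *: x + y, 0) : A * B) = a *: (x, 0) + (y, 0).
Proof. by apply: injective_projections => //=; rewrite scaler0 addr0. Qed.
Lemma prod_inr_lin a (x y : B) : ((0, a *: x + y) : A * B) = a *: (0, x) + (0, y).
Proof. by apply: injective_projections => //=; rewrite scaler0 addr0. Qed.
Definition lin_inl : {linear A -> (A * B)%type} := linof prod_inl_lin.
Definition lin_inr : {linear B -> (A * B)%type} := linof prod_inr_lin.
Lemma prod_fst_lin a (x y : A * B) : (a *: x + y).1 = a *: x.1 + y.1. Proof. by []. Qed.
Lemma prod_snd_lin a (x y : A * B) : (a *: x + y).2 = a *: x.2 + y.2. Proof. by []. Qed.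
Definition lin_fst : {linear (A * B)%type -> A} := linof prod_fst_lin.
Definition lin_snd : {linear (A * B)%type -> B} := linof prod_snd_lin.
Variables (f : {linear C -> A}) (g : {linear C -> B}).
Lemma lin_pair_lin a x y : (f (a *: x + y), g (a *: x + y)) = a *: (f x, g x) + (f y, g y) :> A * B.
Proof. by rewrite !linearP. Qed.
Definition lin_pair : {linear C -> (A * B)%type} := linof lin_pair_lin.
Lemma lin_inlE x : lin_inl x = (x, 0). Proof. by []. Qed.
Lemma lin_inrE x : lin_inr x = (0, x). Proof. by []. Qed.
Lemma lin_fstE x : lin_fst x = x.1. Proof. by []. Qed.
Lemma lin_sndE x : lin_snd x = x.2. Proof. by []. Qed.
Lemma lin_pairE x : lin_pair x = (f x, g x). Proof. by []. Qed.
End Prod.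

Section LinOps.
Variables (A B C : lmodType R).
Lemma lin_comp_lin (f : {linear B -> C}) (g : {linear A -> B}) a x y :
  f (g (a *: x + y)) = a *: f (g x) + f (g y).
Proof. by rewrite !linearP. Qed.
Definition lin_comp (f : {linear B -> C}) (g : {linear A -> B}) : {linear A -> C} :=
  linof (lin_comp_lin f g).
Lemma lin_add_lin (f g : {linear A -> B}) a x y :
  f (a *: x + y) + g (a *: x + y) = a *: (f x + g x) + (f y + g y).
Proof. by rewrite !linearP scalerDr addrACA. Qed.
Definition lin_add (f g : {linear A -> B}) : {linear A -> B} := linof (lin_add_lin f g).
Lemma lin_sub_lin (f g : {linear A -> B}) a x y :
  f (a *: x + y) - g (a *: x + y) = a *: (f x - g x) + (f y - g y).
Proof. by rewrite (linearP f) (linearP g) scalerBr opprD addrACA. Qed.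
Definition lin_sub (f g : {linear A -> B}) : {linear A -> B} := linof (lin_sub_lin f g).
Lemma lin_0_lin a (x y : A) : (0 : B) = a *: 0 + 0.
Proof. by rewrite scaler0 addr0. Qed.
Definition lin_0 : {linear A -> B} := linof lin_0_lin.
Lemma lin_scale_lin c a (x y : A) : c *: (a *: x + y) = a *: (c *: x) + c *: y.
Proof. by rewrite scalerDr !scalerA mulrC. Qed.
Definition lin_scale c : {linear A -> A} := linof (lin_scale_lin c).
Lemma lin_id_lin a (x y : A) : a *: x + y = a *: x + y. Proof. by []. Qed.
Definition lin_id : {linear A -> A} := linof lin_id_lin.
Lemma lin_at_lin (z : A) a (x y : R^o) : (a *: x + y) *: z = a *: (x *: z) + y *: z.
Proof. by rewrite scalerDl scalerA. Qed.
Definition lin_at (z : A) : {linear R^o -> A} := linof (lin_at_lin z).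
Lemma lin_compE f g x : lin_comp f g x = f (g x). Proof. by []. Qed.
Lemma lin_addE f g x : lin_add f g x = f x + g x. Proof. by []. Qed.
Lemma lin_subE f g x : lin_sub f g x = f x - g x. Proof. by []. Qed.
Lemma lin_scaleE c x : lin_scale c x = c *: x. Proof. by []. Qed.
Lemma lin_idE x : lin_id x = x. Proof. by []. Qed.
End LinOps.

Lemma injm_iso A B (h : {linear A -> B}) : bijective h ->
  injective_module A -> injective_module B.
Proof.
move=> [g hg gh] iA C D u v ui.
have gl a x y : g (a *: x + y) = a *: g x + g y.
  by apply: (can_inj hg); rewrite linearP !gh.
have [w hw] := iA C D u (lin_comp (linof gl) v) ui.
by exists (lin_comp h w) => a; rewrite lin_compE hw lin_compE; exact: gh.
Qed.

Lemma injm_retract A B (s : {linear A -> B}) (r : {linear B -> A}) :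
  (forall x, r (s x) = x) -> injective_module B -> injective_module A.
Proof.
move=> rs iB C D u v ui.
have [w hw] := iB C D u (lin_comp s v) ui.
by exists (lin_comp r w) => a; rewrite lin_compE hw lin_compE rs.
Qed.

Lemma injm_split A B (e : {linear A -> B}) : injective_module A -> injective e ->
  exists r : {linear B -> A}, forall x, r (e x) = x.
Proof. by move=> iA ei; have [r hr] := iA _ _ e (lin_id A) ei; exists r. Qed.

Lemma injm_prod A B : injective_module A -> injective_module B ->
  injective_module (A * B)%type.
Proof.
move=> iA iB C D u v ui.
have [w hw] := iA _ _ u (lin_comp (lin_fst A B) v) ui.
have [w' hw'] := iB _ _ u (lin_comp (lin_snd A B) v) ui.
exists (lin_pair w w') => a; rewrite lin_pairE hw hw' !lin_compE lin_fstE lin_sndE.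
by case: (v a).
Qed.

Lemma injm_fun (T : Type) B : injective_module B -> injective_module (T -> B).
Proof.
move=> iB C D u v ui.
have evl t a x y : v (a *: x + y) t = a *: v x t + v y t by rewrite linearP.
have [w hw] := choice (fun t => iB _ _ u (linof (evl t)) ui).
have wl a x y : (fun t => w t (a *: x + y)) = a *: (w^~ x : T -> B) + w^~ y.
  by apply/funext => t; rewrite linearP.
by exists (linof wl) => a; apply/funext => t; rewrite linofE hw.
Qed.

Lemma injm_zero A : (forall x : A, x = 0) -> injective_module A.
Proof. by move=> h B C u v _; exists (lin_0 C A) => a; rewrite [LHS]h [RHS]h. Qed.

Definition baer (J : lmodType R) : Prop :=
  forall (a : set R) (phi : R -> J), ideal a ->
  (forall c x y, a x -> a y -> phi (c * x + y) = c *: phi x + phi y) ->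
  exists w, forall x, a x -> phi x = x *: w.

(** Partial extensions of [v] are encoded as graphs in B x J. Zorn gives a maximal graph, and if
    some b were outside its domain, Baer's condition on the ideal of scalars moving b into the
    domain would provide a value at b. *)
Lemma baer_injective (J : lmodType R) : baer J -> injective_module J.
Proof.
move=> bJ A B u v ui.
pose G0 : set (B * J)%type := [set z | exists a, z = (u a, v a)].
pose good (G : set (B * J)%type) :=
  [/\ submodule G, forall y, G (0, y) -> y = 0 & G0 `<=` G].
have goodG0 : good G0.
  split=> //.
    split; first by exists 0; rewrite !linear0.
    by move=> c _ _ [x ->] [y ->]; exists (c *: x + y); rewrite !linearP.
  move=> y [a [/esym ua ->]].
  by rewrite (inj_lin0 ui ua) linear0.
(* [G0] is joined to every candidate, so that the union of the empty chain still satisfies the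
   predicate. *)
have [F FP Ft|G [[gs gf gG] gm]] :=
    @Zorn_bigcup (B * J)%type [set G | good (G `|` G0)].
  rewrite /=; have [[X0 FX0]|F0] := pselect (exists X, F X); last first.
    suff -> : \bigcup_(X in F) X `|` G0 = G0 by [].
    by rewrite bigcup0 ?set0U // => X FX; case: F0; exists X.
  rewrite /=; split; last by move=> z; right.
    split; first by right; case: goodG0 => [[]].
    move=> c x y.
    have key X : F X -> (X `|` G0) x -> (X `|` G0) y ->
        (\bigcup_(X in F) X `|` G0) (c *: x + y).
      move=> FX hx hy; have [[_ h] _ _] := FP _ FX.
      by case: (h c _ _ hx hy) => h'; [left; exists X|right].
    move=> [[X FX Xx]|Gx] [[Y FY Yy]|Gy].
    - case: (Ft _ _ FX FY) => [XY|YX].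
        by apply: (key Y) => //; left; [exact: XY|].
      by apply: (key X) => //; left => //; exact: YX.
    - by apply: (key X) => //; [left|right].
    - by apply: (key Y) => //; [right|left].
    - by apply: (key X0) => //; right.
  move=> y [[X FX Xx]|Gx]; last by case: goodG0 => _ + _; apply.
  by have [_ h _] := FP _ FX; apply: h; left.
set G1 := G `|` G0 in gs gf gG.
have uniqG b y y' : G1 (b, y) -> G1 (b, y') -> y = y'.
  move=> h h'; apply/eqP; rewrite -subr_eq0; apply/eqP/gf.
  suff -> : (0, y - y') = (b, y) - (b, y') by apply: submB.
  by apply: injective_projections; rewrite /= ?subrr.
have tot b : exists y, G1 (b, y).
  apply: contrapT => nb.
  pose a : set R := [set r | exists y, G1 (r *: b, y)].
  have ia : ideal a.
    split; first by exists 0; rewrite scale0r; exact: (sub0m gs).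
    move=> c x y [z hz] [z' hz']; exists (c *: z + z').
    have [_ h] := gs; move: (h c _ _ hz hz').
    by congr G1; apply: injective_projections; rewrite //= scalerDl scalerA.
  pose phi r := xget 0 [set y | G1 (r *: b, y)].
  have hphi r : a r -> G1 (r *: b, phi r).
    by move=> [y hy]; rewrite /phi; case: xgetP => // /(_ y).
  have [c x y ax ay|w hw] := bJ a phi ia.
    have acxy : a (c * x + y) by case: ia => _; apply.
    apply: uniqG (hphi _ acxy) _.
    have [_ h] := gs; move: (h c _ _ (hphi _ ax) (hphi _ ay)).
    by congr G1; apply: injective_projections; rewrite //= scalerDl scalerA.
  pose G2 : set (B * J)%type := [set z | exists x r, G1 x /\ z = x + r *: (b, w)].
  have G12 : G1 `<=` G2 by move=> z hz; exists z, 0; rewrite scale0r addr0.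
  have G2U : G2 `|` G0 = G2 by apply/setUidPl => z /gG /G12.
  apply: (gm G2).
    split; first by move=> z hz; apply: G12; left.
    move=> /(_ (b, w)) h; apply: nb; exists w; left; apply: h.
    by exists 0, 1; rewrite scale1r add0r; split=> //; exact: (sub0m gs).
  rewrite /= G2U; split.
  - split; first exact/G12/(sub0m gs).
    move=> c _ _ [x [r [hx ->]]] [y [s [hy ->]]].
    exists (c *: x + y), (c * r + s); split; first by case: gs => _; apply.
    by rewrite scalerDr scalerDl scalerA addrACA.
  - move=> y [[x1 x2] [r [hx /pair_equal_spec[/= e1 e2]]]].
    have ar : a r.
      exists (- x2); have := submN gs hx; congr G1; apply: injective_projections => //=.
      by apply/eqP; rewrite eq_sym -addr_eq0 addrC -e1.
    have := submN gs hx; have := hphi _ ar; rewrite hw // => h1 h2.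
    rewrite e2; apply/eqP; rewrite addrC addr_eq0; apply/eqP.
    apply: uniqG h1 _; move: h2; congr G1; apply: injective_projections => //=.
    by apply/eqP; rewrite eq_sym -addr_eq0 addrC -e1.
  - by move=> z /gG /G12.
have [w hw] := choice tot.
have wl c x y : w (c *: x + y) = c *: w x + w y.
  by apply: uniqG (hw _) _; have [_ h] := gs; exact: (h c _ _ (hw x) (hw y)).
exists (linof wl) => a; rewrite linofE; apply: uniqG (hw _) _.
by apply: gG; exists a.
Qed.

Lemma injective_baer (J : lmodType R) : injective_module J -> baer J.
Proof.
move=> iJ a phi ia hphi.
have [B [u [u1 u2]]] := sub_ex (ia : submodule (a : set R^o)).
have au x : a (u x) by apply/u2; exists x.
have vl c x y : phi (u (c *: x + y)) = c *: phi (u x) + phi (u y).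
  by rewrite linearP hphi.
have [w hw] := iJ _ _ u (linof vl) u1.
exists (w 1) => x /u2[y <-].
have := hw y; rewrite linofE => <-.
by rewrite -linearZ /= -[_ *: 1]/(_ * 1) mulr1.
Qed.

End ExactSequences.

(** * Modules of homomorphisms *)

Section HomModule.
Variables (R A : comNzRingType) (f : {rmorphism R -> A}).
Variables (W : lmodType A) (X : lmodType R).

(** Only R-linearity is asked of [g], while A acts through the argument. With W = A this is
    coinduction along [f]; with A = R and [f] the identity it is the usual Hom. *)
Definition homP (g : W -> X) : Prop :=
  forall r x y, g (f r *: x + y) = r *: g x + g y.

Definition homm := {g : W -> X | `[< homP g >]}.
HB.instance Definition _ := [Choice of homm by <:].

Lemma homm_val (g : homm) : homP (val g).
Proof. by case: g => g /= /asboolP. Qed.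

Definition mkhom (g : W -> X) (h : homP g) : homm := exist _ g (asboolT h).

Lemma homP0 : homP (fun=> 0).
Proof. by move=> *; rewrite scaler0 addr0. Qed.
Lemma homPD (g h : homm) : homP (fun x => val g x + val h x).
Proof. by move=> r x y; rewrite !homm_val scalerDr addrACA. Qed.
Lemma homPN (g : homm) : homP (fun x => - val g x).
Proof. by move=> r x y; rewrite !homm_val scalerN opprD. Qed.
Lemma homPZ a (g : homm) : homP (fun x => val g (a *: x)).
Proof. by move=> r x y; rewrite scalerDr scalerA mulrC -scalerA homm_val. Qed.

Definition hom_add (g h : homm) := mkhom (homPD g h).
Definition hom_opp (g : homm) := mkhom (homPN g).
Definition hom_scale a (g : homm) := mkhom (homPZ a g).

Fact hom_addA : associative hom_add.
Proof. by move=> g h k; apply/val_inj/funext => x /=; rewrite addrA. Qed.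
Fact hom_addC : commutative hom_add.
Proof. by move=> g h; apply/val_inj/funext => x /=; rewrite addrC. Qed.
Fact hom_add0 : left_id (mkhom homP0) hom_add.
Proof. by move=> g; apply/val_inj/funext => x /=; rewrite add0r. Qed.
Fact hom_addN : left_inverse (mkhom homP0) hom_opp hom_add.
Proof. by move=> g; apply/val_inj/funext => x /=; rewrite addNr. Qed.
HB.instance Definition _ := GRing.isZmodule.Build homm hom_addA hom_addC hom_add0 hom_addN.

Lemma homm_add (g : homm) x y : val g (x + y) = val g x + val g y.
Proof. by have := homm_val g 1 x y; rewrite rmorph1 !scale1r. Qed.

Lemma homm_scale (g : homm) r x : val g (f r *: x) = r *: val g x.
Proof.
have g0 : val g 0 = 0.
  by apply/eqP; rewrite -(inj_eq (addrI (val g 0))) -homm_add !addr0.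
by have := homm_val g r x 0; rewrite !addr0 g0 addr0.
Qed.

Fact hom_scaleA a b g : hom_scale a (hom_scale b g) = hom_scale (a * b) g.
Proof. by apply/val_inj/funext => x /=; rewrite scalerA mulrC. Qed.
Fact hom_scale1 : left_id 1 hom_scale.
Proof. by move=> g; apply/val_inj/funext => x /=; rewrite scale1r. Qed.
Fact hom_scaleDr : right_distributive hom_scale +%R.
Proof. by move=> a g h; apply/val_inj/funext => x. Qed.
Fact hom_scaleDl g : {morph hom_scale^~ g : a b / a + b}.
Proof. by move=> a b; apply/val_inj/funext => x /=; rewrite scalerDl homm_add. Qed.
HB.instance Definition _ := GRing.Zmodule_isLmodule.Build A homm
  hom_scaleA hom_scale1 hom_scaleDr hom_scaleDl.

Lemma hommDE (g h : homm) x : val (g + h) x = val g x + val h x. Proof. by []. Qed.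
Lemma hommZE a (g : homm) x : val (a *: g) x = val g (a *: x). Proof. by []. Qed.
Lemma homm0E x : val (0 : homm) x = 0. Proof. by []. Qed.

Lemma homm0 (g : homm) : val g 0 = 0.
Proof. by have := homm_scale g 0 0; rewrite scaler0 scale0r. Qed.

Lemma hommP (g h : homm) : (forall x, val g x = val h x) -> g = h.
Proof. by move=> e; apply/val_inj/funext. Qed.

End HomModule.

(** * Noetherian modules and the theorems of Krull *)

Section Noetherian.
Variable R : comNzRingType.
Implicit Types (V W : lmodType R) (I J a : set R).

Definition noeth_mod V : Prop :=
  forall N : set V, submodule N -> exists s : seq V, N = mspan [set` s].

Lemma mspan_cons V (x : V) (s : seq V) z : mspan [set` x :: s] z <->
  exists r y, mspan [set` s] y /\ z = r *: x + y.
Proof.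
split.
  move: z; apply: (@mspan_sub _ _ _ [set z | exists r y, mspan [set` s] y /\ z = r *: x + y]).
    split; first by exists 0, 0; split; [exact: sub0m (submodule_mspan _)|rewrite scale0r addr0].
    move=> c _ _ [r [y [hy ->]]] [r' [y' [hy' ->]]].
    exists (c * r + r'), (c *: y + y'); split.
      by case: (submodule_mspan [set` s]) => _; apply.
    by rewrite scalerDr scalerDl scalerA addrACA.
  move=> z /=; rewrite inE => /orP[/eqP ->|hz].
    by exists 1, 0; split; [exact: sub0m (submodule_mspan _)|rewrite scale1r addr0].
  by exists 0, z; split; [exact: mspan_in|rewrite scale0r add0r].
move=> [r [y [hy ->]]]; case: (submodule_mspan [set` x :: s]) => _; apply.
  by apply: mspan_mem; exact: mem_head.
by apply: mspanS hy => u /= hu; rewrite inE hu orbT.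
Qed.

Lemma mspan_nil V z : mspan [set` ([::] : seq V)] z -> z = 0.
Proof. by move: z; apply: mspan_sub; [exact: submodule_set0|]. Qed.

(** Induction on the generators of V. The coefficients of the first generator occurring in N modulo
    the span of the others form an ideal; lifts of its generators, with generators of the part of N
    in that span, generate N. *)
Lemma fg_noeth V : noetherian R -> fin_gen V -> noeth_mod V.
Proof.
move=> nR [s hs] N hN; have {hs} : N `<=` mspan [set` s] by rewrite hs.
elim: s => [|x s IH] in N hN *.
  move=> h; exists [::]; apply/seteqP; split=> [z /h /mspan_nil ->|z /mspan_nil ->].
    exact: sub0m (submodule_mspan _).
  exact: sub0m.
move=> h.
pose a : set R := [set r | exists y, mspan [set` s] y /\ N (r *: x + y)].
have sp := submodule_mspan [set` s].
have ia : ideal a.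
  split; first by exists 0; split; [exact: sub0m|rewrite scale0r addr0; exact: sub0m].
  move=> c r r' [y [hy Ny]] [y' [hy' Ny']]; exists (c *: y + y').
  split; first by case: sp => _; apply.
  have -> : (c *: (r : R^o) + r') *: x + (c *: y + y') = c *: (r *: x + y) + (r' *: x + y').
    by rewrite scalerDr addrACA scalerDl scalerA.
  by case: hN => _; apply.
have [t ht] := nR a ia.
have lift r : r \in t -> exists z, N z /\ exists y, mspan [set` s] y /\ z = r *: x + y.
  move=> rt; have : a r by rewrite ht; exact: mspan_in.
  by move=> [y [hy Ny]]; exists (r *: x + y); split=> //; exists y.
have [g hg] : exists g : R -> V, forall r, r \in t ->
    N (g r) /\ exists y, mspan [set` s] y /\ g r = r *: x + y.
  have H r : exists z, r \in t -> N z /\ exists y, mspan [set` s] y /\ z = r *: x + y.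
    case: (boolP (r \in t)) => [/lift[z hz]|_]; last by exists 0.
    by exists z.
  by have [g hg] := choice H; exists g.
have [u hu] := IH (N `&` mspan [set` s]) (submoduleI hN sp) (fun _ => @proj2 _ _).
exists (map g t ++ u); apply/seteqP; split; last first.
  apply: mspan_sub => // z /=; rewrite mem_cat => /orP[/mapP[r rt ->]|zu].
    by case: (hg r rt).
  have : mspan [set` u] z by exact: mspan_in.
  by rewrite -hu => -[].
have spu := submodule_mspan [set` map g t ++ u].
have sub1 : mspan [set` u] `<=` mspan [set` map g t ++ u].
  by apply: mspanS => z /= zu; rewrite mem_cat zu orbT.
move=> z Nz; have /mspan_cons[r [y [hy ez]]] := h z Nz.
have ar : a r by exists y; split=> //; rewrite -ez.
move: ar; rewrite ht => /mspan_seq[c hc].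
pose z' := \sum_(i < size t) c i *: g t`_i.
have z'in : mspan [set` map g t ++ u] z'.
  apply: (@subm_sum _ _ _ _ _ _ _ spu) => i _; apply: (submZ _ spu); apply: mspan_mem.
  by rewrite mem_cat map_f ?mem_nth.
apply: (subm_ext spu _ z'in); apply: sub1; rewrite -hu; split.
  apply: submB => //; apply: (@subm_sum _ _ _ _ _ _ _ hN) => i _; apply: (submZ _ hN).
  by case: (hg t`_i (mem_nth 0 (ltn_ord i))).
suff [y' [hy' e']] : exists y', mspan [set` s] y' /\ z' = r *: x + y'.
  by rewrite ez e' opprD addrACA subrr add0r; apply: (submB sp).
pose P i (w : V) := mspan [set` s] w /\ g t`_i = t`_i *: x + w.
have [w hw] : exists w : nat -> V, forall i, (i < size t)%N -> P i (w i).
  have H i : exists w, (i < size t)%N -> P i w.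
    case: (boolP (i < size t)%N) => hi; last by exists 0.
    by have [_ [w hw]] := hg t`_i (mem_nth 0 hi); exists w.
  by have [w hw] := choice H; exists w.
exists (\sum_(i < size t) c i *: w i); split.
  by apply: (@subm_sum _ _ _ _ _ _ _ sp) => i _; apply: (submZ _ sp); case: (hw i (ltn_ord i)).
rewrite hc scaler_suml -big_split /=; apply: eq_bigr => i _.
have [_ ->] := hw i (ltn_ord i).
by rewrite scalerDr scalerA.
Qed.

Lemma noeth_R : noetherian R -> noeth_mod R^o.
Proof. by []. Qed.

Lemma noeth_quot V W (p : {linear V -> W}) :
  (forall y, exists x, p x = y) -> noeth_mod V -> noeth_mod W.
Proof.
move=> ps nV N hN; have [s hs] := nV _ (submodule_preim p hN).
exists (map p s); apply/seteqP; split; last first.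
  apply: mspan_sub => // _ /= /mapP[x xs ->].
  have : mspan [set` s] x by exact: mspan_in.
  by rewrite -hs.
move=> y Ny; have [x ex] := ps y.
have : mspan [set` s] x by rewrite -hs /= ex.
rewrite -ex => /mspan_seq[c ->]; rewrite linear_sum.
have sp := submodule_mspan [set` map p s].
apply: (@subm_sum _ _ _ _ _ _ _ sp) => i _; rewrite linearZ; apply: (submZ _ sp).
by apply: mspan_mem; exact/map_f/mem_nth.
Qed.

Lemma fin_gen_quot V W (p : {linear V -> W}) :
  (forall y, exists x, p x = y) -> fin_gen V -> fin_gen W.
Proof.
move=> ps [s hs]; exists (map p s); apply/seteqP; split=> // y _.
have [x <-] := ps y; have : mspan [set` s] x by rewrite hs.
move=> /mspan_seq[c ->]; rewrite linear_sum.
have sp := submodule_mspan [set` map p s].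
apply: (@subm_sum _ _ _ _ _ _ _ sp) => i _; rewrite linearZ; apply: (submZ _ sp).
by apply: mspan_mem; exact/map_f/mem_nth.
Qed.

(** Zorn's lemma applies because the union of a chain is finitely generated, hence contained in a
    member. *)
Lemma noeth_max V (P : set (set V)) : noeth_mod V ->
  (forall N, P N -> submodule N) -> (exists N, P N) ->
  exists N, P N /\ forall N', P N' -> N `<=` N' -> N' `<=` N.
Proof.
move=> nV Ps [N0 PN0].
pose T := {N : set V | P N}.
pose le (x y : T) := `[< sval x `<=` sval y >].
have [||[x Px] [y Py] /asboolP h /asboolP h'|F Ft|t tm] := @Zorn T le.
- by move=> x; apply/asboolP.
- by move=> x y z /asboolP h /asboolP h'; apply/asboolP; exact: subset_trans h h'.
- by apply: eq_exist; exact/seteqP.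
- have [[X0 FX0]|F0] := pselect (exists X, F X); last first.
    by exists (exist _ N0 PN0) => s Fs; case: F0; exists s.
  pose U : set V := [set x | exists2 X, F X & sval X x].
  have sU : submodule U.
    split; first by exists X0 => //; exact: (sub0m (Ps _ (svalP X0))).
    move=> a x y [X FX hx] [Y FY hy].
    have [/asboolP h|/asboolP h] := Ft _ _ FX FY.
      by exists Y => //; case: (Ps _ (svalP Y)) => _; apply => //; exact: h.
    by exists X => //; case: (Ps _ (svalP X)) => _; apply => //; exact: h.
  have [s hs] := nV U sU.
  have [X FX hX] : exists2 X, F X & forall y, y \in s -> sval X y.
    have : forall y, y \in s -> U y by move=> y ys; rewrite hs; exact: mspan_in.
    elim: s {hs} => [|y s IH] h; first by exists X0.
    have [X FX hX] : exists2 X, F X & forall y, y \in s -> sval X y.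
      by apply: IH => z zs; apply: h; rewrite inE zs orbT.
    have [Y FY hY] := h y (mem_head _ _).
    have [/asboolP l|/asboolP l] := Ft _ _ FX FY.
      by exists Y => // z; rewrite inE => /orP[/eqP ->//|/hX/l].
    by exists X => // z; rewrite inE => /orP[/eqP ->|/hX //]; exact: l.
  exists X => Y FY; apply/asboolP => y Yy.
  have : U y by exists Y.
  rewrite hs; move: y {Yy}; apply: mspan_sub; first exact: (Ps _ (svalP X)).
  exact: hX.
- exists (sval t); split; first exact: svalP.
  move=> N' PN' h; have := tm (exist _ N' PN').
  by rewrite /le /= => /(_ (asboolT h)) <-.
Qed.

Lemma noeth_ind V (Q : set V -> Prop) : noeth_mod V ->
  (forall N, submodule N ->
     (forall N', submodule N' -> N `<=` N' -> ~ (N' `<=` N) -> Q N') -> Q N) ->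
  forall N, submodule N -> Q N.
Proof.
move=> nV IH N hN; apply: contrapT => nQ.
have [|] := @noeth_max V [set N | submodule N /\ ~ Q N] nV (fun _ => @proj1 _ _).
  by exists N.
move=> N1 [[s1 nQ1] mx]; apply: nQ1; apply: IH => // N' sN' h h'.
by apply: contrapT => nQ'; apply: h'; apply: mx.
Qed.

Lemma noeth_stable V (K : nat -> set V) : noeth_mod V ->
  (forall i, submodule (K i)) -> (forall i, K i `<=` K i.+1) ->
  exists j, forall i, (j <= i)%N -> K i `<=` K j.
Proof.
move=> nV sK mK.
have [N [i ->]||] := @noeth_max V [set N | exists i, N = K i] nV.
- exact: sK.
- by exists (K 0%N), 0%N.
move=> _ [[j ->] mx]; exists j => i ji; apply: mx; first by exists i.
elim: i ji => [|i IH]; first by rewrite leqn0 => /eqP ->.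
rewrite leq_eqVlt => /orP[/eqP <- //|]; rewrite ltnS => /IH h.
by move=> x /h /mK.
Qed.

Definition imul I V (N : set V) : set V := mspan [set c *: x | c in I & x in N].

Lemma submodule_imul I V (N : set V) : submodule (imul I N).
Proof. exact: submodule_mspan. Qed.

Lemma imul_in I V (N : set V) c x : I c -> N x -> imul I N (c *: x).
Proof. by move=> ? ?; apply: mspan_in; exists c => //; exists x. Qed.

Lemma imul_sub I V (N N' : set V) : submodule N' ->
  (forall c x, I c -> N x -> N' (c *: x)) -> imul I N `<=` N'.
Proof. by move=> h h'; apply: mspan_sub => // _ [c hc [x hx <-]]; exact: h'. Qed.

Lemma idl0 I : ideal I -> I 0. Proof. by case. Qed.
Lemma idlD I x y : ideal I -> I x -> I y -> I (x + y). Proof. exact: (@submD R R^o). Qed.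
Lemma idlB I x y : ideal I -> I x -> I y -> I (x - y). Proof. exact: (@submB R R^o). Qed.
Lemma idlN I x : ideal I -> I x -> I (- x). Proof. exact: (@submN R R^o). Qed.
Lemma idlM I c x : ideal I -> I x -> I (c * x). Proof. exact: (@submZ R R^o). Qed.
Lemma idlMr I c x : ideal I -> I x -> I (x * c). Proof. by rewrite mulrC; exact: idlM. Qed.
Lemma idl_sum I (T : Type) (r : seq T) (P : pred T) (F : T -> R) :
  ideal I -> (forall i, P i -> I (F i)) -> I (\sum_(i <- r | P i) F i).
Proof. exact: (@subm_sum R R^o). Qed.
Lemma idl1 I : ideal I -> I 1 -> forall x, I x.
Proof. by move=> h h1 x; rewrite -[x]mulr1; exact: idlM. Qed.
Lemma ideal_setT : ideal [set: R]. Proof. by []. Qed.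

Lemma ideal_ideal_gen (A : set R) : ideal (ideal_gen A). Proof. exact: submodule_mspan. Qed.
Lemma ideal_gen_sub (A I : set R) : ideal I -> A `<=` I -> ideal_gen A `<=` I.
Proof. exact: (@mspan_sub R R^o). Qed.
Lemma sub_ideal_gen (A : set R) : A `<=` ideal_gen A. Proof. exact: (@sub_mspan R R^o). Qed.
Lemma idl_gen_in (A : set R) x : A x -> ideal_gen A x. Proof. exact: sub_ideal_gen. Qed.
Lemma idl_gen_mem (s : seq R) x : x \in s -> ideal_gen [set` s] x.
Proof. exact: idl_gen_in. Qed.
Lemma ideal_gen_seq (s : seq R) x : ideal_gen [set` s] x <->
  exists c : nat -> R, x = \sum_(i < size s) c i * s`_i.
Proof. exact: (@mspan_seq R R^o). Qed.
Lemma ideal_gen_cons (y : R) (s : seq R) z : ideal_gen [set` y :: s] z <->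
  exists r u, ideal_gen [set` s] u /\ z = r * y + u.
Proof. exact: (@mspan_cons R^o). Qed.

Lemma ideal_pow_ideal I i : ideal (ideal_pow I i).
Proof. by case: i => [|i]; [exact: ideal_setT|exact: ideal_ideal_gen]. Qed.

Lemma ideal_powS_in I i x y : I x -> ideal_pow I i y -> ideal_pow I i.+1 (x * y).
Proof. by move=> hx hy; apply: idl_gen_in; exists x => //; exists y. Qed.

Lemma ideal_powS_sub I i J : ideal J ->
  (forall x y, I x -> ideal_pow I i y -> J (x * y)) -> ideal_pow I i.+1 `<=` J.
Proof. by move=> hJ h; apply: ideal_gen_sub => // _ [x hx [y hy <-]]; exact: h. Qed.

Lemma ideal_powM I i j x y : ideal_pow I i x -> ideal_pow I j y -> ideal_pow I (i + j) (x * y).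
Proof.
move=> hx hy; elim: i x hx => [|i IH] x hx.
  exact: (idlM x (ideal_pow_ideal I j) hy).
move: x hx; apply: (@ideal_powS_sub I i [set x | ideal_pow I (i.+1 + j) (x * y)]).
  split; first by rewrite /= mul0r; exact: (idl0 (ideal_pow_ideal I (i.+1 + j))).
  move=> c u v hu hv; have [_ h] := ideal_pow_ideal I (i.+1 + j).
  by rewrite /mkset mulrDl -[c *: u * y]mulrA; apply: h.
move=> u v hu hv; rewrite /mkset -mulrA.
exact: (ideal_powS_in hu (IH v hv)).
Qed.

Lemma ideal_pow_mono I i j : (i <= j)%N -> ideal_pow I j `<=` ideal_pow I i.
Proof.
move=> /subnK <-; elim: (j - i)%N => [|k IH] //=.
apply: subset_trans IH; apply: ideal_powS_sub; first exact: ideal_pow_ideal.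
by move=> x y _ hy; exact: (idlM x (ideal_pow_ideal _ _) hy).
Qed.

Lemma ideal_pow1 I x : ideal I -> ideal_pow I 1 x <-> I x.
Proof.
move=> hI; split.
  by move: x; apply: ideal_powS_sub => // x y hx _; exact: idlMr.
by move=> hx; rewrite -[x]mulr1; apply: ideal_powS_in.
Qed.

Lemma ideal_pow_exp I i x : I x -> ideal_pow I i (x ^+ i).
Proof. by move=> hx; elim: i => [|i IH] //; rewrite exprS; exact: ideal_powS_in. Qed.

Lemma ideal_powS I J i : I `<=` J -> ideal_pow I i `<=` ideal_pow J i.
Proof.
move=> h; elim: i => [|i IH] //; apply: ideal_powS_sub; first exact: ideal_pow_ideal.
by move=> x y /h hx /IH hy; exact: ideal_powS_in.
Qed.

Definition idl_add I J : set R := [set x + y | x in I & y in J].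

Lemma ideal_add I J : ideal I -> ideal J -> ideal (idl_add I J).
Proof. exact: (@submodule_add R R^o). Qed.
Lemma idl_addl I J : ideal J -> I `<=` idl_add I J. Proof. exact: (@subm_addl R R^o). Qed.
Lemma idl_addr I J : ideal I -> J `<=` idl_add I J. Proof. exact: (@subm_addr R R^o). Qed.

Lemma ideal_pow_add I J i j : ideal I -> ideal J ->
  ideal_pow (idl_add I J) (i + j) `<=` idl_add (ideal_pow I i) (ideal_pow J j).
Proof.
move=> hI hJ; move: {2}(i + j)%N (erefl (i + j)%N) => n; elim: n i j => [|n IH] i j.
  move=> /eqP; rewrite addn_eq0 => /andP[/eqP -> _] x _.
  exact: (@idl_addl _ _ (ideal_pow_ideal J j) x Logic.I).
have hid := ideal_add (ideal_pow_ideal I i) (ideal_pow_ideal J j).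
case: i => [|i] in hid *; first by move=> _ x _; exact: (@idl_addl _ _ (ideal_pow_ideal J j) x Logic.I).
case: j => [|j] in hid *; first by move=> _ x _; exact: (@idl_addr _ _ (ideal_pow_ideal I i.+1) x Logic.I).
move=> e; rewrite addSn; apply: ideal_powS_sub => // _ y [u hu [v hv <-]] hy.
rewrite mulrDl; apply: (idlD hid).
  have [|w hw [z hz <-]] := IH i j.+1 _ y hy; first by move: e; rewrite addSn => -[].
  rewrite mulrDr; apply: (idlD hid).
    by apply: idl_addl; [exact: ideal_pow_ideal|exact: ideal_powS_in].
  by apply: idl_addr; [exact: ideal_pow_ideal|exact: (idlM _ (ideal_pow_ideal _ _))].
rewrite addnS -addSn in hy.
have [|w hw [z hz <-]] := IH i.+1 j _ y hy; first by move: e; rewrite addnS => -[].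
rewrite mulrDr; apply: (idlD hid).
  by apply: idl_addl; [exact: ideal_pow_ideal|exact: (idlM _ (ideal_pow_ideal _ _))].
by apply: idl_addr; [exact: ideal_pow_ideal|exact: ideal_powS_in].
Qed.

Lemma ideal_pow_gen (s : seq R) J : ideal J ->
  (forall x, x \in s -> exists k, J (x ^+ k)) ->
  exists N, ideal_pow (ideal_gen [set` s]) N `<=` J.
Proof.
move=> hJ; elim: s => [|x s IH] h.
  exists 1%N => y /(ideal_pow1 _ (ideal_ideal_gen _)) /(@mspan_nil R^o) ->; exact: idl0.
have [N hN] : exists N, ideal_pow (ideal_gen [set` s]) N `<=` J.
  by apply: IH => y ys; apply: h; rewrite inE ys orbT.
have [k hk] := h x (mem_head _ _).
have hx : ideal_pow (ideal_gen [set` [:: x]]) k `<=` J.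
  have H : ideal_pow (ideal_gen [set` [:: x]]) k `<=` [set y | exists c, y = c * x ^+ k].
    elim: k {hk} => [|k IHk]; first by move=> y _; exists y; rewrite mulr1.
    apply: ideal_powS_sub.
      split; first by exists 0; rewrite mul0r.
      by move=> c _ _ [u ->] [v ->]; exists (c * u + v); rewrite mulrDl -mulrA.
    move=> y z /ideal_gen_cons[r [u [/(@mspan_nil R^o) -> ->]]] /IHk[c ->].
    by exists (r * c); rewrite addr0 exprS; ring.
  by move=> y /H[c ->]; exact: idlM.
exists (k + N)%N => y hy.
have /ideal_pow_add : ideal_pow (idl_add (ideal_gen [set` [:: x]]) (ideal_gen [set` s])) (k + N) y.
  apply: ideal_powS hy; apply: ideal_gen_sub; first exact: ideal_add (ideal_ideal_gen _) (ideal_ideal_gen _).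
  move=> z /=; rewrite inE => /orP[/eqP ->|zs].
    by apply: idl_addl; [exact: ideal_ideal_gen|apply: idl_gen_mem; exact: mem_head].
  by apply: idl_addr; [exact: ideal_ideal_gen|exact: idl_gen_in].
move=> /(_ (ideal_ideal_gen _) (ideal_ideal_gen _))[u /hx hu [v /hN hv <-]].
exact: idlD.
Qed.

(** For an ideal this means being contained in the Jacobson radical. *)
Definition jac I : Prop := forall x, I x -> exists y, (1 - x) * y = 1.

(** Take H maximal among the submodules over N that do not contain C. For c in I and z in C, if c z
    were outside H then H + R c z would contain z, so (1 - r c) z would lie in H although 1 - r c is
    a unit. *)
Lemma nakayama V I (N C : set V) : noeth_mod V -> ideal I -> jac I ->
  submodule N -> submodule C ->
  C `<=` subm_add N (imul I C) -> C `<=` N.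
Proof.
move=> nV hI jI sN sC hC; apply: contrapT => nCN.
have [H hH||] := @noeth_max V [set H | [/\ submodule H, N `<=` H & ~ C `<=` H]] nV.
- by case: hH => hH1 *; exact: hH1.
- by exists N; split=> //.
move=> H [[sH NH nCH] mx].
apply: nCH; apply: subset_trans hC _ => _ [x /NH hx [y hy <-]].
apply: submD => //; move: y hy; apply: imul_sub => // c z hc hz.
apply: contrapT => ncz.
have hHz : submodule (subm_add H [set x | exists r, x = r *: (c *: z)]).
  apply: submodule_add => //; split; first by exists 0; rewrite scale0r.
  by move=> b _ _ [u ->] [v ->]; exists (b * u + v); rewrite scalerDl scalerA.
have Cin : C `<=` subm_add H [set x | exists r, x = r *: (c *: z)].
  apply: contrapT => nC; apply: ncz; apply: (mx _ _ _ _).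
  - split; first exact: hHz.
      by apply: subset_trans NH _; apply: subm_addl; split; [exists 0; rewrite scale0r|
        move=> b _ _ [u ->] [v ->]; exists (b * u + v); rewrite scalerDl scalerA].
    exact: nC.
  - by move=> u hu; exists u => //; exists 0; [exists 0; rewrite scale0r|rewrite addr0].
  - by exists 0; [exact: sub0m|exists (c *: z); [exists 1; rewrite scale1r|rewrite add0r]].
have [u hu [_ [r ->] ez]] := Cin z hz.
have [y hy] := jI (r * c) (idlM _ hI hc).
apply: ncz; apply: (submZ _ sH).
have -> : z = y *: u.
  rewrite -[z]scale1r -hy mulrC -scalerA; congr (_ *: _).
  by rewrite scalerBl scale1r -scalerA -[X in X - _]ez addrK.
exact: submZ.
Qed.

(** Choose H over I^c G maximal with H meeting G inside I^c G. By maximality every x in I has a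
    power carrying V into H, hence so does a power of I. *)
Lemma weak_artin_rees V I (G : set V) : noetherian R -> noeth_mod V -> ideal I ->
  submodule G ->
  forall c, exists N, forall x, imul (ideal_pow I N) setT x -> G x -> imul (ideal_pow I c) G x.
Proof.
move=> nR nV hI sG c; pose K := imul (ideal_pow I c) G.
have KG : K `<=` G by apply: imul_sub => // b x _; exact: submZ.
have [H hH||] := @noeth_max V [set H | [/\ submodule H, K `<=` H & H `&` G `<=` K]] nV.
- by case: hH => hH1 *; exact: hH1.
- by exists K; split=> [||x []] //; exact: submodule_imul.
move=> H [[sH KH HG] mx].
have key x : I x -> exists j, forall v, H (x ^+ j *: v).
  move=> hx; pose Kx j := [set v | H (x ^+ j *: v)].
  have sKx j : submodule (Kx j).
    split; first by rewrite /Kx /= scaler0; exact: sub0m.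
    move=> b u v; rewrite /Kx /= => hu hv; rewrite scalerDr scalerA mulrC -scalerA.
    by case: sH => _; apply.
  have mKx i : Kx i `<=` Kx i.+1.
    by move=> v; rewrite /Kx /= exprS -scalerA => h; exact: submZ.
  have [j0 hj0] := noeth_stable nV sKx mKx.
  (* The exponent must lie in the stable range of the submodules (H : x^i) and be at least c, so
     that x^j carries G into [K]. *)
  pose j := maxn j0 c; have cj : (c <= j)%N by rewrite leq_maxr.
  have st v : H (x ^+ (j + j) *: v) -> H (x ^+ j *: v).
    move=> /(hj0 (j + j)%N) h; have {h} : Kx j0 v by apply: h; rewrite (leq_trans (leq_maxl j0 c)) ?leq_addr.
    rewrite /Kx /= => h; have -> : j = (j - j0 + j0)%N by rewrite subnK // leq_maxl.
    by rewrite exprD -scalerA; exact: submZ.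
  exists j => v.
  have sX : submodule [set y | exists v, y = x ^+ j *: v].
    split; first by exists 0; rewrite scaler0.
    by move=> b _ _ [u ->] [w ->]; exists (b *: u + w); rewrite scalerDr !scalerA mulrC.
  apply: (mx (subm_add H [set y | exists v, y = x ^+ j *: v])).
  - split; [exact: submodule_add|by apply: subset_trans KH _; exact: subm_addl|].
    move=> _ [[h hh [_ [w ->] <-]] hg]; apply: HG; split=> //.
    apply: submD => //; apply: st; rewrite exprD -scalerA.
    have -> : x ^+ j *: (x ^+ j *: w) = x ^+ j *: (h + x ^+ j *: w) - x ^+ j *: h.
      by rewrite scalerDr addrAC subrr add0r.
    apply: submB => //; last exact: submZ.
    apply: KH; apply: imul_in => //.
    by apply: (ideal_pow_mono cj); exact: ideal_pow_exp.
  - exact: subm_addl.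
  - by apply: subm_addr => //; exists v.
have [s hs] := nR I hI.
pose a : set R := [set r | forall v, H (r *: v)].
have ia : ideal a.
  split; first by move=> v; rewrite scale0r; exact: sub0m.
  move=> b u v hu hv w; rewrite scalerDl -scalerA.
  by case: sH => _; apply; [exact: hu|exact: hv].
have [|N hN] := @ideal_pow_gen s a ia.
  by move=> x xs; apply: key; rewrite hs; exact: idl_gen_in.
exists N => x hx Gx; apply: HG; split=> //.
move: x hx {Gx}; apply: imul_sub => // b x; rewrite hs => /hN ha _; exact: ha.
Qed.

(** Artin-Rees for the line through the class of x in V/N gives x = r x there with r in I, and 1 - r
    is a unit. *)
Lemma krull_intersection V I (N : set V) x : noetherian R -> noeth_mod V ->
  ideal I -> jac I -> submodule N ->
  (forall n, subm_add N (imul (ideal_pow I n) setT) x) -> N x.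
Proof.
move=> nR nV hI jI sN h.
have [Q [p [ps pk]]] := quot_ex sN.
have nQ := noeth_quot ps nV.
pose G : set Q := [set y | exists r, y = r *: p x].
have sG : submodule G.
  split; first by exists 0; rewrite scale0r.
  by move=> b _ _ [u ->] [v ->]; exists (b * u + v); rewrite scalerDl scalerA.
have [n hn] := weak_artin_rees nR nQ hI sG 1.
have hx : imul (ideal_pow I n) setT (p x).
  have [y hy [z hz <-]] := h n.
  rewrite linearD (iffRL (pk y) hy) add0r.
  move: z hz; apply: (@imul_sub _ _ _ [set z | imul (ideal_pow I n) setT (p z)]).
    exact: (submodule_preim p (submodule_imul _ _)).
  by move=> b z hb _ /=; rewrite linearZ; apply: imul_in.
have : imul (ideal_pow I 1) G (p x) by apply: hn => //; exists 1; rewrite scale1r.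
move=> hG; have [r hr er] : exists2 r, I r & p x = r *: p x.
  suff : imul (ideal_pow I 1) G `<=` [set y | exists2 r, I r & y = r *: p x] by apply.
  apply: imul_sub.
    split; first by exists 0; [exact: idl0|rewrite scale0r].
    move=> b _ _ [u hu ->] [v hv ->]; exists (b * u + v); last by rewrite scalerDl scalerA.
    by case: hI => _; apply.
  move=> b _ /(ideal_pow1 _ hI) hb [r ->]; exists (b * r); first exact: idlMr.
  by rewrite scalerA.
apply/pk; have [y hy] := jI r hr.
rewrite -[p x]scale1r -hy mulrC -scalerA scalerBl scale1r -er subrr scaler0.
exact: erefl.
Qed.

Lemma noetherian_local_unit I x : noetherian_local I -> ~ I x -> exists y, x * y = 1.
Proof.
move=> [nR mI uI] nIx; apply: contrapT => nu.
pose X : set R := [set y | exists c, y = c * x].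
have iX : ideal X.
  split; first by exists 0; rewrite mul0r.
  by move=> b _ _ [u ->] [v ->]; exists (b * u + v); rewrite mulrDl -mulrA.
have [J||] := @noeth_max R^o [set J | [/\ ideal J, X `<=` J & ~ J 1]] nR.
- by case.
- by exists X; split=> // -[c hc]; apply: nu; exists c; rewrite mulrC -hc.
move=> J [[iJ XJ nJ] mx]; apply: nIx.
have <- : J = I; last by apply: XJ; exists 1; rewrite mul1r.
apply: uI; split=> // J' iJ' nJ' h; apply/seteqP; split=> //.
by apply: mx => //; split=> //; exact: subset_trans XJ h.
Qed.

Lemma noetherian_local_jac I : noetherian_local I -> jac I.
Proof.
move=> h x hx; apply: (noetherian_local_unit h).
have [_ [iI nI _] _] := h; move=> h1; apply: nI.
by rewrite -(subrK x 1); apply: idlD.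
Qed.

Lemma noetherian_local_ideal I : noetherian_local I -> ideal I.
Proof. by move=> [_ []]. Qed.

End Noetherian.

Lemma mem_rem_neq (T : eqType) (s : seq T) (x y : T) : x != y -> x \in s -> x \in rem y s.
Proof.
move=> xy; elim: s => //= z s IH; rewrite inE => /orP[/eqP <-|/IH h].
  by rewrite (negbTE xy) mem_head.
by case: ifP => _; rewrite ?inE ?h ?orbT //; move: h; move/mem_rem.
Qed.

(** * Prime avoidance, regular elements and Krull's height theorem *)

Section Primes.
Variable R : comNzRingType.
Implicit Types (V : lmodType R) (I J K P Q : set R).

Lemma prime_ideal_prod P (T : eqType) (s : seq T) (c : T -> R) : prime_ideal P ->
  P (\prod_(x <- s) c x) -> exists2 x, x \in s & P (c x).
Proof.
move=> [_ n1 pP]; elim: s => [|x s IH]; first by rewrite big_nil => /n1.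
rewrite big_cons => /pP[h|/IH[y ys h]]; first by exists x; rewrite ?mem_head.
by exists y; rewrite // inE ys orbT.
Qed.

Lemma prime_ideal_exp P x i : prime_ideal P -> P (x ^+ i) -> P x.
Proof.
move=> [_ n1 pP]; elim: i => [|i IH]; first by rewrite expr0 => /n1.
by rewrite exprS => /pP[|/IH].
Qed.

Lemma ideal_prod_mem I (T : eqType) (s : seq T) (c : T -> R) x : ideal I ->
  x \in s -> I (c x) -> I (\prod_(y <- s) c y).
Proof.
move=> hI; elim: s => // y s IH; rewrite inE big_cons => /orP[/eqP <-|xs] h.
  exact: idlMr.
by apply: idlM => //; exact: IH.
Qed.

Lemma prime_avoidance I (s : seq (set R)) : ideal I ->
  (forall P, P \in s -> prime_ideal P) ->
  (forall x, I x -> exists2 P : set R, P \in s & P x) ->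
  exists2 P : set R, P \in s & I `<=` P.
Proof.
move=> hI; elim: {s}_.+1 {-2}s (ltnSn (size s)) => // n IH [|P s] sz hs hc.
  by have [P] := hc 0 (idl0 hI).
have [h|/existsNP[a /not_implyP[Ia ha]]] :=
    pselect (forall x, I x -> exists2 Q : set R, Q \in s & Q x).
  have [Q Qs|Q Qs IQ] := IH s sz _ h; last by exists Q; rewrite // inE Qs orbT.
  by apply: hs; rewrite inE Qs orbT.
have Pa : P a.
  have [Q] := hc a Ia; rewrite inE => /orP[/eqP -> //|Qs Qa].
  by case: ha; exists Q.
have [IP|/existsNP[b /not_implyP[Ib nPb]]] := pselect (I `<=` P).
  by exists P; rewrite ?mem_head.
have [[Q Qs QP]|nQ] := pselect (exists2 Q, Q \in s & Q `<=` P).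
  have [|Q'|x Ix|Q' Q's h] := IH (P :: rem Q s).
  - rewrite /= size_rem //; clear -Qs sz; by case: s Qs sz.
  - rewrite inE => /orP[/eqP ->|/mem_rem Q's]; apply: hs; rewrite ?mem_head //.
    by rewrite inE Q's orbT.
  - have [Q' ] := hc _ Ix; rewrite inE => /orP[/eqP ->|Q's' h]; first by exists P; rewrite ?mem_head.
    have [e|ne] := eqVneq Q' Q; first by exists P; rewrite ?mem_head //; apply: QP; rewrite -e.
    by exists Q'; rewrite // inE (mem_rem_neq ne Q's') orbT.
  - exists Q' => //; move: Q's; rewrite !inE => /orP[->//|/mem_rem ->]; rewrite orbT //.
have H (Q : set R) : exists c, Q \in s -> Q c /\ ~ P c.
  have [Qs|] := boolP (Q \in s); last by exists 0.
  have /existsNP[c /not_implyP[h h']] : ~ (Q `<=` P) by move=> h; apply: nQ; exists Q.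
  by exists c.
have [c hcc] := choice H.
have pP : prime_ideal P by apply: hs; rewrite mem_head.
have [iP _ pPm] := pP.
have nPc : ~ P (\prod_(Q <- s) c Q).
  by move=> /(prime_ideal_prod pP)[Q /hcc[]].
have [Q] := hc (a + b * \prod_(Q <- s) c Q) (idlD hI Ia (idlMr _ hI Ib)).
rewrite inE => /orP[/eqP ->|Qs hQ].
  move=> h; have : P (b * \prod_(Q <- s) c Q).
    by have := idlB iP h Pa; rewrite addrAC subrr add0r.
  by move=> /pPm[].
have [iQ _ _] : prime_ideal Q by apply: hs; rewrite inE Qs orbT.
case: ha; exists Q => //.
have := idlB iQ hQ (idlM b iQ (ideal_prod_mem iQ Qs (proj1 (hcc Q Qs)))).
by rewrite addrK.
Qed.

Lemma noeth_mspan_fin V (A : set V) : noeth_mod V ->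
  exists s : seq V, (forall x, x \in s -> A x) /\ mspan A `<=` mspan [set` s].
Proof.
move=> nV.
have [||N [[s [sA ->]] mx]] := @noeth_max R V
  [set N | exists s : seq V, (forall x, x \in s -> A x) /\ N = mspan [set` s]] nV.
- by move=> N [s [_ ->]]; exact: submodule_mspan.
- by exists (mspan [set` [::]]), [::].
exists s; split=> //; apply: mspan_sub; first exact: submodule_mspan.
move=> a Aa; apply: (mx (mspan [set` a :: s])).
- by exists (a :: s); split=> // x; rewrite inE => /orP[/eqP ->|/sA].
- by apply: mspanS => x /= xs; rewrite inE xs orbT.
- by apply: mspan_mem; exact: mem_head.
Qed.

Definition ann V (x : V) : set R := [set c | c *: x = 0].

Lemma ideal_ann V (x : V) : ideal (ann x).
Proof.
split; first by rewrite /ann /= scale0r.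
by move=> c u v; rewrite /ann /= => hu hv; rewrite scalerDl -scalerA hu hv scaler0 addr0.
Qed.

(** Maximal annihilators of elements of V are prime, and finitely many of them contain all zero
    divisors on V. If I had no regular element, prime avoidance would place I in one of these
    annihilators. *)
Lemma exists_regular V I : noetherian R -> noeth_mod V -> ideal I ->
  (forall x : V, (forall c, I c -> c *: x = 0) -> x = 0) ->
  exists w, I w /\ forall x : V, w *: x = 0 -> x = 0.
Proof.
move=> nR nV hI hsoc.
pose mxann (x : V) := x != 0 /\ forall y : V, y != 0 -> ann x `<=` ann y -> ann y `<=` ann x.
have exmx (x : V) : x != 0 -> exists y, mxann y /\ ann x `<=` ann y.
  move=> x0.
  have [||N [[y [y0 xy ->]] mx]] := @noeth_max R R^o
    [set N | exists y : V, [/\ y != 0, ann x `<=` ann y & N = ann y]] nR.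
  - by move=> N [y [_ _ ->]]; exact: ideal_ann.
  - by exists (ann x), x; split.
  exists y; split=> //; split=> // z z0 yz; apply: mx => //.
  by exists z; split=> //; exact: subset_trans xy yz.
have prmx (x : V) : mxann x -> prime_ideal (ann x).
  move=> [x0 mx]; split; first exact: ideal_ann.
    by rewrite /ann /= scale1r; exact/eqP.
  move=> a b; rewrite /ann /= => h; have [bx|bx] := eqVneq (b *: x) 0; first by right.
  left; apply: (mx (b *: x) bx).
    by move=> c; rewrite /ann /= scalerA mulrC -scalerA => ->; rewrite scaler0.
  by rewrite /ann /= scalerA.
have [s [sA hs]] := @noeth_mspan_fin V mxann nV.
apply: contrapT => nw.
have zd w : I w -> exists2 x : V, x != 0 & w *: x = 0.
  move=> Iw; apply: contrapT => h; apply: nw; exists w; split=> // x wx.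
  by apply: contrapT => /eqP x0; apply: h; exists x.
have [P|x Ix|_ /mapP[y ys ->] IP] := @prime_avoidance I (map (@ann V) s) hI.
- by move=> /mapP[x /sA/prmx h ->].
- have [y y0 xy] := zd x Ix.
  have [z [mz yz]] := exmx y y0.
  suff [u us uz] : exists2 u, u \in s & ann u `<=` ann z.
    exists (ann u); first exact: map_f.
    have [u0 mu] := sA u us; apply: (mu z (proj1 mz) uz).
    by apply: yz.
  apply: contrapT => nu.
  have H (u : V) : exists c, u \in s -> ann u c /\ ~ ann z c.
    have [us|] := boolP (u \in s); last by exists 0.
    have /existsNP[c /not_implyP[h h']] : ~ (ann u `<=` ann z) by move=> h; apply: nu; exists u.
    by exists c.
  have [c hc] := choice H.
  have [u us] : exists2 u, u \in s & ann z (c u).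
    apply: (prime_ideal_prod (prmx z mz)).
    have /mspan_seq[d ->] : mspan [set` s] z by apply: hs; exact: mspan_in.
    rewrite /ann /= scaler_sumr big1 // => i _.
    rewrite scalerA mulrC -scalerA.
    have hi : s`_i \in s by exact: mem_nth.
    have : ann s`_i (\prod_(j <- s) c j).
      by apply: (ideal_prod_mem (ideal_ann _) hi); case: (hc _ hi).
    by rewrite /ann /= => ->; rewrite scaler0.
  by case: (hc u us).
- have [y0 _] := sA y ys.
  by move/eqP: y0; apply; apply: hsoc => c /IP.
Qed.

Lemma avoid_prime I (T : set R) : noetherian R -> ideal I ->
  T 1 -> (forall x y, T x -> T y -> T (x * y)) -> (forall x, I x -> ~ T x) ->
  exists P, [/\ prime_ideal P, I `<=` P & forall x, P x -> ~ T x].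
Proof.
move=> nR hI T1 TM hT.
have [||P [[hP IP PT] mx]] := @noeth_max R R^o
  [set P | [/\ ideal P, I `<=` P & forall x, P x -> ~ T x]] nR.
- by move=> N [].
- by exists I; split.
exists P; split=> //; split=> // [/PT //|x y Pxy].
apply: contrapT => /not_orP[nx ny].
have key z : ~ P z -> exists u r, [/\ P u & T (u + r * z)].
  move=> nz; apply: contrapT => h; apply: nz.
  pose Z : set R := [set c | exists r, c = r * z].
  have iZ : ideal Z.
    split; first by exists 0; rewrite mul0r.
    by move=> c _ _ [u ->] [v ->]; exists (c * u + v); rewrite mulrDl -mulrA.
  apply: (mx (idl_add P Z)).
  - split; [exact: ideal_add|by apply: subset_trans IP _; exact: idl_addl|].
    by move=> _ [u hu [_ [r ->] <-]] hT'; apply: h; exists u, r.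
  - exact: idl_addl.
  - by apply: idl_addr => //; exists 1; rewrite mul1r.
have [u [r [Pu Tu]]] := key x nx; have [v [q [Pv Tv]]] := key y ny.
apply: (PT _ _ (TM _ _ Tu Tv)).
have -> : (u + r * x) * (v + q * y) = (v + q * y) * u + (r * x * v + r * q * (x * y)) by ring.
by apply: idlD => //; [exact: idlM|apply: idlD => //; exact: idlM].
Qed.

Definition minover K Q : Prop :=
  [/\ prime_ideal Q, K `<=` Q &
      forall P, prime_ideal P -> K `<=` P -> P `<=` Q -> Q `<=` P].

Lemma minover_ex K Q : prime_ideal Q -> K `<=` Q -> exists2 P, minover K P & P `<=` Q.
Proof.
move=> pQ KQ; pose T := {P : set R | [/\ prime_ideal P, K `<=` P & P `<=` Q]}.
pose le (x y : T) := `[< sval y `<=` sval x >].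
have [||[x Px] [y Py] /asboolP h /asboolP h'|F Ft|[t [t1 t2 t3]] tm] := @Zorn T le.
- by move=> x; apply/asboolP.
- by move=> x y z /asboolP h /asboolP h'; apply/asboolP; exact: subset_trans h' h.
- by apply: eq_exist; exact/seteqP.
- have [[X0 FX0]|F0] := pselect (exists X, F X); last first.
    have PQ : [/\ prime_ideal Q, K `<=` Q & Q `<=` Q] by split=> // x.
    by exists (exist _ Q PQ) => s Fs; case: F0; exists s.
  pose U : set R := [set x | forall X, F X -> sval X x].
  have PU : [/\ prime_ideal U, K `<=` U & U `<=` Q].
    split; last 2 first.
    - by move=> x Kx X FX; case: (svalP X) => _ + _; apply.
    - by move=> x /(_ _ FX0); case: (svalP X0) => _ _; apply.
    split.
    - split; first by move=> X FX; case: (svalP X) => [[iX _ _] _ _]; exact: idl0.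
      move=> a x y hx hy X FX; case: (svalP X) => [[[_ iX] _ _] _ _].
      by apply: iX; [exact: hx|exact: hy].
    - by move=> /(_ _ FX0); case: (svalP X0) => [[_ n1 _] _ _].
    - move=> x y hxy; apply: contrapT => /not_orP[/existsNP[X /not_implyP[FX nx]]
        /existsNP[Y /not_implyP[FY ny]]].
      have [/asboolP l|/asboolP l] := Ft _ _ FX FY.
        case: (svalP Y) => [[_ _ pY] _ _].
        by have [/l/nx|/ny] := pY _ _ (hxy Y FY).
      case: (svalP X) => [[_ _ pX] _ _].
      by have [/nx|/l/ny] := pX _ _ (hxy X FX).
  by exists (exist _ U PU) => X FX; apply/asboolP => x /(_ _ FX).
- exists t => //; split=> // P pP KP Pt.
  have PP : [/\ prime_ideal P, K `<=` P & P `<=` Q] by split=> //; exact: subset_trans Pt t3.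
  by have [<-] := tm (exist _ P PP) (asboolT Pt).
Qed.

(** This is nilpotency of a in R_Q/K without localizing: otherwise a prime over K avoiding all a^k b
    would lie strictly below Q. *)
Lemma minover_nilp K Q a : noetherian R -> minover K Q -> Q a ->
  exists k b, ~ Q b /\ ideal_gen K (a ^+ k * b).
Proof.
move=> nR [pQ KQ mQ] Qa; apply: contrapT => h.
have [_ n1 pQm] := pQ.
have [|||P [pP KP PT]] := @avoid_prime (ideal_gen K)
  [set x | exists k b, ~ Q b /\ x = a ^+ k * b] nR (ideal_ideal_gen _).
- by exists 0%N, 1; rewrite expr0 mul1r.
- move=> _ _ [i [b [hb ->]]] [j [c [hc ->]]]; exists (i + j)%N, (b * c).
  by split; [move=> /pQm[]|rewrite exprD mulrACA].
- by move=> x hx [i [b [hb e]]]; apply: h; exists i, b; rewrite -e.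
have PQ : P `<=` Q.
  by move=> x Px; apply: contrapT => nx; apply: (PT x Px); exists 0%N, x; rewrite expr0 mul1r.
have /PT := mQ P pP (subset_trans (@sub_ideal_gen _ _) KP) PQ a Qa.
by apply; exists 1%N, 1; rewrite mulr1 expr1.
Qed.

Section LocalAt.
Variables (Q : set R) (pQ : prime_ideal Q).

(** Ideals of the localization R_Q are represented by saturated ideals of R; [sat] is extension to
    R_Q followed by contraction. *)
Definition satd J : Prop := forall s x, ~ Q s -> J (s * x) -> J x.
Definition sat J : set R := [set x | exists2 s, ~ Q s & J (s * x)].

Lemma ideal_sat J : ideal J -> ideal (sat J).
Proof.
move=> hJ; have [_ n1 pQm] := pQ; split; first by exists 1; rewrite ?mulr0 //; exact: idl0.
move=> c x y [s hs hx] [t ht hy]; exists (s * t); first by move=> /pQm[].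
have -> : s * t * (c * x + y) = (t * c) * (s * x) + s * (t * y) by ring.
by apply: idlD => //; exact: idlM.
Qed.

Lemma satd_sat J : satd (sat J).
Proof.
have [_ _ pQm] := pQ.
move=> s x hs [t ht h]; exists (t * s); first by move=> /pQm[].
by rewrite -mulrA.
Qed.

Lemma sub_sat J : J `<=` sat J.
Proof. by have [_ n1 _] := pQ; move=> x hx; exists 1; rewrite ?mul1r. Qed.

Lemma sat_sub J J' : J `<=` J' -> satd J' -> sat J `<=` J'.
Proof. by move=> h hs x [s ns /h]; exact: hs. Qed.

Lemma nakayama_at N C I : noetherian R -> ideal N -> satd N -> ideal C -> I `<=` Q ->
  C `<=` sat (idl_add N (ideal_gen [set x * y | x in I & y in C])) -> C `<=` N.
Proof.
move=> nR iN sN iC IQ hC; apply: contrapT => nCN.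
have [iQ n1 pQm] := pQ.
have [||H [[iH sH NH nCH] mx]] := @noeth_max R R^o
  [set H | [/\ ideal H, satd H, N `<=` H & ~ C `<=` H]] nR.
- by move=> H [].
- by exists N; split.
apply: nCH; apply: subset_trans hC _; apply: sat_sub => //.
move=> _ [u /NH hu [v hv <-]]; apply: idlD => //.
move: v hv; apply: ideal_gen_sub => // _ [h Ih [x Cx <-]].
apply: contrapT => nhx.
pose Z : set R := [set c | exists r, c = r * (h * x)].
have iZ : ideal Z.
  split; first by exists 0; rewrite mul0r.
  by move=> c _ _ [r ->] [v ->]; exists (c * r + v); rewrite mulrDl -mulrA.
have : sat (idl_add H Z) x.
  apply: contrapT => nx; apply: nhx; apply: (mx (sat (idl_add H Z))).
  - split; [exact/ideal_sat/ideal_add|exact: satd_sat| |by move=> /(_ x Cx)].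
    apply: subset_trans NH _ => z hz; apply: sub_sat; exact: idl_addl.
  - by move=> z hz; apply: sub_sat; exact: idl_addl.
  - by apply: sub_sat; apply: idl_addr => //; exists 1; rewrite mul1r.
move=> [s hs [y hy [_ [r ->] e]]]; apply: nhx; apply: idlM => //.
apply: (sH (s - r * h)).
  by move=> h'; apply: hs; rewrite -(subrK (r * h) s); apply: idlD => //; apply: idlM => //; exact: IQ.
by rewrite mulrBl -e -mulrA addrK.
Qed.

(** R_Q/K is artinian. In the noetherian induction on K', choose nu outside K' with Q nu inside K'.
    Either nu lies in the whole chain, or it drops out and adding nu loses no information, since r
    nu in J n then forces r into Q; both cases reduce to K' + (nu). *)
Lemma dcc_at K (J : nat -> set R) : noetherian R -> minover K Q ->
  (forall n, [/\ ideal (J n), satd (J n) & K `<=` J n]) ->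
  (forall n, J n.+1 `<=` J n) ->
  exists n, forall i, (n <= i)%N -> J n `<=` J i.
Proof.
move=> nR mQ; have [iQ n1 pQm] := pQ.
have [g hg] := nR Q iQ.
pose C K' := satd K' -> K `<=` K' -> forall J : nat -> set R,
  (forall n, [/\ ideal (J n), satd (J n) & K' `<=` J n]) -> (forall n, J n.+1 `<=` J n) ->
  exists n, forall i, (n <= i)%N -> J n `<=` J i.
move=> hJ dJ; suff : C (sat (ideal_gen K)).
  apply=> //; [exact: satd_sat|move=> x Kx; apply: sub_sat; exact: idl_gen_in|].
  by move=> n; have [h1 h2 h3] := hJ n; split=> //; apply: sat_sub => //; exact: ideal_gen_sub.
move: (sat _) (ideal_sat (ideal_ideal_gen K)) => K0 iK0 {J hJ dJ}; move: K0 iK0.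
apply: (@noeth_ind R R^o _ nR) => K' iK' IH sK' KK' J hJ dJ.
have dJ' i n : (n <= i)%N -> J i `<=` J n.
  move=> /subnK <-; elim: (i - n)%N => // k IHk; rewrite addSn.
  exact: subset_trans (dJ _) IHk.
have [K1|nK1] := pselect (K' 1).
  by exists 0%N => i _ x _; have [iJ _ KJ] := hJ i; exact: (idl1 iJ (KJ _ K1)).
have [N hN] : exists N, ideal_pow Q N `<=` K'.
  rewrite hg; apply: ideal_pow_gen => // x xg.
  have Qx : Q x by rewrite hg; exact: idl_gen_mem.
  have [k [b [nb h]]] := minover_nilp nR mQ Qx.
  exists k; apply: (sK' b) => //; rewrite mulrC.
  by move: h; apply: ideal_gen_sub.
have [nu [nnu hnu]] : exists nu, ~ K' nu /\ forall c, Q c -> K' (c * nu).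
  elim: N hN => [|N IHN] hN; first by case: nK1; exact: hN.
  have [/IHN//|/existsNP[nu /not_implyP[h1 h2]]] := pselect (ideal_pow Q N `<=` K').
  by exists nu; split=> // c Qc; apply: hN; exact: ideal_powS_in.
pose Z : set R := [set c | exists r, c = r * nu].
have iZ : ideal Z.
  split; first by exists 0; rewrite mul0r.
  by move=> c _ _ [r ->] [v ->]; exists (c * r + v); rewrite mulrDl -mulrA.
pose K2 := sat (idl_add K' Z).
have K'2 : K' `<=` K2 by move=> x hx; apply: sub_sat; exact: idl_addl.
have K2nu : K2 nu by apply: sub_sat; apply: idl_addr => //; exists 1; rewrite mul1r.
have {}IH := IH K2 (ideal_sat (ideal_add iK' iZ)) K'2 (fun h => nnu (h _ K2nu))
  (satd_sat (J := _)) (subset_trans KK' K'2).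
have [allnu|/existsNP[n2 hn2]] := pselect (forall n, J n nu).
  apply: IH => // n; have [iJ sJ KJ] := hJ n; split=> //; apply: sat_sub => //.
  by move=> _ [u /KJ hu [_ [r ->] <-]]; apply: idlD => //; exact: idlM.
have [||n3 hn3] := IH (fun n => sat (idl_add (J n) Z)).
- move=> n; have [iJ sJ KJ] := hJ n; split; [exact/ideal_sat/ideal_add|exact: satd_sat|].
  apply: sat_sub; last exact: satd_sat.
  by move=> _ [u /KJ hu [v hv <-]]; apply: sub_sat; exists u => //; exists v.
- move=> n x [s hs [u /dJ hu [v hv e]]]; exists s => //.
  by exists u => //; exists v.
exists (maxn n2 n3) => i hi x hx.
have [iJi sJi KJi] := hJ i; have [iJ sJ KJ] := hJ (maxn n2 n3).
have nnuJ : ~ J (maxn n2 n3) nu by move/(dJ' _ _ (leq_maxl n2 n3)).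
have [s hs [y hy [_ [r ->] e]]] : sat (idl_add (J i) Z) x.
  apply: (hn3 i); first by rewrite (leq_trans (leq_maxr n2 n3)).
  by apply: sub_sat; apply: idl_addl => //; exact: dJ' (leq_maxr n2 n3) _ hx.
apply: (sJi s) => //; rewrite -e; apply: idlD => //; apply: KJi; apply: hnu.
apply: contrapT => nr; apply: nnuJ; apply: (sJ r) => //.
have -> : r * nu = s * x - y by rewrite -e addrAC subrr add0r.
by apply: idlB => //; [exact: idlM|exact: (dJ' i)].
Qed.

End LocalAt.

(** Krull's argument relative to p. The symbolic powers [qs n] of q over p become stationary modulo
    h at Q, Nakayama at Q removes h, and Nakayama at q then puts a power of q inside p. *)
Lemma principal_ideal_theorem (p q Q : set R) h : noetherian R ->
  minover (p `|` [set h]) Q -> prime_ideal p -> prime_ideal q ->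
  p `<=` q -> q `<=` Q -> ~ Q `<=` q -> q `<=` p.
Proof.
move=> nR mQ pp pq pq' qQ nQq.
have [pQ KQ mQ'] := mQ; have [iQ nQ1 pQm] := pQ; have [iq nq1 pqm] := pq.
have [ip np1 ppm] := pp.
have hnq : ~ q h.
  move=> qh; apply: nQq; apply: mQ' => // x [/pq' //|->] //.
pose qs n := sat q (idl_add (ideal_pow q n) p).
have iqs n : ideal (qs n) by apply: ideal_sat => //; apply: ideal_add => //; exact: ideal_pow_ideal.
have sqs n : satd q (qs n) by exact: satd_sat.
have qsS n : qs n.+1 `<=` qs n.
  move=> x [s hs [u hu [v hv e]]]; exists s => //; exists u; last by exists v.
  exact: ideal_pow_mono hu.
pose H : set R := [set c | exists r, c = r * h].
have iH : ideal H.
  split; first by exists 0; rewrite mul0r.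
  by move=> c _ _ [r ->] [v ->]; exists (c * r + v); rewrite mulrDl -mulrA.
have pqs n : p `<=` qs n.
  move=> x hx; apply: sub_sat => //; apply: idl_addr => //; exact: ideal_pow_ideal.
have [||n hn] := @dcc_at Q pQ _ (fun n => sat Q (idl_add (qs n) H)) nR mQ.
- move=> n; split; [by apply: ideal_sat => //; exact: ideal_add|exact: satd_sat|].
  move=> x hx; apply: sub_sat => //; case: hx => [hx|->].
    by apply: idl_addl => //; exact: pqs.
  by apply: idl_addr => //; exists 1; rewrite mul1r.
- move=> n x [s hs [u /qsS hu [v hv e]]]; exists s => //.
  by exists u => //; exists v.
have nqQ s : ~ Q s -> ~ q s by move=> h1 /qQ.
have qn : qs n `<=` qs n.+1.
  apply: (@nakayama_at Q pQ _ _ [set h]) => //.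
  - by move=> s x /nqQ; exact: sqs.
  - by move=> _ ->; apply: KQ; right.
  move=> x hx.
  have [s hs [y hy [_ [r ->] e]]] : sat Q (idl_add (qs n.+1) H) x.
    by apply: (hn n.+1) => //; apply: sub_sat => //; exact: idl_addl.
  exists s => //; exists y => //; exists (r * h) => //.
  rewrite mulrC; apply: idl_gen_in; exists h => //; exists r => //.
  apply: (sqs n h) => //; rewrite mulrC.
  have -> : r * h = s * x - y by rewrite -e addrAC subrr add0r.
  by apply: idlB => //; [exact: idlM|exact: qsS].
have : ideal_pow q n `<=` p.
  apply: (@nakayama_at q pq _ _ q) => //.
  - by move=> s x hs /ppm[/pq'|].
  - exact: ideal_pow_ideal.
  move=> x hx; have : qs n x by apply: sub_sat => //; exact: idl_addl.
  move=> /qn [s hs [u hu [v hv e]]]; exists s => //; exists v => //.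
  by exists u; rewrite // addrC.
move=> h1 x qx; apply: (@prime_ideal_exp p x n) => //.
by apply: h1; exact: ideal_pow_exp.
Qed.

Definition pchain n (P : nat -> set R) : Prop :=
  (forall i, (i <= n)%N -> prime_ideal (P i)) /\ (forall i, (i < n)%N -> P i `<` P i.+1).

Lemma pchain_sub n (P : nat -> set R) i j : pchain n P -> (i <= j <= n)%N -> P i `<=` P j.
Proof.
move=> [_ h] /andP[/subnK <-]; elim: (j - i)%N => [_ x //|k IH]; rewrite addSn => hk.
by apply: subset_trans (IH (ltnW hk)) _; case: (h _ hk).
Qed.

(** Take q maximal strictly below Q over the last but one prime of the chain, and h in s outside q.
    Then Q is minimal over q + (h), so every other x in s satisfies x^k b = y + a h with y in q and
    b outside Q. By the principal ideal theorem q is minimal over I and these y, which are one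
    fewer. *)
Lemma krull_height (s : seq R) : noetherian R -> forall I Q n (P : nat -> set R),
  minover (I `|` [set` s]) Q -> pchain n P -> I `<=` P 0%N -> P n = Q -> (n <= size s)%N.
Proof.
move=> nR; elim: {s}_.+1 {-2}s (ltnSn (size s)) => // t IH s sz I Q [|n] P mQ cP IP PnQ //.
have [pQ KQ mQ'] := mQ; have [iQ _ _] := pQ.
have [hP hP'] := cP.
have [PQ nQP] : P n `<` Q by rewrite -PnQ; exact: hP'.
have [||q [[pq Pq qQ nQq] mx]] := @noeth_max R R^o
  [set q | [/\ prime_ideal q, P n `<=` q, q `<=` Q & ~ Q `<=` q]] nR.
- by move=> q [[]].
- by exists (P n); split=> //; exact: hP.
have [iq _ pqm] := pq.
have IPn : I `<=` P n by apply: subset_trans IP _; apply: (pchain_sub cP); rewrite leq0n leqnSn.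
have [h hs nqh] : exists2 h, h \in s & ~ q h.
  apply: contrapT => nh; apply: nQq; apply: mQ' => // x [/IPn/Pq //|/= xs].
  by apply: contrapT => nqx; apply: nh; exists x.
have mQh : minover (q `|` [set h]) Q.
  split=> //; first by move=> x [/qQ //|->]; apply: KQ; right.
  move=> P' pP' KP' P'Q; apply: contrapT => nQP'; apply: nqh.
  apply: (mx P'); last by apply: KP'; right.
    split=> //; apply: subset_trans Pq _ => x qx; apply: KP'; by left.
  by move=> x qx; apply: KP'; left.
have H (x : R) : exists y, x \in s -> exists k b a, [/\ ~ Q b, q y & x ^+ k * b = y + a * h].
  have [xs|] := boolP (x \in s); last by exists 0.
  have Qx : Q x by apply: KQ; right.
  have [k [b [nb]]] := minover_nilp nR mQh Qx.
  have hH : ideal [set c | exists r, c = r * h].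
    split; first by exists 0; rewrite mul0r.
    by move=> c _ _ [r ->] [v ->]; exists (c * r + v); rewrite mulrDl -mulrA.
  move=> /(@ideal_gen_sub _ _ _ (ideal_add iq hH)) hh.
  have [|y qy [_ [r ->] e]] := hh.
    move=> z [qz|->]; first exact: idl_addl.
    by apply: idl_addr => //; exists 1; rewrite mul1r.
  by exists y => _; exists k, b, r.
have [g hg] := choice H.
pose u := map g (rem h s).
have su : (size u).+1 = size s.
  by rewrite size_map size_rem // prednK //; clear -hs; case: s hs.
rewrite -su ltnS.
pose P' i := if i == n then q else P i.
apply: (IH u _ I q n P').
- by rewrite -ltnS su.
- split=> //.
    move=> x [/IPn/Pq //|/= /mapP[z /mem_rem zs ->]].
    by have [k [b [a []]]] := hg z zs.
  move=> p pp Kp pq'.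
  have mQp : minover (p `|` [set h]) Q.
    split=> //; first by move=> x [/pq'/qQ //|->]; apply: KQ; right.
    move=> P2 pP2 KP2 P2Q; apply: mQ' => // x [Ix|/= xs].
      by apply: KP2; left; apply: Kp; left.
    have [->|xh] := eqVneq x h; first by apply: KP2; right.
    have [k [b [a [nb qy e]]]] := hg x xs.
    have [iP2 _ pP2m] := pP2.
    have : P2 (x ^+ k * b).
      rewrite e; apply: idlD => //; last by apply: idlM => //; apply: KP2; right.
      by apply: KP2; left; apply: Kp; right; apply: map_f; rewrite mem_rem_neq.
    by move=> /pP2m[/(prime_ideal_exp pP2)|/P2Q].
  exact: (principal_ideal_theorem nR mQp).
- split=> i hi; rewrite /P'.
    by case: eqP => // _; apply: hP; rewrite (leq_trans hi).
  rewrite (ltn_eqF hi); case: (i.+1 =P n) => [e|_]; last by apply: hP'; rewrite (leq_trans hi).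
  have [h1 h2] : P i `<` P n by rewrite -e; apply: hP'; rewrite (leq_trans hi).
  split; first exact: subset_trans h1 Pq.
  by move=> h3; apply: h2; exact: subset_trans Pq h3.
- by rewrite /P'; case: eqP => // _; exact: subset_trans IPn Pq.
- by rewrite /P' eqxx.
Qed.

End Primes.

(** * Injective dimension and vanishing of Ext *)

Section InjectiveDimension.
Variable R : comNzRingType.
Implicit Types (N I X Y Z : lmodType R) (q : set R).

(* The vanishing of Ext^1(R/q, N). *)
Definition ext_from q N : Prop :=
  forall theta : R -> N,
  (forall c x y, q x -> q y -> theta (c * x + y) = c *: theta x + theta y) ->
  exists w, forall x, q x -> theta x = x *: w.

(* An injective coresolution of N of length n along which Ext^i(R/q, N) = 0   *)
(* for all i > d is visible; with q = set0 the second condition is void.      *)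
Fixpoint ext_le q (d n : nat) N : Prop :=
  match n with
  | 0 => injective_module N
  | n'.+1 => (d = 0%N -> ext_from q N) /\
     exists (I N' : lmodType R) (e : {linear N -> I}) (p : {linear I -> N'}),
       [/\ ses e p, injective_module I & ext_le q d.-1 n' N']
  end.

(** To be read as injective dimension at most [n]. *)
Definition idle n N := ext_le set0 0 n N.

Lemma ext_from0 N : ext_from set0 N.
Proof. by move=> theta _; exists 0. Qed.

Lemma injective_ext_from q N : ideal q -> injective_module N -> ext_from q N.
Proof. by move=> iq /injective_baer bN theta; exact: bN. Qed.

Lemma idleSE n N : idle n.+1 N <->
  exists (I N' : lmodType R) (e : {linear N -> I}) (p : {linear I -> N'}),
       [/\ ses e p, injective_module I & idle n N'].
Proof. by split=> [[]|h]; last (split=> // _; exact: ext_from0). Qed.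

Lemma idle_ext_le q d n N : (n <= d)%N -> idle n N -> ext_le q d n N.
Proof.
elim: n d N => [|n IH] [|d] N //= hd [_ [I [N' [e [p [h1 h2 h3]]]]]].
by split=> //; exists I, N', e, p; split=> //; exact: IH.
Qed.

Lemma zero_ex : exists Z : lmodType R, forall x : Z, x = 0.
Proof.
have [Z [p [ps pk]]] := quot_ex (@submodule_setT R R^o).
by exists Z => x; have [y <-] := ps x; apply/pk.
Qed.

Lemma bij_inv X Y (h : {linear X -> Y}) : injective h -> (forall y, exists x, h x = y) ->
  exists g : {linear Y -> X}, (forall x, g (h x) = x) /\ (forall y, h (g y) = y).
Proof.
move=> hi hs; have [y|g hg] := fact_inj (g := lin_id Y) hi; first exact: hs.
by exists g; split=> // x; apply: hi; rewrite hg.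
Qed.

Definition qok q := ideal q \/ q = set0.

Lemma qok_lin q c x y : qok q -> q x -> q y -> q (c * x + y).
Proof. by move=> [[_ h]|-> //]; exact: h. Qed.

Lemma qok0 : qok set0. Proof. by right. Qed.

Lemma ext_le_mono q d n N : qok q -> ext_le q d n N -> ext_le q d n.+1 N.
Proof.
move=> iq; elim: n d N => [|n IH] d N; last first.
  move=> [h0 [I [N' [e [p [h1 h2 h3]]]]]]; split=> //.
  by exists I, N', e, p; split=> //; exact: IH.
move=> iN; split.
  move=> _; case: iq => [iq|q0]; first exact: injective_ext_from.
  by move=> theta _; exists 0; rewrite q0.
have [Z hZ] := zero_ex.
exists N, Z, (lin_id N), (lin_0 N Z); split=> //; last exact: injm_zero.
by split=> // [y|x]; [exists 0; exact: etrans (hZ _) (esym (hZ _))|split=> // _; exists x].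
Qed.

Lemma idle_mono n m N : (n <= m)%N -> idle n N -> idle m N.
Proof.
move=> /subnK <-; elim: (m - n)%N => // k IH h.
by rewrite addSn; apply: ext_le_mono; [right|exact: IH].
Qed.

Lemma ext_le_monod q d n N : ext_le q d n N -> ext_le q d.+1 n N.
Proof.
elim: n d N => [|n IH] d N //= [h0 [I [N' [e [p [h1 h2 h3]]]]]].
split=> //; exists I, N', e, p; split=> //.
by case: d h0 h3 => [|d] h0 h3 //; exact: IH.
Qed.

Lemma ses_id X Y (h : {linear X -> Y}) I Z (e : {linear Y -> I}) (p : {linear I -> Z}) :
  injective h -> (forall y, exists x, h x = y) -> ses e p -> ses (lin_comp e h) p.
Proof.
move=> hi hs [ei ps ek]; split=> //.
  by move=> x y hxy; apply: hi; apply: ei; exact: hxy.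
move=> x; rewrite ek; split=> [[y <-]|[y <-]]; last by exists (h y).
by have [z <-] := hs y; exists z.
Qed.

Lemma ext_le_iso q d n X Y (h : {linear X -> Y}) : injective h ->
  (forall y, exists x, h x = y) -> ext_le q d n Y -> ext_le q d n X.
Proof.
move=> hi hs; case: n => [|n] /=.
  have [g [gh hg]] := bij_inv hi hs.
  by apply: (injm_iso (h := g)); exists h.
move=> [h0 [I [N' [e [p [h1 h2 h3]]]]]]; split; last first.
  by exists I, N', (lin_comp e h), p; split=> //; exact: ses_id.
move=> /h0 hY theta ht.
have [|w hw] := hY (fun x => h (theta x)).
  by move=> c x y qx qy; rewrite ht // linearP.
have [w' ew] := hs w; exists w' => x qx; apply: hi.
by rewrite hw // linearZ ew.
Qed.

(** The horseshoe lemma: Y embeds in I1 x I2 through an extension of X -> I1 and the composite Y ->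
    Z -> I2, and the three cokernels again form a short exact sequence. *)
Lemma ext_le_ext q d n X Y Z (e : {linear X -> Y}) (p : {linear Y -> Z}) : qok q ->
  ses e p -> ext_le q d n X -> ext_le q d n Z -> ext_le q d n Y.
Proof.
move=> oq; elim: n d X Y Z e p => [|n IH] d X Y Z e p [ei ps ek].
  move=> iX iZ; have [r hr] := injm_split iX ei.
  apply: (@ext_le_iso q d 0 _ _ (lin_pair r p)); last exact: injm_prod.
    apply: inj_lin => y; rewrite lin_pairE => -[ry /ek[x ex]].
    by rewrite -ex -[x]hr ex ry linear0.
  move=> [x z]; have [y py] := ps z; exists (y + e (x - r y)).
  have pe u : p (e u) = 0 by apply/ek; exists u.
  by rewrite lin_pairE (linearD r) (linearD p) hr pe addr0 py addrCA subrr addr0.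
move=> [X0 [I1 [X1 [e1 [p1 [[e1i p1s e1k] iI1 hX1]]]]]].
move=> [Z0 [I2 [Z1 [e2 [p2 [[e2i p2s e2k] iI2 hZ1]]]]]].
split.
  move=> d0 theta ht.
  have pt c x y : q x -> q y -> p (theta (c * x + y)) = c *: p (theta x) + p (theta y).
    by move=> qx qy; rewrite ht // linearP.
  have [z hz] := Z0 d0 (fun x => p (theta x)) pt.
  have [b pb] := ps z.
  have H x : exists u, q x -> e u = theta x - x *: b.
    have [qx|] := pselect (q x); last by exists 0.
    have /ek[u eu] : p (theta x - x *: b) = 0 by rewrite linearB linearZ pb hz // subrr.
    by exists u.
  have [g hg] := choice H.
  have [|w hw] := X0 d0 g; first move=> c x y qx qy.
    apply: ei; rewrite hg; last exact: qok_lin.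
    rewrite linearP !hg // ht // scalerBr scalerDl scalerA.
    by rewrite opprD addrACA.
  exists (b + e w) => x qx; rewrite scalerDr -linearZ -hw // hg //.
  by rewrite addrCA subrr addr0.
have [j hj] := iI1 _ _ e e1 ei.
pose h := lin_pair j (lin_comp e2 p).
have pe u : p (e u) = 0 by apply/ek; exists u.
have hi : injective h.
  apply: inj_lin => y; rewrite lin_pairE lin_compE => -[jy /(inj_lin0 e2i)/ek[x ex]].
  by rewrite -ex (inj_lin0 e1i (x := x)) ?linear0 // -hj ex.
have [C [c [_ cs ck]]] := coker_ex hi.
have [x /e1k[u <-]|u hu] := @fact_surj _ _ _ _ p1 (lin_comp c (lin_inl I1 I2)) p1s.
  rewrite lin_compE lin_inlE; apply/ck; exists (e u).
  by rewrite lin_pairE lin_compE pe linear0 hj.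
have [x /ck[y <-]|v hv] := @fact_surj _ _ _ _ c (lin_comp p2 (lin_snd I1 I2)) cs.
  by rewrite lin_compE lin_sndE lin_pairE lin_compE; apply/e2k; exists (p y).
exists (I1 * I2)%type, C, h, c; split=> //; first exact: injm_prod.
apply: (IH _ _ _ _ u v) => //; split.
- apply: inj_lin => x1; have [i <-] := p1s x1; rewrite hu lin_compE lin_inlE => /ck[y].
  rewrite lin_pairE lin_compE => -[jy /(inj_lin0 e2i)/ek[x ex]].
  by apply/e1k; exists x; rewrite -hj ex.
- move=> z1; have [i <-] := p2s z1; exists (c (0, i)).
  by rewrite hv.
- move=> y; have [[i i'] <-] := cs y; rewrite hv lin_compE lin_sndE /= e2k.
  split=> [[z ez]|[x1]].
    have [b pb] := ps z; exists (p1 (i - j b)); rewrite hu lin_compE lin_inlE.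
    apply/eqP; rewrite -subr_eq0 -linearB; apply/eqP/ck; exists (- b).
    apply: injective_projections; rewrite lin_pairE lin_compE /=.
      by rewrite linearN addrAC subrr add0r.
    by rewrite !linearN pb ez sub0r.
  have [i1 <-] := p1s x1; rewrite hu lin_compE lin_inlE.
  move=> /eqP; rewrite -subr_eq0 -linearB => /eqP/ck[b].
  rewrite lin_pairE lin_compE => /(congr1 snd) /= eb.
  by exists (- p b); rewrite linearN eb sub0r opprK.
Qed.

(** For Y embedded in an injective I, the quotient I/X is an extension of I/Y by Z. *)
Lemma idle_ses_left n X Y Z (e : {linear X -> Y}) (p : {linear Y -> Z}) :
  ses e p -> idle n Y -> idle n Z -> idle n.+1 X.
Proof.
case: n => [|n] [ei ps ek] hY hZ.
  by apply/idleSE; exists Y, Z, e, p.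
have /idleSE[I [Y' [i [t [[ii ts ik] iI hY']]]]] := hY.
have hi : injective (lin_comp i e) by move=> x y hxy; apply/ei/ii.
have [C [c [_ cs ck]]] := coker_ex hi.
apply/idleSE; exists I, C, (lin_comp i e), c; split=> //.
have [y /ek[x <-]|u hu] := @fact_surj _ _ _ _ p (lin_comp c i) ps.
  by rewrite lin_compE; apply/ck; exists x.
have [y /ck[x <-]|v hv] := @fact_surj _ _ _ _ c t cs.
  by apply/ik; exists (e x).
apply: (ext_le_ext (e := u) (p := v) qok0) => //; last exact: (idle_mono (leqnSn n) hY').
split.
- apply: inj_lin => z; have [y <-] := ps z; rewrite hu lin_compE => /ck[x] /ii <-.
  by apply/ek; exists x.
- by move=> y; have [w <-] := ts y; exists (c w); rewrite hv.
- move=> y; have [w <-] := cs y; rewrite hv ik; split=> [[y' <-]|[z]].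
    by exists (p y'); rewrite hu.
  have [y' <-] := ps z; rewrite hu lin_compE => /eqP; rewrite -subr_eq0 -linearB.
  move=> /eqP/ck[x ex]; exists (y' - e x); rewrite linearB.
  by rewrite -[i (e x)]/(lin_comp i e x) ex opprB addrCA subrr addr0.
Qed.

(** With Y embedded in I1 x I2, the quotients A by X and B by Y are extensions of cosyzygies by
    injectives, so they have smaller dimension, and Z is the kernel of A -> B. *)
Lemma idle_ses_right n X Y Z (e : {linear X -> Y}) (p : {linear Y -> Z}) :
  ses e p -> idle n X -> idle n Y -> idle n Z.
Proof.
move=> [ei ps ek] hX hY; have pe u : p (e u) = 0 by apply/ek; exists u.
case: n hX hY => [|n] hX hY.
  have [r hr] := injm_split hX ei.
  have [y /ek[x <-]|s hs] := @fact_surj _ _ _ _ p (lin_sub (lin_id Y) (lin_comp e r)) ps.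
    by rewrite lin_subE lin_idE lin_compE hr subrr.
  apply: (injm_retract (s := s) (r := p)) => // z; have [y <-] := ps z.
  by rewrite hs lin_subE lin_idE lin_compE linearB pe subr0.
have /idleSE[I1 [X1 [e1 [p1 [[e1i p1s e1k] iI1 hX1]]]]] := hX.
have /idleSE[I2 [Y1 [e2 [p2 [[e2i p2s e2k] iI2 hY1]]]]] := hY.
have [j hj] := iI1 _ _ e e1 ei.
pose h := lin_pair j e2.
have hi : injective h by apply: inj_lin => y [_ /(inj_lin0 e2i)].
have hei : injective (lin_comp h e) by move=> x y hxy; apply/ei/hi.
have [A [a [_ as_ ak]]] := coker_ex hei.
have [B [b [_ bs bk]]] := coker_ex hi.
have hA : idle n A.
  have [x /ak[u <-]|v hv] := @fact_surj _ _ _ _ a (lin_comp p1 (lin_fst I1 I2)) as_.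
    by rewrite !lin_compE lin_fstE lin_pairE hj; apply/e1k; exists u.
  apply: (ext_le_ext (e := lin_comp a (lin_inr I1 I2)) (p := v) qok0) => //; last first.
    by apply: (idle_mono (leq0n n)); exact: iI2.
  split.
  - apply: inj_lin => y; rewrite lin_compE lin_inrE => /ak[x].
    rewrite lin_compE lin_pairE hj => -[/(inj_lin0 e1i) ->]; by rewrite !linear0.
  - by move=> x1; have [i <-] := p1s x1; exists (a (i, 0)); rewrite hv.
  - move=> x; have [[i i'] <-] := as_ x; rewrite hv lin_compE lin_fstE e1k.
    split=> [[u eu]|[y]].
      rewrite /= in eu.
      exists (i' - e2 (e u)); rewrite lin_compE lin_inrE.
      apply/eqP; rewrite -subr_eq0 -linearB; apply/eqP/ak; exists (- u).
      apply: injective_projections; rewrite lin_compE lin_pairE /=.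
        by rewrite !linearN hj eu sub0r.
      by rewrite !linearN addrAC subrr add0r.
    rewrite lin_compE lin_inrE => /eqP; rewrite -subr_eq0 -linearB => /eqP/ak[u].
    rewrite lin_compE lin_pairE => /(congr1 fst) /=; rewrite hj => eu; rewrite /=.
    by exists (- u); rewrite linearN eu sub0r opprK.
have hB : idle n B.
  have [x /bk[u <-]|v hv] := @fact_surj _ _ _ _ b (lin_comp p2 (lin_snd I1 I2)) bs.
    by rewrite lin_compE lin_sndE lin_pairE; apply/e2k; exists u.
  apply: (ext_le_ext (e := lin_comp b (lin_inl I1 I2)) (p := v) qok0) => //; last first.
    by apply: (idle_mono (leq0n n)); exact: iI1.
  split.
  - apply: inj_lin => y; rewrite lin_compE lin_inlE => /bk[x].
    rewrite lin_pairE => -[jx /(inj_lin0 e2i) x0]; by rewrite -jx x0 linear0.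
  - by move=> y1; have [i <-] := p2s y1; exists (b (0, i)); rewrite hv.
  - move=> x; have [[i i'] <-] := bs x; rewrite hv lin_compE lin_sndE e2k.
    split=> [[u eu]|[y]].
      rewrite /= in eu.
      exists (i - j u); rewrite lin_compE lin_inlE.
      apply/eqP; rewrite -subr_eq0 -linearB; apply/eqP/bk; exists (- u).
      apply: injective_projections; rewrite lin_pairE /=.
        by rewrite !linearN addrAC subrr add0r.
      by rewrite !linearN eu sub0r.
    rewrite lin_compE lin_inlE => /eqP; rewrite -subr_eq0 -linearB => /eqP/bk[u].
    rewrite lin_pairE => /(congr1 snd) /= eu; rewrite /=.
    by exists (- u); rewrite linearN eu sub0r opprK.
have [y /ek[x <-]|u hu] := @fact_surj _ _ _ _ p (lin_comp a h) ps.
  by rewrite lin_compE; apply/ak; exists x.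
have [y /ak[x <-]|v hv] := @fact_surj _ _ _ _ a b as_.
  by apply/bk; exists (e x).
apply: (idle_ses_left (e := u) (p := v)) hA hB; split.
- apply: inj_lin => z; have [y <-] := ps z; rewrite hu lin_compE => /ak[x] /hi <-.
  exact: pe.
- by move=> y; have [w <-] := bs y; exists (a w); rewrite hv.
- move=> y; have [w <-] := as_ y; rewrite hv bk; split=> [[y' <-]|[z]].
    by exists (p y'); rewrite hu.
  have [y' <-] := ps z; rewrite hu lin_compE => /eqP; rewrite -subr_eq0 -linearB.
  move=> /eqP/ak[x ex]; exists (y' - e x); rewrite linearB.
  by rewrite -[h (e x)]/(lin_comp h e x) ex opprB addrCA subrr addr0.
Qed.

(** Schanuel's lemma in dual form: (I x I2)/X is at once an extension of X2 by I and of Z by I2.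
    Hence the bound does not depend on the embedding chosen. *)
Lemma idle_coker n X I Z (e : {linear X -> I}) (p : {linear I -> Z}) :
  ses e p -> injective_module I -> idle n.+1 X -> idle n Z.
Proof.
move=> [ei ps ek] iI /idleSE[I2 [X2 [e2 [p2 [[e2i p2s e2k] iI2 hX2]]]]].
pose h := lin_pair e e2.
have hi : injective h by apply: inj_lin => y [/(inj_lin0 ei)].
have [B [b [_ bs bk]]] := coker_ex hi.
have hB : idle n B.
  have [x /bk[u <-]|v hv] := @fact_surj _ _ _ _ b (lin_comp p2 (lin_snd I I2)) bs.
    by rewrite lin_compE lin_sndE lin_pairE; apply/e2k; exists u.
  apply: (ext_le_ext (e := lin_comp b (lin_inl I I2)) (p := v) qok0) => //; last first.
    by apply: (idle_mono (leq0n n)); exact: iI.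
  split.
  - apply: inj_lin => y; rewrite lin_compE lin_inlE => /bk[x].
    rewrite lin_pairE => -[jx /(inj_lin0 e2i) x0]; by rewrite -jx x0 linear0.
  - by move=> y1; have [i <-] := p2s y1; exists (b (0, i)); rewrite hv.
  - move=> x; have [[i i'] <-] := bs x; rewrite hv lin_compE lin_sndE e2k.
    split=> [[u eu]|[y]].
      rewrite /= in eu.
      exists (i - e u); rewrite lin_compE lin_inlE.
      apply/eqP; rewrite -subr_eq0 -linearB; apply/eqP/bk; exists (- u).
      apply: injective_projections; rewrite lin_pairE /=.
        by rewrite !linearN addrAC subrr add0r.
      by rewrite !linearN eu sub0r.
    rewrite lin_compE lin_inlE => /eqP; rewrite -subr_eq0 -linearB => /eqP/bk[u].
    rewrite lin_pairE => /(congr1 snd) /= eu; rewrite /=.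
    by exists (- u); rewrite linearN eu sub0r opprK.
have [x /bk[u <-]|v hv] := @fact_surj _ _ _ _ b (lin_comp p (lin_fst I I2)) bs.
  by rewrite lin_compE lin_fstE lin_pairE; apply/ek; exists u.
apply: (idle_ses_right (e := lin_comp b (lin_inr I I2)) (p := v)) hB; last first.
  by apply: (idle_mono (leq0n n)); exact: iI2.
split.
- apply: inj_lin => y; rewrite lin_compE lin_inrE => /bk[x].
  rewrite lin_pairE => -[/(inj_lin0 ei) -> <-]; by rewrite linear0.
- by move=> y1; have [i <-] := ps y1; exists (b (i, 0)); rewrite hv.
- move=> x; have [[i i'] <-] := bs x; rewrite hv lin_compE lin_fstE ek.
  split=> [[u eu]|[y]].
      rewrite /= in eu.
    exists (i' - e2 u); rewrite lin_compE lin_inrE.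
    apply/eqP; rewrite -subr_eq0 -linearB; apply/eqP/bk; exists (- u).
    apply: injective_projections; rewrite lin_pairE /=.
      by rewrite !linearN eu sub0r.
    by rewrite !linearN addrAC subrr add0r.
  rewrite lin_compE lin_inrE => /eqP; rewrite -subr_eq0 -linearB => /eqP/bk[u].
  rewrite lin_pairE => /(congr1 fst) /= eu; rewrite /=.
  by exists (- u); rewrite linearN eu sub0r opprK.
Qed.

(** Embed Y in I x I by its components along s r and 1 - s r. The cosyzygy of X in I is then a
    retract of the cokernel, and induction applies. *)
Lemma idle_retract n X Y (s : {linear X -> Y}) (r : {linear Y -> X}) :
  (forall x, r (s x) = x) -> idle n Y -> idle n X.
Proof.
elim: n X Y s r => [|n IH] X Y s r rs hY; first exact: (injm_retract rs).
have /idleSE[I [Y' [e [p [[ei ps ek] iI hY']]]]] := hY.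
have si : injective s by move=> x y hxy; rewrite -[x]rs hxy rs.
have hi : injective (lin_comp e s) by move=> x y hxy; apply/si/ei.
have [X' [p' [_ ps' pk']]] := coker_ex hi.
apply/idleSE; exists I, X', (lin_comp e s), p'; split=> //.
pose k := lin_pair (lin_comp (lin_comp e s) r) (lin_sub e (lin_comp e (lin_comp s r))).
have ki : injective k.
  apply: inj_lin => y; rewrite lin_pairE !(lin_compE, lin_subE) => -[e1].
  by rewrite e1 subr0 => /(inj_lin0 ei).
have [K [t [_ ts tk]]] := coker_ex ki.
have [x /tk[y <-]|v hv] := @fact_surj _ _ _ _ t (lin_comp p' (lin_fst I I)) ts.
  by rewrite lin_compE lin_fstE lin_pairE lin_compE; apply/pk'; exists (r y).
have [x /pk'[y <-]|u hu] := @fact_surj _ _ _ _ p' (lin_comp t (lin_inl I I)) ps'.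
  rewrite lin_compE lin_inlE; apply/tk; exists (s y).
  by rewrite lin_pairE !(lin_compE, lin_subE) rs subrr.
apply: (IH _ _ u v).
  by move=> x; have [y <-] := ps' x; rewrite hu lin_compE hv.
apply: (@idle_coker _ _ _ _ k t) => //; exact: injm_prod.
Qed.

Lemma idle_fun (T : Type) n X : idle n X -> idle n (T -> X).
Proof.
elim: n X => [|n IH] X; first exact: injm_fun.
move=> /idleSE[I [X' [e [p [[ei ps ek] iI hX']]]]].
apply/idleSE; exists (T -> I), (T -> X').
have el a (x y : T -> X) : e \o (a *: x + y) = a *: (e \o x : T -> I) + (e \o y).
  by apply/funext => t /=; rewrite linearP.
have pl a (x y : T -> I) : p \o (a *: x + y) = a *: (p \o x : T -> X') + (p \o y).
  by apply/funext => t /=; rewrite linearP.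
exists (linof el), (linof pl); split; [split|exact: injm_fun|exact: IH].
- move=> x y /(congr1 (fun f => f _)) hxy; apply/funext => t; apply: ei.
  exact: (hxy t).
- move=> y; have [g hg] := choice ps; exists (g \o y); apply/funext => t.
  exact: hg.
- move=> x; split=> [h|[y <-]]; last first.
    by apply/funext => t; apply/ek; exists (y t).
  have H t : exists y, e y = x t by apply/ek; exact: (congr1 (fun f => f t) h).
  by have [g hg] := choice H; exists g; apply/funext => t; exact: hg.
Qed.

Lemma idle_resolution n (M : lmodType R) (I : nat -> lmodType R) (e : {linear M -> I 0%N})
    (d : forall i, {linear I i -> I i.+1}) : injective_resolution e d ->
  (forall i, (n < i)%N -> forall x : I i, x = 0) -> idle n M.
Proof.
elim: n M I e d => [|n IH] M I e d [iI ei e0 ed] hI.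
  apply: (@ext_le_iso _ 0 0 _ _ e) => // [y|]; last exact: iI.
  by apply/e0; apply: hI.
have [N' [p [_ ps pk]]] := coker_ex ei.
have [x /pk/e0 //|u hu] := @fact_surj _ _ _ _ p (d 0%N) ps.
apply/idleSE; exists (I 0%N), N', e, p; split=> //.
apply: (IH _ (fun i => I i.+1) u (fun i => d i.+1)); last by move=> i hi; exact: hI.
split=> //.
- apply: inj_lin => x; have [y <-] := ps x; rewrite hu => /e0 h; exact/pk.
- move=> x; rewrite ed; split=> [[y <-]|[y <-]]; first by exists (p y); rewrite hu.
  by have [z <-] := ps y; exists z; rewrite hu.
Qed.

End InjectiveDimension.

(** * Koszul cochains *)

(* Cochains of the Koszul complex on a list x are families indexed by bit     *)
(* strings, i.e. by subsets of the index set of x.                            *)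
Section Koszul.
Variables (A : comNzRingType) (N : lmodType A).
Implicit Types (x s : seq A) (b c : seq bool) (psi phi : seq bool -> N).
Implicit Type th : seq bool -> A -> N.

(** The Koszul differential with the product u psi(c) replaced by an arbitrary function of c and u;
    this leaves room for linear forms defined only on an ideal containing the entries of x. *)
Fixpoint kosg x th b : N :=
  match x, b with
  | x0 :: x', b0 :: b' =>
    if b0 then th (false :: b') x0 - kosg x' (fun c => th (true :: c)) b'
    else kosg x' (fun c => th (false :: c)) b'
  | _, _ => 0
  end.

Definition kos x psi b : N := kosg x (fun c u => u *: psi c) b.

Definition deg b := count id b.

Lemma kosg_ext x th th' b : size b = size x ->
  (forall c u, size c = size b -> (deg c).+1 = deg b -> u \in x -> th c u = th' c u) ->
  kosg x th b = kosg x th' b.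
Proof.
elim: x b th th' => [|x0 x IH] [|b0 b] th th' //= [sb] h.
case: b0 h => h.
  rewrite h ?mem_head //; congr (_ - _); apply: IH => // c u sc dc ux.
  by apply: h; rewrite /= ?sc // ?inE ?ux ?orbT // /deg /= add1n -/(deg c) dc.
apply: IH => // c u sc dc ux.
by apply: h; rewrite /= ?sc // inE ux orbT.
Qed.

Lemma kosg0 x th b : (forall c u, th c u = 0) -> kosg x th b = 0.
Proof.
elim: x b th => [|x0 x IH] [|b0 b] th //= h.
by case: b0; rewrite ?h ?IH ?subr0 // => c u; exact: h.
Qed.

Lemma kosgD x th th' b : kosg x (fun c u => th c u + th' c u) b = kosg x th b + kosg x th' b.
Proof.
elim: x b th th' => [|x0 x IH] [|b0 b] th th' /=; rewrite ?addr0 //.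
by case: b0; rewrite IH // opprD addrACA.
Qed.

Lemma kosgZ x a th b : kosg x (fun c u => a *: th c u) b = a *: kosg x th b.
Proof.
elim: x b th => [|x0 x IH] [|b0 b] th /=; rewrite ?scaler0 //.
by case: b0; rewrite IH // scalerBr.
Qed.

Lemma kosgN x th b : kosg x (fun c u => - th c u) b = - kosg x th b.
Proof.
rewrite -scaleN1r -kosgZ; congr (kosg x _ b).
by apply/funext => c; apply/funext => u; rewrite scaleN1r.
Qed.

Lemma kosD x psi phi b : kos x (fun c => psi c + phi c) b = kos x psi b + kos x phi b.
Proof.
rewrite -kosgD; congr (kosg x _ b).
by apply/funext => c; apply/funext => u; rewrite scalerDr.
Qed.

Lemma kosZ x a psi b : kos x (fun c => a *: psi c) b = a *: kos x psi b.
Proof.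
rewrite -kosgZ; congr (kosg x _ b).
by apply/funext => c; apply/funext => u; rewrite !scalerA mulrC.
Qed.

Lemma kosN x psi b : kos x (fun c => - psi c) b = - kos x psi b.
Proof.
rewrite -kosgN; congr (kosg x _ b).
by apply/funext => c; apply/funext => u; rewrite scalerN.
Qed.

Lemma kosB x psi phi b : kos x (fun c => psi c - phi c) b = kos x psi b - kos x phi b.
Proof. by rewrite kosD kosN. Qed.

Lemma kos_true (x0 : A) x psi b :
  kos (x0 :: x) psi (true :: b) = x0 *: psi (false :: b) - kos x (fun c => psi (true :: c)) b.
Proof. by []. Qed.

Lemma kos_false (x0 : A) x psi b :
  kos (x0 :: x) psi (false :: b) = kos x (fun c => psi (false :: c)) b.
Proof. by []. Qed.

Lemma kos_ext x psi phi b : size b = size x ->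
  (forall c, size c = size b -> (deg c).+1 = deg b -> psi c = phi c) ->
  kos x psi b = kos x phi b.
Proof. by move=> sb h; apply: kosg_ext => // c u sc dc _; rewrite h. Qed.

Lemma kos_deg0 x psi b : deg b = 0%N -> kos x psi b = 0.
Proof.
by elim: x b psi => [|x0 x IH] [|[] b] psi //= h; rewrite kos_false IH.
Qed.

Lemma koskos x psi b : kos x (kos x psi) b = 0.
Proof.
elim: x b psi => [|x0 x IH] [|[] b] psi //; last exact: IH.
rewrite kos_true kos_false.
have -> : (fun c => kos (x0 :: x) psi (true :: c)) =
    (fun c => x0 *: psi (false :: c) - kos x (fun c => psi (true :: c)) c) by [].
by rewrite kosB IH subr0 kosZ subrr.
Qed.

Fixpoint dot s x : A :=
  match s, x with
  | s0 :: s', x0 :: x' => s0 * x0 + dot s' x'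
  | _, _ => 0
  end.

Lemma dot_cat0 n s x y : size x = n -> dot (nseq n 0 ++ s) (x ++ y) = dot s y.
Proof. by elim: n x => [|n IH] [|x0 x] //= [e]; rewrite mul0r add0r IH. Qed.

Lemma dotN s x : dot (map -%R s) x = - dot s x.
Proof.
by elim: s x => [|s0 s IH] [|x0 x] //=; rewrite ?oppr0 // IH mulNr opprD.
Qed.

Lemma dot_nth s x : size s = size x -> dot s x = \sum_(i < size x) s`_i * x`_i.
Proof.
elim: s x => [|s0 s IH] [|x0 x] //=; first by rewrite big_ord0.
by move=> [e]; rewrite big_ord_recl IH.
Qed.

(** Interior product with the vector [s]; [kos_con] is the homotopy formula relating it to the
    differential. *)
Fixpoint con s psi b : N :=
  match s, b with
  | s0 :: s', b0 :: b' =>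
    if b0 then - con s' (fun c => psi (true :: c)) b'
    else s0 *: psi (true :: b') + con s' (fun c => psi (false :: c)) b'
  | _, _ => 0
  end.

Lemma con_ext s psi phi b :
  (forall c, size c = size b -> deg c = (deg b).+1 -> psi c = phi c) ->
  con s psi b = con s phi b.
Proof.
elim: s b psi phi => [|s0 s IH] [|[] b] psi phi //= h.
  by congr (- _); apply: IH => c sc dc; apply: h; rewrite /= ?sc // /deg /= !add1n -!/(deg _) dc.
rewrite h //; congr (_ + _); apply: IH => c sc dc; apply: h; rewrite /= ?sc //.
Qed.

Lemma con0 s b : con s (fun=> 0) b = 0.
Proof.
by elim: s b => [|s0 s IH] [|[] b] //=; rewrite ?IH ?oppr0 // scaler0 addr0.
Qed.

Lemma conB s psi phi b : con s (fun c => psi c - phi c) b = con s psi b - con s phi b.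
Proof.
elim: s b psi phi => [|s0 s IH] [|[] b] psi phi /=; rewrite ?subr0 //; rewrite IH.
  by rewrite opprB opprK addrC.
by rewrite scalerBr opprD addrACA.
Qed.

Lemma conZ s a psi b : con s (fun c => a *: psi c) b = a *: con s psi b.
Proof.
elim: s b psi => [|s0 s IH] [|[] b] psi /=; rewrite ?scaler0 //; rewrite IH.
  by rewrite scalerN.
by rewrite scalerDr !scalerA mulrC.
Qed.

Lemma kos_con s x psi b : size s = size x -> size b = size x ->
  kos x (con s psi) b + con s (kos x psi) b = dot s x *: psi b.
Proof.
elim: x s b psi => [|x0 x IH] [|s0 s] [|b0 b] psi //.
  by rewrite scale0r addr0.
move=> [ss] [sb]; case: b0.
  rewrite kos_true /=.
  have -> : (fun c => kos (x0 :: x) psi (true :: c)) =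
    (fun c => x0 *: psi (false :: c) - kos x (fun c => psi (true :: c)) c) by [].
  rewrite kosN conB conZ opprK scalerDr.
  have := IH s b (fun c => psi (true :: c)) ss sb; move: (kos x (con s _) b) => u e.
  rewrite scalerDl -e scalerA mulrC opprB.
  by rewrite -!addrA; congr (_ + _); rewrite addrCA; congr (_ + _); rewrite addrCA subrr addr0.
rewrite kos_false /=.
have -> : (fun c => s0 *: psi (true :: c) + con s (fun c => psi (false :: c)) c) =
  (fun c => con (s0 :: s) psi (false :: c)) by [].
rewrite -[kos x (fun c => _ + _) b]/(kos x (fun c => s0 *: psi (true :: c) +
   con s (fun c => psi (false :: c)) c) b) kosD kosZ kos_true.
have -> : (fun c => kos (x0 :: x) psi (false :: c)) = kos x (fun c => psi (false :: c)) by [].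
have := IH s b (fun c => psi (false :: c)) ss sb; move: (kos x (con s _) b) => u e.
rewrite scalerDl -e scalerBr scalerA.
by rewrite addrACA [_ + (_ - _)]addrC subrK.
Qed.

(** Write the first entry of xs as s . ys. The vector (1, 0, ..., 0, -s) has zero product with the
    whole list, so contraction with it anticommutes with the differential. Contracting removes this
    entry at the cost of a sign, and the support condition on G kills the other terms. *)
Lemma kos_elim (xs ys : seq A) i psi (G : seq bool -> N) :
  (forall z, z \in xs -> exists2 s, size s = size ys & z = dot s ys) ->
  (forall b, size b = size (xs ++ ys) -> deg b = (size xs + i)%N ->
     kos (xs ++ ys) psi b = G b) ->
  (forall b, size b = size (xs ++ ys) -> deg b = (size xs + i)%N ->
     take (size xs) b <> nseq (size xs) true -> G b = 0) ->
  exists psi', exists e : bool, forall b, size b = size ys -> deg b = i ->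
     G (nseq (size xs) true ++ b) = (-1) ^+ e *: kos ys psi' b.
Proof.
elim: xs psi G => [|x0 xs IH] psi G hx hG hs.
  by exists psi, false => b sb db; rewrite scale1r hG.
have [s ss ex0] := hx x0 (mem_head _ _).
pose t := nseq (size xs) 0 ++ map -%R s.
have st : size t = size (xs ++ ys) by rewrite !size_cat size_nseq size_map ss.
have dt : dot (1 :: t) (x0 :: xs ++ ys) = 0.
  by rewrite /= dot_cat0 // dotN -ex0 mul1r subrr.
pose psi1 c := con (1 :: t) psi (false :: c).
have h1 b : size b = size (xs ++ ys) -> deg b = (size xs + i)%N ->
    kos (xs ++ ys) psi1 b = - G (true :: b).
  move=> sb db; apply/eqP; rewrite -addr_eq0; apply/eqP.
  have := @kos_con (1 :: t) (x0 :: xs ++ ys) psi (false :: b).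
  rewrite dt scale0r => <- //=; rewrite ?st ?sb //.
  rewrite kos_false; congr (_ + _); rewrite -[LHS]addr0 scale1r; congr (_ + _).
    by rewrite hG //= ?sb // /deg /= add1n -/(deg b) db.
  rewrite (@con_ext _ _ (fun=> 0)) ?con0 // => c sc dc.
  rewrite -[_ :: xs ++ ys]/((x0 :: xs) ++ ys) hG /= ?sc ?sb //; last first.
    by rewrite /deg /= add0n -/(deg c) dc db.
  by apply: hs => //=; rewrite ?sc ?sb // /deg /= add0n -/(deg c) dc db.
have [|||psi' [e he]] := IH psi1 (fun b => - G (true :: b)).
- by move=> z zx; apply: hx; rewrite inE zx orbT.
- by move=> b sb db; rewrite h1.
- move=> b sb db nb; rewrite hs ?oppr0 //= ?sb // /deg /= ?add1n -/(deg b) ?db //.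
  by move=> [].
exists psi', (~~ e) => b sb db.
by rewrite signrN scaleNr -he // opprK.
Qed.

End Koszul.

(** * Vanishing of Ext and Koszul coboundaries *)

Section KoszulLift.
Variables (A : comNzRingType) (q : set A) (iq : ideal q).
Implicit Types (N : lmodType A) (x : seq A) (lam : seq (A -> A)).

(* lam is, modulo q, a dual family of linear forms on q for the list x.       *)
Definition dual_forms x lam : Prop :=
  [/\ size lam = size x,
      forall u, u \in x -> q u,
      forall i c u v, (i < size x)%N -> q u -> q v ->
        q (nth id lam i (c * u + v) - (c * nth id lam i u + nth id lam i v)) &
      forall i j, (i < size x)%N -> (j < size x)%N ->
        q (nth id lam i x`_j - (i == j)%:R)].

Lemma dual_forms_tail (x0 : A) x (l0 : A -> A) lam : dual_forms (x0 :: x) (l0 :: lam) -> dual_forms x lam.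
Proof.
move=> [[h1] h2 h3 h4]; split=> //.
- by move=> u ux; apply: h2; rewrite inE ux orbT.
- by move=> i c u v hi; exact: (h3 i.+1).
- by move=> i j hi hj; exact: (h4 i.+1 j.+1).
Qed.

Definition socle_elt N (v : N) : Prop := forall u, q u -> u *: v = 0.

(** The sum of lam_j(u) phi(b with bit j set) over the positions j before the first set bit of b.
    For a socle-valued phi, [kosg] of this family is phi again in positive degree, as lam_j(x_i) is
    1 or 0 modulo q. *)
Fixpoint kosL N lam (phi : seq bool -> N) (b : seq bool) (u : A) : N :=
  match lam, b with
  | l0 :: lam', b0 :: b' =>
    if b0 then 0 else l0 u *: phi (true :: b') + kosL lam' (fun c => phi (false :: c)) b' u
  | _, _ => 0
  end.

Lemma kosL_0 N lam (phi : seq bool -> N) b u : (forall c, socle_elt (phi c)) ->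
  (forall i, (i < size lam)%N -> q (nth id lam i u)) -> kosL lam phi b u = 0.
Proof.
elim: lam phi b => [|l0 lam IH] phi [|[] b] //= hphi h.
rewrite (hphi (true :: b)) ?add0r; last exact: (h 0%N).
by apply: IH => [c|i hi]; [exact: hphi|exact: (h i.+1)].
Qed.

Lemma kosg_kosL N x lam (phi : seq bool -> N) b : dual_forms x lam ->
  (forall c, socle_elt (phi c)) -> size b = size x -> (0 < deg b)%N ->
  kosg x (kosL lam phi) b = phi b.
Proof.
elim: x lam phi b => [|x0 x IH] lam phi b hd hphi.
  by case: b.
have [] := hd; case: lam hd => [|l0 lam] // hd [sl] hx hl hdl.
case: b => [|[] b] // [sb] db /=.
  rewrite kosg0 ?subr0 //.
  rewrite kosL_0 ?addr0; last 2 first.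
  - by move=> c; exact: hphi.
  - move=> i hi; have := hdl i.+1 0%N; rewrite /= subr0; apply=> //; by rewrite ltnS -sl.
  have /(hphi (true :: b)) : q (l0 x0 - 1) by apply: (hdl 0%N 0%N).
  by rewrite scalerBl scale1r => /eqP; rewrite subr_eq0 => /eqP.
rewrite -[RHS](IH lam (fun c => phi (false :: c)) b) //; last exact: dual_forms_tail hd.
apply: kosg_ext => // c u _ _ ux.
rewrite (hphi (true :: c)) ?add0r //.
have hi : (index u x < size x)%N by rewrite index_mem.
by have := hdl 0%N (index u x).+1 isT hi; rewrite /= nth_index // subr0.
Qed.

Lemma kosL_lin N x lam (phi : seq bool -> N) b c u v : dual_forms x lam ->
  (forall c, socle_elt (phi c)) -> q u -> q v ->
  kosL lam phi b (c * u + v) = c *: kosL lam phi b u + kosL lam phi b v.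
Proof.
move=> hd hphi qu qv; elim: x lam phi b hd hphi => [|x0 x IH] lam phi b hd hphi.
  by have [] := hd; case: lam hd => // *; rewrite scaler0 addr0.
have [] := hd; case: lam hd => [|l0 lam] // hd _ _ hl _.
case: b => [|[] b] /=; rewrite ?scaler0 ?addr0 //.
rewrite IH //; last exact: dual_forms_tail hd.
have /(hphi (true :: b)) := hl 0%N c u v isT qu qv.
rewrite /= scalerBl => /eqP; rewrite subr_eq0 => /eqP ->.
by rewrite scalerDl scalerDr scalerA addrACA.
Qed.

Lemma kosg_map N N' (e : {linear N -> N'}) x (th : seq bool -> A -> N) b :
  e (kosg x th b) = kosg x (fun c u => e (th c u)) b.
Proof.
elim: x b th => [|x0 x IH] [|[] b] th /=; rewrite ?linear0 //.
by rewrite linearB IH.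
Qed.

Lemma kos_map N N' (e : {linear N -> N'}) x (psi : seq bool -> N) b :
  e (kos x psi b) = kos x (fun c => e (psi c)) b.
Proof.
rewrite kosg_map; congr (kosg x _ b).
by apply/funext => c; apply/funext => u; rewrite linearZ.
Qed.

(** Dimension shifting. If Ext^1(A/q, N) = 0, each form is multiplication by an element. Otherwise,
    in an injective I containing N, the form of b is multiplication by P(b). The image of P in I/N
    lies in the socle, so through [kosL] it comes from forms into I/N of degree one less and is a
    coboundary by induction. Subtracting a lift of that coboundary from P brings the values into N
    without changing the differential. *)
Lemma koszul_lift x lam d n N i (th : seq bool -> A -> N) : dual_forms x lam ->
  ext_le q d n N -> (d <= i)%N ->
  (forall b, deg b = i -> forall c u v, q u -> q v -> th b (c * u + v) = c *: th b u + th b v) ->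
  exists psi, forall b, size b = size x -> deg b = i.+1 -> kosg x th b = kos x psi b.
Proof.
move=> hd; have [_ qx _ _] := hd.
have base N' i' (th' : seq bool -> A -> N') : ext_from q N' ->
  (forall b, deg b = i' -> forall c u v, q u -> q v -> th' b (c * u + v) = c *: th' b u + th' b v) ->
  exists psi : seq bool -> N', forall b, deg b = i' -> forall u, q u -> th' b u = u *: psi b.
  move=> hN hth.
  have H b : exists w, deg b = i' -> forall u, q u -> th' b u = u *: w.
    have [db|] := pselect (deg b = i'); last by exists 0.
    by have [w hw] := hN (th' b) (hth b db); exists w.
  by have [psi hpsi] := choice H; exists psi.
have base2 N' i' (th' : seq bool -> A -> N') : ext_from q N' ->
  (forall b, deg b = i' -> forall c u v, q u -> q v -> th' b (c * u + v) = c *: th' b u + th' b v) ->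
  exists psi, forall b, size b = size x -> deg b = i'.+1 -> kosg x th' b = kos x psi b.
  move=> hN hth; have [psi hpsi] := base _ _ _ hN hth; exists psi => b sb db.
  apply: kosg_ext => // c u _ dc /qx qu.
  by apply: hpsi => //; apply: succn_inj; rewrite dc.
elim: n d N i th => [|n IH] d N i th.
  by move=> iN _; apply: base2; exact: injective_ext_from.
move=> [h0 [I [N' [e [p [[ei ps ek] iI hN']]]]]]; case: d h0 hN' => [|d] h0 hN' di hth.
  exact: base2 (h0 erefl) hth.
case: i di hth => // i di hth.
have [P hP] := base I i.+1 (fun b u => e (th b u)) (injective_ext_from iq iI)
  (fun b db c u v qu qv => etrans (congr1 e (hth b db c u v qu qv)) (linearP e c _ _)).
pose phi b := if deg b == i.+1 then p (P b) else 0.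
have hphi b : socle_elt (phi b).
  rewrite /phi; case: eqP => [db|_] u qu; last by rewrite scaler0.
  by rewrite -linearZ -hP //; apply/ek; eexists.
have [b db c u v qu qv|psi' hpsi'] := IH d N' i (kosL lam phi) hN' di.
  exact: kosL_lin hd hphi qu qv.
have [psit hpsit] := choice (fun b => ps (psi' b)).
have H b : exists w, size b = size x -> deg b = i.+1 -> e w = P b - kos x psit b.
  have [[sb db]|nb] := pselect (size b = size x /\ deg b = i.+1); last first.
    by exists 0 => sb db; case: nb.
  have /ek[w ew] : p (P b - kos x psit b) = 0.
    rewrite linearB kos_map.
    have -> : kos x (fun c => p (psit c)) b = kos x psi' b.
      by apply: kos_ext => // c _ _; rewrite hpsit.
    rewrite -hpsi' // (kosg_kosL hd) // ?db //.
    by rewrite /phi db eqxx subrr.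
  by exists w.
have [psi hpsi] := choice H.
exists psi => b sb db; apply: ei; rewrite kosg_map kos_map.
transitivity (kos x P b).
  by apply: kosg_ext => // c u _ dc /qx qu; apply: hP => //; apply: succn_inj; rewrite dc.
transitivity (kos x (fun c => P c - kos x psit c) b).
  by rewrite kosB koskos subr0.
apply: kos_ext => // c sc dc; rewrite hpsi ?sc //.
by apply: succn_inj; rewrite dc.
Qed.

End KoszulLift.

Lemma ses_third (R : comNzRingType) (X Y Z I W C : lmodType R)
    (e : {linear X -> Y}) (pi : {linear Y -> Z}) (i : {linear Y -> I}) (p : {linear I -> W})
    (c : {linear I -> C}) : ses e pi -> ses i p -> ses (lin_comp i e) c ->
  exists (u : {linear Z -> C}) (v : {linear C -> W}), ses u v.
Proof.
move=> [ei ps ek] [ii ts ik] [_ cs ck].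
have [y /ek[x <-]|u hu] := @fact_surj _ _ _ _ pi (lin_comp c i) ps.
  by rewrite lin_compE; apply/ck; exists x.
have [y /ck[x <-]|v hv] := @fact_surj _ _ _ _ c p cs.
  by apply/ik; exists (e x).
exists u, v; split.
- apply: inj_lin => z; have [y <-] := ps z; rewrite hu lin_compE => /ck[x] /ii <-.
  by apply/ek; exists x.
- by move=> y; have [w <-] := ts y; exists (c w); rewrite hv.
- move=> y; have [w <-] := cs y; rewrite hv ik; split=> [[y' <-]|[z]].
    by exists (pi y'); rewrite hu.
  have [y' <-] := ps z; rewrite hu lin_compE => /eqP; rewrite -subr_eq0 -linearB.
  move=> /eqP/ck[x ex]; exists (y' - e x); rewrite linearB.
  by rewrite -[i (e x)]/(lin_comp i e x) ex opprB addrCA subrr addr0.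
Qed.

(** * Polynomial extensions *)

Section Coinduction.
Variables (A B : comNzRingType) (f : {rmorphism A -> B}).

Definition coind (X : lmodType A) : lmodType B := homm f (B^o : lmodType B) X.

(** By adjunction, B-linear maps into Hom_A(B, X) correspond to A-linear maps into X by evaluation
    at 1. *)
Lemma coind_injective (X : lmodType A) : injective_module X -> injective_module (coind X).
Proof.
move=> iX T T' u v ui.
pose u1 : restrict f T -> restrict f T' := u.
have u1l a x y : u1 (a *: x + y) = a *: u1 x + u1 y by rewrite /u1 linearP.
pose v1 (t : restrict f T) : X := val (v t) 1.
have v1l a x y : v1 (a *: x + y) = a *: v1 x + v1 y.
  rewrite /v1 -[v (_ + _)]/(v (f a *: (x : T) + (y : T))) linearP hommDE hommZE.
  by rewrite homm_scale.
have [w1 hw1] := iX _ _ (linof u1l) (linof v1l) ui.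
have wP (t : T') : homP f (fun p : B^o => w1 (p *: t)).
  by move=> r x y; rewrite scalerDl -scalerA -[LHS]/(w1 (r *: ((x *: t : T') : restrict f T') + (y *: t : T'))) linearP.
pose w t : coind X := mkhom (wP t).
have wl a x y : w (a *: x + y) = a *: w x + w y.
  apply: hommP => p; rewrite hommDE hommZE /= scalerDr scalerA.
  rewrite -[LHS]/(w1 (((p * a) *: x : T') + (p *: y : T'))) linearD.
  by rewrite -[a *: p]/(a * p) mulrC.
exists (linof wl) => a; apply: hommP => p /=.
have := hw1 (p *: a); rewrite -[linof u1l _]/(u (p *: a)) linearZ => ->.
rewrite -[LHS]/(val (v (p *: a)) 1) linearZ hommZE.
by rewrite -[p *: 1]/(p * 1) mulr1.
Qed.

Lemma coind_mapP (X Y : lmodType A) (h : {linear X -> Y}) (g : coind X) :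
  homP f (fun p => h (val g p)).
Proof. by move=> r x y; rewrite homm_val linearP. Qed.

Lemma coind_map_lin (X Y : lmodType A) (h : {linear X -> Y}) a (x y : coind X) :
  mkhom (coind_mapP h (a *: x + y)) =
  a *: (mkhom (coind_mapP h x) : coind Y) + mkhom (coind_mapP h y).
Proof. by apply: hommP => p; exact: (linearD h (val x (a *: p)) (val y p)). Qed.

Definition coind_map (X Y : lmodType A) (h : {linear X -> Y}) : {linear coind X -> coind Y} :=
  linof (coind_map_lin h).

Lemma coind_mapE (X Y : lmodType A) (h : {linear X -> Y}) (g : coind X) p :
  val (coind_map h g) p = h (val g p).
Proof. by []. Qed.

End Coinduction.

Section PolyCoinduction.
Variable A : comNzRingType.
Let B : comNzRingType := {poly A}.
Let f : {rmorphism A -> B} := polyC.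
Implicit Types (X Y N I : lmodType A).

(** A linear map out of the polynomial ring amounts to the sequence of its values on the powers of
    the variable. *)
Definition plin X (s : nat -> X) (p : B^o) : X := \sum_(i < size p) p`_i *: s i.

Lemma plinE X (s : nat -> X) (p : B) n : (size p <= n)%N ->
  plin s p = \sum_(i < n) p`_i *: s i.
Proof.
move=> h; rewrite /plin (big_ord_widen n (fun i => p`_i *: s i) h).
rewrite big_mkcond /=; apply: eq_bigr => i _; case: ltnP => // hi.
by rewrite nth_default // scale0r.
Qed.

Lemma plinP X (s : nat -> X) : homP f (plin s).
Proof.
move=> r x y; pose n := maxn (size (f r *: x + y)) (maxn (size x) (size y)).
rewrite (@plinE _ _ (f r *: x + y) n) ?leq_maxl // (@plinE _ _ x n) ?(@plinE _ _ y n) //.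
- rewrite scaler_sumr -big_split; apply: eq_bigr => i _ /=.
  by rewrite -[f r *: x]/(r%:P * x) coefD coefCM scalerDl scalerA.
- by rewrite (leq_trans (leq_maxr (size x) _)) // leq_maxr.
- by rewrite (leq_trans (leq_maxl _ (size y))) // leq_maxr.
Qed.

Definition pcoind X (s : nat -> X) : coind f X := mkhom (plinP s).

Lemma pcoindXn X (s : nat -> X) i : val (pcoind s) 'X^i = s i.
Proof.
rewrite /= (@plinE _ _ _ i.+1) ?size_polyXn // (bigD1 ord_max) //= coefXn eqxx scale1r.
rewrite big1 ?addr0 // => j; rewrite -val_eqE /= => h.
by rewrite coefXn (negbTE h) scale0r.
Qed.

Lemma coind_expand X (g : coind f X) p : val g p = \sum_(i < size p) p`_i *: val g 'X^i.
Proof.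
rewrite -{1}[p]coefK poly_def.
elim/big_rec2: _ => [|i u v _ <-]; first exact: homm0.
by rewrite homm_add; congr (_ + _); rewrite -[RHS]homm_scale /f -mul_polyC.
Qed.

Lemma coind_ext X (g h : coind f X) : (forall i, val g 'X^i = val h 'X^i) -> g = h.
Proof.
by move=> e; apply: hommP => p; rewrite !coind_expand; apply: eq_bigr => i _; rewrite e.
Qed.

Lemma coind_ses N I (N' : lmodType A) (e : {linear N -> I}) (p : {linear I -> N'}) :
  ses e p -> ses (coind_map f e) (coind_map f p).
Proof.
move=> [ei ps ek]; split.
- by move=> g h hgh; apply: hommP => u; apply: ei; rewrite -!coind_mapE hgh.
- move=> g; have [s hs] := choice ps.
  exists (pcoind (fun i => s (val g 'X^i))); apply: coind_ext => i.
  by rewrite coind_mapE pcoindXn hs.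
- move=> g; split=> [hg|[h <-]].
    have H i : exists y, e y = val g 'X^i by apply/ek; rewrite -coind_mapE hg.
    have [s hs] := choice H; exists (pcoind s); apply: coind_ext => i.
    by rewrite coind_mapE pcoindXn hs.
  by apply: hommP => u; rewrite !coind_mapE; apply/ek; eexists.
Qed.

Variables (q : set A) (iq : ideal q).

(** The ideal generated by q and the variable. *)
Definition poly_ideal : set B := [set p : {poly A} | q p`_0].

Lemma ideal_poly_ideal : ideal poly_ideal.
Proof.
split; first by rewrite /poly_ideal /= coef0; exact: idl0.
move=> c x y; rewrite /poly_ideal /= => hx hy.
by rewrite coefD coef0M; apply: idlD => //; exact: idlM.
Qed.

(** A form on the ideal (q, X) is determined by t, its value at 1. On constants t is multiplication
    by some w0, on polynomials without constant term it is already defined, and the two pieces glue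
    to an A-linear map on the polynomial ring. *)
Lemma coind_ext_from X : ext_from q X -> ext_from poly_ideal (coind f X).
Proof.
move=> hX th hth.
pose t (u : {poly A}) : X := val (th u) 1.
have tl c u v : poly_ideal u -> poly_ideal v -> t (c%:P * u + v) = c *: t u + t v.
  by move=> hu hv; rewrite /t hth // hommDE hommZE homm_scale.
have tr r u : poly_ideal u -> val (th u) r = t (r * u).
  move=> hu; have := hth r u 0 hu (idl0 ideal_poly_ideal).
  have -> : th 0 = 0.
    have := hth 1 0 0 (idl0 ideal_poly_ideal) (idl0 ideal_poly_ideal).
    by rewrite mul1r addr0 scale1r => /eqP; rewrite -subr_eq0 opprD addNKr oppr_eq0 => /eqP.
  by rewrite !addr0 /t => ->; rewrite hommZE -[r *: 1]/(r * 1) mulr1.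
have [c u v hu hv|w0 hw0] := hX (fun c => t c%:P).
  by rewrite polyCD polyCM tl //; rewrite /poly_ideal /= coefC.
have h0 (u : {poly A}) : poly_ideal (u - (u`_0)%:P).
  by rewrite /poly_ideal /= coefB coefC /= subrr; exact: idl0.
pose w (u : B^o) : X := (u : {poly A})`_0 *: w0 + t ((u : {poly A}) - ((u : {poly A})`_0)%:P).
have wP : homP f w.
  move=> r x y; rewrite /w -[f r *: x]/(r%:P * x) coefD coefCM.
  have -> : r%:P * x + y - (r * x`_0 + y`_0)%:P = r%:P * (x - (x`_0)%:P) + (y - (y`_0)%:P).
    by rewrite polyCD polyCM mulrBr opprD addrACA.
  by rewrite tl // scalerDl scalerDr scalerA addrACA.
exists (mkhom wP) => u hu; apply: hommP => r; rewrite hommZE tr //=.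
rewrite -[u *: r]/((u : B) * r) [(u : B) * r]mulrC /w.
have hru : poly_ideal (r * u) by exact: (idlM r ideal_poly_ideal hu).
rewrite -hw0 //.
have := tl 1 ((r * u)`_0)%:P (r * u - ((r * u)`_0)%:P).
rewrite polyC1 mul1r scale1r [X in t X]addrC subrK => <- //.
by rewrite /poly_ideal /= coefC.
Qed.

Lemma coind_ext_le d n X : ext_le q d n X -> ext_le poly_ideal d n (coind f X).
Proof.
elim: n d X => [|n IH] d X; first exact: coind_injective.
move=> [h0 [I [N' [e [p [h1 h2 h3]]]]]]; split; first by move=> /h0; exact: coind_ext_from.
exists (coind f I), (coind f N'), (coind_map f e), (coind_map f p); split=> //.
- exact: coind_ses.
- exact: coind_injective.
- exact: IH.
Qed.

Section Unit.
Variable N : lmodType B.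
Let N0 : lmodType A := restrict f N.

Definition coind_unit_fun (x : N) (p : B^o) : N0 := (p : B) *: x.
Lemma coind_unitP x : homP f (coind_unit_fun x).
Proof. by move=> r u v; rewrite /coind_unit_fun scalerDl -scalerA. Qed.
Lemma coind_unit_lin a x y : mkhom (coind_unitP (a *: x + y)) =
  a *: (mkhom (coind_unitP x) : coind f N0) + mkhom (coind_unitP y).
Proof.
apply: hommP => p; rewrite hommDE hommZE /= /coind_unit_fun scalerDr scalerA.
by rewrite -[a *: p]/(a * p) mulrC.
Qed.
Definition coind_unit : {linear N -> coind f N0} := linof coind_unit_lin.
Lemma coind_unitE x p : val (coind_unit x) p = p *: x. Proof. by []. Qed.

Definition coind_shift_fun (g : coind f N0) (p : B^o) : N0 :=
  'X *: (val g p : N) - (val g ('X * p) : N).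
Lemma coind_shiftP g : homP f (coind_shift_fun g).
Proof.
move=> r u v; rewrite /coind_shift_fun.
have -> : 'X * (f r *: u + v) = f r *: (('X * u : B) : B^o) + 'X * v.
  by rewrite -![f r *: _]/(f r * _) mulrDr mulrCA.
rewrite !homm_val scalerDr scalerBr opprD addrACA; congr (_ + _).
by rewrite -![r *: _]/(f r *: (_ : N)) scalerA mulrC -scalerA.
Qed.
Lemma coind_shift_lin a x y : mkhom (coind_shiftP (a *: x + y)) =
  a *: (mkhom (coind_shiftP x) : coind f N0) + mkhom (coind_shiftP y).
Proof.
apply: hommP => p; rewrite hommDE hommZE /= /coind_shift_fun !hommDE !hommZE.
rewrite scalerDr opprD addrACA; congr (_ - _ + _).
by rewrite -![a *: _]/(a * _) mulrCA.
Qed.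
Definition coind_shift : {linear coind f N0 -> coind f N0} := linof coind_shift_lin.
Lemma coind_shiftE g p : val (coind_shift g) p = 'X *: (val g p : N) - (val g ('X * p) : N).
Proof. by []. Qed.

(** N consists of the A-linear maps from the polynomial ring to N that commute with the variable,
    and the defect of commutation can be prescribed by solving a recursion on the powers of the
    variable. *)
Lemma coind_unit_ses : ses coind_unit coind_shift.
Proof.
split.
- move=> x y /(congr1 (fun g : coind f N0 => val g 1)).
  by rewrite !coind_unitE !scale1r.
- move=> h.
  pose s := fix s (i : nat) : N := if i is j.+1 then 'X *: s j - (val h 'X^j : N) else 0.
  exists (pcoind (s : nat -> N0)); apply: coind_ext => i.
  rewrite coind_shiftE -exprS !pcoindXn /=.
  by rewrite opprB addrCA subrr addr0.
- move=> g; split=> [hg|[x <-]]; last first.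
    apply: hommP => p; rewrite coind_shiftE !coind_unitE scalerA subrr.
    by [].
  have hX i : val g 'X^i = 'X^i *: (val g 1 : N).
    elim: i => [|i IH]; first by rewrite expr0 scale1r.
    have := congr1 (fun k : coind f N0 => val k 'X^i) hg; rewrite coind_shiftE -exprS.
    by move=> /eqP; rewrite subr_eq0 => /eqP <-; rewrite IH scalerA -exprS.
  by exists (val g 1); apply: coind_ext => i; rewrite coind_unitE hX.
Qed.

(** Embed N into the coinduced module of N0 and further into that of an injective I. By
    [coind_unit_ses] the cokernel is an extension of the coinduced module of the cosyzygy by that of
    N0, both of which are controlled by [coind_ext_le]. *)
Lemma ext_le_poly d n : ext_le q d n N0 -> ext_le poly_ideal d.+1 n.+1 N.
Proof.
have okp : qok poly_ideal by left; exact: ideal_poly_ideal.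
case: n => [|n] h.
  split=> //; exists (coind f N0), (coind f N0), coind_unit, coind_shift.
  by split; [exact: coind_unit_ses|exact: coind_injective|exact: coind_injective].
have hc := coind_ext_le h.
have [_ [I [N' [e [p [h1 h2 h3]]]]]] := h.
have hs := coind_ses h1.
have [u1 u2 u3] := coind_unit_ses; have [s1 _ _] := hs.
have hi : injective (lin_comp (coind_map f e) coind_unit) by move=> x y hxy; apply/u1/s1.
have [C [c hC]] := coker_ex hi.
split=> //; exists (coind f I), C, (lin_comp (coind_map f e) coind_unit), c; split=> //.
  exact: coind_injective.
have [u [v huv]] := ses_third coind_unit_ses hs hC.
apply: (ext_le_ext okp huv) => //.
have {}h3 := ext_le_mono okp (coind_ext_le h3).
by case: d h h3 {hc} => [|d] h h3 //; exact: ext_le_monod.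
Qed.

End Unit.
End PolyCoinduction.

(** * Hilbert's basis theorem *)

Section HilbertBasis.
Variable A : comNzRingType.

(** [L n] collects the coefficients of index n of the members of I of degree at most n. This
    sequence of ideals stabilizes, and lifts of generators up to the stable index allow the leading
    term to be removed in every degree. *)
Lemma noetherian_poly : noetherian A -> noetherian {poly A}.
Proof.
move=> nA I hI.
pose L n : set A := [set c | exists p : {poly A}, [/\ I p, (size p <= n.+1)%N & p`_n = c]].
have iL n : ideal (L n).
  split; first by exists 0; rewrite size_poly0 coef0; split=> //; exact: idl0.
  move=> c x y [p [hp sp <-]] [p' [hp' sp' <-]]; exists (c *: p + p'); split.
  - by rewrite -mul_polyC; apply: idlD => //; exact: idlM.
  - rewrite (leq_trans (size_polyD _ _)) // geq_max sp' andbT.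
    by rewrite (leq_trans (size_scale_leq _ _)).
  - by rewrite coefD coefZ.
have mL n : L n `<=` L n.+1.
  move=> c [p [hp sp <-]]; exists ('X * p); split.
  - exact: idlM.
  - rewrite (leq_trans (size_polyMleq _ _)) // size_polyX /=.
    by rewrite !ltnS in sp *.
  - by rewrite coefXM.
have [N hN] := noeth_stable (noeth_R nA) iL mL.
have mL' i j : (i <= j)%N -> L i `<=` L j.
  move=> /subnK <-; elim: (j - i)%N => // k IH; rewrite addSn.
  exact: subset_trans IH (mL _).
have H n : exists s : seq {poly A},
    (forall p, p \in s -> I p /\ (size p <= n.+1)%N) /\
    forall c, L n c -> exists a : nat -> A, c = \sum_(i < size s) a i * (s`_i)`_n.
  have [t ht] := nA _ (iL n).
  have ht' c : exists p : {poly A}, c \in t -> [/\ I p, (size p <= n.+1)%N & p`_n = c].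
    have [ct|] := boolP (c \in t); last by exists 0.
    have [p hp] : L n c by rewrite ht; exact: idl_gen_mem.
    by exists p.
  have [g hg] := choice ht'.
  exists (map g t); split.
    by move=> _ /mapP[c ct ->]; have [] := hg c ct.
  move=> c; rewrite ht => /ideal_gen_seq[a ->]; exists a.
  rewrite size_map; apply: eq_bigr => i _.
  by have [_ _ e] := hg t`_i (mem_nth 0 (ltn_ord i)); rewrite (nth_map 0) ?e.
have [s hs] := choice H.
pose S := flatten [seq s n | n <- iota 0 N.+1].
have hS n p : (n <= N)%N -> p \in s n -> p \in S.
  by move=> nN ps; apply/flattenP; exists (s n) => //; apply: map_f; rewrite mem_iota.
exists S; apply/seteqP; split; last first.
  apply: ideal_gen_sub => // p /= /flattenP[_ /mapP[n _ ->]] ps.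
  by case: (hs n) => /(_ p ps)[].
have iS := ideal_ideal_gen [set` S].
suff main k : forall p, I p -> (size p <= k)%N -> ideal_gen [set` S] p.
  by move=> p Ip; apply: (main (size p)).
elim: k => [|k IH] p Ip sp.
  by move: sp; rewrite leqn0 size_poly_eq0 => /eqP ->; exact: idl0.
pose n := minn k N.
have nk : (n <= k)%N by rewrite geq_minl.
have nN : (n <= N)%N by rewrite geq_minr.
have Lk : L n p`_k.
  have : L k p`_k by exists p.
  rewrite /n; case: (leqP k N) => // /ltnW h; exact: hN.
have [hs1 /(_ _ Lk)[a ea]] := hs n.
pose r := \sum_(i < size (s n)) (a i *: 'X^(k - n)) * (s n)`_i.
have rI J : ideal J -> (forall p, p \in s n -> J p) -> J r.
  move=> iJ h; apply: idl_sum => // i _; apply: idlM => //; apply: h.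
  exact: mem_nth.
rewrite -(subrK r p); apply: (idlD iS); last first.
  by apply: rI => // u us; apply: idl_gen_mem; exact: (hS n).
apply: IH; first by apply: idlB => //; apply: rI => // u /hs1[].
have hsz (i : 'I_(size (s n))) : (size ((s n)`_i : {poly A})%R <= n.+1)%N.
  by case: (hs1 _ (mem_nth 0 (ltn_ord i))).
have sr : (size r <= k.+1)%N.
  apply: (leq_trans (size_sum _ _ _)); apply/bigmax_leqP => i _.
  rewrite -scalerAl (leq_trans (size_scale_leq _ _)) //.
  rewrite (leq_trans (size_polyMleq _ _)) // size_polyXn /=.
  by rewrite (leq_trans (leq_add (leqnn _) (hsz i))) // addnS subnK.
apply/leq_sizeP => j; rewrite leq_eqVlt => /orP[/eqP <-|kj]; last first.
  by rewrite coefB !nth_default ?subrr // (leq_trans _ kj).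
rewrite coefB ea coef_sum; apply/eqP; rewrite subr_eq0; apply/eqP.
apply: eq_bigr => i _; rewrite -scalerAl coefZ coefXnM.
by rewrite ltnNge leq_subr /= subKn.
Qed.

End HilbertBasis.

(** * Flatness by equations, and the tower R[Y_1, ..., Y_e] *)

Section RelationalFlatness.

(* The equational criterion of flatness, for an algebra.                      *)
Definition frel (A B : comNzRingType) (f : A -> B) : Prop :=
  forall n (a : 'I_n -> A) (r : 'I_n -> B), \sum_i f (a i) * r i = 0 ->
  mspan [set ((fun i => f (rho i)) : 'I_n -> B^o) |
    rho in [set rho : 'I_n -> A | \sum_i a i * rho i = 0]] (r : 'I_n -> B^o).

Lemma frel_id (A : comNzRingType) : frel (@idfun A).
Proof. by move=> n a r h; apply: mspan_in; exists r. Qed.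

Lemma frel_comp (A B C : comNzRingType) (f : {rmorphism A -> B}) (g : {rmorphism B -> C}) :
  frel f -> frel g -> frel (g \o f).
Proof.
move=> hf hg n a r h; have := hg n (f \o a) r h.
move: (r : 'I_n -> C^o); apply: (@mspan_sub _ _ _ (mspan _)); first exact: submodule_mspan.
move=> _ [rho hr <-]; have := hf n a rho hr.
move: (rho : 'I_n -> B^o); apply: (@mspan_sub _ _ _ [set rho : 'I_n -> B^o |
  mspan [set ((fun i => (g \o f) (rho i)) : 'I_n -> C^o) |
    rho in [set rho : 'I_n -> A | \sum_i a i * rho i = 0]] (fun i => g (rho i) : C^o)]).
  set T := mspan _; have sT : submodule T by exact: submodule_mspan.
  split; first by rewrite /= (_ : (fun i => _) = 0); [exact: (sub0m sT)|apply/funext => i; rewrite /= rmorph0].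
  move=> b u v hu hv; rewrite /= (_ : (fun i => _) =
    g b *: ((fun i => g (u i)) : 'I_n -> C^o) + (fun i => g (v i))).
    by case: sT => _; apply.
    by apply/funext => i; rewrite /= rmorphD rmorphM.
by move=> _ [sig hs <-] N [sN]; apply; exists sig.
Qed.

Lemma frel_polyC (A : comNzRingType) : frel (@polyC A).
Proof.
move=> n a r h; pose N := \max_(i < n) size (r i).
have -> : r = \sum_(k < N) 'X^k *: ((fun i => ((r i)`_k)%:P) : 'I_n -> {poly A}^o).
  apply/funext => i; rewrite fct_sumE.
  have hN : (size (r i) <= N)%N by exact: leq_bigmax.
  rewrite -{1}[r i]coefK poly_def (big_ord_widen N (fun j => (r i)`_j *: 'X^j) hN) big_mkcond.
  apply: eq_bigr => j _; rewrite -[RHS]/('X^j * _) mulrC mul_polyC.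
  by case: ltnP => // hj; rewrite nth_default // scale0r.
have sT := submodule_mspan [set ((fun i => (rho i)%:P) : 'I_n -> {poly A}^o) |
  rho in [set rho : 'I_n -> A | \sum_i a i * rho i = 0]].
apply: (@subm_sum _ _ _ _ _ _ _ sT) => k _; apply: (submZ _ sT); apply: mspan_in.
exists (fun i => (r i)`_k) => //=.
have := congr1 (fun p : {poly A} => p`_k) h; rewrite coef_sum coef0 => h'.
rewrite /= -[RHS]h'; by apply: eq_bigr => i _; rewrite coefCM.
Qed.

End RelationalFlatness.

(** A stands for R[Y], q for (m, Y). The fields are chosen so as to pass to one more variable:
    [tw_dual] is independence modulo q^2, [tw_ext] is the shift of Ext by the number of variables,
    and [tw_reg] says that Y is regular over every ideal extended from R. *)
Record tower (R S : comNzRingType) (m : set R) (f : {rmorphism R -> S}) (ys : seq S)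
    (A : comNzRingType) (i : {rmorphism R -> A}) (g : {rmorphism A -> S})
    (q : set A) (Y : seq A) : Prop := Tower {
  tw_comp : forall x, g (i x) = f x;
  tw_Y : map g Y = ys;
  tw_q : ideal q;
  tw_res : forall u, exists c, q (u - i c);
  tw_qi : forall c, q (i c) <-> m c;
  tw_Yq : forall u, u \in Y -> q u;
  tw_gen : forall J : set A, ideal J -> (forall c, m c -> J (i c)) ->
     (forall u, u \in Y -> J u) -> q `<=` J;
  tw_dual : forall x lam, dual_forms m x lam ->
     exists lam', dual_forms q (map i x ++ Y) lam';
  tw_ext : forall (M : lmodType S) d n, ext_le m d n (restrict f M) ->
     ext_le q (d + size ys) (n + size ys) (restrict g M);
  tw_noeth : noetherian R -> noetherian A;
  tw_flat : frel i;
  tw_reg : forall (a : set R) j y, ideal a -> (j < size Y)%N ->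
     ideal_gen ([set i c | c in a] `|` [set` take j Y]) (Y`_j * y) ->
     ideal_gen ([set i c | c in a] `|` [set` take j Y]) y }.

Section TowerExists.
Variables (R S : comNzRingType) (m : set R) (f : {rmorphism R -> S}).
Hypothesis im : ideal m.

Lemma ideal_gen_polyC (A : comNzRingType) (T : set A) (p : {poly A}) :
  ideal_gen (polyC @` T) p <-> forall n, ideal_gen T p`_n.
Proof.
have iT := ideal_ideal_gen T.
split.
  move: p; apply: ideal_gen_sub.
    split; first by move=> n; rewrite coef0; exact: idl0.
    move=> c u v hu hv n; rewrite coefD; apply: (idlD iT) => //.
    by rewrite -[c *: u]/(c * u) coefM; apply: (@idl_sum _ _ _ _ _ _ iT) => j _; exact: (idlM _ iT).
  move=> _ [c hc <-] n; rewrite coefC; case: eqP => _; first exact: idl_gen_in.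
  exact: idl0.
move=> h; rewrite -[p]coefK poly_def.
have iP := ideal_ideal_gen (polyC @` T).
apply: (@idl_sum _ _ _ _ _ _ iP) => j _; rewrite -mul_polyC; apply: (idlMr _ iP).
move: (p`_j) (h j); apply: (@ideal_gen_sub _ _ [set c | ideal_gen (polyC @` T) c%:P]).
  split; first by rewrite /= polyC0; exact: idl0.
  move=> c u v /= hu hv; rewrite polyCD polyCM; apply: (idlD iP) => //; exact: (idlM _ iP).
by move=> c hc; apply: idl_gen_in; exists c.
Qed.

Lemma tower_ex (ys : seq S) : exists (A : comNzRingType) (i : {rmorphism R -> A})
  (g : {rmorphism A -> S}) (q : set A) (Y : seq A), tower m f ys i g q Y.
Proof.
elim/last_ind: ys => [|ys y [A [i [g [q [Y tw]]]]]].
  exists R, idfun, f, m, [::]; split=> //.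
  - by move=> u; exists u; rewrite subrr; exact: idl0.
  - by move=> x lam hx; exists lam; rewrite map_id cats0.
  - by move=> M d n; rewrite !addn0.
  - exact: frel_id.
pose g1 : {rmorphism {poly A} -> S} := horner_eval y \o map_poly g.
pose i1 : {rmorphism R -> {poly A}} := polyC \o i.
have g1C c : g1 c%:P = g c by rewrite /= /horner_eval map_polyC hornerC.
have g1X : g1 'X = y by rewrite /= /horner_eval map_polyX hornerX.
exists {poly A}, i1, g1, (poly_ideal q), (rcons (map polyC Y) 'X).
have iq := tw_q tw; have ip := ideal_poly_ideal iq.
have pC c : poly_ideal q c%:P <-> q c by rewrite /poly_ideal /= coefC.
have genE (a : set R) j : (j <= size Y)%N ->
   [set i1 c | c in a] `|` [set` take j (rcons (map polyC Y) 'X)] =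
   polyC @` ([set i c | c in a] `|` [set` take j Y]).
  move=> hj; rewrite -cats1 takel_cat ?size_map // -map_take.
  apply/seteqP; split=> x.
    move=> [[c hc <-]|/= /mapP[u hu ->]]; first by exists (i c) => //; left; exists c.
    by exists u => //; right.
  by move=> [v [[c hc <-]|/= hu] <-]; [left; exists c|right; exact: map_f].
split.
- by move=> x; rewrite -(tw_comp tw) -g1C.
- rewrite map_rcons g1X -map_comp -(tw_Y tw); congr rcons.
  by apply: eq_map => u; exact: g1C.
- exact: ip.
- move=> u; have [c hc] := tw_res tw u`_0; exists c.
  by rewrite /poly_ideal /= coefB coefC.
- by move=> c; rewrite -(tw_qi tw) -pC.
- move=> u; rewrite mem_rcons inE => /orP[/eqP ->|/mapP[v vY ->]].
    by rewrite /poly_ideal /= coefX; exact: idl0.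
  by apply/pC; exact: (tw_Yq tw).
- move=> J iJ hm hY u hu.
  have hX : J 'X by apply: hY; rewrite mem_rcons mem_head.
  have -> : u = (u`_0)%:P + drop_poly 1 u * 'X.
    rewrite -{1}(poly_take_drop 1 u) expr1; congr (_ + _).
    by apply/polyP => k; rewrite coef_take_poly coefC; case: k.
  apply: idlD => //; last exact: idlM.
  move: (u`_0) (hu : q u`_0); apply: (tw_gen tw (J := [set c | J c%:P])).
  + split; first by rewrite /= polyC0; exact: idl0.
    by move=> c x z /= hx hz; rewrite polyCD polyCM; apply: idlD => //; exact: idlM.
  + by move=> c; exact: hm.
  + by move=> v vY; apply: hY; rewrite mem_rcons inE map_f ?orbT.
- move=> x lam /(tw_dual tw)[lam' [h1 h2 h3 h4]].
  set x' := map i x ++ Y in h1 h2 h3 h4.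
  have ex' : map i1 x ++ rcons (map polyC Y) 'X = rcons (map polyC x') 'X.
    by rewrite -rcons_cat /x' map_cat -map_comp.
  (* The old forms act on the constant coefficient; the form dual to the new variable is the linear
     coefficient. *)
  exists (rcons (map (fun (l : A -> A) (p : {poly A}) => (l p`_0)%:P) lam')
    (fun p : {poly A} => (p`_1)%:P)); rewrite ex'; split.
  + by rewrite !size_rcons !size_map h1.
  + move=> u; rewrite mem_rcons inE => /orP[/eqP ->|/mapP[v vx ->]].
      by rewrite /poly_ideal /= coefX; exact: idl0.
    by apply/pC; exact: h2.
  + move=> j c u v; rewrite size_rcons size_map ltnS leq_eqVlt => /orP[/eqP ->|hj] hu hv.
      rewrite nth_rcons size_map h1 ltnn eqxx.
      rewrite /poly_ideal /= coefB !coefD !coef0M !coefC /= coefM.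
      rewrite big_ord_recl big_ord1 /= subn0 subSS subn0.
      set a := c`_0 * u`_1; have -> : a + c`_1 * u`_0 + v`_1 - (a + v`_1) = c`_1 * u`_0 by ring.
      exact: (idlM _ iq).
    rewrite nth_rcons size_map h1 hj (nth_map id) ?h1 //.
    have := h3 j c`_0 u`_0 v`_0 hj hu hv.
    by rewrite /poly_ideal /= coefB !coefD !coef0M !coefC /=.
  + have q0 j : (j < size x')%N -> q (nth id lam' j 0).
      move=> hj; have := h3 j 1 0 0 hj (idl0 iq) (idl0 iq).
      by rewrite mulr0 addr0 mul1r opprD addNKr => /(idlN iq); rewrite opprK.
    have sz : size x' = size lam' by rewrite h1.
    move=> j k; rewrite size_rcons size_map !ltnS.
    rewrite leq_eqVlt => /orP[/eqP ->|hj]; rewrite leq_eqVlt => /orP[/eqP ->|hk];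
      rewrite !nth_rcons ?size_map ?sz ?ltnn ?eqxx /poly_ideal /= coefB -polyC_natr ?coefC /=.
    - by rewrite coefX subrr; exact: idl0.
    - by rewrite -sz hk (nth_map 0) // coefC /= gtn_eqF // mulr0n subr0; exact: idl0.
    - rewrite -sz hj (nth_map id) ?h1 // coefC /= coefX /= ltn_eqF // mulr0n subr0; exact: q0.
    - by rewrite -sz hj hk (nth_map id) ?h1 // (nth_map 0) // !coefC /=; exact: h4.
- move=> M d n h; rewrite size_rcons !addnS.
  have {}h := tw_ext tw h.
  apply: (ext_le_poly (N := restrict g1 M) iq).
  pose h0 (x : restrict polyC (restrict g1 M)) : restrict g M := x.
  have hl c x z : h0 (c *: x + z) = c *: h0 x + h0 z.
    rewrite /h0 -[c *: (x : restrict g M)]/(g c *: (x : M)) -g1C.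
    by [].
  apply: (ext_le_iso (h := linof hl)) h; first by [].
  by move=> z; exists z.
- by move=> /(tw_noeth tw); exact: noetherian_poly.
- exact: frel_comp (tw_flat tw) (@frel_polyC A).
- move=> a j u ia; rewrite size_rcons size_map ltnS leq_eqVlt => /orP[/eqP ->|hj].
    rewrite genE // nth_rcons size_map ltnn eqxx => /ideal_gen_polyC h.
    by apply/ideal_gen_polyC => n; have := h n.+1; rewrite coefXM.
  rewrite genE 1?ltnW // nth_rcons size_map hj (nth_map 0) // => /ideal_gen_polyC h.
  apply/ideal_gen_polyC => n; apply: (tw_reg tw) => //.
  by have := h n; rewrite coefCM.
Qed.
End TowerExists.

(** * Comparison of Ext over R and over S *)

Section NatInf.
Implicit Types (A : set nat) (n : nat).

Lemma nat_inf_min A n : A n -> (forall j, A j -> (n <= j)%N) ->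
  nat_inf A = (n%:Z)%:E.
Proof.
move=> An hA; rewrite /nat_inf; set B := [set _ | _ in A].
have hB : infimums B (n%:Z)%:E.
  split; first by move=> _ [j Aj <-]; rewrite lee_fin lez_nat; exact: hA.
  by move=> x; apply; exists n.
rewrite /infimum ifF; last by apply/eqP => e; have : B (n%:Z)%:E; [exists n|rewrite e].
exact: (is_subset1_infimums (xgetI _ hB) hB).
Qed.

Lemma nat_sup_max A n : A n -> (forall j, A j -> (j <= n)%N) ->
  nat_sup A = (n%:Z)%:E.
Proof.
move=> An hA; rewrite /nat_sup; set B := [set _ | _ in A].
have hB : supremums B (n%:Z)%:E.
  split; first by move=> _ [j Aj <-]; rewrite lee_fin lez_nat; exact: hA.
  by move=> x; apply; exists n.
rewrite /supremum ifF; last by apply/eqP => e; have : B (n%:Z)%:E; [exists n|rewrite e].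
exact: (is_subset1_supremums (xgetI _ hB) hB).
Qed.

Lemma set_nat_min A : (exists n, A n) -> exists n, A n /\ forall j, A j -> (n <= j)%N.
Proof.
move=> [n0 h0]; have ex : exists n, `[< A n >] by exists n0; apply/asboolP.
case: (ex_minnP ex) => n /asboolP hn mn; exists n; split=> // j hj.
by apply: mn; apply/asboolP.
Qed.

Lemma nat_infP A : (exists n, A n /\ (forall j, A j -> (n <= j)%N) /\ nat_inf A = (n%:Z)%:E) \/
  nat_inf A = +oo%E.
Proof.
have [h|h] := pselect (exists n, A n).
  by left; have [n [An mn]] := set_nat_min h; exists n; split=> //; split=> //; exact: nat_inf_min.
right; rewrite /nat_inf /infimum ifT //; apply/eqP/seteqP; split=> // x [n An _].
by case: h; exists n.
Qed.

End NatInf.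

(** * Minimal generators and dual forms *)

Section MinimalGenerators.
Variables (R : comNzRingType) (m : set R).
Hypothesis lR : noetherian_local m.
Let im := noetherian_local_ideal lR.

Definition min_gens (x : seq R) : Prop :=
  m = ideal_gen [set` x] /\ edim m = ((size x)%:Z)%:E /\
  forall y, m = ideal_gen [set` y] -> (size x <= size y)%N.

Lemma min_gens_ex : exists x, min_gens x.
Proof.
have [s hs] := (let: And3 nR _ _ := lR in nR) m im.
have [|n [[x [sx hx]] mn]] := @set_nat_min [set n | exists s, size s = n /\ m = ideal_gen [set` s]].
  by exists (size s), s.
exists x; split=> //; split.
  by rewrite sx; apply: nat_inf_min => //; exists x.
by move=> y hy; rewrite sx; apply: mn; exists y.
Qed.

Lemma ideal_pow2_gens x z : m = ideal_gen [set` x] -> ideal_pow m 2 z ->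
  exists c : nat -> R, (forall j, m (c j)) /\ z = \sum_(j < size x) c j * x`_j.
Proof.
move=> mx; move: z; apply: (@ideal_powS_sub _ _ _ [set z | exists c : nat -> R,
  (forall j, m (c j)) /\ z = \sum_(j < size x) c j * x`_j]).
  split; first by exists (fun=> 0); split=> [j|]; [exact: (idl0 im)|rewrite big1 // => j _; rewrite mul0r].
  move=> a _ _ [c [hc ->]] [c' [hc' ->]]; exists (fun j => a * c j + c' j); split.
    by move=> j; apply: (idlD im) => //; exact: (idlM _ im).
  rewrite -[a *: _]/(a * _) mulr_sumr -big_split; apply: eq_bigr => j _ /=.
  by rewrite mulrDl mulrA.
move=> u v hu /(ideal_pow1 _ im); rewrite {1}mx => /ideal_gen_seq[c ->].
exists (fun j => u * c j); split; first by move=> j /=; exact: (idlMr _ im).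
by rewrite mulr_sumr; apply: eq_bigr => j _; rewrite mulrA.
Qed.

(** Rewrite the sum with coefficients c_j in m. If d_j were outside m, then d_j - c_j would be a
    unit and x_j could be omitted from the generators. *)
Lemma min_gens_rel x (d : nat -> R) : min_gens x ->
  ideal_pow m 2 (\sum_(j < size x) d j * x`_j) ->
  forall j, (j < size x)%N -> m (d j).
Proof.
move=> [mx [_ mn]] /(ideal_pow2_gens mx)[c [hc e]] j hj.
apply: contrapT => nd.
have nd' : ~ m (d j - c j) by move=> h; apply: nd; rewrite -(subrK (c j) (d j)); exact: (idlD im).
have [y hy] := noetherian_local_unit lR nd'.
pose x' := take j x ++ drop j.+1 x.
have xi i : (i < size x)%N -> i != j -> x`_i \in x'.
  move=> hi; rewrite neq_ltn mem_cat => /orP[ij|ij].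
    by rewrite -(nth_take 0 ij) mem_nth // size_take hj.
  have -> : i = (j.+1 + (i - j.+1))%N by rewrite subnKC.
  by rewrite -nth_drop mem_nth ?orbT // size_drop ltn_sub2r // (leq_ltn_trans ij).
have i' := ideal_ideal_gen [set` x'].
have xj : ideal_gen [set` x'] x`_j.
  have -> : x`_j = - y * \sum_(i < size x | i != Ordinal hj) (d i - c i) * x`_i.
    move/eqP: e; rewrite -subr_eq0 -sumrB (eq_bigr (fun i : 'I__ => (d i - c i) * x`_i)).
      rewrite (bigD1 (Ordinal hj)) //= addrC addr_eq0 => /eqP ->.
      by rewrite mulrN mulNr opprK mulrA [y * _]mulrC hy mul1r.
    by move=> i _; rewrite mulrBl.
  apply: (idlM _ i'); apply: (@idl_sum _ _ _ _ _ _ i') => i; rewrite -val_eqE /= => hi.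
  by apply: (idlM _ i'); apply: idl_gen_mem; apply: xi.
have mx' : m = ideal_gen [set` x'].
  rewrite mx; apply/seteqP; split.
    apply: ideal_gen_sub => // u /= ux; rewrite -(nth_index 0 ux).
    have [->//|ij] := eqVneq (index u x) j.
    by apply: idl_gen_mem; apply: xi; rewrite ?index_mem.
  apply: ideal_gen_sub; first exact: ideal_ideal_gen.
  by move=> u /=; rewrite mem_cat => /orP[/mem_take|/mem_drop] h; exact: idl_gen_mem.
have := mn _ mx'; rewrite /x' size_cat size_take hj size_drop leqNgt => /negP; apply.
by rewrite -addSn subnKC.
Qed.

(** The coefficients of a chosen expression through x are unique modulo m by [min_gens_rel]; this is
    why dual forms are only required to be linear modulo m. *)
Lemma min_gens_dual x : min_gens x -> exists lam, dual_forms m x lam.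
Proof.
move=> mg; have [mx _] := mg.
have ex u : exists c : nat -> R, m u -> u = \sum_(j < size x) c j * x`_j.
  have [|nu] := pselect (m u); last by exists (fun=> 0) => /nu.
  by rewrite {1}mx => /ideal_gen_seq[c ->]; exists c.
have [c hc] := choice ex.
exists (mkseq (fun j u => c u j) (size x)); split.
- by rewrite size_mkseq.
- by move=> u ux; rewrite mx; exact: idl_gen_mem.
- move=> i a u v hi hu hv; rewrite nth_mkseq //.
  apply: (@min_gens_rel x (fun i => c (a * u + v) i - (a * c u i + c v i)) mg) => //.
  rewrite (eq_bigr (fun j : 'I__ => c (a * u + v) j * x`_j - (a * (c u j * x`_j) + c v j * x`_j))).
    rewrite sumrB big_split -mulr_sumr /= -!hc ?subrr //.
      exact: idl0 (ideal_pow_ideal m 2).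
    by apply: (idlD im) => //; exact: (idlM _ im).
  by move=> j _; rewrite mulrBl mulrDl mulrA.
- move=> i j hi hj; rewrite nth_mkseq //.
  apply: (@min_gens_rel x (fun i => c x`_j i - (i == j)%:R) mg) => //.
  rewrite (eq_bigr (fun i : 'I__ => c x`_j i * x`_i - (i == Ordinal hj)%:R * x`_i)).
    rewrite sumrB -hc; last by rewrite mx; apply: idl_gen_mem; exact: mem_nth.
    rewrite (bigD1 (Ordinal hj)) //= eqxx mul1r big1 ?addr0 ?subrr.
      exact: idl0 (ideal_pow_ideal m 2).
    by move=> k /negbTE ->; rewrite mul0r.
  by move=> k _; rewrite mulrBl.
Qed.

End MinimalGenerators.

Section KoszulDelta.
Variables (A : comNzRingType) (N : lmodType A).
Implicit Types (x : seq A) (b B : seq bool) (th : seq bool -> A -> N).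

Definition unitv n j : seq bool := mkseq (eq_op^~ j) n.

Lemma kosg_delta x th B b : size B = size x -> size b = size x ->
  (forall c u, c != B -> th c u = 0) ->
  kosg x th b = 0 \/ forall i, nth false B i -> nth false b i.
Proof.
elim: x th B b => [|x0 x IH] th [|B0 B] [|b0 b] //=; first by left.
move=> [sB] [sb] h.
have h' c0 : kosg x (fun c => th (c0 :: c)) b = 0 \/
    c0 = B0 /\ forall i, nth false B i -> nth false b i.
  have [->|ne] := eqVneq c0 B0.
    have [|->|hi] := IH (fun c => th (B0 :: c)) B b sB sb; [|by left|by right].
    by move=> c u hc; apply: h; apply: contra_neq hc => -[].
  by left; apply: kosg0 => c u; apply: h; apply: contra_neq ne => -[].
case: b0.
  have [e1|[e1 hi]] := h' true; last by right=> -[|i] //=; exact: hi.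
  rewrite e1 subr0; have [e|ne] := eqVneq (false :: b) (B0 :: B); last by left; exact: h.
  by case: e => <- <-; right=> -[|i].
have [e1|[e1 hi]] := h' false; first by left.
by right=> -[|i] /=; [rewrite -e1|exact: hi].
Qed.

Lemma size_unitv n j : size (unitv n j) = n. Proof. exact: size_mkseq. Qed.

Lemma unitvS n j : unitv n.+1 j.+1 = false :: unitv n j.
Proof. by rewrite /unitv /mkseq /= -[in iota 1 _]add1n iotaDl -map_comp. Qed.

Lemma unitv0 n : unitv n.+1 0 = true :: nseq n false.
Proof.
rewrite /unitv /mkseq /= -[in iota 1 _]add1n iotaDl -map_comp; congr cons.
apply: (@eq_from_nth _ false); first by rewrite !size_map size_iota size_nseq.
move=> i; rewrite !size_map size_iota => hi.
by rewrite (nth_map 0%N) ?size_iota // nth_nseq hi.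
Qed.

Lemma deg_nseq n c : deg (nseq n c) = (c * n)%N.
Proof. by rewrite /deg count_nseq. Qed.

Lemma deg_unitv n j : (j < n)%N -> deg (unitv n j) = 1%N.
Proof.
elim: n j => [|n IH] [|j] // hj; first by rewrite unitv0 /deg /= -/(deg _) deg_nseq.
by rewrite unitvS /deg /= -/(deg _) IH.
Qed.

Lemma kosg_nseq0 x th : kosg x th (nseq (size x) false) = 0.
Proof. by elim: x th => [|x0 x IH] th //=. Qed.

Lemma kosg_unitv x th j : (j < size x)%N ->
  kosg x th (unitv (size x) j) = th (nseq (size x) false) x`_j.
Proof.
elim: x th j => [|x0 x IH] th [|j] // hj.
  by rewrite unitv0 /= kosg_nseq0 subr0.
by rewrite unitvS /= IH.
Qed.

End KoszulDelta.

Lemma kosg_restrict (A S : comNzRingType) (g : {rmorphism A -> S}) (N : lmodType S)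
    (x : seq A) (th : seq bool -> A -> restrict g N) (th' : seq bool -> S -> N) b :
  (forall c u, th c u = th' c (g u)) -> kosg x th b = kosg (map g x) th' b.
Proof.
move=> h; elim: x th th' b h => [|x0 x IH] th th' [|[] b] h //=.
  by rewrite h (IH _ (fun c => th' (true :: c))).
by rewrite (IH _ (fun c => th' (false :: c))).
Qed.

(** * Transfer of Ext from R to S *)

Section LocalExt.
Variables (R S : comNzRingType) (m : set R) (n : set S) (f : {rmorphism R -> S}).
Hypotheses (lR : noetherian_local m) (iN : ideal n) (fmn : local_hom m n f).
Variables (x : seq R) (ys : seq S).
Hypotheses (mx : min_gens m x) (ny : n = ideal_gen [set` ys]).
Variable M : lmodType S.

Lemma dot_gens z : ideal_gen [set` ys] z -> exists2 s, size s = size ys & z = dot s ys.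
Proof.
move=> /ideal_gen_seq[c ->]; exists (mkseq c (size ys)); first by rewrite size_mkseq.
by rewrite dot_nth ?size_mkseq //; apply: eq_bigr => i _; rewrite nth_mkseq.
Qed.

Let r := size x.
Let e := size ys.

Lemma tower_local (A : comNzRingType) (i : {rmorphism R -> A}) (g : {rmorphism A -> S}) (q : set A) (Y : seq A) :
  tower m f ys i g q Y -> forall u, q u -> n (g u).
Proof.
move=> tw; apply: (tw_gen tw (J := [set u | n (g u)])).
- split; first by rewrite /= rmorph0; exact: (idl0 iN).
  move=> c u v /= hu hv; rewrite rmorphD rmorphM.
  by apply: (idlD iN) => //; exact: (idlM _ iN).
- by move=> c hc; rewrite /= (tw_comp tw); apply: fmn; exists c.
- move=> u uY; rewrite /= ny; apply: idl_gen_mem.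
  by rewrite -(tw_Y tw); exact: map_f.
Qed.

Lemma map_tower (A : comNzRingType) (i : {rmorphism R -> A}) (g : {rmorphism A -> S}) (q : set A) (Y : seq A) :
  tower m f ys i g q Y -> map g (map i x ++ Y) = map f x ++ ys.
Proof.
move=> tw; rewrite map_cat (tw_Y tw) -map_comp; congr (_ ++ _).
by apply: eq_map => c; exact: (tw_comp tw).
Qed.

Lemma xs_gens z : z \in map f x -> exists2 s, size s = size ys & z = dot s ys.
Proof.
move=> /mapP[c cx ->]; apply: dot_gens; rewrite -ny; apply: fmn; exists c => //.
by have [-> _] := mx; exact: idl_gen_mem.
Qed.

(** Place theta, pulled back to q, on the string [B] of r ones followed by e zeros. Its degree r = d
    + e is exactly the bound above which Ext over A vanishes, so [koszul_lift] makes the product a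
    coboundary. After [kos_elim] there remains theta(y_j) = y_j w up to a sign independent of j. *)
Lemma local_ext_from d t : r = (d + e)%N -> ext_le m d t (restrict f M) -> ext_from n M.
Proof.
move=> rde hM theta ht.
have im := noetherian_local_ideal lR.
have [A [i [g [q [Y tw]]]]] := tower_ex f im ys.
have [lam hlam] := min_gens_dual lR mx.
have [lam' hlam'] := tw_dual tw hlam.
pose B := nseq r true ++ nseq e false.
pose th (b : seq bool) (u : A) : restrict g M := if b == B then theta (g u) else 0.
pose th' (b : seq bool) (u : S) : M := if b == B then theta u else 0.
have gq := tower_local tw.
have [|psi hpsi] := koszul_lift (tw_q tw) hlam' (tw_ext tw hM) (leqnn _) (th := th).
  move=> b _ c u v hu hv; rewrite /th; case: eqP => _; last by rewrite scaler0 addr0.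
  by rewrite rmorphD rmorphM ht //; exact: gq.
have sx : size (map i x ++ Y) = (r + e)%N.
  by rewrite size_cat size_map -(size_map g Y) (tw_Y tw).
have sB : size B = (r + e)%N by rewrite size_cat !size_nseq.
have G0 b : size b = (r + e)%N -> take r b <> nseq r true ->
    kosg (map f x ++ ys) th' b = 0.
  move=> sb nb; have [|||//|hb] := @kosg_delta _ M (map f x ++ ys) th' B b.
  - by rewrite sB [RHS]size_cat size_map.
  - by rewrite sb [RHS]size_cat size_map.
  - by move=> c u /negbTE hc; rewrite /th' hc.
  have st : size (take r b) = r by rewrite size_takel // sb leq_addr.
  case: nb; apply: (@eq_from_nth _ false); first by rewrite size_nseq st.
  move=> j; rewrite st => jr.
  rewrite nth_take // nth_nseq jr; apply: hb.
  by rewrite /B nth_cat size_nseq jr nth_nseq jr.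
have [|||psi' [ep hp]] := @kos_elim S M (map f x) ys 1 psi (kosg (map f x ++ ys) th').
- exact: xs_gens.
- move=> b; rewrite size_cat !size_map addn1 => sb db.
  have := hpsi b; rewrite sx -rde => /(_ sb db).
  rewrite (@kosg_restrict _ _ _ M _ th th') //.
  rewrite /kos (@kosg_restrict _ _ _ M _ _ (fun c u => u *: psi c)) //.
  by rewrite (map_tower tw) => <-.
- by move=> b; rewrite size_cat !size_map => sb _ nb; apply: G0.
exists ((-1) ^+ ep *: ((-1) ^+ r *: psi' (nseq e false))) => y; rewrite ny => hy.
(* Crossing the r leading ones produces the sign (-1)^r. *)
have Gj j : (j < e)%N -> kosg (map f x ++ ys) th' (nseq r true ++ unitv e j) =
    (-1) ^+ r *: theta ys`_j.
  move=> je; have : forall th2 : seq bool -> S -> M,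
      (forall c u, c != nseq r true ++ nseq e false -> th2 c u = 0) ->
      kosg (map f x ++ ys) th2 (nseq r true ++ unitv e j) =
      (-1) ^+ r *: th2 (nseq r true ++ nseq e false) ys`_j.
    rewrite -(size_map f x : _ = r); elim: (map f x) => [|z s IH] th2 h2 /=.
      by rewrite scale1r kosg_unitv.
    rewrite h2 ?sub0r; last by [].
    by rewrite (IH (fun c => th2 (true :: c))) ?exprS ?mulN1r ?scaleNr // => c u hc;
      apply: h2; apply: contra_neq hc => -[].
  move=> /(_ th') ->; first by rewrite /th' eqxx.
  by move=> c u /negbTE hc; rewrite /th' hc.
have tj j : (j < e)%N -> theta ys`_j = ys`_j *: ((-1) ^+ ep *: ((-1) ^+ r *: psi' (nseq e false))).
  move=> je; have := hp (unitv e j); rewrite size_unitv deg_unitv // => /(_ erefl erefl).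
  rewrite size_map Gj // /kos kosg_unitv // => /(congr1 (fun w => (-1) ^+ r *: w)).
  rewrite scalerA -exprMn mulrNN mulr1 expr1n scale1r => ->.
  by rewrite !scalerA; congr (_ *: _); ring.
move: y hy => _ /ideal_gen_seq[c ->].
have hn j : (j < e)%N -> n ys`_j by move=> je; rewrite ny; apply: idl_gen_mem; exact: mem_nth.
have t0 : theta 0 = 0.
  have := ht 1 0 0 (idl0 iN) (idl0 iN); rewrite mulr0 addr0 scale1r.
  by move=> /eqP; rewrite -subr_eq0 opprD addNKr oppr_eq0 => /eqP.
suff [] : n (\sum_(i0 < e) c i0 * ys`_i0) /\ theta (\sum_(i0 < e) c i0 * ys`_i0) =
  (\sum_(i0 < e) c i0 * ys`_i0) *: ((-1) ^+ ep *: ((-1) ^+ r *: psi' (nseq e false))) by [].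
elim/big_rec: _ => [|j z _ [nz ez]]; first by split; [exact: (idl0 iN)|rewrite t0 scale0r].
split; first by apply: (idlD iN) => //; apply: (idlM _ iN); exact: hn.
rewrite ht //; last exact: hn.
by rewrite ez tj // scalerDl -[in RHS]scalerA.
Qed.

(** The cochain with value v on [B] comes, through the dual forms, from linear forms of degree r - 1
    >= d + e, so it is a coboundary. Once the generators of m are eliminated it sits in degree 0,
    where coboundaries are zero. *)
Lemma local_ext_lower d t v : (d + e < r)%N -> ext_le m d t (restrict f M) ->
  (forall u, n u -> u *: v = 0) -> v = 0 :> M.
Proof.
move=> rde hM hv.
have im := noetherian_local_ideal lR.
have [A [i [g [q [Y tw]]]]] := tower_ex f im ys.
have [lam hlam] := min_gens_dual lR mx.
have [lam' hlam'] := tw_dual tw hlam.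
pose B := nseq r true ++ nseq e false.
pose phi (b : seq bool) : restrict g M := if b == B then v else 0.
have gq := tower_local tw.
have sphi c : socle_elt q (phi c).
  move=> u qu; rewrite /phi; case: ifP => _; last exact: scaler0.
  by apply: hv; exact: gq.
have [||psi hpsi] := @koszul_lift _ _ (tw_q tw) _ _ _ _ _ r.-1 (kosL lam' phi) hlam' (tw_ext tw hM).
- by rewrite -ltnS (ltn_predK rde).
- by move=> b _ c u w qu qw; exact: (kosL_lin _ _ hlam' sphi qu qw).
rewrite (ltn_predK rde) in hpsi.
have r0 : (0 < r)%N by apply: leq_ltn_trans rde.
have sx : size (map i x ++ Y) = (r + e)%N.
  by rewrite size_cat size_map -(size_map g Y) (tw_Y tw).
have [|||psi' [ep hp]] := @kos_elim S M (map f x) ys 0 psi phi.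
- exact: xs_gens.
- move=> b; rewrite size_cat !size_map addn0 => sb db.
  have := hpsi b; rewrite sx => /(_ sb db).
  rewrite (kosg_kosL hlam') ?sx // ?db // => ->.
  rewrite /kos (@kosg_restrict _ _ _ M _ _ (fun c u => u *: psi c)) //.
  by rewrite (map_tower tw).
- move=> b; rewrite size_cat !size_map => sb _ nb; rewrite /phi; case: eqP => // eb.
  by case: nb; rewrite eb take_size_cat ?size_nseq.
have := hp (nseq e false); rewrite size_nseq deg_nseq mul0n => /(_ erefl erefl).
by rewrite size_map /phi eqxx kos_deg0 ?scaler0 // deg_nseq mul0n.
Qed.

End LocalExt.

(** * Nilpotency, injectivity and Matlis structure *)

Section ArtinianLocal.
Variables (S : comNzRingType) (n : set S).
Hypothesis lS : noetherian_local n.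
Let iN : ideal n := noetherian_local_ideal lS.
Let nS : noetherian S := let: And3 h _ _ := lS in h.
Implicit Types (M : lmodType S).

(** Noetherian induction on a. An element c outside a with n c inside a spans a copy of l in S/a,
    and the vanishing of Ext^1(l, M) extends the form to a + (c). *)
Lemma ext_from_pow M N a (phi : S -> M) : ext_from n M -> ideal a ->
  ideal_pow n N `<=` a ->
  (forall c x y, a x -> a y -> phi (c * x + y) = c *: phi x + phi y) ->
  exists w, forall x, a x -> phi x = x *: w.
Proof.
move=> hM ia; move: phi.
pose Q (b : set S) := ideal_pow n N `<=` b -> forall phi : S -> M,
  (forall c x y, b x -> b y -> phi (c * x + y) = c *: phi x + phi y) ->
  exists w, forall x, b x -> phi x = x *: w.
suff : Q a by move=> h phi ha; exact: h.
move: ia; apply: (@noeth_ind S S^o Q) => // {a} a ia IH Na phi lphi.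
have [a1|na1] := pselect (a 1).
  exists (phi 1) => x ax; have := lphi x 1 0 a1 (idl0 ia).
  have := lphi 0 1 1 a1 a1; rewrite !(mulr1, mulr0, addr0) => _ ->.
  have := lphi 1 0 0 (idl0 ia) (idl0 ia); rewrite mulr0 addr0 scale1r.
  by move=> /eqP; rewrite -subr_eq0 opprD addNKr oppr_eq0 => /eqP ->; rewrite addr0.
have [c nca nc] : exists2 c, ~ a c & forall u, n u -> a (u * c).
  elim: N Na {IH Q} => [|N IHN] Na; first by case: na1; exact: Na.
  have [Na'|] := pselect (ideal_pow n N `<=` a); first exact: IHN.
  move=> /existsNP[c /not_implyP[cN nac]]; exists c => // u nu.
  by apply: Na; exact: ideal_powS_in.
have phi0 : phi 0 = 0.
  have := lphi 1 0 0 (idl0 ia) (idl0 ia); rewrite mulr0 addr0 scale1r.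
  by move=> /eqP; rewrite -subr_eq0 opprD addNKr oppr_eq0 => /eqP ->.
have unit_n u : a (u * c) -> n u.
  move=> h; apply: contrapT => nu; have [v uv] := noetherian_local_unit lS nu.
  by apply: nca; rewrite -[c]mul1r -uv mulrAC; exact: (idlMr _ ia).
have [|w hw] := hM (fun u => phi (u * c)).
  move=> b x y nx ny; rewrite mulrDl -mulrA lphi //; exact: nc.
pose b : set S := idl_add a [set s * c | s in setT].
have ic : ideal [set s * c | s in setT].
  split; first by exists 0; rewrite ?mul0r.
  by move=> z _ _ [s _ <-] [t _ <-]; exists (z * s + t) => //; rewrite mulrDl -mulrA.
have ib : ideal b := ideal_add ia ic.
have ab : a `<=` b := idl_addl ic.
have ex x : exists s, b x -> a (x - s * c).
  have [[u au [_ [s _ <-] <-]]|nb] := pselect (b x); last by exists 0 => /nb.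
  by exists s => _; rewrite addrK.
have [s hs] := choice ex.
pose phi' x := phi (x - s x * c) + s x *: w.
(* The value of [phi'] does not depend on the coefficient of c chosen for x; linearity follows from
   this. *)
have key x t : b x -> a (x - t * c) -> phi' x = phi (x - t * c) + t *: w.
  move=> bx ht; rewrite /phi' -[s x](subrK t).
  set d := s x - t; have ad : a (d * c).
    have -> : d * c = (x - t * c) - (x - s x * c) by rewrite /d; ring.
    by apply: (idlB ia) => //; exact: hs.
  rewrite scalerDl -hw ?addrA; last exact: unit_n.
  congr (_ + _); have -> : x - (d + t) * c = (-1) * (d * c) + (x - t * c) by ring.
  by rewrite lphi // scaleN1r addrAC addNr add0r.
have [|||w' hw'] := IH b ib ab _ _ phi'.
- move=> ba; apply: nca; apply: ba; exists 0; first exact: (idl0 ia).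
  by exists c; [exists 1; rewrite ?mul1r|rewrite add0r].
- exact: subset_trans ab.
- move=> z x y bx by_.
  have bz : b (z * x + y) by apply: (idlD ib) => //; exact: (idlM _ ib).
  rewrite (@key _ (z * s x + s y) bz).
    rewrite (_ : _ - _ = z * (x - s x * c) + (y - s y * c)); last by ring.
    rewrite lphi; [|exact: hs|exact: hs].
    by rewrite /phi' scalerDr scalerDl scalerA addrACA.
  rewrite (_ : _ - _ = z * (x - s x * c) + (y - s y * c)); last by ring.
  by apply: (idlD ia); [apply: (idlM _ ia)|]; exact: hs.
exists w' => x ax; rewrite -hw'; last exact: ab.
by rewrite (@key x 0 (ab _ ax)) ?mul0r ?subr0 // scale0r addr0.
Qed.

(** The form on n^N + (c) that kills n^N and sends c to v is well defined, since s c in n^N forces s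
    into n, which kills v. By [ext_from_pow] it is multiplication by some w. *)
Lemma socle_multiple M N c (v : M) : ext_from n M -> (forall u, n u -> u *: v = 0) ->
  ~ ideal_pow n N c ->
  exists w, c *: w = v /\ forall u, ideal_pow n N u -> u *: w = 0.
Proof.
move=> hM hv nc; have iNN := ideal_pow_ideal n N.
pose a : set S := idl_add (ideal_pow n N) [set s * c | s in setT].
have ic : ideal [set s * c | s in setT].
  split; first by exists 0; rewrite ?mul0r.
  by move=> z _ _ [s _ <-] [t _ <-]; exists (z * s + t) => //; rewrite mulrDl -mulrA.
have ia : ideal a := ideal_add iNN ic.
have ex x : exists s, a x -> ideal_pow n N (x - s * c).
  have [[u au [_ [s _ <-] <-]]|nb] := pselect (a x); last by exists 0 => /nb.
  by exists s => _; rewrite addrK.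
have [s hs] := choice ex.
have key x t : a x -> ideal_pow n N (x - t * c) -> s x *: v = t *: v.
  move=> ax ht; apply/eqP; rewrite -subr_eq0 -scalerBl; apply/eqP/hv.
  apply: contrapT => nu; have [u hu] := noetherian_local_unit lS nu.
  apply: nc; rewrite -[c]mul1r -hu mulrAC; apply: (idlMr _ iNN).
  have -> : (s x - t) * c = (x - t * c) - (x - s x * c) by ring.
  by apply: (idlB iNN) => //; exact: hs.
have [||w hw] := @ext_from_pow M N a (fun x => s x *: v) hM ia.
- exact: (idl_addl ic).
- move=> z x y ax ay; rewrite scalerA -scalerDl; apply: key.
    by apply: (idlD ia) => //; exact: (idlM _ ia).
  rewrite (_ : _ - _ = z * (x - s x * c) + (y - s y * c)); last by ring.
  by apply: (idlD iNN); [apply: (idlM _ iNN)|]; exact: hs.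
have ac : a c by apply: (idl_addr iNN); exists 1; rewrite ?mul1r.
exists w; split.
  by rewrite -hw // (@key c 1) ?scale1r // mul1r subrr; exact: (idl0 iNN).
move=> u hu; have au : a u by exact: (idl_addl ic).
by rewrite -hw // (@key u 0) ?scale0r // mul0r subr0.
Qed.

(** The submodules of M killed by n^k are stationary from some k0 on. If c in n^k0 were outside
    n^(k0+1), then v = c w with w killed by n^(k0+1), hence by n^k0, and v would be 0. So n^k0 =
    n^(k0+1), and Nakayama applies. *)
Lemma ext_from_nilpotent M (v : M) : noeth_mod M -> ext_from n M -> v != 0 ->
  (forall u, n u -> u *: v = 0) -> exists N, ideal_pow n N `<=` [set 0].
Proof.
move=> nM hM v0 hv.
pose K k : set M := [set x | forall u, ideal_pow n k u -> u *: x = 0].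
have [|k|k0 hk0] := @noeth_stable S M K nM.
- move=> k; split; first by move=> u _; rewrite scaler0.
  move=> a x y hx hy u hu; rewrite scalerDr hy // scalerA mulrC -scalerA hx //.
  by rewrite scaler0 addr0.
- by move=> x hx u hu; apply: hx; apply: ideal_pow_mono hu.
exists k0; have sub : ideal_pow n k0 `<=` ideal_pow n k0.+1.
  move=> c hc; apply: contrapT => nc.
  have [w [cw hw]] := socle_multiple hM hv nc.
  by move: v0; rewrite -cw (hk0 k0.+1 _ w) ?eqxx.
apply: (@nakayama S S^o n [set 0] (ideal_pow n k0) nS iN (noetherian_local_jac lS)).
- exact: submodule_set0.
- exact: ideal_pow_ideal.
apply: subset_trans sub _; refine (@ideal_powS_sub _ n k0 _ _ _).
  exact: (@submodule_add S S^o _ _ (@submodule_set0 S S^o) (@submodule_imul S n S^o _)).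
move=> x y hx hy; apply: (@subm_addr S S^o _ _ (@submodule_set0 S S^o)).
exact: (@imul_in S n S^o).
Qed.

Lemma socle_ex M N (x : M) : ideal_pow n N `<=` [set 0] -> x != 0 ->
  exists c, c *: x != 0 /\ forall u, n u -> u *: (c *: x) = 0.
Proof.
move=> hN x0; have : forall u, ideal_pow n N u -> u *: x = 0.
  by move=> u /hN ->; rewrite scale0r.
elim: N {hN} => [|N IH] h; first by move: x0; rewrite -[x]scale1r h ?eqxx.
have [/IH//|] := pselect (forall u, ideal_pow n N u -> u *: x = 0).
move=> /existsNP[c /not_implyP[hc /eqP cx]]; exists c; split=> // u nu.
by rewrite scalerA; apply: h; exact: ideal_powS_in.
Qed.

Lemma nilpotent_injective M N : ideal_pow n N `<=` [set 0] -> ext_from n M ->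
  injective_module M.
Proof.
move=> hN hM; apply: baer_injective => a phi ia hphi.
by apply: (ext_from_pow hM ia) hphi => u /hN ->; exact: (idl0 ia).
Qed.

End ArtinianLocal.

Section RestrictLin.
Variables (R S : comNzRingType) (f : {rmorphism R -> S}).

Lemma rlin_lin (X Y : lmodType S) (h : {linear X -> Y}) a (x y : restrict f X) :
  (h (a *: x + y) : restrict f Y) = a *: (h x : restrict f Y) + h y.
Proof. exact: (linearP h (f a) x y). Qed.
Definition rlin (X Y : lmodType S) (h : {linear X -> Y}) :
  {linear restrict f X -> restrict f Y} := linof (rlin_lin h).
Lemma ses_rlin (X Y Z : lmodType S) (e : {linear X -> Y}) (p : {linear Y -> Z}) :
  ses e p -> ses (rlin e) (rlin p).
Proof. by []. Qed.

End RestrictLin.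

Section InjectiveModule.
Variables (R S : comNzRingType) (m : set R) (n : set S) (f : {rmorphism R -> S}).
Hypotheses (lR : noetherian_local m) (lS : noetherian_local n) (fmn : local_hom m n f).
Let iN : ideal n := noetherian_local_ideal lS.
Let nS : noetherian S := let: And3 h _ _ := lS in h.

(** Among the non-zero quotients M/b of R-injective dimension at most d take b maximal. With zero
    socle, n would contain a regular element w, and (M/b)/w would be a smaller quotient of the same
    kind, non-zero by Nakayama. *)
Lemma fg_nonzero_socle (M : lmodType S) d : nonzero_module M -> fin_gen M ->
  idle d (restrict f M) ->
  exists Q : lmodType S, [/\ fin_gen Q, idle d (restrict f Q) &
    exists2 v : Q, v != 0 & forall u, n u -> u *: v = 0].
Proof.
move=> [x0 x00] fM hM; have nM := fg_noeth nS fM.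
have [||b [[sb [y nby] [Q [p [ps pk hQ]]]] mx]] := @noeth_max S M [set b | [/\ submodule b,
  exists x, ~ b x & exists (Q : lmodType S) (p : {linear M -> Q}),
  [/\ forall y, exists x, p x = y, forall x, p x = 0 <-> b x & idle d (restrict f Q)]]] nM.
- by move=> N [].
- exists [set 0]; split; first exact: submodule_set0.
    by exists x0 => /= h; rewrite h eqxx in x00.
  by exists M, (lin_id M); split=> // z; exists z.
have fQ := fin_gen_quot ps fM; have nQ := fg_noeth nS fQ.
exists Q; split=> //; apply: contrapT => hsoc.
have [|w [nw hw]] := exists_regular nS nQ iN.
  move=> x hx; apply: contrapT => /eqP xn0; apply: hsoc; exists x => //.
pose pw := lin_scale Q w.
have ipw : injective pw by apply: inj_lin => x; exact: hw.
have [Q' [p' sp']] := coker_ex ipw; have [_ ps' pk'] := sp'.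
have hQ' : idle d (restrict f Q') := idle_ses_right (ses_rlin f sp') hQ hQ.
pose b' : set M := [set x | p' (p x) = 0].
have [z nz] : exists z, ~ b' z.
  apply: contrapT => /forallNP h; apply: nby; apply/pk.
  have : forall x : Q, [set 0] x; last by apply.
  move=> x; have : [set: Q] x by [].
  move: x; apply: (nakayama nQ iN (noetherian_local_jac lS)).
  + exact: submodule_set0.
  + exact: submodule_setT.
  move=> x _; have [z <-] := ps x; have /contrapT/pk'[t <-] := h z.
  by apply: subm_addr; [exact: submodule_set0|exact: imul_in].
have sb' : submodule b'.
  by split=> [|a u v]; rewrite /b' /= ?linear0 // !linearP => -> ->; rewrite scaler0 addr0.
have h : b' `<=` b.
  apply: mx; last by move=> x /pk hx; rewrite /b' /= hx linear0.
  split=> //; first by exists z.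
  exists Q', (lin_comp p' p); split=> // t.
  by have [u <-] := ps' t; have [x <-] := ps u; exists x.
have py : p y != 0 by apply/eqP => /pk.
have [t ht] := ps (w *: p y).
have /pk : b t by apply: h; rewrite /b' /= ht; apply/pk'; exists (p y).
by rewrite ht => /hw e0; rewrite e0 eqxx in py.
Qed.

Variables (x : seq R) (ys : seq S) (d : nat).
Hypotheses (mx : min_gens m x) (ny : n = ideal_gen [set` ys]) (rde : size x = (d + size ys)%N).
Variable M : lmodType S.
Hypotheses (M0 : nonzero_module M) (fM : fin_gen M) (hM : idle d (restrict f M)).

Lemma idle_ext_from (Q : lmodType S) : idle d (restrict f Q) -> ext_from n Q.
Proof.
move=> hQ; apply: (local_ext_from lR iN fmn mx ny rde).
exact: (idle_ext_le m (leqnn d) hQ).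
Qed.

Lemma nilpotent_max_ideal : exists N, ideal_pow n N `<=` [set 0].
Proof.
have [Q [fQ hQ [v v0 hv]]] := fg_nonzero_socle M0 fM hM.
exact: (ext_from_nilpotent lS (fg_noeth nS fQ) (idle_ext_from hQ) v0 hv).
Qed.

Lemma injective_over_S : injective_module M.
Proof.
have [N hN] := nilpotent_max_ideal.
exact: (nilpotent_injective lS hN (idle_ext_from hM)).
Qed.

(** As n^N = 0, [socle_multiple] shows that a non-zero socle element is a multiple of every c
    different from 0. *)
Lemma faithful_over_S c : (forall w : M, c *: w = 0) -> c = 0.
Proof.
have [N hN] := nilpotent_max_ideal; have [x0 x00] := M0.
have [a [ax hax]] := socle_ex hN x00.
move=> hc; apply: contrapT => /eqP c0; move: ax.
have [|w [<- _]] := socle_multiple lS (c := c) (N := N) (idle_ext_from hM) hax.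
  by move=> /hN e; rewrite e eqxx in c0.
by rewrite hc eqxx.
Qed.

End InjectiveModule.

(** * Matlis structure of an injective module over a local ring with nilpotent maximal ideal *)

Section Matlis.
Variables (S : comNzRingType) (n : set S) (l : fieldType) (pl : {rmorphism S -> l}).
Hypotheses (lS : noetherian_local n) (ql : is_quotient n pl).
Let iN : ideal n := noetherian_local_ideal lS.
Let nS : noetherian S := let: And3 h _ _ := lS in h.

Lemma residue_ker s : pl s = 0 <-> n s.
Proof. by have [_ <-] := ql. Qed.

Lemma residue_lin_lin a (x y : S^o) :
  (pl (a *: x + y) : residue_module pl) = a *: (pl x : residue_module pl) + pl y.
Proof. by rewrite rmorphD rmorphM. Qed.
Definition residue_lin : {linear S^o -> residue_module pl} := linof residue_lin_lin.

Lemma residue_hom (M : lmodType S) (v : M) : (forall u, n u -> u *: v = 0) ->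
  exists j : {linear residue_module pl -> M}, forall s, j (pl s) = s *: v.
Proof.
move=> hv; apply: (@fact_surj S S^o (residue_module pl) M residue_lin (lin_at v)).
  by have [h _] := ql.
by move=> s /residue_ker /hv.
Qed.

Lemma residue_module_socle u (a : residue_module pl) : n u -> u *: a = 0.
Proof. by move=> /residue_ker e; rewrite -[u *: a]/(pl u * a) e mul0r. Qed.

Variables (M : lmodType S) (N : nat).
Hypotheses (M0 : nonzero_module M) (fM : fin_gen M) (iM : injective_module M)
  (hN : ideal_pow n N `<=` [set 0]).
Let nM : noeth_mod M := fg_noeth nS fM.

Definition soc : set M := [set x | forall u, n u -> u *: x = 0].

Lemma submodule_soc : submodule soc.
Proof.
split; first by move=> u _; rewrite scaler0.
move=> a x y hx hy u hu; rewrite scalerDr hy // scalerA mulrC -scalerA hx //.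
by rewrite scaler0 addr0.
Qed.

Lemma soc_basis : exists bs : seq M, [/\ bs != [::], forall b, b \in bs -> soc b,
  forall x, soc x -> exists c : nat -> S, x = \sum_(i < size bs) c i *: bs`_i &
  forall c : nat -> S, \sum_(i < size bs) c i *: bs`_i = 0 ->
    forall i, (i < size bs)%N -> n (c i)].
Proof.
have [s0 hs0] := nM submodule_soc.
have [|r [[bs [sz hbs]] mn]] := @set_nat_min [set k | exists s : seq M, size s = k /\ soc = mspan [set` s]].
  by exists (size s0), s0.
have sbs b : b \in bs -> soc b by move=> h; rewrite hbs; exact: mspan_mem.
exists bs; split=> //.
- apply/eqP => e; have [x x0] := M0; have [c [cx hc]] := socle_ex hN x0.
  have : soc (c *: x) by [].
  by rewrite hbs e => /mspan_nil e0; rewrite e0 eqxx in cx.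
- by move=> x; rewrite {1}hbs => /mspan_seq.
move=> c e j hj; apply: contrapT => nc.
have [y hy] := noetherian_local_unit lS nc.
pose x' := take j bs ++ drop j.+1 bs.
have xi i : (i < size bs)%N -> i != j -> bs`_i \in x'.
  move=> hi; rewrite neq_ltn mem_cat => /orP[ij|ij].
    by rewrite -(nth_take 0 ij) mem_nth // size_take hj.
  have -> : i = (j.+1 + (i - j.+1))%N by rewrite subnKC.
  by rewrite -nth_drop mem_nth ?orbT // size_drop ltn_sub2r // (leq_ltn_trans ij).
have i' := submodule_mspan [set` x'].
have xj : mspan [set` x'] bs`_j.
  have -> : bs`_j = - y *: \sum_(i < size bs | i != Ordinal hj) c i *: bs`_i.
    move: e; rewrite (bigD1 (Ordinal hj)) //= addrC => /eqP; rewrite addr_eq0 => /eqP ->.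
    by rewrite scaleNr scalerN opprK scalerA [y * _]mulrC hy scale1r.
  apply: (submZ _ i'); apply: (@subm_sum _ _ _ _ _ _ _ i') => i; rewrite -val_eqE /= => hi.
  by apply: (submZ _ i'); apply: mspan_mem; apply: xi.
have mx' : soc = mspan [set` x'].
  rewrite hbs; apply/seteqP; split.
    apply: mspan_sub => // u /= ux; rewrite -(nth_index 0 ux).
    have [->//|ij] := eqVneq (index u bs) j.
    by apply: mspan_mem; apply: xi; rewrite ?index_mem.
  apply: mspan_sub; first exact: submodule_mspan.
  by move=> u /=; rewrite mem_cat => /orP[/mem_take|/mem_drop] h; exact: mspan_mem.
have := mn _ (ex_intro _ x' (conj erefl mx')).
rewrite -sz leqNgt /x' size_cat size_take hj size_drop => /negP; apply.
by rewrite -addSn subnKC.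
Qed.

(* A maximal essential extension of S v inside the injective module M is a    *)
(* direct summand, hence injective.                                           *)
Lemma hull_ex (v : M) : v != 0 -> soc v ->
  exists (E : lmodType S) (w : E), [/\ injective_module E, w != 0,
    forall u, n u -> u *: w = 0 & forall x : E, x != 0 -> exists c, c *: x = w].
Proof.
move=> v0 sv.
have [||G [[sG Gv eG] mG]] := @noeth_max S M [set G | [/\ submodule G, G v &
  forall x, G x -> x != 0 -> exists c, c *: x = v]] nM.
- by move=> G [].
- exists [set x | exists c, x = c *: v]; split.
  + split; first by exists 0; rewrite scale0r.
    by move=> a _ _ [c ->] [c' ->]; exists (a * c + c'); rewrite scalerDl scalerA.
  + by exists 1; rewrite scale1r.
  + move=> _ [c ->] cv; have nc : ~ n c by move=> /sv e; rewrite e eqxx in cv.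
    have [y hy] := noetherian_local_unit lS nc; exists y.
    by rewrite scalerA mulrC hy scale1r.
have [||H [[sH nHv] mH]] := @noeth_max S M [set H | submodule H /\ ~ H v] nM.
- by move=> H [].
- by exists [set 0]; split; [exact: submodule_set0|move=> /= e; rewrite e eqxx in v0].
have essH x : ~ H x -> exists c, H (v - c *: x).
  move=> nHx; apply: contrapT => nh; apply: nHx.
  pose H' := subm_add H [set z | exists c, z = c *: x].
  have sx : submodule [set z | exists c, z = c *: x].
    split; first by exists 0; rewrite scale0r.
    by move=> a _ _ [c ->] [c' ->]; exists (a * c + c'); rewrite scalerDl scalerA.
  apply: (mH H'); last 2 first.
  - exact: (subm_addl sx).
  - by apply: (subm_addr sH); exists 1; rewrite scale1r.
  split; first exact: (submodule_add sH sx).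
  by move=> [h hh [_ [c ->] e]]; apply: nh; exists c; rewrite -e addrK.
have [E [io [ioi iom]]] := sub_ex sG.
have [Q [p [ps pk]]] := quot_ex sH.
have ipo : injective (lin_comp p io).
  apply: inj_lin => z; rewrite lin_compE => /pk Hz.
  apply: (inj_lin0 (u := io)) => //; apply: contrapT => /eqP z0.
  have [|c cz] := eG (io z) _ z0; first by apply/iom; exists z.
  by apply: nHv; rewrite -cz; exact: (submZ _ sH).
have [nu hnu] := iM io ipo.
have inu : injective nu.
  apply: inj_lin => y; have [x <-] := ps y => nx; apply/pk; apply: contrapT => nHx.
  have [c /pk] := essH x nHx; rewrite linearB linearZ => /eqP; rewrite subr_eq0 => /eqP e.
  have [w hw] : exists w, io w = v by apply/iom.
  have := hnu w; rewrite lin_compE hw e linearZ /= nx scaler0 => h.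
  by rewrite -h eqxx in v0.
have imG x : G (nu (p x)).
  apply: (mG [set y | exists z, nu z = y]); last by exists (p x).
  - split; first exact: submodule_im.
      have [w hw] : exists w, io w = v by apply/iom.
      by exists (p v); rewrite -{2}hw -hnu lin_compE hw.
    move=> _ [z <-] nz; have [t et] := ps z; rewrite -et in nz *.
    have [c /pk] : exists c, H (v - c *: t).
      by apply: essH => /pk e; rewrite e linear0 eqxx in nz.
    rewrite linearB linearZ => /eqP; rewrite subr_eq0 => /eqP e.
    exists c; rewrite -linearZ -e.
    have [w hw] : exists w, io w = v by apply/iom.
    by rewrite -{2}hw -hnu lin_compE hw.
  - move=> y /iom[z <-]; exists (p (io z)); exact: hnu.
have [rho hrho] := @fact_inj S E M M io (lin_comp nu p) ioi (fun x => (iom _).1 (imG x)).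
have [w hw] : exists w, io w = v by apply/iom.
exists E, w; split.
- apply: (injm_retract (s := io) (r := rho)) => // z.
  by apply: ioi; rewrite hrho; exact: hnu.
- by apply/eqP => e; rewrite -hw e linear0 eqxx in v0.
- by move=> u nu'; apply: ioi; rewrite linearZ /= hw sv // linear0.
- move=> x x0; have [||c hc] := eG (io x).
  + by apply/iom; exists x.
  + by apply: contra_neq x0 => /(inj_lin0 ioi).
  by exists c; apply: ioi; rewrite linearZ /= hc hw.
Qed.

End Matlis.

Section MatlisStructure.
Variables (S : comNzRingType) (n : set S) (l : fieldType) (pl : {rmorphism S -> l}).
Hypotheses (lS : noetherian_local n) (ql : is_quotient n pl).
Let iN : ideal n := noetherian_local_ideal lS.
Variables (M : lmodType S) (N : nat).
Hypotheses (M0 : nonzero_module M) (fM : fin_gen M) (iM : injective_module M)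
  (hN : ideal_pow n N `<=` [set 0]).

(** E is the hull of one line of the socle. The coordinates on the socle extend to maps M -> E,
    which together are injective because they are so on the socle; this embedding splits, and the
    kernel of the retraction has no socle, so it is 0. Since M is injective, Ext^0(l, M) is the
    socle, of rank r, and the depth is 0. *)
Lemma matlis_structure : exists (r : nat) (E : lmodType S)
           (j : {linear residue_module pl -> E}),
           [/\ has_type pl M r, injective_envelope j &
               mod_iso M {ffun 'I_r -> E}].
Proof.
have [bs [bs0 sbs hbs fbs]] := soc_basis lS M0 fM hN.
set r := size bs in hbs fbs.
have r0 : (0 < r)%N by rewrite lt0n size_eq0.
have sbi i : (i < r)%N -> soc n bs`_i by move=> ir; apply: sbs; exact: mem_nth.
have [|E [w [iE w0 sw eE]]] := @hull_ex S n lS M fM iM bs`_0 _ (sbi _ r0).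
  apply/eqP => e; have [_ [_ n1 _] _] := lS; apply: n1.
  apply: (fbs (fun i => (i == 0%N)%:R)) r0.
  rewrite big1 // => -[[|i] hi] _ /=; first by rewrite e scaler0.
  by rewrite scale0r.
have [j hj] := residue_hom ql sw.
have [pls _] := ql.
have exc x : exists c : nat -> S, soc n x -> x = \sum_(i < r) c i *: bs`_i.
  by have [/hbs[c e]|nx] := pselect (soc n x); [exists c|exists (fun=> 0) => /nx].
have [c hc] := choice exc.
have ssoc := submodule_soc n M.
have soc_sum (d : nat -> S) : soc n (\sum_(i < r) d i *: bs`_i).
  by apply: (@subm_sum _ _ _ _ _ _ _ ssoc) => i _; apply: (submZ _ ssoc); exact: sbi.
have cE (d : nat -> S) x i : x = \sum_(i < r) d i *: bs`_i -> (i < r)%N -> n (c x i - d i).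
  move=> ex; apply: (fbs (fun i => c x i - d i)).
  rewrite (eq_bigr (fun i : 'I_r => c x i *: bs`_i - d i *: bs`_i)).
    by rewrite sumrB -hc ?{1}ex ?subrr // ex.
  by move=> k _; rewrite scalerBl.
have c_lin a x y i : soc n x -> soc n y -> (i < r)%N -> n (c (a *: x + y) i - (a * c x i + c y i)).
  move=> sx sy; apply: (cE (fun i => a * c x i + c y i)).
  rewrite {1}(hc x sx) {1}(hc y sy) scaler_sumr -big_split.
  by apply: eq_bigr => k _ /=; rewrite scalerDl scalerA.
have n_eq u v (z : E) : n (u - v) -> (forall t, n t -> t *: z = 0) -> u *: z = v *: z.
  by move=> h hz; apply/eqP; rewrite -subr_eq0 -scalerBl hz.
exists r, E, j; split.
- have [Z hZ] := zero_ex S.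
  (* M is its own injective resolution, continued by zero modules. *)
  pose I (i : nat) : lmodType S := if i is 0%N then M else Z.
  pose dd i : {linear I i -> I i.+1} := lin_0 (I i) (I i.+1).
  have resI : @injective_resolution S M I (lin_id M) dd.
    split.
    + by case=> [|i] //=; exact: injm_zero.
    + by [].
    + by move=> x; split=> // _; exists x.
    + by move=> i x; split=> // _; exists 0; rewrite linear0 [RHS]hZ.
  pose qq (phi : {linear residue_module pl -> I 0%N}) : restrict pl 'rV[l]_r :=
    (\row_(i < r) pl (c (phi 1 : M) i)) : 'rV[l]_r.
  have sphi (phi : {linear residue_module pl -> M}) : soc n (phi 1).
    by move=> u hu; rewrite -linearZ (residue_module_socle ql) // linear0.
  have ext0 : is_Ext 0 (residue_module pl) M (restrict pl 'rV[l]_r).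
    exists I, (lin_id M), dd, qq; split=> //.
    + move=> a phi psi chi _ _ hchi; apply/rowP => i.
      rewrite !mxE hchi.
      have := c_lin a (phi 1) (psi 1) i (sphi _) (sphi _) (ltn_ord i).
      move=> /(residue_ker ql); rewrite rmorphB rmorphD rmorphM => /eqP.
      by rewrite subr_eq0 => /eqP.
    + move=> y; have [s hs] := choice (fun i : nat => pls ((y : 'rV[l]_r) 0 (insubd (Ordinal r0) i))).
      have [phi hphi] := residue_hom ql (soc_sum s).
      exists phi; split=> //; apply/rowP => i; rewrite mxE.
      have e1 : phi 1 = \sum_(i < r) s i *: bs`_i by rewrite -(rmorph1 pl) hphi scale1r.
      have /(residue_ker ql) := cE s _ i e1 (ltn_ord i).
      rewrite rmorphB => /eqP; rewrite subr_eq0 => /eqP ->; rewrite hs.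
      by congr ((y : 'rV_r) _ _); apply: val_inj; rewrite val_insubd ltn_ord.
    + move=> phi _; split=> [h|h] /=.
        move=> x; have [s <-] := pls x.
        have -> : pl s = s *: (1 : residue_module pl) by rewrite -[RHS]/(pl s * 1) mulr1.
        rewrite linearZ /= (hc _ (sphi phi)) big1 ?scaler0 // => i _.
        apply: (sbi i (ltn_ord i)); apply/(residue_ker ql).
        by have := congr1 (fun v : 'rV[l]_r => v 0 i) h; rewrite !mxE.
      apply/rowP => i; rewrite !mxE; apply/(residue_ker ql).
      have := cE (fun=> 0) (phi 1) i; rewrite subr0; apply=> //.
      by rewrite h big1 // => k _; rewrite scale0r.
  exists 0%N; split=> //; apply: nat_inf_min => //.
  exists (restrict pl 'rV[l]_r); split=> //.
  exists ((\row_(i < r) 1) : 'rV[l]_r); apply/eqP => /(congr1 (fun v : 'rV[l]_r => v 0 (Ordinal r0))).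
  by rewrite !mxE => /eqP; rewrite oner_eq0.
- split=> //.
    apply: inj_lin => x; have [s <-] := pls x; rewrite hj => e; apply/(residue_ker ql).
    apply: contrapT => ns; have [y hy] := noetherian_local_unit lS ns.
    by move: w0; rewrite -[w]scale1r -hy mulrC -scalerA e scaler0 eqxx.
  move=> G sG [x [Gx x0]]; have [a ax] := eE x x0; exists 1.
  have j1 : j 1 = w by rewrite -(rmorph1 pl) hj scale1r.
  by rewrite j1; split=> //; rewrite -ax; exact: submZ.
have [B [io [ioi iom]]] := sub_ex ssoc.
have sio b : soc n (io b) by apply/iom; exists b.
have phi_ex (i : 'I_r) : exists phi : {linear M -> E}, forall x, soc n x -> phi x = c x i *: w.
  have gl a (x y : B) : c (io (a *: x + y)) i *: w = a *: (c (io x) i *: w) + c (io y) i *: w.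
    by rewrite linearP scalerA -scalerDl; apply: n_eq => //; exact: c_lin.
  have [phi hphi] := iE _ _ io (linof gl) ioi.
  by exists phi => x /iom[b <-]; rewrite hphi.
have [phi hphi] := choice phi_ex.
have Phil a x y : [ffun i => phi i (a *: x + y)] =
    a *: [ffun i => phi i x] + [ffun i => phi i y] :> {ffun 'I_r -> E}.
  by apply/ffunP => i; rewrite !ffunE linearP.
pose Phi : {linear M -> {ffun 'I_r -> E}} := linof Phil.
have Phi_inj : injective Phi.
  apply: inj_lin => x ex; apply: contrapT => /eqP x0.
  have [a [ax ha]] := socle_ex hN x0.
  have : Phi (a *: x) = a *: Phi x by exact: linearZ.
  rewrite ex scaler0.
  move=> /ffunP e; move: ax; rewrite (hc _ ha) big1 ?eqxx // => i _.
  apply: (sbi i (ltn_ord i)); have := e i; rewrite !ffunE hphi // => e1.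
  apply: contrapT => ns; have [y hy] := noetherian_local_unit lS ns.
  by move: w0; rewrite -[w]scale1r -hy mulrC -scalerA e1 scaler0 eqxx.
have [rho hrho] := injm_split iM Phi_inj.
have ker0 z : rho z = 0 -> z = 0.
  move=> rz; apply: contrapT => /eqP z0; have [a [az ha]] := socle_ex hN z0.
  (* An element of E killed by n is a multiple of w: if t carries it to w, then t lies outside n and
     is a unit. *)
  have ex i : exists s, (a *: z) i = s *: w.
    have [->|xi0] := eqVneq ((a *: z) i) 0; first by exists 0; rewrite scale0r.
    have [t ht] := eE _ xi0.
    have nt : ~ n t.
      move=> nt; have := ha t nt => /ffunP/(_ i); rewrite !ffunE.
      by move: ht; rewrite !ffunE => -> e; rewrite e eqxx in w0.
    have [y hy] := noetherian_local_unit lS nt; exists y.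
    by rewrite -ht scalerA [y * t]mulrC hy scale1r.
  have [s hs] := choice ex.
  have [s' hs'] : exists s' : nat -> S, forall i : 'I_r, s' i = s i.
    exists (fun k => s (insubd (Ordinal r0) k)) => i; congr s.
    by apply: val_inj; rewrite val_insubd ltn_ord.
  have e : a *: z = Phi (\sum_(i < r) s' i *: bs`_i).
    apply/ffunP => i; rewrite [in RHS]ffunE hphi // hs -hs'; apply/esym/n_eq => //.
    exact: (cE s').
  have := hrho (\sum_(i < r) s' i *: bs`_i).
  by rewrite -e (linearZ_LR rho) rz scaler0 => e0; rewrite e -e0 linear0 eqxx in az.
exists Phi; exists rho => [x|z]; first exact: hrho.
apply/eqP; rewrite -subr_eq0; apply/eqP/ker0.
by rewrite linearB hrho subrr.
Qed.

End MatlisStructure.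

(** * Ext modulo regular elements *)

Section Depth.
Variable R : comNzRingType.
Implicit Types (N I X Y Z : lmodType R) (q : set R).

(* q N' -> N' stands for Ext^1(R/q, N') = Ext^2(R/q, N): the long exact       *)
(* sequence of 0 -> R/q -> R/q -> R/(q + (y)) -> 0.                           *)
Lemma ext_lift q N I N' (e : {linear N -> I}) (p : {linear I -> N'}) t :
  ses e p -> ext_from q N -> ideal q -> (forall b, q b -> b *: t = 0) ->
  exists z, p z = t /\ forall b, q b -> b *: z = 0.
Proof.
move=> [ei ps pk] hN iq ht; have [z1 hz1] := ps t.
have ex b : exists x, q b -> e x = b *: z1.
  have [qb|nb] := pselect (q b); last by exists 0 => /nb.
  have /pk[x hx] : p (b *: z1) = 0 by rewrite linearZ /= hz1 ht.
  by exists x.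
have [th hth] := choice ex.
have [|z0 hz0] := hN th.
  move=> c x y qx qy; apply: ei; rewrite linearP !hth //; last exact: (idlD iq (idlM _ iq qx)).
  by rewrite scalerDl scalerA.
exists (z1 - e z0); split.
  by rewrite linearB hz1 (_ : p (e z0) = 0) ?subr0 //; apply/pk; exists z0.
by move=> b qb; rewrite scalerBr -linearZ -hz0 // hth // subrr.
Qed.

(* Extending to R the map sending y to x and q to 0.                          *)
Lemma injective_divide q y I (x : I) : injective_module I -> ideal q ->
  (forall a, q (a * y) -> a *: x = 0) ->
  exists w, y *: w = x /\ forall b, q b -> b *: w = 0.
Proof.
move=> /injective_baer bI iq hx.
pose a : set R := idl_add q [set s * y | s in setT].
have ic : ideal [set s * y | s in setT].
  split; first by exists 0; rewrite ?mul0r.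
  by move=> z _ _ [s _ <-] [t _ <-]; exists (z * s + t) => //; rewrite mulrDl -mulrA.
have ia : ideal a := ideal_add iq ic.
have ex u : exists s, a u -> q (u - s * y).
  have [[v qv [_ [s _ <-] <-]]|nb] := pselect (a u); last by exists 0 => /nb.
  by exists s => _; rewrite addrK.
have [s hs] := choice ex.
have key u t : a u -> q (u - t * y) -> s u *: x = t *: x.
  move=> au ht; apply/eqP; rewrite -subr_eq0 -scalerBl; apply/eqP/hx.
  have -> : (s u - t) * y = (u - t * y) - (u - s u * y) by ring.
  by apply: (idlB iq) => //; exact: hs.
have [|w hw] := bI a (fun u => s u *: x) ia.
  move=> z u v au av; rewrite scalerA -scalerDl; apply: key.
    by apply: (idlD ia) => //; exact: (idlM _ ia).
  rewrite (_ : _ - _ = z * (u - s u * y) + (v - s v * y)); last by ring.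
  by apply: (idlD iq); [apply: (idlM _ iq)|]; exact: hs.
have ay : a y by apply: (idl_addr iq); exists 1; rewrite ?mul1r.
exists w; split.
  by rewrite -hw // (@key y 1) ?scale1r // mul1r subrr; exact: (idl0 iq).
move=> b qb; have ab : a b by exact: (idl_addl ic).
by rewrite -hw // (@key b 0) ?scale0r // mul0r subr0.
Qed.

Definition addgen q y : set R := idl_add q [set s * y | s in setT].

Lemma ideal_addgen q y : ideal q -> ideal (addgen q y).
Proof.
move=> iq; apply: ideal_add => //; split; first by exists 0; rewrite ?mul0r.
by move=> z _ _ [s _ <-] [t _ <-]; exists (z * s + t) => //; rewrite mulrDl -mulrA.
Qed.

(** On q the form is multiplication by some w0. Its defect t at y is killed by q, so [ext_lift]
    gives a preimage z in I killed by q, and z = y w1 with q w1 = 0 because y is regular modulo q.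
    The image of w1 corrects w0. *)
Lemma ext_from_addgen q y N I N' (e : {linear N -> I}) (p : {linear I -> N'}) :
  ideal q -> (forall a, q (a * y) -> q a) -> ses e p -> injective_module I ->
  ext_from q N -> ext_from q N' -> ext_from (addgen q y) N'.
Proof.
move=> iq hy se iI hN hN' th hth.
have qa b : q b -> addgen q y b.
  by move=> qb; exists b => //; exists 0; rewrite ?addr0 //; exists 0; rewrite ?mul0r.
have ya : addgen q y y.
  by exists 0; [exact: (idl0 iq)|exists y; rewrite ?add0r //; exists 1; rewrite ?mul1r].
have [|w0 hw0] := hN' th; first by move=> c u v qu qv; apply: hth; exact: qa.
have th0 : th 0 = 0 by rewrite hw0 ?scale0r //; exact: (idl0 iq).
have thM c u : addgen q y u -> th (c * u) = c *: th u.
  move=> au; have := hth c u 0 au (qa _ (idl0 iq)); rewrite addr0 th0 addr0; exact.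
pose t := th y - y *: w0.
have [|z [pz qz]] := ext_lift se hN iq (t := t).
  move=> b qb; rewrite /t scalerBr -thM // scalerA hw0 ?subrr //.
  exact: (idlMr _ iq).
have [|w1 [yw1 qw1]] := injective_divide (y := y) (x := z) iI iq.
  by move=> a /hy /qz.
exists (p w1 + w0) => _ [b qb [_ [s _ <-] <-]].
rewrite addrC hth ?(hw0 b qb) //; last exact: qa.
have e1 : (s * y + b) *: p w1 = s *: t.
  by rewrite -(linearZ_LR p) scalerDl -scalerA yw1 qw1 // addr0 (linearZ_LR p) pz.
by rewrite [RHS]scalerDr e1 scalerDl /t scalerBr -scalerA addrA subrK.
Qed.

Lemma ext_le0_addgen q y n N I N' (e : {linear N -> I}) (p : {linear I -> N'}) :
  ideal q -> (forall a, q (a * y) -> q a) -> ses e p -> injective_module I ->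
  ext_from q N -> ext_le q 0 n N' -> ext_le (addgen q y) 0 n N'.
Proof.
move=> iq hy; elim: n N I N' e p => [|n IH] N I N' e p se iI hN //= [h0 [I' [N'' [e' [p' [h1 h2 h3]]]]]].
have hN' := h0 erefl; split; first by move=> _; exact: ext_from_addgen se iI hN hN'.
exists I', N'', e', p'; split=> //; exact: IH h1 h2 hN' h3.
Qed.

Lemma ext_le_addgen q y d n N : ideal q -> (forall a, q (a * y) -> q a) ->
  ext_le q d n N -> ext_le (addgen q y) d.+1 n N.
Proof.
move=> iq hy; elim: d n N => [|d IH] [|n] N //= [h0 [I [N' [e [p [h1 h2 h3]]]]]];
  split=> //; exists I, N', e, p; split=> //; last exact: IH.
exact: ext_le0_addgen h1 h2 (h0 erefl) h3.
Qed.

(** The conditions on u say that R/m embeds in R/q by 1 -> u. Then Ext^(d+1)(R/q, N) = 0 maps onto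
    Ext^(d+1)(R/m, N), as the next Ext is 0 for a coresolution of length d + 1. *)
Lemma ext_le_socle q m u d N : ideal q -> ideal m -> (forall a, q (a * u) -> m a) ->
  (forall c, m c -> q (c * u)) -> ext_le q d d.+1 N -> ext_le m d d.+1 N.
Proof.
move=> iq im hu hu'; elim: d N => [|d IH] N [h0 [I [N' [e [p [h1 h2 h3]]]]]]; last first.
  by split=> //; exists I, N', e, p; split=> //; exact: IH.
split; last by exists I, N', e, p.
move=> _ th hth; have [ei ps pk] := h1.
  have [|w1 hw1] := @injective_baer _ _ h2 m (fun x => e (th x)) im.
    by move=> c x y mx my; rewrite hth // linearP.
  have pw1 c : m c -> c *: p w1 = 0.
    by move=> mc; rewrite -linearZ -hw1 //; apply/pk; exists (th c).
  have [|w2 [uw2 qw2]] := injective_divide (y := u) (x := p w1) h3 iq.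
    by move=> a /hu /pw1.
  have [w3 [pw3 qw3]] := ext_lift h1 (h0 erefl) iq qw2.
  have /pk[w hw] : p (w1 - u *: w3) = 0 by rewrite linearB linearZ /= pw3 uw2 subrr.
  exists w => x mx; apply: ei; rewrite linearZ /= hw hw1 // scalerBr scalerA qw3 ?subr0 //.
exact: hu'.
Qed.

End Depth.

(** * Regular sequences *)

Section WeaklyRegular.
Variable R : comNzRingType.

Definition weakly_regular (s : seq R) : Prop :=
  forall i, (i < size s)%N -> forall y,
    ideal_gen [set` take i s] (s`_i * y) -> ideal_gen [set` take i s] y.

Lemma ideal_gen_rcons (g : seq R) w :
  ideal_gen [set` rcons g w] = addgen (ideal_gen [set` g]) w.
Proof.
apply/seteqP; split.
  apply: ideal_gen_sub; first by apply: ideal_addgen; exact: ideal_ideal_gen.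
  move=> u /=; rewrite mem_rcons inE => /orP[/eqP ->|ug].
    exists 0; first exact: (idl0 (ideal_ideal_gen _)).
    by exists w; rewrite ?add0r //; exists 1; rewrite ?mul1r.
  exists u; first exact: idl_gen_mem.
  by exists 0; rewrite ?addr0 //; exists 0; rewrite ?mul0r.
have iw := ideal_ideal_gen [set` rcons g w].
move=> _ [b hb [_ [s _ <-] <-]]; apply: (idlD iw).
  move: b hb; apply: ideal_gen_sub; first exact: iw.
  by move=> u /= ug; apply: idl_gen_mem; rewrite mem_rcons inE ug orbT.
by apply: (idlM _ iw); apply: idl_gen_mem; rewrite mem_rcons mem_head.
Qed.

Lemma weakly_regular_rcons (g : seq R) w : weakly_regular (rcons g w) <->
  weakly_regular g /\ forall y, ideal_gen [set` g] (w * y) -> ideal_gen [set` g] y.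
Proof.
split=> [h|[hg hw] i].
  split=> [i ig y|].
    have := h i; rewrite size_rcons ltnS (ltnW ig) nth_rcons ig -cats1 takel_cat ?(ltnW ig) //.
    exact.
  have := h (size g); rewrite size_rcons ltnSn nth_rcons ltnn eqxx -cats1 take_size_cat //.
  exact.
rewrite size_rcons ltnS leq_eqVlt => /orP[/eqP ->|ig].
  by rewrite nth_rcons ltnn eqxx -cats1 take_size_cat.
by rewrite nth_rcons ig -cats1 takel_cat ?(ltnW ig) //; exact: hg.
Qed.

Lemma ext_le_nil n (N : lmodType R) : idle n N -> ext_le (ideal_gen [set` ([::] : seq R)]) 0 n N.
Proof.
elim: n N => [|n IH] N //= [_ [I [N' [e [p [h1 h2 h3]]]]]]; split; last first.
  by exists I, N', e, p; split=> //; exact: IH.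
have i0 := ideal_ideal_gen [set` ([::] : seq R)].
move=> _ th hth; exists 0 => x /(@mspan_nil R R^o) ->; rewrite scaler0.
have := hth 1 0 0 (idl0 i0) (idl0 i0); rewrite mulr0 addr0 scale1r.
by move=> /eqP; rewrite -subr_eq0 opprD addNKr oppr_eq0 => /eqP.
Qed.

Lemma ext_le_regular (g : seq R) n (N : lmodType R) : weakly_regular g -> idle n N ->
  ext_le (ideal_gen [set` g]) (size g) n N.
Proof.
move=> hg hN; elim/last_ind: g hg => [|g w IH] hg; first exact: ext_le_nil.
have [hg' hw] := (weakly_regular_rcons g w).1 hg.
rewrite ideal_gen_rcons size_rcons; apply: ext_le_addgen; [exact: ideal_ideal_gen| |exact: IH].
by move=> a; rewrite mulrC; exact: hw.
Qed.

End WeaklyRegular.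

(** * A regular sequence of length d in R *)

Section DepthBound.
Variables (R S : comNzRingType) (m : set R) (n : set S) (f : {rmorphism R -> S}).
Hypotheses (lR : noetherian_local m) (lS : noetherian_local n) (fmn : local_hom m n f).
Variables (x : seq R) (ys : seq S) (d : nat).
Hypotheses (mx : min_gens m x) (ny : n = ideal_gen [set` ys]) (rde : size x = (d + size ys)%N).
Variables (M : lmodType S) (v : M).
Hypotheses (hM : idle d (restrict f M)) (v0 : v != 0) (sv : forall u, n u -> u *: v = 0).

(** If a regular sequence g of length k < d could not be prolonged, the residue field would embed in
    R/(g). As Ext from R/(g) vanishes above k <= d - 1, [ext_le_socle] would make Ext from the
    residue field vanish above d - 1, and [local_ext_lower] would kill v. *)
Lemma regular_sequence_ex : exists g : seq R, [/\ size g = d, forall u, u \in g -> m u &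
  weakly_regular g].
Proof.
have nR : noetherian R by have [] := lR.
have im := noetherian_local_ideal lR; have iN := noetherian_local_ideal lS.
suff H k : (k <= d)%N -> exists g : seq R, [/\ size g = k, forall u, u \in g -> m u &
  weakly_regular g] by exact: H (leqnn d).
elim: k => [_|k IH kd]; first by exists [::].
have [g [sg gm wg]] := IH (ltnW kd).
have ig := ideal_ideal_gen [set` g].
have gsub : ideal_gen [set` g] `<=` m by apply: ideal_gen_sub.
have [Q [p [ps pk]]] := @quot_ex R R^o _ ig.
have nQ : noeth_mod Q by apply: (noeth_quot (p := p)).
have [|w [mw hw]] := exists_regular nR nQ im; last first.
  exists (rcons g w); split; first by rewrite size_rcons sg.
    by move=> u; rewrite mem_rcons inE => /orP[/eqP ->|/gm].
  apply/weakly_regular_rcons; split=> // y hy; apply/pk/hw.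
  by rewrite -linearZ; apply/pk.
move=> z hz; have [u hu] := ps z; apply: contrapT => z0.
have nu : ~ ideal_gen [set` g] u by move=> /pk; rewrite hu.
move/eqP: v0; apply.
have d0 : (0 < d)%N := leq_ltn_trans (leq0n k) kd.
apply: (@local_ext_lower R S m n f lR iN fmn x ys mx ny M d.-1 d) => //.
  by rewrite rde ltn_add2r prednK.
have := ext_le_regular wg hM; rewrite sg => h.
have {}h : ext_le (ideal_gen [set` g]) d.-1 d (restrict f M).
  have -> : d.-1 = (k + (d.-1 - k))%N by rewrite subnKC // -ltnS prednK.
  elim: (d.-1 - k)%N => [|j IHj]; first by rewrite addn0.
  by rewrite addnS; exact: ext_le_monod.
have gen (N : lmodType R) : ext_le (ideal_gen [set` g]) d.-1 d N -> ext_le m d.-1 d N.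
  case: (d) d0 => // d' _ /=; apply: (ext_le_socle (u := u) ig im).
    move=> a ha; apply: contrapT => na; have [b hb] := noetherian_local_unit lR na.
    by apply: nu; rewrite -[u]mul1r -hb mulrAC; exact: (idlMr _ ig).
  move=> c mc; apply/pk; rewrite -[c * u]/(c *: (u : R^o)) linearZ /= hu.
  exact: hz.
exact: gen.
Qed.

End DepthBound.

Import -(notations) finmap.
Import -(notations) monalg.

(** * Flat dimension and duality *)

Section FreeModule.
Variables (R : comNzRingType) (K : choiceType).
Local Notation F := (malg K R).

Definition fgen (k : K) : F := mkmalgU k 1.

Lemma malg_sumE (s : seq K) (P : lmodType R) (h : K -> P) (g : F) : uniq s ->
  (forall k, mcoeff k g != 0 -> k \in s) ->
  \sum_(k <- msupp g) mcoeff k g *: h k = \sum_(k <- s) mcoeff k g *: h k.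
Proof.
move=> us hs; rewrite [RHS](bigID (fun k => mcoeff k g != 0)) /= [X in _ + X]big1 ?addr0; last first.
  by move=> k /negPn/eqP ->; rewrite scale0r.
rewrite -[RHS]big_filter; apply: perm_big; apply: uniq_perm; rewrite ?filter_uniq ?fset_uniq //.
move=> k; rewrite mem_filter -mcoeff_neq0.
by have [h0|] := boolP (mcoeff k g != 0) => //=; rewrite hs.
Qed.

Section Lift.
Variables (P : lmodType R) (h : K -> P).

Lemma free_lift_lin a (x y : F) :
  \sum_(k <- msupp (a *: x + y)) mcoeff k (a *: x + y) *: h k =
  a *: (\sum_(k <- msupp x) mcoeff k x *: h k) + \sum_(k <- msupp y) mcoeff k y *: h k.
Proof.
pose s := undup (msupp x ++ msupp y).
have us : uniq s by exact: undup_uniq.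
have sx k : mcoeff k x != 0 -> k \in s by move=> hk; rewrite mem_undup mem_cat -mcoeff_neq0 hk.
have sy k : mcoeff k y != 0 -> k \in s.
  by move=> hk; rewrite mem_undup mem_cat orbC -mcoeff_neq0 hk.
rewrite !(@malg_sumE s) //; last first.
  move=> k; rewrite mcoeffD mcoeffZ => hk.
  have [x0|/eqP/sx//] := mcoeff k x =P 0; have [y0|/eqP/sy//] := mcoeff k y =P 0.
  by rewrite x0 y0 mulr0 addr0 eqxx in hk.
rewrite scaler_sumr -big_split; apply: eq_bigr => k _ /=.
by rewrite mcoeffD mcoeffZ scalerDl scalerA.
Qed.

Definition free_lift : {linear F -> P} := linof free_lift_lin.

Lemma free_liftE k : free_lift (fgen k) = h k.
Proof.
rewrite -[LHS]/(\sum_(i <- msupp (fgen k)) mcoeff i (fgen k) *: h i).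
rewrite (@malg_sumE [:: k]) ?big_seq1 ?mcoeffUU ?scale1r // => i.
by rewrite mcoeffU inE [i == k]eq_sym; case: (k == i) => //; rewrite mulr0n eqxx.
Qed.

End Lift.

Lemma free_ext (P : lmodType R) (u v : {linear F -> P}) :
  (forall k, u (fgen k) = v (fgen k)) -> u =1 v.
Proof.
move=> h g; rewrite (monalgE g) !linear_sum; apply: eq_bigr => k _.
have -> : mkmalgU k (mcoeff k g) = mcoeff k g *: fgen k :> F.
  by apply/malgP => i; rewrite mcoeffZ !mcoeffU mulrnAr mulr1.
by rewrite !linearZ /= h.
Qed.

End FreeModule.

Section Tensor.
Variables (R : comNzRingType) (M A : lmodType R).

Lemma bilin_ex (P : lmodType R) (g : M -> A -> P) :
  (forall a x y z, g (a *: x + y) z = a *: g x z + g y z) ->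
  (forall a x y z, g z (a *: x + y) = a *: g z x + g z y) ->
  exists t : {bilinear M -> A -> P}, forall x y, t x y = g x y.
Proof.
move=> h1 h2.
have hb : bilinear_for *:%R *:%R g.
  by split=> u a x y; [exact: h1|exact: h2].
pose b : {bilinear M -> A -> P} := HB.pack g (bilinear_isBilinear.Build R M A P *:%R *:%R g hb).
by exists b.
Qed.

Lemma tensor_ex : exists (T : lmodType R) (t : {bilinear M -> A -> T}), is_tensor t.
Proof.
pose F := malg (M * A)%type R; pose e (x : M) (y : A) : F := fgen R (x, y).
pose N := mspan ([set z : F | exists a x y z', z = e (a *: x + y) z' - (a *: e x z' + e y z')] `|`
  [set z : F | exists a x y z', z = e z' (a *: x + y) - (a *: e z' x + e z' y)]).
have sN : submodule N by exact: submodule_mspan.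
have [T [p [ps pk]]] := quot_ex sN.
have [||t ht] := @bilin_ex T (fun x y => p (e x y)).
- move=> a x y z; rewrite -linearP; apply/eqP; rewrite -subr_eq0 -linearB; apply/eqP/pk.
  by apply: mspan_in; left; exists a, x, y, z.
- move=> a x y z; rewrite -linearP; apply/eqP; rewrite -subr_eq0 -linearB; apply/eqP/pk.
  by apply: mspan_in; right; exists a, x, y, z.
exists T, t => P g; split.
  have [G GE] : exists G : {linear F -> P}, forall x y, G (e x y) = g x y.
    by exists (free_lift (fun k : M * A => g k.1 k.2)) => x y; rewrite /e free_liftE.
  have [|h hh] := fact_surj (g := G) ps.
    move=> x /pk; move: x; apply: mspan_sub; first exact: submodule_ker.
    move=> _ [[a [x [y [z ->]]]]|[a [x [y [z ->]]]]] /=.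
      by rewrite linearB linearP !GE linearPl subrr.
    by rewrite linearB linearP !GE linearPr subrr.
  by exists h => x a; rewrite ht hh GE.
move=> h h' eh eh' z; have [x <-] := ps z.
apply: (@free_ext R _ P (lin_comp h p) (lin_comp h' p)) => -[y a].
by rewrite !lin_compE -[fgen _ _]/(e y a) -ht eh eh'.
Qed.

End Tensor.

Section Duality.
Variables (R : comNzRingType) (J : lmodType R).
Hypothesis iJ : injective_module J.
Implicit Types (W X F N : lmodType R).

Definition dual W : lmodType R := homm (idfun : {rmorphism R -> R}) W J.

Lemma dual_lin W (g : dual W) : exists h : {linear W -> J}, forall x, h x = val g x.
Proof. by exists (linof (homm_val g)). Qed.

Lemma lin_homP W (h : {linear W -> J}) : homP (idfun : {rmorphism R -> R}) h.
Proof. by move=> r x y; rewrite linearP. Qed.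
Definition lin_dual W (h : {linear W -> J}) : dual W := mkhom (lin_homP h).
Lemma lin_dualE W (h : {linear W -> J}) x : val (lin_dual h) x = h x. Proof. by []. Qed.

Lemma dual_scale W a (g : dual W) x : val (a *: g) x = a *: val g x.
Proof. exact: (homm_scale g a x). Qed.

Lemma dual_mapP W X (u : {linear W -> X}) (g : dual X) :
  homP (idfun : {rmorphism R -> R}) (fun x => val g (u x)).
Proof. by move=> r x y; rewrite linearP homm_val. Qed.

Lemma dual_map_lin W X (u : {linear W -> X}) a (g h : dual X) :
  mkhom (dual_mapP u (a *: g + h)) = a *: (mkhom (dual_mapP u g) : dual W) + mkhom (dual_mapP u h).
Proof. apply: hommP => x; rewrite [RHS]hommDE dual_scale -[LHS]/(val (a *: g + h) (u x)).
by rewrite hommDE dual_scale. Qed.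

Definition dual_map W X (u : {linear W -> X}) : {linear dual X -> dual W} :=
  linof (dual_map_lin u).
Lemma dual_mapE W X (u : {linear W -> X}) g x : val (dual_map u g) x = val g (u x).
Proof. by []. Qed.

Lemma dual_ses N F W (e : {linear N -> F}) (p : {linear F -> W}) : ses e p ->
  ses (dual_map p) (dual_map e).
Proof.
move=> [ei ps pk]; split.
- move=> g h gh; apply: hommP => y; have [x <-] := ps y.
  by rewrite -!dual_mapE gh.
- move=> g; have [h hh] := dual_lin g; have [w hw] := iJ h ei.
  by exists (lin_dual w); apply: hommP => x; rewrite dual_mapE lin_dualE hw hh.
move=> g; split=> [g0|[h <-]]; last first.
  apply: hommP => x; rewrite !dual_mapE homm0E.
  have -> : p (e x) = 0 by apply/pk; exists x.
  by rewrite homm0.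
have [h hh] := dual_lin g.
have [|w hw] := fact_surj (g := h) ps.
  by move=> x /pk[y <-]; rewrite hh -dual_mapE g0 homm0E.
by exists (lin_dual w); apply: hommP => x; rewrite dual_mapE lin_dualE hw hh.
Qed.

(** Tensor-Hom adjunction: flatness keeps u injective after tensoring with F, and the injectivity of
    J extends the corresponding map. *)
Lemma flat_dual F : flat F -> injective_module (dual F).
Proof.
move=> fF A B u v ui.
have [TA [tA hTA]] := tensor_ex F A; have [TB [tB hTB]] := tensor_ex F B.
have [||g hg] := @bilin_ex R F A J (fun x a => val (v a) x).
- by move=> c x y a; rewrite homm_val.
- by move=> c a b x; rewrite linearP hommDE dual_scale.
have [[G hG] _] := hTA _ g.
have [||k hk] := @bilin_ex R F A TB (fun x a => tB x (u a)).
- by move=> c x y a; rewrite linearPl.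
- by move=> c a b x; rewrite linearP linearPr.
have [[h hh] _] := hTA _ k.
have hi : injective h by apply: (fF _ _ u ui _ _ tA tB hTA hTB) => x a; rewrite hh hk.
have [w hw] := iJ G hi.
have wP b : homP (idfun : {rmorphism R -> R}) (fun x => w (tB x b)).
  by move=> r x y; rewrite linearPl linearP.
have wl c a b : mkhom (wP (c *: a + b)) = c *: (mkhom (wP a) : dual F) + mkhom (wP b).
  by apply: hommP => x; rewrite hommDE dual_scale /= linearPr linearP.
exists (linof wl) => a; apply: hommP => x /=.
by rewrite -hk -hh hw hG hg.
Qed.

(** The dual of a free module is a power of J. *)
Lemma free_dual (K : choiceType) : injective_module (dual (malg K R)).
Proof.
pose s (g : dual (malg K R)) : K -> J := fun k => val g (fgen R k).
have sl a g h : s (a *: g + h) = a *: s g + s h.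
  by apply/funext => k; rewrite /s hommDE dual_scale.
pose r (h : K -> J) : dual (malg K R) := lin_dual (free_lift h).
have rl a g h : r (a *: g + h) = a *: r g + r h.
  apply: hommP => x; rewrite hommDE dual_scale !lin_dualE.
  rewrite -[RHS]/((lin_add (lin_comp (lin_scale J a) (free_lift g)) (free_lift h)) x).
  apply: free_ext => k.
  by rewrite lin_addE lin_compE lin_scaleE !free_liftE.
apply: (injm_retract (s := linof sl) (r := linof rl)); last exact: injm_fun.
move=> g; have [h hh] := dual_lin g.
apply: hommP => x; rewrite -hh; apply: free_ext => k.
by rewrite free_liftE /s hh.
Qed.

Hypothesis cJ : forall X (z : X), z != 0 -> exists h : {linear X -> J}, h z != 0.

(** An element z of the kernel, if non-zero, is detected by some xi into J. Viewed as a map from A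
    to the dual of W, xi extends to B, so xi factors through h and vanishes at z. *)
Lemma dual_flat W : injective_module (dual W) -> flat W.
Proof.
move=> iW A B u ui TA TB tA tB hTA hTB h hh; apply: inj_lin => z hz.
apply: contrapT => /eqP z0; have [xi xz] := cJ z0.
have vP a : homP (idfun : {rmorphism R -> R}) (fun x => xi (tA x a)).
  by move=> r x y; rewrite linearPl linearP.
have vl c a b : mkhom (vP (c *: a + b)) = c *: (mkhom (vP a) : dual W) + mkhom (vP b).
  by apply: hommP => x; rewrite hommDE dual_scale /= linearPr linearP.
have [w hw] := iW _ _ u (linof vl) ui.
have [||g hg] := @bilin_ex R W B J (fun x b => val (w b) x).
- by move=> c x y a; rewrite homm_val.
- by move=> c a b x; rewrite linearP hommDE dual_scale.
have [[G hG] _] := hTB _ g.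
have [||g0 hg0] := @bilin_ex R W A J (fun x a => xi (tA x a)).
- by move=> c x y a; rewrite linearPl linearP.
- by move=> c a b x; rewrite linearPr linearP.
have [_ uq] := hTA _ g0; move: xz; rewrite (uq xi (lin_comp G h)).
- by rewrite lin_compE hz linear0 eqxx.
- by move=> x a; rewrite hg0.
- by move=> x a; rewrite lin_compE hh hG hg hw hg0.
Qed.

(** Flat dimension at most [n], by syzygies, in the shape that [dual] exchanges with [idle]. *)
Fixpoint fdle n W : Prop :=
  match n with
  | 0 => flat W
  | n'.+1 => exists (F N : lmodType R) (e : {linear N -> F}) (p : {linear F -> W}),
       [/\ ses e p, flat F & fdle n' N]
  end.

Lemma free_cover W : exists (K : choiceType) (p : {linear malg K R -> W}),
  forall y, exists x, p x = y.
Proof.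
exists W, (free_lift (fun k : W => k)) => y; exists (fgen R y).
by rewrite free_liftE.
Qed.

Lemma fdle_dual n W : fdle n W -> idle n (dual W).
Proof.
elim: n W => [|n IH] W; first exact: flat_dual.
move=> [F [N [e [p [se fF hN]]]]]; apply/idleSE.
by exists (dual F), (dual N), (dual_map p), (dual_map e); split; [exact: dual_ses|exact: flat_dual|exact: IH].
Qed.

Lemma dual_fdle n W : idle n (dual W) -> fdle n W.
Proof.
elim: n W => [|n IH] W; first exact: dual_flat.
move=> hW; have [K [p ps]] := free_cover W; have [N [e se]] := ker_ex ps.
exists (malg K R), N, e, p; split=> //; first exact: (@dual_flat (malg K R) (@free_dual K)).
apply: IH; exact: idle_coker (dual_ses se) (@free_dual K) hW.
Qed.

Lemma fdle_resolution n W : fdle n W -> exists (F : nat -> lmodType R) (e : {linear F 0%N -> W})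
    (d : forall i, {linear F i.+1 -> F i}), flat_resolution e d /\
    forall i, (n < i)%N -> forall x : F i, x = 0.
Proof.
elim: n W => [|n IH] W.
  move=> fW; have [Z hZ] := zero_ex R.
  have fZ : flat Z.
    apply: (@dual_flat Z); apply: injm_zero => g; apply: hommP => x.
    by rewrite (hZ x) homm0.
  pose F (i : nat) : lmodType R := if i is 0%N then W else Z.
  exists F, (lin_id W), (fun i => lin_0 (F i.+1) (F i)); split; last by case.
  split.
  - by case.
  - by move=> y; exists y.
  - by move=> x; split=> [h|[y <-]] //; exists 0; exact: esym h.
  - by move=> i x; split=> // _; exists 0; rewrite linear0 [RHS]hZ.
move=> [F0 [N [e [p [[ei ps pk] fF /IH[F [e' [d [[fF' e's e'k dk] hF]]]]]]]]].
pose G (i : nat) : lmodType R := if i is j.+1 then F j else F0.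
pose dd i : {linear G i.+1 -> G i} :=
  match i with 0%N => lin_comp e e' | j.+1 => d j end.
exists G, p, dd; split; last by case=> // i; rewrite ltnS; exact: hF.
split.
- by case.
- exact: ps.
- move=> x; rewrite pk; split=> [[y <-]|[y <-]]; last by exists (e' y).
  by have [z <-] := e's y; exists z.
- case=> [|i] x; last exact: dk.
  rewrite -e'k; split=> [h|h]; last by rewrite -[LHS]/(e (e' x)) h linear0.
  by apply: (inj_lin0 ei); exact: h.
Qed.

Lemma resolution_fdle n W (F : nat -> lmodType R) (e : {linear F 0%N -> W})
    (d : forall i, {linear F i.+1 -> F i}) : flat_resolution e d ->
    (forall i, (n < i)%N -> forall x : F i, x = 0) -> fdle n W.
Proof.
elim: n W F e d => [|n IH] W F e d [fF es ek dk] hF.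
  have ei : injective e.
    by apply: inj_lin => x /ek[y <-]; rewrite (hF 1%N _ y) ?linear0.
  have [g [ge eg]] := bij_inv ei es.
  apply: dual_flat; apply: (injm_iso (h := dual_map g)); last exact: flat_dual (fF 0%N).
  exists (dual_map e) => h; apply: hommP => x; rewrite !dual_mapE ?ge ?eg //.
have [N [i se]] := ker_ex es; have [ii ps pk] := se.
have [|d0 hd0] := fact_inj (g := d 0%N) ii.
  by move=> z; apply/pk/ek; exists z.
exists (F 0%N), N, i, e; split=> //.
apply: (IH N (fun j => F j.+1) d0 (fun j => d j.+1)); last by move=> j hj; exact: hF.
split.
- by move=> j; exact: fF.
- move=> y; have /ek[z hz] : e (i y) = 0 by apply/pk; exists y.
  by exists z; apply: ii; rewrite hd0.
- move=> x; rewrite -dk -hd0; split=> [->|/(inj_lin0 ii)//]; exact: linear0.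
- by move=> j x; exact: dk.
Qed.

End Duality.

(** The annihilator of z lies in m, which kills w; so z -> w defines a map on R z, and it extends to
    X. *)
Lemma cogenerator (R : comNzRingType) (m : set R) (J : lmodType R) (w : J) :
  noetherian_local m -> injective_module J -> w != 0 -> (forall u, m u -> u *: w = 0) ->
  forall (X : lmodType R) (z : X), z != 0 -> exists h : {linear X -> J}, h z != 0.
Proof.
move=> lR iJ w0 hw X z z0.
have [Z [p [e [ps ei ep]]]] := im_fact (lin_at z).
have [|g hg] := fact_surj (g := lin_at w) ps.
  move=> a pa; apply: hw; apply: contrapT => na.
  have [b hb] := noetherian_local_unit lR na.
  move/eqP: z0; apply; rewrite -[z]scale1r -hb mulrC -scalerA.
  by rewrite -[a *: z]/(lin_at z a) -ep pa linear0 scaler0.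
have [h hh] := iJ _ _ e g ei; exists h.
have -> : z = e (p 1) by rewrite ep -[RHS]/(1 *: z) scale1r.
by rewrite hh hg -[lin_at w 1]/(1 *: w) scale1r.
Qed.

(** * Comparison of injective and flat dimension *)

Section Dimensions.
Variables (R S : comNzRingType) (m : set R) (n : set S) (f : {rmorphism R -> S}).
Variables (l : fieldType) (pl : {rmorphism S -> l}).
Hypotheses (lR : noetherian_local m) (lS : noetherian_local n) (fmn : local_hom m n f)
  (ql : is_quotient n pl).
Variables (M : lmodType S) (d : nat) (v : M).
Hypotheses (hM : idle d (restrict f M)) (iM : injective_module M) (v0 : v != 0)
  (sv : forall u, n u -> u *: v = 0).

(** X embeds over S in a power of Y and splits off since it is injective; over R, powers and
    retracts do not raise injective dimension. *)
Lemma idle_cogenerated (X Y : lmodType S) j : injective_module X ->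
  (forall x : X, x != 0 -> exists h : {linear X -> Y}, h x != 0) ->
  idle j (restrict f Y) -> idle j (restrict f X).
Proof.
move=> iX cX hY; pose T := {linear X -> Y}.
pose s (x : X) : T -> Y := fun h => h x.
have sl a x y : s (a *: x + y) = a *: s x + s y.
  by apply/funext => h; rewrite /s linearP.
have si : injective (linof sl).
  apply: inj_lin => x sx; apply: contrapT => /eqP /cX[h /eqP]; apply.
  exact: (congr1 (fun k : T -> Y => k h) sx).
have [r hr] := injm_split iX si.
have sl' a (x y : restrict f X) : (s (a *: x + y) : T -> restrict f Y) = a *: (s x : T -> restrict f Y) + s y.
  exact: (sl (f a) x y).
have rl' a (x y : T -> restrict f Y) : (r (a *: x + y) : restrict f X) = a *: (r x : restrict f X) + r y.
  exact: (linearP r (f a) (x : T -> Y) (y : T -> Y)).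
apply: (idle_retract (s := linof sl') (r := linof rl')); last exact: idle_fun.
exact: hr.
Qed.

Lemma idle_embed (N : lmodType R) j : idle j N ->
  exists (J : lmodType R) (e : {linear N -> J}), injective_module J /\ injective e.
Proof.
case: j => [|j]; first by move=> iN; exists N, (lin_id N); split=> // x y; exact.
by move=> /idleSE[I [N' [e [p [[ei _ _] iI _]]]]]; exists I, e.
Qed.

Lemma injective_cogenerator_ex : exists J : lmodType R, injective_module J /\
  forall (X : lmodType R) (z : X), z != 0 -> exists h : {linear X -> J}, h z != 0.
Proof.
have [J [e0 [iJ ei]]] := idle_embed hM.
exists J; split=> //; apply: (@cogenerator R m J (e0 v) lR iJ).
  by apply: contra_neq v0 => h; apply: (inj_lin0 (u := e0) ei).
move=> u hu; rewrite -(linearZ_LR e0) -[X in e0 X]/(f u *: v).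
by rewrite sv ?linear0 //; apply: fmn; exists u.
Qed.

(** Take J an injective cogenerator of R. Both M and Hom_R(S, J) are injective cogenerators of S, so
    each bound on the R-injective dimension passes from one to the other, and for Hom_R(S, J) the
    bound is one on the flat dimension of S. *)
Lemma fdle_iff : (forall j, fdle j (restrict f S^o) -> idle j (restrict f M)) /\
  fdle d (restrict f S^o) /\
  (injective_module (restrict f M) -> flat (restrict f S^o)).
Proof.
have [J [iJ cJ]] := injective_cogenerator_ex.
pose H : lmodType S := coind f J.
have iH : injective_module H := coind_injective iJ.
have [phi hphi] := cJ (restrict f (residue_module pl)) (1 : l) (oner_neq0 l).
have gP : homP f (fun s : S^o => phi (pl s)).
  by move=> r x y; rewrite -linearP; congr (phi _); rewrite rmorphD rmorphM.
pose g : H := mkhom gP.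
have g0 : g != 0.
  apply/eqP => /(congr1 (fun h : H => val h 1)) e.
  by move: hphi; rewrite -[X in phi X](rmorph1 pl) (e : phi (pl 1) = 0) eqxx.
have sg u : n u -> u *: g = 0.
  move=> hu; apply: hommP => s; rewrite hommZE homm0E /=.
  have /(residue_ker ql) -> : n (u * s) by apply: (idlMr _ (noetherian_local_ideal lS)).
  exact: linear0.
have cH : forall (X : lmodType S) (z : X), z != 0 -> exists h : {linear X -> H}, h z != 0 := cogenerator lS iH g0 sg.
have cM : forall (X : lmodType S) (z : X), z != 0 -> exists h : {linear X -> M}, h z != 0 := cogenerator lS iM v0 sv.
have kl a (x y : dual J (restrict f S^o)) : (mkhom (homm_val (a *: x + y) : homP f (val (a *: x + y) : S^o -> J)) : restrict f H) =
   a *: (mkhom (homm_val x : homP f (val x : S^o -> J)) : restrict f H) + (mkhom (homm_val y : homP f (val y : S^o -> J)) : restrict f H).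
  by apply: hommP => s.
have ki : injective (linof kl).
  by move=> x y /(congr1 val) /= e; apply: val_inj.
have ks (y : restrict f H) : exists x, linof kl x = y.
  exists (mkhom (homm_val (y : H) : homP (idfun : {rmorphism R -> R}) (val (y : H) : restrict f S^o -> J))).
  exact: val_inj.
have [k' [k'1 k'2]] := bij_inv ki ks.
have k'i : injective k' by move=> x y /(congr1 (linof kl)); rewrite !k'2.
have k's x : exists y, k' y = x by exists (linof kl x).
split; last split.
- move=> j /(fdle_dual iJ) hj; apply: (idle_cogenerated iM (@cH M)).
  exact: ext_le_iso k'i k's hj.
- apply: (dual_fdle iJ cJ); apply: (ext_le_iso ki ks).
  exact: (idle_cogenerated iH (@cM H)).
- move=> iRM; have T : idle 0 (dual J (restrict f S^o)).
    apply: (ext_le_iso (d := 0) (n := 0) (q := set0) ki ks).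
    exact: (idle_cogenerated (j := 0) iH (@cM H)).
  exact: (@dual_fdle _ _ iJ cJ 0 _ T).
Qed.

Variables (x : seq R) (ys : seq S).
Hypotheses (mx : min_gens m x) (ny : n = ideal_gen [set` ys]) (rde : size x = (d + size ys)%N).

Lemma idle_lower j : idle j (restrict f M) -> (d <= j)%N.
Proof.
move=> hj; rewrite leqNgt; apply/negP => jd; move/eqP: v0; apply.
apply: (local_ext_lower lR (noetherian_local_ideal lS) fmn mx ny _ (idle_ext_le m (leqnn j) hj) sv).
by rewrite rde ltn_add2r.
Qed.

Lemma inj_dimE : (inj_dim (restrict f M) <= (d%:Z)%:E)%E -> inj_dim (restrict f M) = (d%:Z)%:E.
Proof.
rewrite /inj_dim; set A := (X in nat_inf X).
case: (nat_infP A) => [[j [[I [e [dd [h1 h2]]]] [_ ->]]]|->] //.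
rewrite lee_fin lez_nat => jd; congr (_%:Z%:E); apply/eqP; rewrite eqn_leq jd.
exact: idle_lower (idle_resolution h1 h2).
Qed.

Lemma flat_dimE : flat_dim (restrict f S^o) = (d%:Z)%:E.
Proof.
have [h1 [h2 _]] := fdle_iff.
have [J [iJ cJ]] := injective_cogenerator_ex.
apply: nat_inf_min.
  have [F [e [dd h]]] := fdle_resolution cJ h2.
  by exists F, e, dd.
move=> k [F [e [dd [h3 h4]]]]; apply: idle_lower; apply: h1.
exact: (resolution_fdle iJ cJ h3 h4).
Qed.

End Dimensions.

Lemma ring_quot_ex (V : comNzRingType) (I : set V) : ideal I -> ~ I 1 ->
  exists (Q : comNzRingType) (p : {rmorphism V -> Q}), is_quotient I p.
Proof.
move=> iI n1.
have [||||||| Q [p [pB p1 pM ps pk]]] := @subquot_ring V setT I _ _ _ _ _ _ n1 _ => //.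
- exact: (idl0 iI).
- by move=> x y; exact: (idlB iI).
- by move=> x y _; exact: (idlM _ iI).
have pz : zmod_morphism p by move=> x y; exact: pB.
have pm : monoid_morphism p by split=> [|x y]; [exact: p1|exact: pM].
pose pr : {rmorphism V -> Q} := HB.pack p (GRing.isZmodMorphism.Build V Q p pz)
  (GRing.isMonoidMorphism.Build V Q p pm).
exists Q, pr; split; first by move=> y; have [x _ <-] := ps y; exists x.
by apply/seteqP; split=> x; rewrite /kernel /=; [move/pk; apply|move=> h; apply/pk].
Qed.

Lemma ring_fact (V Q T : comNzRingType) (p : {rmorphism V -> Q}) (g : {rmorphism V -> T}) :
  (forall y, exists x, p x = y) -> (forall x, p x = 0 -> g x = 0) ->
  exists h : {rmorphism Q -> T}, forall x, h (p x) = g x.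
Proof.
move=> ps pg; have [s hs] := choice ps.
have key x y : p x = p y -> g x = g y.
  move=> e; apply/eqP; rewrite -subr_eq0 -rmorphB; apply/eqP/pg.
  by rewrite rmorphB e subrr.
have hB : zmod_morphism (g \o s).
  by move=> x y; rewrite /= -rmorphB; apply: key; rewrite rmorphB !hs.
have hM : monoid_morphism (g \o s).
  split=> [|x y] /=; first by rewrite -(rmorph1 g); apply: key; rewrite rmorph1 hs.
  by rewrite -rmorphM; apply: key; rewrite rmorphM !hs.
pose hr : {rmorphism Q -> T} := HB.pack (g \o s)
  (GRing.isZmodMorphism.Build Q T (g \o s) hB) (GRing.isMonoidMorphism.Build Q T (g \o s) hM).
by exists hr => x; apply: key; rewrite hs.
Qed.

Lemma malgZU (K : choiceType) (A : comNzRingType) (k : K) (c : A) :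
  mkmalgU k c = c *: mkmalgU k 1 :> malg K A.
Proof. by apply/malgP => i; rewrite mcoeffZ !mcoeffU mulrnAr mulr1. Qed.

(** * Flat local extensions with a prescribed residue field *)

Section PolynomialGenerators.
Variables (I : choiceType) (A B : comNzRingType) (cst : {rmorphism A -> B}) (var : I -> B).

Inductive pgen (V : set I) : B -> Prop :=
| pgen_cst a : pgen V (cst a)
| pgen_var i : V i -> pgen V (var i)
| pgen_add x y : pgen V x -> pgen V y -> pgen V (x + y)
| pgen_mul x y : pgen V x -> pgen V y -> pgen V (x * y).

Lemma pgen_sub (V W : set I) x : V `<=` W -> pgen V x -> pgen W x.
Proof.
move=> VW; elim=> *; [exact: pgen_cst|apply: pgen_var; exact: VW|exact: pgen_add|exact: pgen_mul].
Qed.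

Lemma pgen_fin (V : set I) x : pgen V x -> exists s : seq I, (forall i, i \in s -> V i) /\ pgen [set` s] x.
Proof.
elim=> [a|i Vi|{}x y _ [s [sV hs]] _ [t [tV ht]]|{}x y _ [s [sV hs]] _ [t [tV ht]]].
- by exists [::]; split=> //; exact: pgen_cst.
- by exists [:: i]; split=> [j|]; [rewrite inE => /eqP ->|apply: pgen_var; rewrite /= mem_head].
- exists (s ++ t); split; first by move=> i; rewrite mem_cat => /orP[/sV|/tV].
  by apply: pgen_add; [apply: pgen_sub hs|apply: pgen_sub ht] => i /= hi; rewrite mem_cat hi ?orbT.
- exists (s ++ t); split; first by move=> i; rewrite mem_cat => /orP[/sV|/tV].
  by apply: pgen_mul; [apply: pgen_sub hs|apply: pgen_sub ht] => i /= hi; rewrite mem_cat hi ?orbT.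
Qed.

Lemma pgen_sum V (J : Type) (r : seq J) (P : pred J) (F : J -> B) :
  (forall j, P j -> pgen V (F j)) -> pgen V (\sum_(j <- r | P j) F j).
Proof.
move=> h; elim/big_ind: _ => [||//]; last exact: pgen_add.
by rewrite -(rmorph0 cst); exact: pgen_cst.
Qed.

Lemma pgen1 V : pgen V 1. Proof. by rewrite -(rmorph1 cst); exact: pgen_cst. Qed.
Lemma pgen0 V : pgen V 0. Proof. by rewrite -(rmorph0 cst); exact: pgen_cst. Qed.
Lemma pgenN V x : pgen V x -> pgen V (- x).
Proof. by move=> h; rewrite -mulN1r -(rmorph1 cst) -rmorphN; apply: pgen_mul => //; exact: pgen_cst. Qed.
Lemma pgenX V x k : pgen V x -> pgen V (x ^+ k).
Proof.
by move=> h; elim: k => [|k IH]; [rewrite expr0; exact: pgen1|rewrite exprS; exact: pgen_mul].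
Qed.

Lemma pgen_morph_eq (T : comNzRingType) (V : set I) (e e' : {rmorphism B -> T}) :
  (forall a, e (cst a) = e' (cst a)) -> (forall i, V i -> e (var i) = e' (var i)) ->
  forall x, pgen V x -> e x = e' x.
Proof.
move=> h1 h2 x; elim=> [a|i|{}x y _ ex _ ey|{}x y _ ex _ ey] //; first exact: h2.
  by rewrite !rmorphD ex ey.
by rewrite !rmorphM ex ey.
Qed.

(** What is used of the polynomial ring over A in variables indexed by I. The last field is freeness
    over A: a function that is linear only modulo P is congruent modulo P to a linear one. *)
Record polynomial_ring : Prop := PolynomialRing {
  pring_gen : forall x, pgen setT x;
  pring_eval : forall (T : comNzRingType) (f : {rmorphism A -> T}) (h : I -> T),
    exists e : {rmorphism B -> T}, (forall a, e (cst a) = f a) /\ forall i, e (var i) = h i;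
  (* Phi x is x seen as a polynomial in the variable i only. *)
  pring_split : forall i : I, exists Phi : {rmorphism B -> {poly B}},
    [/\ forall x, (Phi x).[var i] = x,
      Phi (var i) = 'X,
      forall V x, ~ V i -> pgen V x -> Phi x = x%:P &
      forall V x, pgen (V `|` [set i]) x -> forall k, pgen V (Phi x)`_k];
  pring_functional : forall P : A -> Prop, forall f : B -> A, exists chi : B -> A,
    (forall a x y, chi (cst a * x + y) = a * chi x + chi y) /\
    ((forall a b, P a -> P b -> P (a - b)) -> (forall a b, P b -> P (a * b)) ->
     (forall a x y, P (f (cst a * x + y) - (a * f x + f y))) -> forall x, P (chi x - f x)) }.

End PolynomialGenerators.

Section PolynomialRing.
Variables (I : choiceType) (A : comNzRingType).

Definition mpol : comNzRingType := malg (cmonom I) A.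
Definition pcst : {rmorphism A -> mpol} := @mkmalgU (cmonom I) A mone.
Definition pvar (i : I) : mpol := mkmalgU (ucm i) 1.

Lemma pmonomM (m1 m2 : cmonom I) :
  (mkmalgU m1 1 : mpol) * mkmalgU m2 1 = mkmalgU (mulcm m1 m2) 1.
Proof. by rewrite [LHS]malgM_def fgmulUU mulr1. Qed.

Lemma pgen_monom (mo : cmonom I) : pgen pcst pvar setT (mkmalgU mo 1 : mpol).
Proof.
elim: {mo}_.+1 {-2}mo (ltnSn (mdeg mo)) => // k IH mo hk.
have [->|/eqP m1] := eqVneq mo (onecm I); first exact: pgen_cst.
have [i hi] : exists i, mo i != 0%N.
  apply: contrapT => /forallNP h; apply: m1; apply/eqP/cmP => i; rewrite onecmE.
  by have /negP/negPn/eqP := h i.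
have em : mo = mulcm (ucm i) (divcm mo (ucm i)).
  apply/eqP/cmP => j; rewrite mulcmE divcmE ucmE subnKC //.
  by case: eqP => // <-; rewrite lt0n.
rewrite em -pmonomM; apply: pgen_mul; first exact: pgen_var.
by apply: IH; move: hk; rewrite {1}em mdegM mdegU add1n ltnS.
Qed.

Lemma mpol_monom (x : mpol) : x = \sum_(mo <- msupp x) pcst (mcoeff mo x) * mkmalgU mo 1.
Proof.
rewrite {1}(monalgE x); apply: eq_bigr => mo _.
by rewrite malgZU; exact/esym/mul_malgC.
Qed.

Lemma pgen_all x : pgen pcst pvar setT x.
Proof.
rewrite (mpol_monom x); apply: pgen_sum => mo _.
by apply: pgen_mul; [exact: pgen_cst|exact: pgen_monom].
Qed.

Lemma peval_ex (T : comNzRingType) (f : {rmorphism A -> T}) (h : I -> T) :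
  exists e : {rmorphism mpol -> T}, (forall a, e (pcst a) = f a) /\ forall i, e (pvar i) = h i.
Proof.
pose H (mo : cmonom I) : T := \prod_(i <- finsupp mo) h i ^+ mo i.
have HE (s : seq I) (mo : cmonom I) : uniq s -> (forall i, mo i != 0%N -> i \in s) ->
    H mo = \prod_(i <- s) h i ^+ mo i.
  move=> us hs; rewrite [RHS](bigID (fun i => mo i != 0%N)) /= [X in _ * X]big1 ?mulr1; last first.
    by move=> i /negPn/eqP ->; rewrite expr0.
  rewrite -[RHS]big_filter; apply: perm_big; apply: uniq_perm; rewrite ?filter_uniq ?fset_uniq //.
  move=> k; rewrite mem_filter -cmE_neq0.
  by have [h0|] := boolP (mo k != 0%N) => //=; rewrite hs.
have Hm : mmorphism H.
  split=> [m1 m2|]; last by rewrite (HE [::]) ?big_nil // => i; rewrite cm1.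
  pose s := undup (finsupp m1 ++ finsupp m2).
  have us : uniq s by exact: undup_uniq.
  have s1 i : m1 i != 0%N -> i \in s by move=> hi; rewrite mem_undup mem_cat -cmE_neq0 hi.
  have s2 i : m2 i != 0%N -> i \in s by move=> hi; rewrite mem_undup mem_cat orbC -cmE_neq0 hi.
  rewrite !(HE s) //; last first.
    by move=> i; rewrite cmM addn_eq0 negb_and => /orP[/s1|/s2].
  by rewrite -big_split; apply: eq_bigr => i _; rewrite cmM exprD.
pose Hr : MMorphism.type (cmonom I) T := HB.pack H (isMultiplicative.Build (cmonom I) T H Hm).
pose e : {rmorphism mpol -> T} := mmap f Hr.
exists e; split=> [a|i]; first exact: mmapC.
rewrite [LHS]mmapU -[LHS]/(f 1 * H (ucm i)) rmorph1 mul1r (HE [:: i]) //.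
  by rewrite big_seq1 cmUU expr1.
by move=> j; rewrite cmU inE [j == i]eq_sym; case: (i == j).
Qed.

Lemma psplit_ex (i : I) : exists (Phi : {rmorphism mpol -> {poly mpol}}),
  [/\ forall x, (Phi x).[pvar i] = x,
      Phi (pvar i) = 'X,
      forall V x, ~ V i -> pgen pcst pvar V x -> Phi x = x%:P &
      forall V x, pgen pcst pvar (V `|` [set i]) x -> forall k, pgen pcst pvar V (Phi x)`_k].
Proof.
have [Phi [h1 h2]] := peval_ex (polyC \o pcst)
  (fun j => if j == i then 'X else (pvar j)%:P : {poly mpol}).
exists Phi; split.
- move=> x; have := pgen_all x.
  have -> : (Phi x).[pvar i] = (horner_eval (pvar i) \o Phi : {rmorphism _ -> _}) x by [].
  apply: (@pgen_morph_eq I A mpol pcst pvar mpol setT _ idfun).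
    by move=> a; rewrite /= h1 /horner_eval hornerC.
  move=> j _; rewrite /= h2 /horner_eval; case: eqP => [->|_]; last by rewrite hornerC.
  by rewrite hornerX.
- by rewrite h2 eqxx.
- move=> V x nV; apply: (@pgen_morph_eq I A mpol pcst pvar {poly mpol} V Phi polyC); first exact: h1.
  by move=> j Vj; rewrite h2; case: eqP => // ej; rewrite ej in Vj.
move=> V x; elim=> [a|j hj|{}x y _ hx _ hy|{}x y _ hx _ hy] k.
- by rewrite h1 coefC; case: eqP => _; [exact: pgen_cst|exact: pgen0].
- rewrite h2; case: eqP hj => [_ _|nj [Vj|//]].
    by rewrite coefX; case: eqP => _; [exact: pgen1|exact: pgen0].
  by rewrite coefC; case: eqP => _; [exact: pgen_var|exact: pgen0].
- by rewrite rmorphD coefD; apply: pgen_add.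
- by rewrite rmorphM coefM; apply: pgen_sum => t _; apply: pgen_mul.
Qed.

Lemma pfunctional_ex (P : A -> Prop) (f : mpol -> A) : exists chi : mpol -> A,
    (forall a x y, chi (pcst a * x + y) = a * chi x + chi y) /\
    ((forall a b, P a -> P b -> P (a - b)) -> (forall a b, P b -> P (a * b)) ->
     (forall a x y, P (f (pcst a * x + y) - (a * f x + f y))) -> forall x, P (chi x - f x)).
Proof.
pose chi : {linear (malg (cmonom I) A) -> A^o} :=
  free_lift (fun mo : cmonom I => f (mkmalgU mo 1) : A^o).
have cl a x y : chi (pcst a * x + y) = a * chi x + chi y.
  rewrite -[RHS]/(a *: chi x + chi y) -linearP; congr (chi (_ + _)).
  exact: mul_malgC.
exists chi; split; first exact: cl.
move=> hB hM hf x.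
have P0 a : P a -> P 0 by move=> h; rewrite -(subrr a); exact: hB.
have PN b : P b -> P (- b) by move=> h; rewrite -sub0r; exact: (hB _ _ (P0 b h) h).
have c0 : chi 0 = 0 by exact: linear0.
have f0 : P (chi 0 - f 0).
  have := PN _ (hf 1 0 0); rewrite mulr0 addr0 mul1r opprB addrK => h.
  rewrite c0 sub0r; exact: PN.
have step a mo y : P (chi y - f y) ->
    P (chi (pcst a * (mkmalgU mo 1 : mpol) + y) - f (pcst a * (mkmalgU mo 1 : mpol) + y)).
  move=> hy; rewrite cl /chi free_liftE.
  set u := f (_ * _ + y).
  have -> : a * f (mkmalgU mo 1) + chi y - u = (chi y - f y) - (u - (a * f (mkmalgU mo 1) + f y)) by ring.
  by apply: hB => //; exact: hf.
rewrite (mpol_monom x); elim: (enum_fset (msupp x) : seq _) => [|mo s IH]; first by rewrite big_nil.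
by rewrite big_cons; exact: step.
Qed.

Lemma mpol_polynomial_ring : polynomial_ring pcst pvar.
Proof.
split; [exact: pgen_all|exact: peval_ex|exact: psplit_ex|exact: pfunctional_ex].
Qed.

End PolynomialRing.

Lemma polynomial_ring_ex (I : choiceType) (A : comNzRingType) :
  exists (B : comNzRingType) (cst : {rmorphism A -> B}) (var : I -> B), polynomial_ring cst var.
Proof. by exists (mpol I A), (pcst I A), (pvar A); exact: mpol_polynomial_ring. Qed.

(** A polynomial that stays regular after every change of base ring. The two sources are monic
    polynomials and polynomials with invertible constant coefficient. *)
Definition cancellable (B : comNzRingType) (p : {poly B}) : Prop :=
  forall (T : comNzRingType) (pi : {rmorphism B -> T}) (Q : {poly T}),
    map_poly pi p * Q = 0 -> Q = 0.

Lemma cancellable_monic (B : comNzRingType) (p : {poly B}) : p \is monic -> cancellable p.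
Proof.
move=> mp T pi Q h; have mp' : map_poly pi p \is monic by exact: monic_map.
by apply: (monic_lreg mp'); rewrite h mulr0.
Qed.

Lemma cancellable_unit (B : comNzRingType) (p : {poly B}) w : p`_0 * w = 1 -> cancellable p.
Proof.
move=> hw T pi Q h; apply/polyP => k; rewrite coef0.
elim/ltn_ind: k => k IH; have := congr1 (fun r : {poly T} => r`_k) h.
rewrite coef0 coefM big_ord_recl subn0 big1 ?addr0 => [e|i _]; last first.
  by rewrite IH ?mulr0 // lift0 ltn_subrL /= (leq_ltn_trans (leq0n i) (ltn_ord i)).
by rewrite -[LHS]mul1r -(rmorph1 pi) -hw rmorphM mulrAC mulrC -coef_map e mulr0.
Qed.

Lemma cancel_ideal (B : comNzRingType) (p Q : {poly B}) (J : set B) : ideal J -> cancellable p ->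
  (forall k, J (p * Q)`_k) -> forall k, J Q`_k.
Proof.
move=> iJ cp h k; have [J1|n1] := pselect (J 1); first exact: (idl1 iJ J1).
have [T [pi [_ piJ]]] := ring_quot_ex iJ n1.
have {}piJ x : pi x = 0 <-> J x by rewrite -piJ.
have e0 : map_poly pi Q = 0.
  apply: (cp T pi); rewrite -rmorphM; apply/polyP => i.
  by rewrite coef0 coef_map /=; apply/piJ.
by apply/piJ; rewrite -coef_map e0 coef0.
Qed.

(** * Triangular systems of relations *)

Section Regularity.
Variables (I : choiceType) (A B : comNzRingType) (cst : {rmorphism A -> B}) (var : I -> B).
Hypothesis pr : polynomial_ring cst var.
Local Notation pgen := (pgen cst var).
Variables (lt : I -> I -> Prop) (W : set I) (p : I -> {poly B}) (g : I -> B) (q : set A).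
Hypotheses (lt_irr : forall i, ~ lt i i) (lt_trans : forall i j k, lt i j -> lt j k -> lt i k)
  (pc : forall i, W i -> cancellable (p i))
  (pV : forall i, W i -> forall k, pgen [set j | lt j i] (p i)`_k)
  (iq : ideal q).

Let P i : B := (p i).[var i].

Definition qB k : set B := ideal_gen [set cst u | u in ideal_pow q k].
Hypothesis gq : forall i, W i -> qB 1 (g i).
Definition zrel i : B := P i - g i.

Lemma ideal_qB k : ideal (qB k). Proof. exact: ideal_ideal_gen. Qed.

Lemma qB0 x : qB 0 x.
Proof. by apply: (idl1 (ideal_qB 0)); apply: idl_gen_in; exists 1; rewrite ?rmorph1. Qed.

Lemma qBM a b x y : qB a x -> qB b y -> qB (a + b) (x * y).
Proof.
move=> hx hy; move: x hx; apply: (@ideal_gen_sub _ _ [set x | qB (a + b) (x * y)]).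
  have i1 := ideal_qB (a + b); split; first by rewrite /= mul0r; exact: (idl0 i1).
  move=> c u v /= hu hv; rewrite -[c *: u]/(c * u) mulrDl -mulrA.
  by apply: (idlD i1) => //; exact: (idlM _ i1).
move=> _ [u hu <-]; move: y hy; apply: (@ideal_gen_sub _ _ [set y | qB (a + b) (cst u * y)]).
  have i1 := ideal_qB (a + b); split; first by rewrite /= mulr0; exact: (idl0 i1).
  move=> c x y /= hx hy; rewrite -[c *: x]/(c * x) mulrDr mulrCA.
  by apply: (idlD i1) => //; exact: (idlM _ i1).
move=> _ [v hv <-] /=; rewrite -rmorphM; apply: idl_gen_in; exists (u * v) => //.
exact: ideal_powM.
Qed.

Lemma qB_mono a b : (a <= b)%N -> qB b `<=` qB a.
Proof.
move=> ab; apply: ideal_gen_sub; first exact: ideal_qB.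
by move=> _ [u hu <-]; apply: idl_gen_in; exists u => //; exact: ideal_pow_mono hu.
Qed.

Lemma P_pgen j : W j -> pgen ([set k | lt k j] `|` [set j]) (P j).
Proof.
move=> Wj; rewrite /P -[p j]coefK horner_poly; apply: pgen_sum => k _.
apply: pgen_mul; first by apply: pgen_sub (pV Wj k) => t; left.
by apply: pgenX; apply: pgen_var; right.
Qed.

(** Seen as a polynomial in the variable i alone, [P i] becomes [p i] while the elements of G are
    constants, so [p i] cancels modulo G coefficient by coefficient. *)
Lemma cancel_relation (G : set B) i b : W i ->
  (forall x, G x -> exists2 V : set I, ~ V i & pgen V x) ->
  ideal_gen G (b * P i) -> ideal_gen G b.
Proof.
move=> Wi hG; have iG := ideal_ideal_gen G.
have [Phi [h1 h2 h3 h4]] := pring_split pr i.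
have PhiG x : ideal_gen G x -> forall k, ideal_gen G (Phi x)`_k.
  move: x; apply: ideal_gen_sub.
    split; first by move=> k; rewrite rmorph0 coef0; exact: (idl0 iG).
    move=> c u v hu hv k; rewrite -[c *: u]/(c * u) rmorphD rmorphM coefD coefM.
    apply: (idlD iG) => //; apply: (@idl_sum _ _ _ _ _ _ iG) => t _; exact: (idlM _ iG).
  move=> x Gx k; have [V nV hV] := hG x Gx; rewrite (h3 V) // coefC.
  by case: eqP => _; [exact: idl_gen_in|exact: (idl0 iG)].
have PhiP : Phi (P i) = p i.
  rewrite /P -{1}[p i]coefK horner_poly rmorph_sum /= -[RHS]coefK poly_def.
  apply: eq_bigr => k _; rewrite rmorphM rmorphXn /= h2 (h3 [set j | lt j i]) //.
  - by rewrite mul_polyC.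
  - exact: lt_irr.
  - exact: (pV Wi k).
move=> /PhiG; rewrite rmorphM PhiP mulrC => h.
have hb := cancel_ideal iG (pc Wi) h.
rewrite -(h1 b) -[Phi b]coefK horner_poly.
by apply: (@idl_sum _ _ _ _ _ _ iG) => t _; exact: (idlMr _ iG).
Qed.

Lemma max_mem (s : seq I) i0 : i0 \in s -> exists2 i, i \in s & forall j, j \in s -> ~ lt i j.
Proof.
elim: s i0 => // x s IH i0 _; case: s IH => [_|y s IH].
  by exists x; rewrite ?mem_head // => j; rewrite inE => /eqP ->.
have [i si hi] := IH y (mem_head _ _).
have [ix|nix] := pselect (lt i x); last first.
  exists i; first by rewrite inE si orbT.
  by move=> j; rewrite inE => /orP[/eqP ->|/hi].
exists x; first exact: mem_head.
move=> j; rewrite inE => /orP[/eqP ->|js]; first exact: lt_irr.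
move=> xj; apply: (hi j js); exact: lt_trans xj.
Qed.

(** Let i be maximal in s. Modulo q^(a+1) B and the q^a P_j for the other j, none of which involves
    the variable i, the product c_i P_i is 0; hence c_i is a sum of kap_j z_j plus eps in q^(a+1) B.
    The terms kap_j z_j z_i join the coefficients of the z_j, and the list has become shorter. *)
Lemma kosz_step a (s : seq I) (c : I -> B) : uniq s -> (forall i, i \in s -> W i) ->
  (forall i, i \in s -> qB a (c i)) -> qB a.+1 (\sum_(i <- s) c i * zrel i) ->
  exists c', (forall i, i \in s -> qB a.+1 (c' i)) /\
    \sum_(i <- s) c' i * zrel i = \sum_(i <- s) c i * zrel i.
Proof.
elim: {s}_.+1 {-2}s c (ltnSn (size s)) => // t IH s c; rewrite ltnS => st us sW sc hs.
case: s => [|i0 s0] in st us sW sc hs *; first by exists c.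
set s := i0 :: s0 in st us sW sc hs *.
have [i si mi] := max_mem (mem_head i0 s0 : i0 \in s).
have ps : perm_eq s (i :: rem i s) by exact: perm_to_rem.
pose s' := rem i s.
have us' : uniq s' by exact: rem_uniq.
have s'E j : (j \in s') = (j != i) && (j \in s) by rewrite mem_rem_uniq // inE.
have s's j : j \in s' -> j \in s by rewrite s'E => /andP[].
rewrite (perm_big _ ps) big_cons -/s' in hs.
have iA := ideal_qB a; have iA1 := ideal_qB a.+1.
pose G : set B := [set x | exists u j, [/\ ideal_pow q a u, j \in s' & x = cst u * P j]] `|`
  [set cst u | u in ideal_pow q a.+1].
have iG := ideal_ideal_gen G.
have qBG : qB a.+1 `<=` ideal_gen G.
  by apply: ideal_gen_sub => // x hx; apply: idl_gen_in; right.
have PG x j : j \in s' -> qB a x -> ideal_gen G (x * P j).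
  move=> js; move: x; apply: (@ideal_gen_sub _ _ [set x | ideal_gen G (x * P j)]).
    split; first by rewrite /= mul0r; exact: (idl0 iG).
    move=> b u v /= hu hv; rewrite -[b *: u]/(b * u) mulrDl -mulrA.
    by apply: (idlD iG) => //; exact: (idlM _ iG).
  by move=> _ [u hu <-]; apply: idl_gen_in; left; exists u, j.
have gG x j : W j -> qB a x -> qB a.+1 (x * g j).
  by move=> Wj hx; rewrite -addn1; apply: qBM => //; exact: gq.
have ciG : ideal_gen G (c i).
  apply: (@cancel_relation G i); first exact: sW.
    move=> x [[u [j [hu js ->]]]|[u hu <-]]; last by exists set0 => //; exact: pgen_cst.
    exists ([set k | lt k j] `|` [set j]).
      move: js; rewrite s'E => /andP[/eqP ji js] [/mi|ij]; first exact.
      by apply: ji; rewrite ij.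
    by apply: pgen_mul; [exact: pgen_cst|apply: P_pgen; apply: sW; exact: s's].
  have -> : c i * P i = (c i * zrel i + \sum_(j <- s') c j * zrel j) + c i * g i -
      \sum_(j <- s') c j * zrel j by rewrite /zrel; ring.
  apply: (idlB iG); first by apply: (idlD iG); apply: qBG => //; apply: gG; [exact: sW|exact: sc].
  rewrite big_seq; apply: (@idl_sum _ _ _ _ _ _ iG) => j js; rewrite /zrel mulrBr.
  by apply: (idlB iG); [apply: PG => //; apply: sc; exact: s's|
    apply: qBG; apply: gG; [apply: sW|apply: sc]; exact: s's].
have [kap [hk hk']] : exists kap : I -> B, (forall j, qB a (kap j)) /\
    qB a.+1 (c i - \sum_(j <- s') kap j * zrel j).
  move: (c i) ciG; apply: (@ideal_gen_sub _ _ [set x | exists kap : I -> B, (forall j, qB a (kap j)) /\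
    qB a.+1 (x - \sum_(j <- s') kap j * zrel j)]).
    split.
      exists (fun=> 0); split; first by move=> j; exact: (idl0 iA).
      by rewrite big1 ?subr0; [exact: (idl0 iA1)|move=> j _; rewrite mul0r].
    move=> b x y [k1 [h1 h1']] [k2 [h2 h2']]; exists (fun j => b * k1 j + k2 j); split.
      by move=> j; apply: (idlD iA) => //; exact: (idlM _ iA).
    rewrite (eq_bigr (fun j => b * (k1 j * zrel j) + k2 j * zrel j)); last by move=> j _; ring.
    rewrite big_split -mulr_sumr /= -[b *: x]/(b * x).
    set e1 := \sum_(j <- s') k1 j * _; set e2 := \sum_(j <- s') k2 j * _.
    have -> : b * x + y - (b * e1 + e2) = b * (x - e1) + (y - e2) by ring.
    by apply: (idlD iA1) => //; exact: (idlM _ iA1).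
  move=> x [[u [j [hu js ->]]]|hx]; last first.
    exists (fun=> 0); split; first by move=> j; exact: (idl0 iA).
    rewrite big1 ?subr0; last by move=> j _; rewrite mul0r.
    exact: idl_gen_in.
  have qu : qB a (cst u) by apply: idl_gen_in; exists u.
  exists (fun k => if k == j then cst u else 0); split.
    by move=> k; case: ifP => _ //; exact: (idl0 iA).
  rewrite (bigD1_seq j) //= eqxx big1 => [|k /negbTE ->]; last by rewrite mul0r.
  rewrite addr0 -mulrBr /zrel (_ : P j - (P j - g j) = g j); last by ring.
  by apply: gG => //; apply: sW; exact: s's.
set eps := c i - _ in hk'.
have [|||||c' [hc' hc'e]] := IH s' (fun j => c j + kap j * zrel i).
- by rewrite size_rem //; move: st; rewrite /s /=.
- exact: us'.
- by move=> j /s's; exact: sW.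
- by move=> j /s's/sc h; apply: (idlD iA) => //; exact: (idlMr _ iA).
- have -> : \sum_(j <- s') (c j + kap j * zrel i) * zrel j =
    (c i * zrel i + \sum_(j <- s') c j * zrel j) - eps * zrel i.
    rewrite (eq_bigr (fun j => c j * zrel j + (kap j * zrel j) * zrel i)); last by move=> j _; ring.
    by rewrite big_split -mulr_suml /= /eps; ring.
  by apply: (idlB iA1) => //; exact: (idlMr _ iA1).
exists (fun j => if j == i then eps else c' j); split.
  by move=> j js; case: eqP => [_ //|/eqP ji]; apply: hc'; rewrite s'E ji.
rewrite !(perm_big _ ps) !big_cons -/s' eqxx big_seq (eq_bigr (fun j => c' j * zrel j)); last first.
  by move=> j; rewrite s'E => /andP[/negbTE ->].
rewrite -big_seq hc'e (eq_bigr (fun j => c j * zrel j + (kap j * zrel j) * zrel i)); last by move=> j _; ring.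
by rewrite big_split -mulr_suml /= /eps; ring.
Qed.

Definition Zgen : set B := ideal_gen [set zrel i | i in W].
Definition qJ k : set B := idl_add Zgen (qB k).

Lemma ideal_qJ k : ideal (qJ k).
Proof. by apply: ideal_add; exact: ideal_ideal_gen. Qed.

Lemma Zgen_seq x : Zgen x -> exists (s : seq I) (c : I -> B), [/\ uniq s, forall i, i \in s -> W i,
  forall i, i \notin s -> c i = 0 & x = \sum_(i <- s) c i * zrel i].
Proof.
have ext (s t : seq I) (c : I -> B) : uniq s -> uniq t -> (forall i, i \notin s -> c i = 0) ->
    (forall i, i \in s -> i \in t) -> \sum_(i <- s) c i * zrel i = \sum_(i <- t) c i * zrel i.
  move=> us ut hc st; rewrite [RHS](bigID (mem s)) /= [X in _ + X]big1 ?addr0; last first.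
    by move=> i /hc ->; rewrite mul0r.
  rewrite -[RHS]big_filter; apply: perm_big; apply: uniq_perm; rewrite ?filter_uniq // => i.
  by rewrite mem_filter /=; case: (boolP (i \in s)) => // /st ->.
move: x; apply: ideal_gen_sub.
  split; first by exists [::], (fun=> 0); split=> //; rewrite big_nil.
  move=> a _ _ [s [c [us sW sc ->]]] [s2 [c2 [us2 sW2 sc2 ->]]].
  pose t := undup (s ++ s2).
  exists t, (fun i => a * c i + c2 i); split.
  - exact: undup_uniq.
  - by move=> i; rewrite mem_undup mem_cat => /orP[/sW|/sW2].
  - move=> i; rewrite mem_undup mem_cat negb_or => /andP[/sc -> /sc2 ->].
    by rewrite mulr0 addr0.
  rewrite (ext s t c) ?undup_uniq // ?(ext s2 t c2) ?undup_uniq //; last 2 first.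
  - by move=> i hi; rewrite mem_undup mem_cat hi orbT.
  - by move=> i hi; rewrite mem_undup mem_cat hi.
  rewrite -[a *: _]/(a * _) mulr_sumr -big_split; apply: eq_bigr => i _ /=; ring.
move=> _ [i Wi <-]; exists [:: i], (fun j => (j == i)%:R); split=> //.
- by move=> j; rewrite inE => /eqP ->.
- by move=> j; rewrite inE => /negbTE ->.
- by rewrite big_seq1 eqxx mul1r.
Qed.

(* The relations zrel i behave like a regular sequence on the graded pieces.  *)
Lemma qB_cap_qJ k x : qB k x -> qJ k.+1 x ->
  ideal_gen [set cst u * y | u in ideal_pow q k & y in qJ 1] x.
Proof.
move=> qx [y /Zgen_seq[s [c [us sW _ ->]]] [e he ex]].
have {}qx a : (a <= k)%N -> qB a (\sum_(i <- s) c i * zrel i).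
  move=> ak; have -> : \sum_(i <- s) c i * zrel i = x - e by rewrite -ex addrK.
  by apply: (idlB (ideal_qB a)); [apply: qB_mono qx|apply: qB_mono he; exact: leqW].
have [c' [hc' ec']] : exists c', (forall i, i \in s -> qB k (c' i)) /\
    \sum_(i <- s) c' i * zrel i = \sum_(i <- s) c i * zrel i.
  elim: k qx {he ex} => [|k IH] qx; first by exists c; split=> // i _; exact: qB0.
  have [|c1 [h1 e1]] := IH; first by move=> a ak; apply: qx; exact: leqW.
  have [|c2 [h2 e2]] := @kosz_step k s c1 us sW h1; first by rewrite e1; exact: qx.
  by exists c2; rewrite e2.
set T := ideal_gen _; have iT : ideal T by exact: ideal_ideal_gen.
rewrite -ex -ec'; apply: (idlD iT).
  rewrite big_seq; apply: (@idl_sum _ _ _ _ _ _ iT) => i si.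
  have hz : qJ 1 (zrel i).
    by apply: (idl_addl (ideal_qB 1)); apply: idl_gen_in; exists i => //; exact: sW.
  move: (c' i) (hc' i si); apply: (@ideal_gen_sub _ _ [set b | T (b * zrel i)]).
    split; first by rewrite /= mul0r; exact: (idl0 iT).
    move=> b u v /= hu hv; rewrite -[b *: u]/(b * u) mulrDl -mulrA.
    by apply: (idlD iT) => //; exact: (idlM _ iT).
  by move=> _ [u hu <-]; apply: idl_gen_in; exists u => //; exists (zrel i).
move: e he {ex}; apply: (@ideal_gen_sub _ _ T) => // _ [u hu <-].
move: u hu; apply: (@ideal_powS_sub _ _ _ [set u | T (cst u)]).
  split; first by rewrite /= rmorph0; exact: (idl0 iT).
  move=> b u v /= hu hv; rewrite rmorphD rmorphM; apply: (idlD iT) => //; exact: (idlM _ iT).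
move=> u v hu hv; rewrite /= mulrC rmorphM; apply: idl_gen_in; exists v => //; exists (cst u) => //.
apply: (idl_addr (ideal_ideal_gen _)); apply: idl_gen_in; exists u => //.
exact/(ideal_pow1 _ iq).
Qed.

End Regularity.

Section FiniteRank.
Variable K : comNzRingType.
Hypothesis fK : forall x : K, x != 0 -> exists y, x * y = 1.

Lemma field_functional (V : lmodType K) (v : V) : v != 0 -> exists psi : {linear V -> K^o}, psi v = 1.
Proof.
move=> v0.
have iK : injective_module K^o.
  apply: baer_injective => a phi ia hphi.
  have [[x [ax x0]]|h] := pselect (exists x, a x /\ x != 0); last first.
    exists 0 => x ax; have -> : x = 0 by apply: contrapT => /eqP xn; apply: h; exists x.
    rewrite scaler0; have := hphi 1 0 0 (idl0 ia) (idl0 ia); rewrite mulr0 addr0 scale1r.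
    by move=> /eqP; rewrite -subr_eq0 opprD addNKr oppr_eq0 => /eqP.
  have [y hy] := fK x0; have a1 : a 1 by rewrite -hy; exact: (idlMr _ ia).
  exists (phi 1) => z az; have := hphi z 1 0 a1 (idl0 ia).
  have := hphi 1 0 0 (idl0 ia) (idl0 ia); rewrite !mulr0 !addr0 scale1r mulr1.
  by move=> /eqP; rewrite -subr_eq0 opprD addNKr oppr_eq0 => /eqP ->; rewrite addr0.
have inj1 : injective (lin_at v).
  apply: inj_lin => x; rewrite -[lin_at v x]/(x *: v) => e; apply: contrapT => /eqP x0.
  have [y hy] := fK x0; move/eqP: v0; apply.
  by rewrite -[v]scale1r -hy mulrC -scalerA e scaler0.
have [w hw] := iK _ _ (lin_at v) (lin_id K^o) inj1.
by exists w; rewrite -[v]scale1r -[1 *: v]/(lin_at v 1) hw.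
Qed.

Lemma finite_rank (V : lmodType K) (s : seq V) : exists (E : seq (V * {linear V -> K^o})),
  forall x, x \in s -> x = \sum_(e <- E) (e.2 x : K) *: e.1.
Proof.
elim: s => [|x s [E hE]]; first by exists [::].
pose pr (y : V) := \sum_(e <- E) (e.2 y : K) *: e.1.
have prl a y z : pr (a *: y + z) = a *: pr y + pr z.
  rewrite /pr scaler_sumr -big_split; apply: eq_bigr => e _ /=.
  by rewrite linearP scalerDl scalerA.
have [e0|n0] := eqVneq (x - pr x) 0.
  exists E => y; rewrite inE => /orP[/eqP ->|/hE//].
  by move/eqP: e0; rewrite subr_eq0 => /eqP.
have [psi hpsi] := field_functional n0.
pose q1 : {linear V -> K^o} := lin_comp psi (lin_sub (lin_id V) (linof prl)).
exists ((x - pr x, q1) :: E) => y ys; rewrite big_cons.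
suff : y = (psi (y - pr y) : K) *: (x - pr x) + pr y by exact.
move: ys; rewrite inE => /orP[/eqP ->|ys]; first by rewrite hpsi scale1r subrK.
rewrite [y - pr y](_ : _ = 0) ?linear0 ?scale0r ?add0r; first exact: hE.
by rewrite /pr -hE // subrr.
Qed.

End FiniteRank.

(** * Flatness modulo the powers of q *)

Section Level.
Variables (I : choiceType) (A B : comNzRingType) (cst : {rmorphism A -> B}) (var : I -> B).
Hypothesis pr : polynomial_ring cst var.
Local Notation pgen := (pgen cst var).
Variables (lt : I -> I -> Prop) (W : set I) (p : I -> {poly B}) (g : I -> B) (q : set A).
Hypotheses (lt_irr : forall i, ~ lt i i) (lt_trans : forall i j k, lt i j -> lt j k -> lt i k)
  (pc : forall i, W i -> cancellable (p i))
  (pV : forall i, W i -> forall k, pgen [set j | lt j i] (p i)`_k)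
  (iq : ideal q) (gq : forall i, W i -> qB cst q 1 (g i)).
Hypotheses (q1 : ~ q 1) (fq : forall u, ~ q u -> exists v, q (u * v - 1)).
Local Notation J := (qJ cst var W p g q).
Local Notation Z := (Zgen var W p g).
Variables (l : comNzRingType) (ev : {rmorphism B -> l}).
Hypotheses (evJ : forall x, ev x = 0 <-> J 1 x) (evS : forall y, exists x, ev x = y).

(** Functionals on l as a vector space over A/q lift to A-linear maps B -> A by freeness of B; a
    finite dual system serves for the list s. *)
Lemma level_functional (s : seq B) : exists E : seq (B * (B -> A)),
  (forall e, e \in map snd E -> (forall a x y, e (cst a * x + y) = a * e x + e y) /\
                 forall x, J 1 x -> q (e x)) /\
  forall x, x \in s -> J 1 (x - \sum_(e <- E) cst (e.2 x) * e.1).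
Proof.
have [K [pk [pks pkq]]] := ring_quot_ex iq q1.
have {}pkq u : pk u = 0 <-> q u by rewrite -pkq.
have fK (x : K) : x != 0 -> exists y, x * y = 1.
  have [u <-] := pks x => u0; have [|v hv] := fq (u := u).
    by move=> /pkq e; rewrite e eqxx in u0.
  exists (pk v); apply/eqP; rewrite -subr_eq0 -rmorphM -(rmorph1 pk) -rmorphB.
  by apply/eqP/pkq.
have [|phi hphi] := ring_fact (g := ev \o cst) pks.
  move=> u /pkq qu; apply/evJ; apply: (idl_addr (ideal_ideal_gen _)); apply: idl_gen_in.
  by exists u => //; exact/(ideal_pow1 _ iq).
pose V : lmodType K := restrict phi l^o.
have [E hE] := finite_rank fK (map ev s : seq V).
have ex (e : V * {linear V -> K^o}) : exists b : B * (B -> A),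
  [/\ ev b.1 = e.1, forall a x y, b.2 (cst a * x + y) = a * b.2 x + b.2 y &
   forall x, pk (b.2 x) = e.2 (ev x)].
  have [b eb] := evS e.1; have [f hf] := choice (fun x : B => pks (e.2 (ev x))).
  have [chi [chl chq]] := pring_functional pr q f.
  exists (b, chi); split=> // x; apply/eqP; rewrite -subr_eq0 -hf -rmorphB; apply/eqP/pkq.
  apply: chq; [by move=> *; exact: (idlB iq)|by move=> *; exact: (idlM _ iq)|].
  move=> a y z; apply/pkq; rewrite rmorphB rmorphD rmorphM !hf rmorphD rmorphM.
  rewrite -[ev (cst a)]hphi -[phi (pk a) * ev y]/(pk a *: (ev y : V)) linearP.
  by rewrite subrr.
have [F hF] := choice ex.
exists (map F E); split.
  elim: (E) => [//|e0 E' IHE] e; rewrite [map _ _]/= inE => /orP[/eqP ->|]; last exact: IHE.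
  have [_ h2 h3] := hF e0; split=> // x /evJ e1.
  by apply/pkq; rewrite h3 e1 linear0.
move=> x xs; apply/evJ; rewrite rmorphB rmorph_sum big_map.
rewrite {1}(hE (ev x)); last exact: map_f.
apply/eqP; rewrite subr_eq0; apply/eqP; apply: eq_bigr => e _; have [h1 _ h3] := hF e.
by rewrite rmorphM h1 -[ev (cst _)]hphi h3.
Qed.

Variables (n : nat) (a : 'I_n -> A).
Definition relB N : set ('I_n -> B^o) := mspan [set ((fun i => cst (rho i)) : 'I_n -> B^o) |
  rho in [set rho : 'I_n -> A | ideal_pow q N (\sum_i a i * rho i)]].

Lemma relB_seq N tau : relB N tau -> exists t : seq (B * ('I_n -> A)),
  (forall e, e \in map snd t -> ideal_pow q N (\sum_i a i * e i)) /\
  forall i, tau i = \sum_(e <- t) cst (e.2 i) * e.1.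
Proof.
move: tau; apply: mspan_sub.
  split; first by exists [::]; split=> // i; rewrite big_nil.
  move=> b u v [t [h1 h2]] [t' [h1' h2']].
  exists (map (fun e => (b * e.1, e.2)) t ++ t'); split.
    move=> e; rewrite map_cat mem_cat => /orP[|/h1'//].
    by rewrite -map_comp => /mapP[e0 e0t ->]; apply: h1; apply: map_f.
  move=> i; rewrite big_cat big_map /= -h2' -[RHS]/(_ + _); congr (_ + _).
  rewrite -[(b *: u) i]/(b * u i) h2 mulr_sumr; apply: eq_bigr => e _ /=.
  by rewrite mulrCA.
move=> _ [rho hr <-]; exists [:: (1, rho)]; split.
  by move=> e; rewrite inE => /eqP ->.
by move=> i; rewrite big_seq1 mulr1.
Qed.

Lemma relB_qB N (rho : 'I_n -> A) x : ideal_pow q N (\sum_i a i * rho i) -> qB cst q 1 x ->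
  relB N.+1 (fun i => cst (rho i) * x).
Proof.
move=> hr; have sR : submodule (relB N.+1) by exact: submodule_mspan.
move: x; apply: (@ideal_gen_sub _ _ [set x | relB N.+1 (fun i => cst (rho i) * x)]).
  split.
    rewrite /= (_ : (fun i => _) = 0); first exact: (sub0m sR).
    by apply/funext => i; rewrite mulr0.
  move=> b u v hu hv; rewrite /= (_ : (fun i => _) =
      b *: ((fun i => cst (rho i) * u) : 'I_n -> B^o) + (fun i => cst (rho i) * v)).
    by case: sR => _; apply.
  apply/funext => i; rewrite -[RHS]/(b * (cst (rho i) * u) + cst (rho i) * v).
  by rewrite -[b *: u]/(b * u) mulrDr mulrCA.
move=> _ [v /(ideal_pow1 _ iq) hv <-]; rewrite /= (_ : (fun i => _) = (fun i => cst (v * rho i))).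
  apply: mspan_in; exists (fun i => v * rho i) => //=.
  rewrite (eq_bigr (fun i => v * (a i * rho i))); last by move=> i _; ring.
  by rewrite -mulr_sumr; exact: ideal_powS_in.
by apply/funext => i; rewrite -rmorphM mulrC.
Qed.

(** Relations of [a] in B modulo Z + q^N B come from relations over A modulo q^N. To pass to N + 1,
    note that X, the value of the relation tau, lies in q^N B and in J (N+1), so in q^N J 1 by
    [qB_cap_qJ]. The functionals of [level_functional] send X into q^(N+1), so applied to the
    coefficients of tau they yield relations modulo q^(N+1). *)
Lemma level_flat N (b : 'I_n -> B) : J N (\sum_i cst (a i) * b i) ->
  exists tau, relB N tau /\ forall i, Z (b i - tau i).
Proof.
have iZ : ideal Z by exact: ideal_ideal_gen.
have iJ k : ideal (J k) := ideal_qJ cst var W p g q k.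
elim: N => [_|N IH hb].
  exists b; split; last by move=> i; rewrite subrr; exact: (idl0 iZ).
  have sR : submodule (relB 0) by exact: submodule_mspan.
  have -> : b = \sum_i b i *: ((fun k => cst (k == i)%:R) : 'I_n -> B^o).
    apply/funext => k; rewrite fct_sumE (bigD1 k) //= big1 => [|i /negbTE ik].
      by rewrite addr0 -[RHS]/(b k * cst (k == k)%:R) eqxx rmorph1 mulr1.
    by rewrite -[LHS]/(b i * cst (k == i)%:R) eq_sym ik rmorph0 mulr0.
  apply: (@subm_sum _ _ _ _ _ _ _ sR) => i _; apply: (submZ _ sR); apply: mspan_in.
  by exists (fun k => (k == i)%:R).
have JS k : J k.+1 `<=` J k.
  move=> _ [z hz [e he <-]]; exists z => //; exists e => //; exact: (qB_mono (leqnSn k) he).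
have [tau [htau hbt]] := IH (JS _ _ hb).
have [t [ht1 ht2]] := relB_seq htau.
pose alpha (e : 'I_n -> A) := \sum_i a i * e i.
pose X := \sum_(e <- t) cst (alpha e.2) * e.1.
have eX : X = \sum_i cst (a i) * tau i.
  rewrite /X (eq_bigr (fun e : B * ('I_n -> A) => \sum_i cst (a i) * (cst (e.2 i) * e.1))).
    rewrite exchange_big; apply: eq_bigr => i _ /=.
    by rewrite ht2 mulr_sumr.
  move=> e _; rewrite /alpha rmorph_sum mulr_suml; apply: eq_bigr => i _.
  by rewrite rmorphM mulrA.
have XJ : J N.+1 X.
  rewrite eX; have -> : \sum_i cst (a i) * tau i =
      \sum_i cst (a i) * b i - \sum_i cst (a i) * (b i - tau i).
    by rewrite -sumrB; apply: eq_bigr => i _; ring.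
  apply: (idlB (iJ _)) => //; apply: (@idl_sum _ _ _ _ _ _ (iJ _)) => i _.
  by apply: (idlM _ (iJ _)); apply: (idl_addl (ideal_qB cst q _)); exact: hbt.
have iqN := ideal_qB cst q N.
have Xq : qB cst q N X.
  rewrite /X big_seq; apply: (@idl_sum _ _ _ _ _ _ iqN) => e et; apply: (idlMr _ iqN).
  by apply: idl_gen_in; exists (alpha e.2) => //; apply: ht1; exact: map_f.
have := qB_cap_qJ pr lt_irr lt_trans pc pV iq gq Xq XJ.
have [E [hE1 hE2]] := level_functional (map fst t).
move=> hX.
have eq0 e : e \in map snd E -> e 0 = 0.
  move=> /hE1[el _]; have := el 1 0 0; rewrite mulr0 addr0 mul1r.
  by move=> /eqP; rewrite -subr_eq0 opprD addNKr oppr_eq0 => /eqP.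
have eqX e : e \in map snd E -> ideal_pow q N.+1 (e X).
  move=> eE; have [el eJ] := hE1 e eE; have iN := ideal_pow_ideal q N.+1.
  suff : forall c, ideal_pow q N.+1 (e (c * X)) by move=> /(_ 1); rewrite mul1r.
  move: X hX {eX XJ Xq} => X; move: X; apply: (@ideal_gen_sub _ _
    [set X | forall c, ideal_pow q N.+1 (e (c * X))]).
    split; first by move=> c; rewrite mulr0 eq0 //; exact: (idl0 iN).
    move=> c u v hu hv c'; rewrite mulrDr -[c *: u]/(c * u) mulrA.
    have -> : e (c' * c * u + c' * v) = e (c' * c * u) + e (c' * v).
      by have := el 1 (c' * c * u) (c' * v); rewrite rmorph1 !mul1r.
    by apply: (idlD iN).
  move=> _ [u hu [y hy <-]] c; rewrite mulrCA.
  have := el u (c * y) 0; rewrite addr0 eq0 // addr0 => ->.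
  by rewrite mulrC; apply: ideal_powS_in => //; apply: eJ; exact: (idlM _ (iJ 1%N)).
pose gam (e : B -> A) (i : 'I_n) : A := \sum_(w <- t) e w.1 * w.2 i.
have eXE e : e \in map snd E -> e X = \sum_(w <- t) e w.1 * alpha w.2.
  move=> eE; have [el _] := hE1 e eE; rewrite /X; elim: (t) => [|w t' IHt].
    by rewrite !big_nil eq0.
  by rewrite !big_cons el IHt [_ * e _]mulrC.
have r_ex (w : B * ('I_n -> A)) : exists k, w \in t ->
    qB cst q 1 k /\ Z (w.1 - \sum_(e <- E) cst (e.2 w.1) * e.1 - k).
  have [wt|nw] := boolP (w \in t); last by exists 0.
  have [z hz [k hk ek]] := hE2 w.1 (map_f _ wt).
  by exists k => _; split=> //; rewrite -ek addrK.
have [kk hkk] := choice r_ex.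
have sR : submodule (relB N.+1) by exact: submodule_mspan.
(* Modulo Z each coefficient of tau is its expansion through E plus [kk w] in qB. The expansions
   regroup into the vectors [gam], and the remainders gain one factor from q. *)
exists (\sum_(e <- E) e.1 *: ((fun i => cst (gam e.2 i)) : 'I_n -> B^o) +
        \sum_(w <- t) ((fun i => cst (w.2 i) * kk w) : 'I_n -> B^o)); split.
  apply: (submD sR).
    rewrite big_seq; apply: (@subm_sum _ _ _ _ _ _ _ sR) => e eE; apply: (submZ _ sR).
    apply: mspan_in; exists (gam e.2) => //=.
    have eE' := map_f snd eE.
    rewrite (_ : \sum_i _ = e.2 X); first exact: eqX.
    rewrite eXE //; rewrite (eq_bigr (fun i => \sum_(w <- t) e.2 w.1 * (a i * w.2 i))).
      by rewrite exchange_big; apply: eq_bigr => w _; rewrite -mulr_sumr.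
    by move=> i _; rewrite /gam mulr_sumr; apply: eq_bigr => w _; rewrite mulrCA.
  rewrite big_seq; apply: (@subm_sum _ _ _ _ _ _ _ sR) => w wt; apply: relB_qB.
    by apply: ht1; exact: map_f.
  by have [] := hkk w wt.
move=> i; rewrite -(subrK (tau i) (b i)) -addrA; apply: (idlD iZ); first exact: hbt.
rewrite -[X in _ - X]/((\sum_(e <- E) e.1 *: ((fun i => cst (gam e.2 i)) : 'I_n -> B^o)) i +
        (\sum_(w <- t) ((fun i => cst (w.2 i) * kk w) : 'I_n -> B^o)) i) !fct_sumE.
have -> : \sum_(e <- E) (e.1 *: ((fun i => cst (gam e.2 i)) : 'I_n -> B^o)) i =
   \sum_(w <- t) cst (w.2 i) * \sum_(e <- E) cst (e.2 w.1) * e.1.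
  rewrite (eq_bigr (fun e : B * (B -> A) => \sum_(w <- t) cst (w.2 i) * (cst (e.2 w.1) * e.1))).
    by rewrite exchange_big; apply: eq_bigr => w _ /=; rewrite -mulr_sumr.
  move=> e _; rewrite -[LHS]/(e.1 * cst (gam e.2 i)) /gam rmorph_sum mulr_sumr.
  by apply: eq_bigr => w _; rewrite rmorphM; ring.
rewrite ht2 -big_split -sumrB big_seq; apply: (@idl_sum _ _ _ _ _ _ iZ) => w wt.
have [_ h] := hkk w wt.
rewrite (_ : _ - _ = cst (w.2 i) * (w.1 - \sum_(e <- E) cst (e.2 w.1) * e.1 - kk w)).
  exact: (idlM _ iZ).
by rewrite /=; ring.
Qed.

End Level.

(** * A well-ordered tower of generators of the residue field *)

Section FieldTower.
Variables (A : comNzRingType) (l : fieldType) (phi : {rmorphism A -> l}) (q : set A).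
Hypothesis phiq : forall u, phi u = 0 <-> q u.
Variable le : rel l.
Hypothesis wo : wochoice.well_order le.

Definition lt1 (a b : l) : Prop := le a b /\ a <> b.

Lemma wo_min (P : set l) : (exists a, P a) -> exists a, P a /\ forall b, P b -> le a b.
Proof.
move=> [a0 h0]; have [|a [[ha mn] _]] := @wo [pred x | `[< P x >]].
  by exists a0; rewrite inE; apply/asboolP.
exists a; split; first by move: ha; rewrite inE => /asboolP.
by move=> b hb; apply: mn; rewrite inE; apply/asboolP.
Qed.

Lemma le_refl a : le a a.
Proof. by have [|b [-> h]] := @wo_min [set a]; [exists a|exact: h]. Qed.

Lemma le_anti a b : le a b -> le b a -> a = b.
Proof.
move=> ab ba; have [|c [_ u]] := @wo [pred x | (x == a) || (x == b)].
  by exists a; rewrite inE eqxx.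
have <- : c = a by apply: u; split=> [|x]; rewrite ?inE ?eqxx // => /orP[/eqP ->|/eqP ->] //; exact: le_refl.
by apply: u; split=> [|x]; rewrite ?inE ?eqxx ?orbT // => /orP[/eqP ->|/eqP ->] //; exact: le_refl.
Qed.

Lemma le_tot a b : le a b \/ le b a.
Proof.
have [|c [[->|->] h]] := @wo_min [set x | x = a \/ x = b]; first by exists a; left.
  by left; apply: h; right.
by right; apply: h; left.
Qed.

Lemma lt1_cmp a b : a = b \/ lt1 a b \/ lt1 b a.
Proof.
have [->|/eqP ab] := eqVneq a b; first by left.
by right; have [h|h] := le_tot a b; [left|right]; split=> //; apply: nesym.
Qed.

Lemma lt1_irr a : ~ lt1 a a. Proof. by case. Qed.

Lemma lt1_le a b : lt1 a b -> ~ le b a.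
Proof. by move=> [h ne] h'; apply: ne; exact: le_anti. Qed.

Lemma lt1_trans a b c : lt1 a b -> lt1 b c -> lt1 a c.
Proof.
move=> h1 h2; have [|d [hd mn]] := @wo_min [set x | [\/ x = a, x = b | x = c]].
  by exists a; apply: Or31.
have la := mn a (Or31 _ _ erefl); have lb := mn b (Or32 _ _ erefl); have lc := mn c (Or33 _ _ erefl).
case: hd => e; rewrite e in la lb lc.
- split=> // eac; apply: (lt1_le h2); rewrite -eac; by case: h1.
- by case: (lt1_le h1).
- by case: (lt1_le h2).
Qed.

Lemma lt1_ind (P : l -> Prop) : (forall a, (forall b, lt1 b a -> P b) -> P a) -> forall a, P a.
Proof.
move=> h a; apply: contrapT => na.
have [|c [nc mn]] := @wo_min [set x | ~ P x]; first by exists a.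
apply: nc; apply: h => b hb; apply: contrapT => nb; exact: lt1_le hb (mn b nb).
Qed.

Local Notation I := (l * option l)%type.
(** Within a level, (a, None) comes before all the (a, Some h), which are mutually incomparable. *)
Definition lti (i j : I) : Prop := lt1 i.1 j.1 \/ [/\ i.1 = j.1, i.2 = None & j.2 <> None].

Lemma lti_irr i : ~ lti i i. Proof. by case=> [/lt1_irr|[_ -> ]]. Qed.

Lemma lti_trans i j k : lti i j -> lti j k -> lti i k.
Proof.
case=> [h1|[e1 n1 n1']]; case=> [h2|[e2 n2 n2']].
- by left; exact: lt1_trans h2.
- by left; rewrite -e2.
- by left; rewrite e1.
- by case: n1'.
Qed.

Inductive subfield_below (a : l) : l -> Prop :=
| sfb_cst u : subfield_below a (phi u)
| sfb_elt b : lt1 b a -> subfield_below a b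
| sfb_add x y : subfield_below a x -> subfield_below a y -> subfield_below a (x + y)
| sfb_mul x y : subfield_below a x -> subfield_below a y -> subfield_below a (x * y)
| sfb_inv x : subfield_below a x -> subfield_below a x^-1.

Definition simple_ext a (h : l) : Prop :=
  exists r : {poly l}, (forall k, subfield_below a r`_k) /\ h = r.[a].

Lemma simple_ext0 a h : subfield_below a h -> simple_ext a h.
Proof.
move=> hh; exists h%:P; rewrite hornerC; split=> // k; rewrite coefC.
by case: eqP => // _; rewrite -(rmorph0 phi); exact: sfb_cst.
Qed.

Lemma sfb_sum a (J : Type) (r : seq J) (F : J -> l) :
  (forall j, subfield_below a (F j)) -> subfield_below a (\sum_(j <- r) F j).
Proof.
move=> h; elim/big_ind: _ => [||//]; last exact: sfb_add.
by rewrite -(rmorph0 phi); exact: sfb_cst.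
Qed.

Lemma simple_extD a x y : simple_ext a x -> simple_ext a y -> simple_ext a (x + y).
Proof.
move=> [r [hr ->]] [s [hs ->]]; exists (r + s); rewrite hornerD; split=> // k.
by rewrite coefD; exact: sfb_add.
Qed.

Lemma simple_extM a x y : simple_ext a x -> simple_ext a y -> simple_ext a (x * y).
Proof.
move=> [r [hr ->]] [s [hs ->]]; exists (r * s); rewrite hornerM; split=> // k.
by rewrite coefM; apply: sfb_sum => j; exact: sfb_mul.
Qed.

(** Let F be the subfield generated by A and the elements below a. The variable (a, None) stands for
    a, and (a, Some h) for the inverse of h when h lies in F[a], for 0 otherwise. Thanks to the
    inverses, F is the image of a polynomial subring. *)
Definition tval (i : I) : l :=
  if i.2 is Some h then if `[< simple_ext i.1 h >] then h^-1 else 0 else i.1.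

Variables (B : comNzRingType) (cst : {rmorphism A -> B}) (var : I -> B).
Hypothesis pr : polynomial_ring cst var.
Local Notation pgen := (pgen cst var).
Variable ev : {rmorphism B -> l}.
Hypotheses (ev_cst : forall u, ev (cst u) = phi u) (ev_var : forall i, ev (var i) = tval i).

Definition below a : set I := [set i | lt1 i.1 a].
Definition img (V : set I) x := exists b, pgen V b /\ ev b = x.

Lemma img_sub (V V' : set I) x : V `<=` V' -> img V x -> img V' x.
Proof. by move=> h [b [hb <-]]; exists b; split=> //; exact: pgen_sub hb. Qed.

Lemma imgM V x y : img V x -> img V y -> img V (x * y).
Proof. by move=> [b [hb <-]] [c [hc <-]]; exists (b * c); rewrite rmorphM; split=> //; exact: pgen_mul. Qed.

Lemma imgD V x y : img V x -> img V y -> img V (x + y).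
Proof. by move=> [b [hb <-]] [c [hc <-]]; exists (b + c); rewrite rmorphD; split=> //; exact: pgen_add. Qed.

Lemma img_simple a (V : set I) h : below a `<=` V -> V (a, None) ->
  (forall x, subfield_below a x -> img (below a) x) -> simple_ext a h -> img V h.
Proof.
move=> bV Va hF [r [hr ->]]; rewrite horner_coef.
elim/big_ind: _ => [||k _].
- by exists 0; rewrite rmorph0; split=> //; exact: pgen0.
- by move=> x y; exact: imgD.
apply: imgM; first by apply: img_sub bV _; exact: hF.
exists (var (a, None) ^+ k); rewrite rmorphXn ev_var; split=> //.
by apply: pgenX; exact: pgen_var.
Qed.

Lemma tval_below c i : lt1 i.1 c -> subfield_below c (tval i).
Proof.
case: i => b o /= bc; rewrite /tval /=; case: o => [h|]; last exact: sfb_elt.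
have s0 : subfield_below c 0 by rewrite -(rmorph0 phi); exact: sfb_cst.
case: asboolP => // -[r [hr ->]]; apply: sfb_inv; rewrite horner_coef; apply: sfb_sum => k.
have sX j : subfield_below c (b ^+ j).
  elim: j => [|j IH]; first by rewrite expr0 -(rmorph1 phi); exact: sfb_cst.
  by rewrite exprS; apply: sfb_mul => //; exact: sfb_elt.
apply: sfb_mul => //; elim: (hr k) => *.
- exact: sfb_cst.
- apply: sfb_elt; exact: lt1_trans bc.
- exact: sfb_add.
- exact: sfb_mul.
- exact: sfb_inv.
Qed.

(** With fractions of elements of F[c] at hand, the inverse of a value of level c needs only one
    further variable (c, Some u). *)
Lemma pgen_frac c b : pgen [set i | i.1 = c \/ lt1 i.1 c] b ->
  exists u w, [/\ simple_ext c u, simple_ext c w, w != 0 & ev b = u / w].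
Proof.
have c1 : simple_ext c 1 by apply: simple_ext0; rewrite -(rmorph1 phi); exact: sfb_cst.
have c0 : simple_ext c 0 by apply: simple_ext0; rewrite -(rmorph0 phi); exact: sfb_cst.
elim=> [a|i hi|x y _ [u [w [h1 h2 h3 e]]] _ [u' [w' [h1' h2' h3' e']]] |
        x y _ [u [w [h1 h2 h3 e]]] _ [u' [w' [h1' h2' h3' e']]]].
- exists (phi a), 1; split=> //; rewrite ?oner_eq0 ?divr1 ?ev_cst //.
  by apply: simple_ext0; exact: sfb_cst.
- rewrite ev_var; case: hi => [ic|lc]; last first.
    exists (tval i), 1; split; rewrite ?oner_eq0 ?divr1 //.
    by apply: simple_ext0; exact: tval_below.
  case: i ic => a o /= ->; rewrite /tval /=; case: o => [h|]; last first.
    exists c, 1; split; rewrite ?oner_eq0 ?divr1 //.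
    exists 'X; rewrite hornerX; split=> // k; rewrite coefX -(rmorph_nat phi); exact: sfb_cst.
  case: asboolP => hh; last by exists 0, 1; split; rewrite ?oner_eq0 ?mul0r.
  have [->|h0] := eqVneq h 0; first by exists 0, 1; split; rewrite ?oner_eq0 ?invr0 ?mul0r.
  by exists 1, h; split; rewrite ?mul1r.
- exists (u * w' + u' * w), (w * w'); split; rewrite ?mulf_neq0 //.
  + by apply: simple_extD; exact: simple_extM.
  + exact: simple_extM.
  + by rewrite rmorphD /= e e' addf_div.
- exists (u * u'), (w * w'); split; rewrite ?mulf_neq0 //; try exact: simple_extM.
  by rewrite rmorphM /= e e' mulf_div.
Qed.

End FieldTower.

(** * Relations among the generators of the tower *)

Section TowerRelations.
Variables (A : comNzRingType) (l : fieldType) (phi : {rmorphism A -> l}) (q : set A).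
Hypotheses (phiq : forall u, phi u = 0 <-> q u) (fq : forall u, ~ q u -> exists v, q (u * v - 1)).
Variable le : rel l.
Hypothesis wo : wochoice.well_order le.
Local Notation I := (l * option l)%type.
Variables (B : comNzRingType) (cst : {rmorphism A -> B}) (var : I -> B).
Hypothesis pr : polynomial_ring cst var.
Local Notation pgen := (pgen cst var).
Variable ev : {rmorphism B -> l}.
Hypotheses (ev_cst : forall u, ev (cst u) = phi u) (ev_var : forall i, ev (var i) = tval phi le i).
Local Notation lt1 := (lt1 le).
Local Notation lti := (lti le).
Local Notation below := (below le).
Local Notation img := (img cst var ev).
Local Notation sfb := (subfield_below phi le).
Local Notation dn i := [set j | lti j i].

(** Only inverses need an argument. If c is the top level of the finitely many variables in b, then
    ev b = u/w by [pgen_frac], the inverse of u is the value of (c, Some u), and w is reached by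
    induction. Without variables, b is a constant and has an inverse modulo q. *)
Lemma img_below a x : sfb a x -> img (below a) x.
Proof.
move: a x; apply: (lt1_ind wo) => a IH x.
elim=> [u|b ba|{}x y _ hx _ hy|{}x y _ hx _ hy|{}x _ [b [hb <-]]].
- by exists (cst u); split=> //; exact: pgen_cst.
- by exists (var (b, None)); split; [exact: pgen_var|rewrite ev_var].
- exact: imgD.
- exact: imgM.
have img0 : img (below a) 0 by exists 0; rewrite rmorph0; split=> //; exact: pgen0.
have [e0|n0] := eqVneq (ev b) 0; first by rewrite e0 invr0.
have [s [hs hbs]] := pgen_fin hb.
have [s0|[c [ca hc]]] : s = [::] \/ exists c, lt1 c a /\ forall i, i \in s -> i.1 = c \/ lt1 i.1 c.
  case: s hs {hbs} => [|i s] hs; [by left|right].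
  have [i0 i0s mi] := max_mem (@lt1_irr l le) (@lt1_trans l le wo) (mem_head i.1 (map fst s)).
  exists i0; split.
    by have /mapP[j js ->] : i0 \in map fst (i :: s) by []; exact: hs.
  move=> j js; have [->|[h|h]] := lt1_cmp wo j.1 i0; [by left|by right|].
  by case: (mi j.1) => //; exact: (map_f fst js).
- have : pgen set0 b by apply: pgen_sub hbs; rewrite s0.
  move=> h; have [u eu] : exists u, ev b = phi u.
    elim: h {hb hbs n0} => [u|i []|{}x y _ [u ex] _ [v ey]|{}x y _ [u ex] _ [v ey]].
    + by exists u.
    + by exists (u + v); rewrite !rmorphD ex ey.
    + by exists (u * v); rewrite !rmorphM ex ey.
  have [|v hv] := fq (u := u); first by move=> /phiq u0; rewrite eu u0 eqxx in n0.
  exists (cst v); split; first exact: pgen_cst.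
  rewrite ev_cst eu; apply: (mulfI (x := phi u)); first by rewrite -eu.
  rewrite divff -?eu // eu; apply/eqP; rewrite -subr_eq0 -rmorphM -(rmorph1 phi) -rmorphB.
  exact/eqP/phiq.
have [|u [w [hu hw w0 e]]] := pgen_frac wo ev_cst ev_var (c := c) (b := b).
  by apply: pgen_sub hbs => i /hc.
have u0 : u != 0 by apply: contra_neq n0 => u0; rewrite e u0 mul0r.
rewrite e invfM invrK; apply: imgM.
  have -> : u^-1 = ev (var (c, Some u)).
    by rewrite ev_var /tval /=; case: asboolP.
  by exists (var (c, Some u)); split=> //; exact: pgen_var.
apply: (img_simple ev_var (a := c)) hw.
- by move=> i ic; exact: (lt1_trans wo ic ca).
- by [].
- exact: IH.
Qed.

(** [w] tells whether the variable i carries a relation, and p is that relation. The last clause is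
    elimination of i: if J contains the relation and every element of the kernel of [ev] in the
    variables V, it contains those in V and i as well. *)
Definition tower_rel (i : I) (w : Prop) (p : {poly B}) : Prop :=
  [/\ w -> cancellable p, w -> forall k, pgen (dn i) p`_k, w -> ev p.[var i] = 0 &
   forall (J : set B) (V : set I), ideal J -> (w -> J p.[var i]) ->
     (i.2 = None -> V = below i.1) -> dn i `<=` V -> ~ V i ->
     (forall b, pgen V b -> ev b = 0 -> J b) ->
     forall b, pgen (V `|` [set i]) b -> ev b = 0 -> J b].

Lemma dn_None a : dn (a, None : option l) = below a.
Proof. by apply/seteqP; split=> j; [case=> // -[_ _]|left]. Qed.

Lemma ev_horner (p : {poly B}) i : ev p.[var i] = (map_poly ev p).[tval phi le i].
Proof. by rewrite -ev_var horner_map. Qed.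

Lemma horner_J (J : set B) (p : {poly B}) x : ideal J -> (forall k, J p`_k) -> J p.[x].
Proof.
move=> iJ h; rewrite horner_coef; apply: (@idl_sum _ _ _ _ _ _ iJ) => k _.
exact: (idlMr _ iJ).
Qed.

Lemma lift_monic a (p : {poly B}) : (forall k, pgen (below a) p`_k) -> map_poly ev p != 0 ->
  exists r : {poly B}, [/\ r \is monic, forall k, pgen (below a) r`_k, (size r <= size p)%N &
    exists c, map_poly ev r = c *: map_poly ev p].
Proof.
move=> hp n0; set P := map_poly ev p in n0 *.
have lc0 : lead_coef P != 0 by rewrite lead_coef_eq0.
have PF k : sfb a P`_k.
  rewrite coef_map /=; elim: (hp k) => [u|i hi|x y _ hx _ hy|x y _ hx _ hy].
  - by rewrite ev_cst; exact: sfb_cst.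
  - by rewrite ev_var; apply: tval_below => //; exact: hi.
  - by rewrite rmorphD; exact: sfb_add.
  - by rewrite rmorphM; exact: sfb_mul.
pose c := (lead_coef P)^-1; pose n := (size P).-1.
have sP : size P = n.+1 by rewrite prednK // size_poly_gt0.
have [f hf] := choice (fun k => img_below (sfb_mul (sfb_inv (PF n)) (PF k))).
pose r : {poly B} := 'X^n + \poly_(k < n) f k.
have sr : (size (\poly_(k < n) f k) < size ('X^n : {poly B}))%N.
  by rewrite size_polyXn ltnS size_poly.
exists r; split.
- by rewrite monicE lead_coefDl // lead_coefXn.
- move=> k; rewrite coefD coefXn coef_poly; apply: pgen_add.
    by case: eqP => _; [exact: pgen1|exact: pgen0].
  by case: ifP => _; [have [] := hf k|exact: pgen0].
- rewrite size_polyDl // size_polyXn -sP; exact: size_poly.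
- exists c; apply/polyP => k; rewrite coefZ coef_map /= coefD coefXn coef_poly rmorphD.
  have -> : c * P`_k = (P`_n)^-1 * P`_k by [].
  have [->|kn] := eqVneq k n.
    by rewrite ltnn rmorph0 addr0 rmorph1 mulVf.
  rewrite mulr0n rmorph0 add0r; case: ltnP => hk; first by have [_ ->] := hf k.
  by rewrite rmorph0 [P`_k]nth_default ?mulr0 // sP ltn_neqAle eq_sym kn.
Qed.

(* If w fails, a is transcendental over the field img (below a); otherwise p  *)
(* lifts its minimal polynomial.                                              *)
Lemma tower_rel_elt a : exists wp : Prop * {poly B}, tower_rel (a, None) wp.1 wp.2.
Proof.
pose M (p : {poly B}) := [/\ p \is monic, forall k, pgen (below a) p`_k & (map_poly ev p).[a] = 0].
have va : tval phi le (a, None) = a by [].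
have nba : ~ below a (a, None) by move=> /lt1_irr.
have coefs (V : set I) b : V = below a -> pgen (V `|` [set (a, None)]) b ->
    exists be : {poly B}, (forall k, pgen (below a) be`_k) /\ be.[var (a, None)] = b.
  move=> -> hb; have [Phi [h1 _ _ h4]] := pring_split pr (a, None).
  by exists (Phi b); split; [exact: h4|exact: h1].
have [[p0 hp0]|nM] := pselect (exists p, M p); last first.
  exists (False, 0); split=> //= J V iJ _ /(_ erefl) eV _ _ hV b hb eb.
  have [be [hbe ebe]] := coefs V b eV hb.
  have [e0|n0] := eqVneq (map_poly ev be) 0.
    rewrite -ebe; apply: horner_J => // k; apply: hV; first by rewrite eV.
    by rewrite -[LHS]coef_map e0 coef0.
  have [r [mr hr _ [c er]]] := lift_monic hbe n0; case: nM; exists r; split=> //.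
  by rewrite er hornerZ -va -ev_horner ebe eb mulr0.
have [|n [[p [sp [mp hp rp]]] mn]] := @set_nat_min [set n | exists p : {poly B}, size p = n /\ M p].
  by exists (size p0), p0.
exists (True, p); split=> /=.
- by move=> _; exact: cancellable_monic.
- by move=> _; rewrite dn_None.
- by move=> _; rewrite ev_horner.
move=> J V iJ /(_ Logic.I) Jp /(_ erefl) eV _ _ hV b hb eb.
have [be [hbe ebe]] := coefs V b eV hb.
rewrite -ebe in eb *; elim: {be}_.+1 {-2}be (ltnSn (size be)) hbe eb {ebe hb b} => // t IH be.
rewrite ltnS => st hbe eb.
have [e0|n0] := eqVneq (map_poly ev be) 0.
  apply: horner_J => // k; apply: hV; first by rewrite eV.
  by rewrite -[LHS]coef_map e0 coef0.
have spb : (size p <= size be)%N.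
  have [r [mr hr sr [c er]]] := lift_monic hbe n0; apply: leq_trans sr.
  rewrite sp; apply: mn; exists r; split=> //; split=> //.
  by rewrite er hornerZ -va -ev_horner eb mulr0.
have p0' : (0 < size p)%N by rewrite size_poly_gt0 monic_neq0.
pose be' := be - (lead_coef be)%:P * 'X^(size be - size p) * p.
have hJ : J ((lead_coef be)%:P * 'X^(size be - size p) * p).[var (a, None)].
  by rewrite hornerM; exact: (idlM _ iJ).
have -> : be = be' + (lead_coef be)%:P * 'X^(size be - size p) * p by rewrite subrK.
rewrite hornerD; apply: (idlD iJ) => //; apply: IH.
- have be0 : be != 0 by apply: contra_neq n0 => ->; rewrite rmorph0.
  apply: leq_trans st; rewrite -(prednK (leq_trans p0' spb)) ltnS.
  apply/leq_sizeP => k hk; rewrite coefB -mulrA coefCM coefXnM.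
  have sb : (0 < size be)%N by rewrite size_poly_gt0.
  rewrite leq_eqVlt in hk; case/orP: hk => [/eqP <-|hk].
    have -> : ((size be).-1 < size be - size p)%N = false.
      by apply/negbTE; rewrite -leqNgt -subn1; apply: leq_sub2l.
    have -> : ((size be).-1 - (size be - size p) = (size p).-1)%N.
      by rewrite -subn1 -subnDA addnC subnDA subKn // subn1.
    by move/monicP: mp; rewrite /lead_coef => ->; rewrite mulr1 subrr.
  have hk' : (size be <= k)%N by rewrite -(prednK sb).
  rewrite (nth_default _ hk') sub0r; case: ltnP => [_|_]; first by rewrite mulr0 oppr0.
  rewrite nth_default ?mulr0 ?oppr0 //.
  by rewrite leq_subRL ?(leq_trans (leq_subr _ _)) // subnK.
- move=> k; rewrite coefB -mulrA coefCM coefXnM; apply: pgen_add => //; apply: pgenN.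
  by apply: pgen_mul; [exact: hbe|case: ifP => _; [exact: pgen0|exact: hp]].
- rewrite /be' hornerD hornerN rmorphB eb hornerM rmorphM ev_horner /= [ev p.[_]]ev_horner rp.
  by rewrite mulr0 subrr.
Qed.

(** If the value is 0 the relation is the variable itself. Otherwise it is H X - 1 with H a lift of
    h; modulo it H is invertible, and multiplying by a power of H removes the variable. *)
Lemma tower_rel_inv a h : exists wp : Prop * {poly B}, tower_rel (a, Some h) wp.1 wp.2.
Proof.
set i := (a, Some h).
have coefs (V : set I) b : pgen (V `|` [set i]) b ->
    exists be : {poly B}, (forall k, pgen V be`_k) /\ be.[var i] = b.
  move=> hb; have [Phi [h1 _ _ h4]] := pring_split pr i.
  by exists (Phi b); split; [exact: h4|exact: h1].
have [[hh h0]|nh] := pselect (simple_ext phi le a h /\ h != 0); last first.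
  have v0 : tval phi le i = 0.
    rewrite /tval /=; case: asboolP => // hh; have [->|hn] := eqVneq h 0; first by rewrite invr0.
    by case: nh.
  exists (True, 'X); split=> /=.
  - by move=> _; apply: cancellable_monic; exact: monicX.
  - by move=> _ k; rewrite coefX; case: eqP => _; [exact: pgen1|exact: pgen0].
  - by move=> _; rewrite hornerX ev_var.
  move=> J V iJ /(_ Logic.I); rewrite hornerX => JX _ _ nVi hV b hb eb.
  have [be [hbe ebe]] := coefs V b hb.
  have eb0 : b = be`_0 + (drop_poly 1 be).[var i] * var i.
    rewrite -ebe -{1}(poly_take_drop 1 be) expr1 hornerD hornerM hornerX; congr (_ + _).
    have -> : take_poly 1 be = (be`_0)%:P.
      by apply/polyP => k; rewrite coef_take_poly coefC; case: k.
    by rewrite hornerC.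
  have Jd : J ((drop_poly 1 be).[var i] * var i) by exact: (idlM _ iJ).
  rewrite eb0; apply: (idlD iJ) => //; apply: hV => //.
  by move: eb; rewrite eb0 rmorphD rmorphM ev_var v0 mulr0 addr0.
have [H [hH eH]] : img (dn i) h.
  apply: (img_simple ev_var (a := a)) hh; first by move=> j hj; left.
    by right.
  by move=> x; exact: img_below.
have vi : tval phi le i = h^-1 by rewrite /tval /=; case: asboolP.
exists (True, H%:P * 'X - 1); split=> /=.
- move=> _; apply: (@cancellable_unit _ _ (-1)).
  by rewrite coefB coefMX coef1 /= sub0r mulrNN mulr1.
- move=> _ k; rewrite coefB coefMX coef1 coefC; apply: pgen_add.
    by case: eqP => _; [exact: pgen0|case: eqP => _ //; exact: pgen0].
  by apply: pgenN; case: eqP => _; [exact: pgen1|exact: pgen0].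
- by move=> _; rewrite !hornerE rmorphB rmorphM rmorph1 ev_var vi eH divff // subrr.
move=> J V iJ /(_ Logic.I); rewrite !hornerE => JX _ dV nVi hV b hb eb.
have [be [hbe ebe]] := coefs V b hb.
have JXk k : J ((H * var i) ^+ k - 1).
  elim: k => [|k IH]; first by rewrite expr0 subrr; exact: (idl0 iJ).
  have -> : (H * var i) ^+ k.+1 - 1 = (H * var i) * ((H * var i) ^+ k - 1) + (H * var i - 1).
    by rewrite exprS; ring.
  by apply: (idlD iJ) => //; exact: (idlM _ iJ).
pose n := size be; pose c := \sum_(k < n) be`_k * H ^+ (n - k).
have Jc : J (H ^+ n * b - c).
  rewrite -ebe horner_coef mulr_sumr /c -sumrB; apply: (@idl_sum _ _ _ _ _ _ iJ) => k _.
  have -> : H ^+ n * (be`_k * var i ^+ k) - be`_k * H ^+ (n - k) =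
      be`_k * H ^+ (n - k) * ((H * var i) ^+ k - 1).
    have -> : H ^+ n = H ^+ (n - k) * H ^+ k by rewrite -exprD subnK // ltnW.
    by rewrite exprMn; ring.
  exact: (idlM _ iJ).
have hc : J c.
  apply: hV.
    apply: pgen_sum => k _; apply: pgen_mul => //; apply: pgenX.
    exact: pgen_sub hH.
  have evc : forall k : 'I_n, ev (H ^+ n * (be`_k * var i ^+ k)) = ev (be`_k * H ^+ (n - k)).
    move=> k; have -> : H ^+ n = H ^+ (n - k) * H ^+ k by rewrite -exprD subnK // ltnW.
    rewrite !rmorphM !rmorphXn /= ev_var vi eH.
    have YZ : h ^+ k * h^-1 ^+ k = 1 by rewrite -exprMn divff // expr1n.
    rewrite -[RHS]mulr1 -YZ; ring.
  have := congr1 (fun x => ev (H ^+ n) * x) eb; rewrite -ebe horner_coef rmorph_sum mulr_sumr mulr0.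
  by rewrite /c rmorph_sum => h'; rewrite -[RHS]h'; apply: eq_bigr => k _; rewrite -evc rmorphM.
have JHb : J (H ^+ n * b) by rewrite -(subrK c (H ^+ n * b)); exact: (idlD iJ).
have -> : b = var i ^+ n * (H ^+ n * b) - b * ((H * var i) ^+ n - 1) by rewrite exprMn; ring.
by apply: (idlB iJ); exact: (idlM _ iJ).
Qed.

Lemma tower_rel_ex : exists (W : set I) (p : I -> {poly B}), forall i, tower_rel i (W i) (p i).
Proof.
have [F hF] := choice (fun i : I => match i return exists wp : Prop * {poly B}, tower_rel i wp.1 wp.2 with
  (a, None) => tower_rel_elt a | (a, Some h) => tower_rel_inv a h end).
by exists (fun i => (F i).1), (fun i => (F i).2).
Qed.

(** Transfinite induction on the level. At level c the variable (c, None) is adjoined first, then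
    the finitely many (c, Some h) that occur. *)
Lemma tower_kernel (W : set I) (p : I -> {poly B}) (J : set B) :
  (forall i, tower_rel i (W i) (p i)) -> ideal J -> (forall i, W i -> J (p i).[var i]) ->
  (forall u, q u -> J (cst u)) -> forall b, ev b = 0 -> J b.
Proof.
move=> hrel iJ hJ hq.
pose hyp (V : set I) := forall b, pgen V b -> ev b = 0 -> J b.
have hyp0 : hyp set0.
  move=> b hb; suff [u ->] : exists u, b = cst u by rewrite ev_cst => /phiq /hq.
  elim: hb => [u|i []|{}x y _ [u ->] _ [v ->]|{}x y _ [u ->] _ [v ->]].
  - by exists u.
  - by exists (u + v); rewrite rmorphD.
  - by exists (u * v); rewrite rmorphM.
have step c : hyp (below c) -> forall s : seq I, (forall i, i \in s -> i.1 = c) ->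
    hyp (below c `|` [set (c, None)] `|` [set` s]).
  move=> hc; have h1 : hyp (below c `|` [set (c, None)]).
    have [_ _ _ el] := hrel (c, None); apply: el => //; first exact: hJ.
      by rewrite dn_None.
    by move=> /lt1_irr.
  elim=> [_|i s IH his]; first by move=> b hb; apply: h1; apply: pgen_sub hb => j [].
  have {}IH := IH (fun j js => his j (mem_behead (s := i :: s) js)).
  have ic : i.1 = c by apply: his; rewrite mem_head.
  pose V := below c `|` [set (c, None)] `|` [set` s].
  have sub : below c `|` [set (c, None)] `|` [set` i :: s] `<=` V `|` [set i].
    move=> j [h|/=]; first by left; left.
    by rewrite inE => /orP[/eqP ->|js]; [right|left; right].
  move=> b hb; have {}hb := pgen_sub sub hb.
  have [Vi|nVi] := pselect (V i).
    by apply: IH; apply: pgen_sub hb => j [//|->].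
  have [_ _ _ el] := hrel i; apply: (el J V) hb => //; first exact: hJ.
    by move=> i0; case: nVi; left; right; rewrite -ic -i0; case: (i).
  move=> j [hj|[e0 e1 _]]; left; [by left; rewrite -ic|right].
  by rewrite -ic -e0 -e1; case: (j).
have fin (s : seq I) : (forall c, c \in map fst s -> hyp (below c)) -> hyp [set` s].
  case: s => [_|i s hs]; first by move=> b hb; apply: hyp0; apply: pgen_sub hb.
  have [c cs mi] := max_mem (@lt1_irr l le) (@lt1_trans l le wo) (mem_head i.1 (map fst s)).
  have hc := step c (hs c cs) [seq j <- i :: s | j.1 == c].
  move=> b hb; apply: hc => [j|]; first by rewrite mem_filter => /andP[/eqP].
  apply: pgen_sub hb => j /= js.
  have [jc|[h|h]] := lt1_cmp wo j.1 c; [right|by left; left|].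
    suff : j \in [seq j <- i :: s | j.1 == c] by [].
    by rewrite mem_filter jc eqxx.
  by case: (mi j.1) => //; exact: (map_f fst js).
have all c : hyp (below c).
  move: c; apply: (lt1_ind wo) => c IH b hb.
  have [s [hs hb']] := pgen_fin hb; apply: (fin s) hb' => c' /mapP[j js ->].
  by apply: IH; exact: hs.
move=> b; have [s [_ hb]] := pgen_fin (pring_gen pr b).
by apply: (fin s) hb => c _; exact: all.
Qed.

End TowerRelations.

(** * Cohen's criterion and inverse limits *)

Section CohenNoetherian.
Variable R : comNzRingType.
Definition fgi (I : set R) := exists s : seq R, I = ideal_gen [set` s].

(** Zorn gives P maximal among the ideals that are not finitely generated. If ab is in P with a and
    b outside, then P + (a) and (P : a) are finitely generated, and P is generated by finitely many
    elements of P together with a (P : a). *)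
Lemma maximal_not_fg : ~ noetherian R -> exists P, [/\ prime_ideal P, ~ fgi P &
  forall y, ~ P y -> fgi (addgen P y)].
Proof.
move=> nn; have [I0 [iI0 nI0]] : exists I, ideal I /\ ~ fgi I.
  apply: contrapT => h; apply: nn => I iI; apply: contrapT => nI; apply: h.
  by exists I.
pose T := {I : set R | ideal I /\ ~ fgi I}.
pose le (x y : T) := `[< sval x `<=` sval y >].
have [||[x Px] [y Py] /asboolP h /asboolP h'|F Ft|[P [iP nP]] mP] := @Zorn T le.
- by move=> x; apply/asboolP.
- by move=> x y z /asboolP h /asboolP h'; apply/asboolP; exact: subset_trans h h'.
- by apply: eq_exist => /=; apply/seteqP.
- have [[t Fx0]|nF] := pselect (exists t, F t); last first.
    by exists (exist _ I0 (conj iI0 nI0)) => s Fs; case: nF; exists s.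
  pose U : set R := [set u | exists2 s, F s & sval s u].
  have iU : ideal U.
    split; first by exists t => //; case: (svalP t) => /idl0.
    move=> a u v [s Fs us] [s' Fs' us'].
    have [/asboolP h|/asboolP h] := Ft s s' Fs Fs'.
      by exists s' => //; have [[_ h1] _] := svalP s'; apply: h1 => //; exact: h.
    by exists s => //; have [[_ h1] _] := svalP s; apply: h1 => //; exact: h.
  have nU : ~ fgi U.
    move=> [g hg]; have [s [Fs gs]] : exists s, F s /\ forall u, u \in g -> sval s u.
      have : forall u, u \in g -> U u by move=> u ug; rewrite hg; exact: idl_gen_mem.
      elim: (g) => [|u g' IH] hU; first by exists t.
      have [s [Fs hs]] := IH (fun v vg => hU v (mem_behead (s := u :: g') vg)).
      have [s' Fs' us'] := hU u (mem_head _ _).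
      have [/asboolP h|/asboolP h] := Ft s s' Fs Fs'.
        by exists s'; split=> // v; rewrite inE => /orP[/eqP ->//|/hs]; exact: h.
      by exists s; split=> // v; rewrite inE => /orP[/eqP ->|/hs//]; exact: h.
    have [is_ ns] := svalP s; apply: ns; exists g; rewrite -hg; apply/seteqP; split.
      by move=> u us; exists s.
    by rewrite hg; apply: ideal_gen_sub => // u /gs.
  exists (exist _ U (conj iU nU)) => s Fs; apply/asboolP => u us; by exists s.
have big y : ~ P y -> fgi (addgen P y).
  move=> nPy; apply: contrapT => nf; apply: nPy.
  have ia := ideal_addgen y iP.
  have PQ : P `<=` addgen P y.
    by move=> b Pb; exists b => //; exists 0; rewrite ?addr0 //; exists 0; rewrite ?mul0r.
  have := mP (exist _ (addgen P y) (conj ia nf)) (asboolT PQ) => /(congr1 sval) /= e.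
  rewrite -e; exists 0; first exact: (idl0 iP).
  by exists y; rewrite ?add0r //; exists 1; rewrite ?mul1r.
exists P; split=> //; split=> //.
  have nP' := nP; move=> P1; apply: nP'; exists [:: 1]; apply/seteqP; split=> x _; last exact: (idl1 iP P1).
  rewrite -[x]mulr1; apply: (idlM _ (ideal_ideal_gen _)); apply: idl_gen_mem; exact: mem_head.
move=> a b Pab; apply: contrapT => /not_orP[nPa nPb]; have nP' := nP; apply: nP'.
have ex_gens (y : R) : ~ P y -> exists s : seq R, (forall u, u \in s -> P u) /\
    forall x, P x -> exists r, ideal_gen [set` s] (x - r * y).
  move=> nPy; have [g hg] := big y nPy.
  have hgen u : u \in g -> exists v, P (u - v * y).
    move=> ug; have [p Pp [_ [v _ <-] e]] : addgen P y u by rewrite hg; exact: idl_gen_mem.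
    by exists v; rewrite -e addrK.
  have ex u : exists v, u \in g -> P (u - v * y).
    by have [/hgen[v hv]|nu] := boolP (u \in g); [exists v|exists 0].
  have [v hv] := choice ex.
  exists (map (fun u => u - v u * y) g); split.
    by move=> _ /mapP[u ug ->]; exact: hv.
  move=> x Px; have : ideal_gen [set` g] x.
    by rewrite -hg; exists x => //; exists 0; rewrite ?addr0 //; exists 0; rewrite ?mul0r.
  set s := map _ _; have is_ := ideal_ideal_gen [set` s].
  move: x {Px}; apply: (@ideal_gen_sub _ _ [set x | exists r, ideal_gen [set` s] (x - r * y)]).
    split; first by exists 0; rewrite mul0r subrr; exact: (idl0 is_).
    move=> c z w [r hr] [r' hr']; exists (c * r + r'); rewrite -[c *: z]/(c * z).
    have -> : c * z + w - (c * r + r') * y = c * (z - r * y) + (w - r' * y) by ring.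
    by apply: (idlD is_) => //; exact: (idlM _ is_).
  by move=> u ug; exists (v u); apply: idl_gen_mem; apply: map_f.
have [s [sP hs]] := ex_gens a nPa.
pose Q : set R := [set r | P (r * a)].
have iQ : ideal Q.
  split; first by rewrite /Q /= mul0r; exact: (idl0 iP).
  by move=> c x y hx hy; rewrite /Q /= mulrDl -mulrA; apply: (idlD iP) => //; exact: (idlM _ iP).
have [t ht] : fgi Q.
  apply: contrapT => nQ; apply: nPb.
  have PQ : P `<=` Q by move=> x Px; exact: (idlMr _ iP).
  have := mP (exist _ Q (conj iQ nQ)) (asboolT PQ) => /(congr1 sval) /= e.
  by rewrite -e /Q /= mulrC.
exists (s ++ map (fun r => r * a) t).
have ist := ideal_ideal_gen [set` s ++ map (fun r => r * a) t].
apply/seteqP; split; last first.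
  apply: ideal_gen_sub => // u /=; rewrite mem_cat => /orP[/sP//|/mapP[r rt ->]].
  have : Q r by rewrite ht; exact: idl_gen_mem.
  by [].
move=> x Px; have [r hr] := hs x Px.
have sub : ideal_gen [set` s] `<=` ideal_gen [set` s ++ map (fun r => r * a) t].
  by apply: ideal_gen_sub => // u us; apply: idl_gen_mem; rewrite mem_cat us.
rewrite -(subrK (r * a) x); apply: (idlD ist); first exact: sub.
have Pra : Q r.
  have Px' : P (x - r * a).
    by move: hr; apply: ideal_gen_sub => // u /sP.
  have : P (x - (x - r * a)) by exact: (idlB iP).
  by rewrite subKr.
move: r Pra {hr}; rewrite ht; apply: (@ideal_gen_sub _ _ [set r | ideal_gen _ (r * a)]).
  split; first by rewrite /= mul0r; exact: (idl0 ist).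
  by move=> c z w hz hw; rewrite /= mulrDl -mulrA; apply: (idlD ist) => //; exact: (idlM _ ist).
by move=> u ut; apply: idl_gen_mem; rewrite mem_cat; apply/orP; right; apply/mapP; exists u.
Qed.

End CohenNoetherian.

(** L is the limit of the B/J N, and [U N] the kernel of L -> B/J N. *)
Record inverse_limit (B L : comNzRingType) (J : nat -> set B) (c : {rmorphism B -> L})
    (U : nat -> set L) : Prop := InverseLimit {
  il_ideal : forall N, ideal (U N);
  il_dense : forall x N, exists b, U N (x - c b);
  il_c : forall N b, U N (c b) <-> J N b;
  il_mono : forall N, U N.+1 `<=` U N;
  il_sep : forall x, (forall N, U N x) -> x = 0;
  il_complete : forall x : nat -> L, (forall N, U N (x N.+1 - x N)) ->
     exists y, forall N, U N (y - x N) }.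

(** The limit is the ring of compatible sequences in B modulo those whose N-th term lies in J N for
    all N; completeness is a diagonal argument. *)
Lemma inverse_limit_ex (B : comNzRingType) (J : nat -> set B) :
  (forall N, ideal (J N)) -> (forall N, J N.+1 `<=` J N) -> ~ J 1%N 1 ->
  exists (L : comNzRingType) (c : {rmorphism B -> L}) (U : nat -> set L), inverse_limit J c U.
Proof.
move=> iJ JS J1.
pose V : comNzRingType := (nat -> B)%type.
pose C : set V := [set x | forall N, J N (x N.+1 - x N)].
pose Z : set V := [set x | forall N, J N (x N)].
have CB (x y : V) : C x -> C y -> C (x - y).
  move=> hx hy N; rewrite -[(x - y) N.+1]/(x N.+1 - y N.+1) -[(x - y) N]/(x N - y N).
  have -> : x N.+1 - y N.+1 - (x N - y N) = (x N.+1 - x N) - (y N.+1 - y N) by ring.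
  exact: (idlB (iJ N)).
have C1 : C 1 by move=> N; rewrite -[(1 : V) N.+1]/(1 : B) subrr; exact: (idl0 (iJ N)).
have CM (x y : V) : C x -> C y -> C (x * y).
  move=> hx hy N; rewrite -[(x * y) N.+1]/(x N.+1 * y N.+1) -[(x * y) N]/(x N * y N).
  have -> : x N.+1 * y N.+1 - x N * y N = y N.+1 * (x N.+1 - x N) + x N * (y N.+1 - y N) by ring.
  by apply: (idlD (iJ N)); exact: (idlM _ (iJ N)).
have [|||||Q [p [pB p1 pM ps pk]]] := @subquot_ring V C Z CB C1 CM.
- by move=> N; exact: (idl0 (iJ N)).
- by move=> x y hx hy N; exact: (idlB (iJ N)).
- by move=> x y _ hy N; exact: (idlM _ (iJ N)).
- by move=> h; exact: J1 (h 1%N).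
- by move=> x hx N; apply: (idlB (iJ N)) => //; exact: JS.
have Ccst b : C (fun=> b) by move=> N; rewrite subrr; exact: (idl0 (iJ N)).
pose cf (b : B) : Q := p (fun=> b).
have cz : zmod_morphism cf by move=> x y; rewrite /cf -pB.
have cm : monoid_morphism cf by split=> [|x y]; [exact: p1|rewrite /cf -pM].
pose c : {rmorphism B -> Q} := HB.pack cf (GRing.isZmodMorphism.Build B Q cf cz)
  (GRing.isMonoidMorphism.Build B Q cf cm).
pose U N : set Q := [set y | exists x, [/\ C x, p x = y & J N (x N)]].
have UE N x : C x -> (U N (p x) <-> J N (x N)).
  move=> Cx; split=> [[x' [Cx' e hx']]|hx]; last by exists x.
  have /pk h : p (x' - x) = 0 by rewrite pB // e subrr.
  rewrite -(subKr (x' N) (x N)); apply: (idlB (iJ N)) => //; exact: (h (CB _ _ Cx' Cx) N).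
have C0 : C 0 by move=> N; rewrite subrr; exact: (idl0 (iJ N)).
have pr0 : p 0 = 0 by rewrite -(subrr 1) pB // subrr.
have pN x : C x -> p (- x) = - p x by move=> hx; rewrite -sub0r pB // pr0 sub0r.
have CN x : C x -> C (- x) by move=> hx; rewrite -sub0r; exact: CB.
have pD x y : C x -> C y -> p (x + y) = p x + p y.
  by move=> hx hy; rewrite -[y]opprK pB ?pN ?opprK //; exact: CN.
have CD x y : C x -> C y -> C (x + y) by move=> hx hy; rewrite -[y]opprK; apply: CB => //; exact: CN.
exists Q, c, U; split.
- move=> N; split; first by exists 0; split=> //; exact: (idl0 (iJ N)).
  move=> a _ _ [x [Cx <- hx]] [y [Cy <- hy]]; have [z Cz <-] := ps a.
  exists (z * x + y); split; first by apply: CD => //; exact: CM.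
    by rewrite pD ?pM //; exact: CM.
  by apply: (idlD (iJ N)) => //; exact: (idlM _ (iJ N)).
- move=> y N; have [x Cx <-] := ps y; exists (x N).
  rewrite -[c (x N)]/(p (fun=> x N)) -pB // UE; last exact: CB.
  have -> : ((x - (fun=> x N)) : V) N = 0 by exact: subrr.
  exact: (idl0 (iJ N)).
- by move=> N b; rewrite -[c b]/(p (fun=> b)) UE.
- move=> N _ [x [Cx <- hx]]; apply/UE => //.
  rewrite -(subKr (x N.+1) (x N)); apply: (idlB (iJ N)); [exact: JS|exact: Cx].
- move=> y; have [x Cx <-] := ps y => h; apply/pk => // N.
  exact: (UE N x Cx).1 (h N).
- move=> X hX; have hps N : exists x, C x /\ p x = X N by have [x Cx e] := ps (X N); exists x.
  have [xi hxi] := choice hps.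
  pose eta : V := fun N => xi N N.
  have Ceta : C eta.
    move=> N; have [C1' e1] := hxi N.+1; have [C0' e0] := hxi N.
    have /UE h : U N (p (xi N.+1 - xi N)) by rewrite pB // e1 e0.
    have -> : eta N.+1 - eta N = (xi N.+1 N.+1 - xi N.+1 N) + (xi N.+1 - xi N) N.
      by rewrite -[(xi N.+1 - xi N) N]/(xi N.+1 N - xi N N) /eta; ring.
    by apply: (idlD (iJ N)); [exact: C1'|apply: h; exact: CB].
  exists (p eta) => N; have [CN' eN] := hxi N; rewrite -eN -pB // UE; last exact: CB.
  by rewrite -[(eta - xi N) N]/(xi N N - xi N N) subrr; exact: (idl0 (iJ N)).
Qed.

Lemma ideal_pow_add_gen (R : comNzRingType) (I : set R) N k :
  ideal_pow I (N + k) `<=` ideal_gen [set x * y | x in ideal_pow I N & y in ideal_pow I k].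
Proof.
elim: N => [|N IH]; first by move=> y hy; apply: idl_gen_in; exists 1 => //; exists y; rewrite ?mul1r.
set G := ideal_gen _; have iG : ideal G by exact: ideal_ideal_gen.
apply: (@ideal_powS_sub _ _ _ G) => // x y hx /IH; move: y.
apply: (@ideal_gen_sub _ _ [set y | G (x * y)]).
  split; first by rewrite /= mulr0; exact: (idl0 iG).
  by move=> a u v hu hv; rewrite /= mulrDr mulrCA; apply: (idlD iG) => //; exact: (idlM _ iG).
move=> _ [u hu [v hv <-]]; rewrite /= mulrA; apply: idl_gen_in.
by exists (x * u); [exact: ideal_powS_in|exists v].
Qed.

(** * The completed ring is noetherian and local *)

Section CompleteRing.
Variables (A B L : comNzRingType) (cst : {rmorphism A -> B}) (q : set A) (Z : set B).
Hypotheses (nA : noetherian A) (iq : ideal q) (iZ : ideal Z).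
Local Notation J := (fun N => idl_add Z (qB cst q N)).
Variables (c : {rmorphism B -> L}) (U : nat -> set L).
Hypothesis il : inverse_limit J c U.
Hypotheses (J1 : ~ J 1%N 1) (fJ : forall b, ~ J 1%N b -> exists b', J 1%N (b * b' - 1)).
Let iU N : ideal (U N) := il_ideal il N.
Let h : {rmorphism A -> L} := c \o cst.

Lemma cZ b : Z b -> c b = 0.
Proof.
move=> hb; apply: (il_sep il) => N; apply/(il_c il).
by apply: (idl_addl (ideal_qB cst q N)).
Qed.

Lemma c_qB N b : qB cst q N b -> U N (c b).
Proof. by move=> hb; apply/(il_c il); exact: (idl_addr iZ). Qed.

Lemma U_mono N M : (N <= M)%N -> U M `<=` U N.
Proof.
elim: M => [|M IH]; first by rewrite leqn0 => /eqP ->.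
rewrite leq_eqVlt => /orP[/eqP -> //|]; rewrite ltnS => NM.
by apply: subset_trans (IH NM); exact: (il_mono il).
Qed.

Lemma U_lift N M x : U N x -> (N <= M)%N -> exists e, qB cst q N e /\ U M (x - c e).
Proof.
move=> hx NM; have [b hb] := il_dense il x M.
have /(il_c il)[z hz [e he eb]] : U N (c b).
  by rewrite -(subKr x (c b)); apply: (idlB (iU N)) => //; exact: U_mono hb.
by exists e; split=> //; move: hb; rewrite -eb rmorphD cZ // add0r.
Qed.

Lemma UM N M x y : U N x -> U M y -> U (N + M) (x * y).
Proof.
move=> hx hy; have [e [he hxe]] := U_lift hx (leq_addr M N).
have [e' [he' hye]] := U_lift hy (leq_addl N M).
have -> : x * y = (x - c e) * y + c e * (y - c e') + c (e * e') by rewrite rmorphM; ring.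
apply: (idlD (iU _)); first by apply: (idlD (iU _)); [exact: (idlMr _ (iU _))|exact: (idlM _ (iU _))].
by apply: c_qB; exact: qBM.
Qed.

Lemma UX x k : U 1%N x -> U k (x ^+ k).
Proof.
move=> hx; elim: k => [|k IH]; last by rewrite exprS; exact: (UM hx IH).
rewrite expr0 -(rmorph1 c); apply: c_qB; exact: qB0.
Qed.

(** Successive approximation: the remainder at stage k is expressed through the fixed p t with
    coefficients in U k, and these coefficients add up to convergent series. *)
Lemma iter_limit (T : finType) (good : L -> Prop) (p : T -> L) (y : nat -> L) N x :
  (forall k r, good r -> U (N + k)%N r -> exists (v : T -> L) r',
     [/\ r = \sum_t p t * v t + r', good r', U (N + k.+1)%N r' & forall t, U k (v t)]) ->
  good x -> U N x -> exists v : T -> L, x = \sum_t p t * v t.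
Proof.
move=> step gx Ux.
have step' (kr : nat * L) : exists vr : (T -> L) * L, good kr.2 -> U (N + kr.1)%N kr.2 ->
    [/\ kr.2 = \sum_t p t * vr.1 t + vr.2, good vr.2, U (N + kr.1.+1)%N vr.2 & forall t, U kr.1 (vr.1 t)].
  have [[g u]|ng] := pselect (good kr.2 /\ U (N + kr.1)%N kr.2); last first.
    by exists (fun=> 0, 0) => g u; case: ng.
  by have [v [r' h1]] := step kr.1 kr.2 g u; exists (v, r').
have [F hF] := choice step'.
pose R := fix R k := if k is k'.+1 then (F (k', R k')).2 else x.
have hR k : good (R k) /\ U (N + k)%N (R k).
  elim: k => [|k [g u]]; first by rewrite addn0.
  by have [_ g' u' _] := hF (k, R k) g u.
have hv k t : U k ((F (k, R k)).1 t).
  by have [g u] := hR k; have [_ _ _ h1] := hF (k, R k) g u.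
pose V t k := \sum_(i < k) (F (val i, R i)).1 t.
have Vc t : exists w, forall k, U k (w - V t k).
  apply: (il_complete il) => k; rewrite /V big_ord_recr /= addrAC subrr add0r; exact: hv.
have [w hw] := choice Vc; exists w.
have eR k : x = \sum_t p t * V t k + R k.
  elim: k => [|k IH]; first by rewrite big1 ?add0r // => t _; rewrite /V big_ord0 mulr0.
  have [g u] := hR k; have [e _ _ _] := hF (k, R k) g u.
  rewrite {1}IH [X in _ + X](e : R k = _) /= addrA -big_split; congr (_ + _); apply: eq_bigr => t _.
  by rewrite /V big_ord_recr /= mulrDr.
apply/eqP; rewrite -subr_eq0; apply/eqP; apply: (il_sep il) => k.
rewrite {1}(eR k) addrAC -sumrB; apply: (idlD (iU k)).
  apply: (@idl_sum _ _ _ _ _ _ (iU k)) => t _; rewrite -mulrBr; apply: (idlM _ (iU k)).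
  by rewrite -opprB; apply: (idlN (iU k)); exact: hw.
by have [_ u] := hR k; apply: U_mono u; exact: leq_addl.
Qed.

Definition hq N : set L := ideal_gen [set h u | u in ideal_pow q N].

Lemma U_hq N : U N = hq N.
Proof.
apply/seteqP; split; last first.
  apply: ideal_gen_sub => // _ [u hu <-]; apply: c_qB; apply: idl_gen_in.
  by exists u.
have [s hs] := nA (ideal_pow_ideal q N).
have qBs k e : qB cst q (N + k) e -> exists v : 'I_(size s) -> B,
    e = \sum_(t < size s) cst s`_t * v t /\ forall t, qB cst q k (v t).
  move: e; apply: ideal_gen_sub.
    split; first by exists (fun=> 0); split=> [|t]; [rewrite big1 // => t _; rewrite mulr0|exact: (idl0 (ideal_qB _ _ _))].
    move=> a _ _ [v [-> hv]] [w [-> hw]]; exists (fun t => a * v t + w t); split.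
      rewrite -[a *: _]/(a * _) mulr_sumr -big_split; apply: eq_bigr => t _ /=; ring.
    by move=> t; apply: (idlD (ideal_qB _ _ _)) => //; exact: (idlM _ (ideal_qB _ _ _)).
  move=> _ [u hu <-].
  suff [v [-> hv]] : exists v : nat -> A, u = \sum_(t < size s) s`_t * v t /\ forall t, ideal_pow q k (v t).
    exists (fun t => cst (v t)); split.
      by rewrite rmorph_sum; apply: eq_bigr => t _; rewrite rmorphM.
    by move=> t; apply: idl_gen_in; exists (v t).
  have iqk := ideal_pow_ideal q k.
  move: u hu; apply: subset_trans (@ideal_pow_add_gen A q N k) _; apply: ideal_gen_sub.
    split; first by exists (fun=> 0); split=> [|t]; [rewrite big1 // => t _; rewrite mulr0|exact: (idl0 iqk)].
    move=> a _ _ [v [-> hv]] [w [-> hw]]; exists (fun t => a * v t + w t); split.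
      rewrite -[a *: _]/(a * _) mulr_sumr -big_split; apply: eq_bigr => t _ /=; ring.
    by move=> t; apply: (idlD iqk) => //; exact: (idlM _ iqk).
  move=> _ [x + [y hy <-]]; rewrite hs => /ideal_gen_seq[d ->].
  exists (fun t => d t * y); split; last by move=> t; exact: (idlM _ iqk).
  rewrite mulr_suml; apply: eq_bigr => t _; ring.
move=> x Ux; have [|v ->] := @iter_limit _ (fun=> True) (fun t : 'I_(size s) => h s`_t) 
  (fun=> 0) N x _ Logic.I Ux.
  move=> k r _ Ur; have [e [he hr]] := U_lift Ur (leqnSn _ : (N + k <= (N + k).+1)%N).
  have [v [ev hv]] := qBs k e he.
  exists (fun t => c (v t)), (r - c e); rewrite addnS; split=> //; last by move=> t; exact: c_qB.
  have <- : c e = \sum_(t < size s) h s`_t * c (v t).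
    by rewrite ev rmorph_sum; apply: eq_bigr => t _; rewrite rmorphM.
  by rewrite addrC subrK.
have ih := ideal_ideal_gen [set h u | u in ideal_pow q N].
apply: (@idl_sum _ _ _ _ _ _ ih) => t _; apply: (idlMr _ ih); apply: idl_gen_in.
by exists s`_t => //; rewrite hs; apply: idl_gen_mem; exact: mem_nth.
Qed.

Lemma U_unit1 u : U 1%N u -> exists y, (1 - u) * y = 1.
Proof.
move=> hu; have [|y hy] := il_complete il (x := fun N => \sum_(k < N) u ^+ k).
  by move=> N; rewrite big_ord_recr /= addrAC subrr add0r; exact: UX.
exists y; apply/eqP; rewrite -subr_eq0; apply/eqP; apply: (il_sep il) => N.
have e1 : (1 - u) * \sum_(k < N) u ^+ k = 1 - u ^+ N.
  elim: N => [|N IH]; first by rewrite big_ord0 mulr0 expr0 subrr.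
  by rewrite big_ord_recr /= mulrDr IH exprS; ring.
have -> : (1 - u) * y - 1 = (1 - u) * (y - \sum_(k < N) u ^+ k) - u ^+ N.
  by rewrite mulrBr e1; ring.
by apply: (idlB (iU N)); [apply: (idlM _ (iU N))|exact: UX].
Qed.

Lemma U_unit x : ~ U 1%N x -> exists y, x * y = 1.
Proof.
move=> nx; have [b hb] := il_dense il x 1%N.
have nb : ~ J 1%N b.
  by move=> /(il_c il) h1; apply: nx; rewrite -(subrK (c b) x); exact: (idlD (iU _)).
have [b' /(il_c il) hb'] := fJ nb.
have [|y hy] := @U_unit1 (1 - x * c b').
  have -> : 1 - x * c b' = - ((x - c b) * c b' + c (b * b' - 1)).
    by rewrite rmorphB rmorphM rmorph1; ring.
  by apply: (idlN (iU _)); apply: (idlD (iU _)) => //; exact: (idlMr _ (iU _)).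
by exists (c b' * y); rewrite mulrA -[x * c b'](subKr 1).
Qed.

Lemma U1_proper : ~ U 1%N 1.
Proof. by rewrite -(rmorph1 c) => /(il_c il). Qed.

Lemma U_maximal P : ideal P -> ~ P 1 -> P `<=` U 1%N.
Proof.
move=> iP nP x Px; apply: contrapT => /U_unit[y e].
by apply: nP; rewrite -e; exact: (idlMr _ iP).
Qed.

(** Let P be as in [maximal_not_fg]. Some y in U 1 is outside P, else P = U 1 would be finitely
    generated. As P + (y) is finitely generated and P is prime, P = (t) + P y for a finite list t in
    P; iterating, P = (t), since the powers of y tend to 0. *)
Lemma complete_noetherian : noetherian L.
Proof.
apply: contrapT => /maximal_not_fg[P [[iP nP1 pP] nfP big]].
have [s hs] := nA (iq).
have eU1 : U 1%N = ideal_gen [set` map h s].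
  rewrite U_hq; apply/seteqP; split; apply: ideal_gen_sub; try exact: ideal_ideal_gen.
    move=> _ [u /(ideal_pow1 _ iq) + <-]; rewrite hs => /ideal_gen_seq[d ->].
    rewrite rmorph_sum; apply: (@idl_sum _ _ _ _ _ _ (ideal_ideal_gen _)) => t _.
    rewrite rmorphM; apply: (idlM _ (ideal_ideal_gen _)); apply: idl_gen_mem.
    by apply: map_f; exact: mem_nth.
  move=> _ /mapP[u us ->]; apply: idl_gen_in; exists u => //; apply/(ideal_pow1 _ iq).
  by rewrite hs; exact: idl_gen_mem.
have [y [Uy nPy]] : exists y, U 1%N y /\ ~ P y.
  apply: contrapT => hn; apply: nfP; exists (map h s); rewrite -eU1.
  apply/seteqP; split; first exact: U_maximal.
  by move=> y Uy; apply: contrapT => nPy; apply: hn; exists y.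
have [g hg] := big y nPy.
have ia := ideal_addgen y iP.
have ex u : exists v, u \in g -> P (u - v * y).
  have [ug|nu] := boolP (u \in g); last by exists 0.
  have [p Pp [_ [v _ <-] e]] : addgen P y u by rewrite hg; exact: idl_gen_mem.
  by exists v => _; rewrite -e addrK.
have [v hv] := choice ex.
apply: (nfP); exists (map (fun u => u - v u * y) g).
set t := map _ _; have it := ideal_ideal_gen [set` t].
have tP : ideal_gen [set` t] `<=` P.
  by apply: ideal_gen_sub => // _ /mapP[u ug ->]; exact: hv.
apply/seteqP; split=> // x Px.
have dec z : P z -> exists (d : nat -> L) z', P z' /\ z = \sum_(i < size t) d i * t`_i + z' * y.
  move=> Pz; have : ideal_gen [set` g] z.
    by rewrite -hg; exists z => //; exists 0; rewrite ?addr0 //; exists 0; rewrite ?mul0r.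
  move=> gz; have [r [w [tw ezw]]] : exists r w, ideal_gen [set` t] w /\ z = w + r * y.
    move: z {Pz} gz; apply: (@ideal_gen_sub _ _ [set z | exists r w, ideal_gen [set` t] w /\ z = w + r * y]).
      split; first by exists 0, 0; rewrite mul0r addr0; split=> //; exact: (idl0 it).
      move=> a _ _ [r [w [hw ->]]] [r' [w' [hw' ->]]]; exists (a * r + r'), (a * w + w'); split.
        by apply: (idlD it) => //; exact: (idlM _ it).
      rewrite -[a *: _]/(a * _); ring.
    move=> u ug; exists (v u), (u - v u * y); rewrite subrK; split=> //.
    by apply: idl_gen_mem; apply/mapP; exists u.
  have [d ed] := (ideal_gen_seq _ _).1 tw; exists d, r; split; last by rewrite ezw ed.
  have : P (r * y).
    have -> : r * y = z - w by rewrite ezw [w + _]addrC addrK.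
    by apply: (idlB iP) => //; exact: tP.
  by case/pP.
pose good (k : nat) z := exists2 z', P z' & z = z' * y ^+ k.
have step' (kz : nat * L) : exists dz : (nat -> L) * L, P kz.2 -> P dz.2 /\
    kz.2 = \sum_(i < size t) dz.1 i * t`_i + dz.2 * y.
  have [Pz|nz] := pselect (P kz.2); last by exists (fun=> 0, 0) => /nz.
  by have [d [z' [h1 h2]]] := dec _ Pz; exists (d, z').
have [F hF] := choice step'.
pose R := fix R k := if k is k'.+1 then (F (k', R k')).2 else x.
have PR k : P (R k) by elim: k => [//|k IH]; have [] := hF (k, R k) IH.
pose V i k := \sum_(j < k) (F (val j, R j)).1 i * y ^+ j.
have Vc i : exists w, forall k, U k (w - V i k).
  apply: (il_complete il) => k; rewrite /V big_ord_recr /= addrAC subrr add0r.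
  by apply: (idlM _ (iU k)); exact: UX.
have [w hw] := choice Vc.
have eR k : x = \sum_(i < size t) V i k * t`_i + R k * y ^+ k.
  elim: k => [|k IH].
    by rewrite big1 ?add0r ?expr0 ?mulr1 // => i _; rewrite /V big_ord0 mul0r.
  have [_ e] := hF (k, R k) (PR k).
  rewrite {1}IH [X in _ + X](_ : _ = ((\sum_(i < size t) (F (k, R k)).1 i * t`_i) + (F (k, R k)).2 * y) * y ^+ k); last by congr (_ * _); exact: e.
  rewrite /= mulrDl mulr_suml addrA -big_split exprS mulrA; congr (_ + _).
  by apply: eq_bigr => i _; rewrite /V big_ord_recr /= mulrDl; ring.
suff -> : x = \sum_(i < size t) w i * t`_i.
  apply: (@idl_sum _ _ _ _ _ _ it) => i _; apply: (idlM _ it); apply: idl_gen_mem.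
  exact: mem_nth.
apply/eqP; rewrite -subr_eq0; apply/eqP; apply: (il_sep il) => k.
rewrite {1}(eR k) addrAC -sumrB; apply: (idlD (iU k)).
  apply: (@idl_sum _ _ _ _ _ _ (iU k)) => i _; rewrite -mulrBl; apply: (idlMr _ (iU k)).
  by rewrite -opprB; apply: (idlN (iU k)); exact: hw.
by apply: (idlM _ (iU k)); exact: UX.
Qed.

Lemma complete_local : noetherian_local (U 1%N).
Proof.
split; first exact: complete_noetherian.
  split; [exact: iU|exact: U1_proper|].
  move=> P iP nP UP; apply/seteqP; split=> //; exact: U_maximal.
move=> P [iP nP mP]; apply/esym; apply: mP; [exact: iU|exact: U1_proper|exact: U_maximal].
Qed.

End CompleteRing.

(** * Flatness of the completed ring *)

Section CompleteFlat.
Variables (A B L : comNzRingType) (cst : {rmorphism A -> B}) (q : set A) (Z : set B).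
Hypotheses (nA : noetherian A) (iq : ideal q) (iZ : ideal Z).
Local Notation J := (fun N => idl_add Z (qB cst q N)).
Variables (c : {rmorphism B -> L}) (U : nat -> set L).
Hypothesis il : inverse_limit J c U.
Hypotheses (J1 : ~ J 1%N 1) (fJ : forall b, ~ J 1%N b -> exists b', J 1%N (b * b' - 1)).
Hypothesis lev : forall n (a : 'I_n -> A) N (b : 'I_n -> B), J N (\sum_i cst (a i) * b i) ->
  exists tau, relB cst q a N tau /\ forall i, Z (b i - tau i).

Lemma noeth_fun n : noetherian L -> noeth_mod ('I_n -> L^o).
Proof.
move=> nL; apply: fg_noeth => //.
pose e (i : 'I_n) : 'I_n -> L^o := fun k => (k == i)%:R.
exists (map e (enum 'I_n)); apply/seteqP; split=> // r _.
have sT := submodule_mspan [set` map e (enum 'I_n)].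
have -> : r = \sum_i r i *: e i.
  apply/funext => k; rewrite fct_sumE (bigD1 k) //= big1 => [|i /negbTE ik].
    by rewrite addr0 -[RHS]/(r k * (k == k)%:R) eqxx mulr1.
  by rewrite -[LHS]/(r i * (k == i)%:R) eq_sym ik mulr0.
apply: (@subm_sum _ _ _ _ _ _ _ sT) => i _; apply: (submZ _ sT); apply: mspan_mem.
by apply/mapP; exists i => //; rewrite mem_enum.
Qed.

(** By Krull's intersection theorem in L^n it is enough to treat r modulo each power of the maximal
    ideal. Approximate r by elements of B; [lev] produces relations modulo a high power of q, and
    Artin-Rees in A turns these into true relations up to q^k. *)
Lemma complete_frel : frel (c \o cst).
Proof.
move=> n a r hr.
have nL := complete_noetherian nA iq iZ il fJ.
have lL := complete_local nA iq iZ il J1 fJ.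
set T := mspan _; have sT : submodule T by exact: submodule_mspan.
apply: (krull_intersection (I := U 1%N) nL (noeth_fun nL) (noetherian_local_ideal lL)
  (noetherian_local_jac lL) sT) => k.
pose G : set A^o := [set x | exists u : 'I_n -> A, x = \sum_i a i * u i].
have sG : submodule G.
  split; first by exists (fun=> 0); rewrite big1 // => i _; rewrite mulr0.
  move=> d _ _ [u ->] [v ->]; exists (fun i => d * u i + v i).
  rewrite -[d *: _]/(d * _) mulr_sumr -big_split; apply: eq_bigr => i _ /=.
  by rewrite mulrDr mulrCA.
have [N hN] := @weak_artin_rees A A^o q G nA (noeth_R nA) iq sG k.
have iqk := ideal_pow_ideal q k.
have AR rho : ideal_pow q N (\sum_i a i * rho i) ->
    exists u : 'I_n -> A, (forall i, ideal_pow q k (u i)) /\ \sum_i a i * u i = \sum_i a i * rho i.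
  set x := \sum_i a i * rho i => hx.
  have : imul (ideal_pow q k) G x.
    apply: hN; last by exists rho.
    by rewrite -[x]mulr1; exact: (@imul_in A (ideal_pow q N) A^o setT x 1).
  move: x {hx}; apply: (@imul_sub A (ideal_pow q k) A^o G [set x | exists u : 'I_n -> A,
    (forall i, ideal_pow q k (u i)) /\ \sum_i a i * u i = x]).
    split; first by exists (fun=> 0); split=> [i|]; [exact: (idl0 iqk)|rewrite big1 // => i _; rewrite mulr0].
    move=> d _ _ [u [hu <-]] [v [hv <-]]; exists (fun i => d * u i + v i); split.
      by move=> i; apply: (idlD iqk) => //; exact: (idlM _ iqk).
    rewrite -[d *: _]/(d * _) mulr_sumr -big_split; apply: eq_bigr => i _ /=.
    by rewrite mulrDr mulrCA.
  move=> d _ hd [u ->]; exists (fun i => d * u i); split; first by move=> i; exact: (idlMr _ iqk).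
  by rewrite -[d *: _]/(d * _) mulr_sumr; apply: eq_bigr => i _; rewrite mulrCA.
pose W : set ('I_n -> L^o) := imul (ideal_pow (U 1%N) k) setT.
have sW : submodule W by exact: submodule_imul.
have sTW : submodule (subm_add T W) by exact: submodule_add.
have hqU j u : ideal_pow q j u -> ideal_pow (U 1%N) j (c (cst u)).
  elim: j u => // j IH; apply: (@ideal_powS_sub _ _ _ [set u | ideal_pow (U 1%N) j.+1 (c (cst u))]).
    have ij := ideal_pow_ideal (U 1%N) j.+1.
    split; first by rewrite /= !rmorph0; exact: (idl0 ij).
    by move=> d u v hu hv; rewrite /= !rmorphD !rmorphM; apply: (idlD ij) => //; exact: (idlM _ ij).
  move=> u v hu /IH hv; rewrite /= !rmorphM; apply: ideal_powS_in => //.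
  by apply: (c_qB iZ il); apply: idl_gen_in; exists u => //; exact/(ideal_pow1 _ iq).
have Wvec (w : 'I_n -> L) : (forall i, ideal_pow (U 1%N) k (w i)) -> W w.
  move=> hw; have -> : w = \sum_i w i *: ((fun j => (j == i)%:R) : 'I_n -> L^o).
    apply/funext => j; rewrite fct_sumE (bigD1 j) //= big1 => [|i /negbTE ij].
      by rewrite addr0 -[RHS]/(w j * (j == j)%:R) eqxx mulr1.
    by rewrite -[LHS]/(w i * (j == i)%:R) eq_sym ij mulr0.
  by apply: (@subm_sum _ _ _ _ _ _ _ sW) => i _; exact: imul_in.
pose M := maxn N k.
have [b hb] := choice (fun i => il_dense il (r i) M).
have JM : J M (\sum_i cst (a i) * b i).
  apply/(il_c il); have -> : c (\sum_i cst (a i) * b i) = - \sum_i c (cst (a i)) * (r i - c (b i)).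
    rewrite (eq_bigr (fun i => c (cst (a i)) * r i - c (cst (a i) * b i))).
      by rewrite sumrB [X in X - _]hr sub0r opprK rmorph_sum.
    by move=> i _; rewrite rmorphM mulrBr.
  apply: (idlN (il_ideal il M)); apply: (@idl_sum _ _ _ _ _ _ (il_ideal il M)) => i _.
  exact: (idlM _ (il_ideal il M)).
have [tau [htau hZ]] := lev JM.
have -> : r = ((fun i => c (tau i)) : 'I_n -> L^o) + (fun i => r i - c (b i)).
  apply/funext => i; rewrite -[RHS]/(c (tau i) + (r i - c (b i))).
  have := cZ il (hZ i); rewrite rmorphB => /eqP; rewrite subr_eq0 => /eqP ->.
  by rewrite addrC subrK.
apply: (submD sTW).
  move: tau htau {hZ}; apply: (@mspan_sub _ _ _ [set tau : 'I_n -> B^o |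
     subm_add T W (fun i => c (tau i))]).
    split.
      rewrite /= (_ : (fun i => _) = 0); first exact: (sub0m sTW).
      by apply/funext => i; rewrite /= rmorph0.
    move=> d u v hu hv; rewrite /= (_ : (fun i => _) =
        c d *: ((fun i => c (u i)) : 'I_n -> L^o) + (fun i => c (v i))).
      by case: sTW => _; apply.
    by apply/funext => i; rewrite /= rmorphD rmorphM.
  move=> _ [rho hrho <-].
  have [u [hu eu]] := AR rho (ideal_pow_mono (leq_maxl N k) hrho).
  exists (fun i => c (cst (rho i - u i))).
    apply: mspan_in; exists (fun i => rho i - u i) => //=.
    rewrite (eq_bigr (fun i => a i * rho i - a i * u i)); last by move=> i _; rewrite mulrBr.
    by rewrite sumrB eu subrr.
  exists (fun i => c (cst (u i))); first by apply: Wvec => i; exact: hqU.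
  by apply/funext => i; rewrite -[LHS]/(c (cst (rho i - u i)) + c (cst (u i))) !rmorphB subrK.
apply: (subm_addr sT); apply: Wvec => i.
have := U_mono il (leq_maxr N k) (hb i); rewrite (U_hq nA iZ il).
apply: ideal_gen_sub; first exact: ideal_pow_ideal.
by move=> _ [u hu <-]; exact: hqU.
Qed.

End CompleteFlat.

(** L is the completion of a polynomial ring over A, with variables for the tower of l, modulo the
    relations of the tower. Each relation is corrected by an element of qB so as to hold in S; the
    system remains triangular, which gives flatness and the maximal ideal qL. *)
Theorem gonflement (A S : comNzRingType) (l : fieldType) (q : set A) (n : set S)
    (pl : {rmorphism S -> l}) (g : {rmorphism A -> S}) N0 :
  noetherian A -> ideal q -> (forall u, q u <-> n (g u)) ->
  (forall u, ~ q u -> exists v, q (u * v - 1)) -> noetherian_local n ->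
  is_quotient n pl -> n = ideal_gen (g @` q) -> ideal_pow n N0 `<=` [set 0] ->
  exists (L : comNzRingType) (h : {rmorphism A -> L}) (pi : {rmorphism L -> S}) (mL : set L),
   [/\ noetherian_local mL, mL = ideal_gen (h @` q), frel h,
       forall u, pi (h u) = g u & forall y, exists x, pi x = y].
Proof.
move=> nA iq qn fq lS ql ng hN0.
have iN := noetherian_local_ideal lS.
have [pls _] := ql.
have plk s : pl s = 0 <-> n s by exact: residue_ker ql s.
pose phi : {rmorphism A -> l} := pl \o g.
have phiq u : phi u = 0 <-> q u by rewrite qn -plk.
have [le wo] := wochoice.well_ordering_principle l.
pose I := (l * option l)%type.
have [B [cst [var pr]]] := polynomial_ring_ex (I : choiceType) A.
have [sl hsl] := choice (fun i : I => pls (tval phi le i)).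
have [evS [evSc evSv]] := pring_eval pr g sl.
pose ev : {rmorphism B -> l} := pl \o evS.
have ev_cst u : ev (cst u) = phi u by rewrite /= evSc.
have ev_var i : ev (var i) = tval phi le i by rewrite /= evSv hsl.
have [W [p hrel]] := tower_rel_ex phiq fq wo pr ev_cst ev_var.
have evS1 y : exists b, n (y - evS b).
  by exists (var (pl y, None)); apply/plk; rewrite rmorphB evSv hsl subrr.
have approx k y : exists b, ideal_pow n k (y - evS b).
  elim: k y => [|k IH] y; first by exists 0.
  have [b hb] := evS1 y; have ik := ideal_pow_ideal n k.+1.
  suff : forall a, exists b', ideal_pow n k.+1 (a * (y - evS b) - evS b').
    by move=> /(_ 1)[b']; rewrite mul1r -addrA -opprD -rmorphD => h; exists (b + b').
  move: (y - evS b) hb; rewrite {1}ng; apply: (@ideal_gen_sub _ _ [set r | forall a,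
     exists b', ideal_pow n k.+1 (a * r - evS b')]).
    split; first by move=> a; exists 0; rewrite mulr0 rmorph0 subrr; exact: (idl0 ik).
    move=> d u v hu hv a; have [b1 h1] := hu (a * d); have [b2 h2] := hv a.
    exists (b1 + b2); rewrite -[d *: u]/(d * u) rmorphD.
    have -> : a * (d * u + v) - (evS b1 + evS b2) = (a * d * u - evS b1) + (a * v - evS b2) by ring.
    exact: (idlD ik).
  move=> _ [u qu <-] a; have [b' hb'] := IH a; exists (cst u * b').
  rewrite rmorphM evSc.
  have -> : a * g u - g u * evS b' = g u * (a - evS b') by ring.
  by apply: ideal_powS_in => //; apply/qn.
have evSs y : exists b, evS b = y.
  have [b /hN0 e] := approx N0 y; exists b; apply/eqP; rewrite eq_sym -subr_eq0.
  exact/eqP.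
have liftn y : n y -> exists b, qB cst q 1 b /\ evS b = y.
  move=> hy; suff : forall a, exists b, qB cst q 1 b /\ evS b = a * y.
    by move=> /(_ 1)[b]; rewrite mul1r; exists b.
  move: y hy; rewrite {1}ng; apply: (@ideal_gen_sub _ _ [set y | forall a,
      exists b, qB cst q 1 b /\ evS b = a * y]); have i1 := ideal_qB cst q 1.
    split; first by move=> a; exists 0; rewrite mulr0 rmorph0; split=> //; exact: (idl0 i1).
    move=> d u v hu hv a; have [b1 [h1 e1]] := hu (a * d); have [b2 [h2 e2]] := hv a.
    exists (b1 + b2); rewrite rmorphD e1 e2 -[d *: u]/(d * u); split; first exact: (idlD i1).
    by rewrite mulrDr mulrA.
  move=> _ [u qu <-] a; have [b eb] := evSs a; exists (b * cst u); split.
    by apply: (idlM _ i1); apply: idl_gen_in; exists u => //; exact/(ideal_pow1 _ iq).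
  by rewrite rmorphM evSc eb.
have exg i : exists gi, W i -> qB cst q 1 gi /\ evS gi = evS (p i).[var i].
  have [Wi|nW] := pselect (W i); last by exists 0 => /nW.
  have [_ _ h3 _] := hrel i.
  by have [|b hb] := liftn (evS (p i).[var i]); [apply/plk; exact: h3|exists b].
have [gg hgg] := choice exg.
have gq i : W i -> qB cst q 1 (gg i) by move=> /hgg[].
set Z := Zgen var W p gg.
have iZ : ideal Z by exact: ideal_ideal_gen.
have evZ b : Z b -> evS b = 0.
  move: b; apply: (@ideal_gen_sub _ _ [set b | evS b = 0]).
    split; first exact: rmorph0.
    by move=> d u v /= hu hv; rewrite rmorphD rmorphM hu hv mulr0 addr0.
  by move=> _ [i Wi <-] /=; rewrite /zrel rmorphB; have [_ ->] := hgg i Wi; rewrite subrr.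
have evqB k b : qB cst q k b -> ideal_pow n k (evS b).
  have ik := ideal_pow_ideal n k; move: b; apply: (@ideal_gen_sub _ _ [set b | ideal_pow n k (evS b)]).
    split; first by rewrite /= rmorph0; exact: (idl0 ik).
    by move=> d u v /= hu hv; rewrite rmorphD rmorphM; apply: (idlD ik) => //; exact: (idlM _ ik).
  move=> _ [u hu <-]; rewrite /= evSc; elim: k u hu {ik} => // k IH.
  have ik := ideal_pow_ideal n k.+1.
  apply: (@ideal_powS_sub _ _ _ [set u | ideal_pow n k.+1 (g u)]).
    split; first by rewrite /= rmorph0; exact: (idl0 ik).
    by move=> d u v /= hu hv; rewrite rmorphD rmorphM; apply: (idlD ik) => //; exact: (idlM _ ik).
  by move=> u v /qn hu /IH hv; rewrite /= rmorphM; exact: ideal_powS_in.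
have evJ x : ev x = 0 <-> qJ cst var W p gg q 1 x.
  split.
    move: x; apply: (tower_kernel phiq wo pr ev_cst hrel); first exact: ideal_qJ.
      move=> i Wi; exists (zrel var p gg i); first by apply: idl_gen_in; exists i.
      by exists (gg i); [exact: gq|rewrite /zrel subrK].
    move=> u qu; apply: (idl_addr iZ); apply: idl_gen_in; exists u => //.
    exact/(ideal_pow1 _ iq).
  move=> [z hz [e he <-]]; apply/plk; rewrite rmorphD (evZ _ hz) add0r.
  exact/(ideal_pow1 _ iN)/evqB.
have J1 : ~ qJ cst var W p gg q 1 1 by move=> /evJ; rewrite rmorph1 => /eqP; rewrite oner_eq0.
have fJ b : ~ qJ cst var W p gg q 1 b -> exists b', qJ cst var W p gg q 1 (b * b' - 1).
  move=> /evJ nb; have [y hy] := pls (ev b)^-1; have [b' eb'] := evSs y.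
  exists b'; apply/evJ; rewrite rmorphB rmorphM rmorph1 -[ev b']/(pl (evS b')) eb' hy divff ?subrr //.
  exact/eqP.
have q1 : ~ q 1.
  by move=> /phiq; rewrite rmorph1 => /eqP; rewrite oner_eq0.
have iJ N : ideal (qJ cst var W p gg q N) by exact: ideal_qJ.
have JS N : qJ cst var W p gg q N.+1 `<=` qJ cst var W p gg q N.
  move=> _ [z hz [e he <-]]; exists z => //; exists e => //; exact: (qB_mono (leqnSn N) he).
have [L [c [U il]]] := inverse_limit_ex iJ JS J1.
have evs y : exists x, ev x = y.
  by have [s <-] := pls y; have [b <-] := evSs s; exists b.
have lev n0 (a : 'I_n0 -> A) N (b : 'I_n0 -> B) : qJ cst var W p gg q N (\sum_i cst (a i) * b i) ->
  exists tau, relB cst q a N tau /\ forall i, Z (b i - tau i).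
  apply: (level_flat pr (@lti_irr l le) (@lti_trans l le wo) _ _ iq gq q1 fq evJ evs).
  - by move=> i Wi; have [h _ _ _] := hrel i; exact: h.
  - by move=> i Wi; have [_ h _ _] := hrel i; exact: h.
(* The map to S is read off from an approximation modulo U N0; it is well defined because n^N0 =
   0. *)
have [beta hbeta] := choice (fun x => il_dense il x N0).
have key x b : U N0 (x - c b) -> evS (beta x) = evS b.
  move=> hb; have /(il_c il)[z hz [e he eb]] : U N0 (c (beta x - b)).
    have -> : c (beta x - b) = (x - c b) - (x - c (beta x)) by rewrite rmorphB; ring.
    by apply: (idlB (il_ideal il N0)).
  apply/eqP; rewrite -subr_eq0 -rmorphB -eb rmorphD evZ // add0r; apply/eqP.
  by have /hN0 := evqB _ _ he.
have pz : zmod_morphism (evS \o beta).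
  move=> x y; rewrite /= -rmorphB; apply: key.
  have -> : x - y - c (beta x - beta y) = (x - c (beta x)) - (y - c (beta y)).
    by rewrite rmorphB; ring.
  exact: (idlB (il_ideal il N0)).
have pm : monoid_morphism (evS \o beta).
  split=> [|x y] /=.
    by rewrite -(rmorph1 evS); apply: key; rewrite rmorph1 subrr; exact: (idl0 (il_ideal il N0)).
  rewrite -rmorphM; apply: key; rewrite rmorphM.
  have -> : x * y - c (beta x) * c (beta y) = y * (x - c (beta x)) + c (beta x) * (y - c (beta y)) by ring.
  by apply: (idlD (il_ideal il N0)); exact: (idlM _ (il_ideal il N0)).
pose pi : {rmorphism L -> S} := HB.pack (evS \o beta) (GRing.isZmodMorphism.Build L S (evS \o beta) pz)
  (GRing.isMonoidMorphism.Build L S (evS \o beta) pm).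
have piE b : pi (c b) = evS b.
  by apply: key; rewrite subrr; exact: (idl0 (il_ideal il N0)).
exists L, (c \o cst : {rmorphism A -> L}), pi, (U 1%N); split.
- exact: (complete_local nA iq iZ il J1 fJ).
- rewrite (U_hq nA iZ il); congr ideal_gen; apply/seteqP; split=> _ [u hu <-]; exists u => //.
    exact/(ideal_pow1 _ iq).
  exact/(ideal_pow1 _ iq).
- exact: (complete_frel nA iq iZ il J1 fJ lev).
- by move=> u; exact: (etrans (piE (cst u)) (evSc u)).
- by move=> y; have [b <-] := evSs y; exists (c b).
Qed.

(** By duality it suffices that Hom_R(B, J) satisfies Baer's criterion. A form on the ideal (s_1,
    ..., s_n) gives the map r -> sum of phi(s_i)(r_i) on B^n; by the equational criterion it kills
    the relations, so it factors through the sum of the s_i r_i and extends to B. *)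
Lemma frel_flat (R B : comNzRingType) (f : {rmorphism R -> B}) (J : lmodType R) :
  noetherian R -> injective_module J ->
  (forall (X : lmodType R) (z : X), z != 0 -> exists h : {linear X -> J}, h z != 0) ->
  frel f -> flat (restrict f B^o).
Proof.
move=> nR iJ cJ ff; apply: (@dual_fdle _ _ iJ cJ 0); apply: baer_injective => a phi ia hphi.
have [s hs] := nR a ia; pose n := size s; pose W : lmodType R := restrict f B^o.
have sa i : (i < n)%N -> a s`_i by move=> hi; rewrite hs; apply: idl_gen_mem; exact: mem_nth.
pose P (r : 'I_n -> W) : W := \sum_(i < n) s`_i *: r i.
have Pl c r r' : P (c *: r + r') = c *: P r + P r'.
  rewrite /P scaler_sumr -big_split; apply: eq_bigr => i _ /=.
  rewrite -[(c *: r + r') i]/(c *: r i + r' i) scalerDr !scalerA mulrC.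
  by [].
pose Q (r : 'I_n -> W) : J := \sum_(i < n) val (phi s`_i) (r i).
have Ql c r r' : Q (c *: r + r') = c *: Q r + Q r'.
  rewrite /Q scaler_sumr -big_split; apply: eq_bigr => i _ /=.
  by rewrite -[(c *: r + r') i]/(c *: r i + r' i) homm_val.
have QD (r r' : 'I_n -> W) : Q (fun i => r i + r' i) = Q r + Q r'.
  by rewrite /Q -big_split; apply: eq_bigr => i _; rewrite homm_add.
have phi_sum (c : 'I_n -> R) : a (\sum_(i < n) c i * s`_i) /\ phi (\sum_(i < n) c i * s`_i) = \sum_(i < n) c i *: phi s`_i.
  have p0 : phi 0 = 0.
    have := hphi 1 0 0 (idl0 ia) (idl0 ia); rewrite mulr0 addr0 scale1r.
    by move=> /eqP; rewrite -subr_eq0 opprD addNKr oppr_eq0 => /eqP.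
  elim/big_rec2: _ => [|i u v _ [av ev]]; first by split; [exact: (idl0 ia)|].
  split; first by apply: (idlD ia) => //; apply: (idlM _ ia); exact: sa.
  by rewrite hphi ?ev //; exact: sa.
have PQ r : linof Pl r = 0 -> linof Ql r = 0.
  move=> Pr; have := ff n (fun i => s`_i) (r : 'I_n -> B) Pr.
  suff : mspan [set ((fun i => f (rho i)) : 'I_n -> B^o) | rho in [set rho : 'I_n -> R |
      \sum_(i < n) s`_i * rho i = 0]] `<=` [set r : 'I_n -> B^o | forall t : B, Q (fun i => t * r i : B) = 0].
    move=> h /h /(_ 1).
    have -> : (fun i => 1 * r i) = r :> ('I_n -> B) by apply/funext => i; rewrite mul1r.
    by [].
  apply: mspan_sub.
    split=> [t|c u v hu hv t].
      by rewrite /Q big1 // => i _; rewrite mulr0 homm0.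
    transitivity (Q (fun i => ((t * c * u i : B) : W) + ((t * v i : B) : W))).
      congr Q; apply/funext => i.
      by rewrite -[(c *: u + v) i]/(c * u i + v i) mulrDr mulrA.
    by rewrite QD hu hv addr0.
  move=> _ [rho hr <-] t.
  have -> : Q (fun i => t * f (rho i) : B) = val (\sum_(i < n) rho i *: phi s`_i) (t : W).
    have hval (F : 'I_n -> dual J W) x : val (\sum_i F i) x = \sum_i val (F i) x.
      elim/big_rec2: _ => [|i u v _ <-]; first exact: homm0E.
      exact: hommDE.
    rewrite hval; apply: eq_bigr => i _; rewrite hommZE; congr (val _ _).
    by rewrite mulrC.
  have [_ <-] := phi_sum rho.
  rewrite (_ : \sum_i _ = 0); last by rewrite -[RHS]hr; apply: eq_bigr => i _; rewrite mulrC.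
  have := hphi 1 0 0 (idl0 ia) (idl0 ia); rewrite mulr0 addr0 scale1r.
  by move=> /eqP; rewrite -subr_eq0 opprD addNKr oppr_eq0 => /eqP ->; rewrite homm0E.
have [Zm [p [e [ps ei ep]]]] := im_fact (linof Pl).
have [|g hg] := fact_surj (g := linof Ql) ps.
  by move=> r pr; apply: PQ; rewrite -ep pr linear0.
have [w hw] := iJ _ _ e g ei.
exists (lin_dual w) => x; rewrite hs => /ideal_gen_seq[c ->].
have [_ ->] := phi_sum (fun i => c i).
apply: hommP => b; rewrite dual_scale lin_dualE -linearZ.
have -> : (\sum_(i < size s) c i * s`_i) *: (b : W) = linof Pl (fun i => c i *: (b : W)).
  rewrite scaler_suml; apply: eq_bigr => i _; rewrite mulrC -scalerA.
  by [].
rewrite -ep hw hg -[RHS]/(\sum_(i < n) val (phi s`_i) (c i *: (b : W))).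
have hval (F : 'I_n -> dual J W) y : val (\sum_i F i) y = \sum_i val (F i) y.
  elim/big_rec2: _ => [|i u v _ <-]; first exact: homm0E.
  exact: hommDE.
by rewrite hval; apply: eq_bigr.
Qed.

(** Apply the equational criterion to y followed by generators of a: in every relation over A the
    coefficient of y lies in (a : y) = a. *)
Lemma frel_colon (A B : comNzRingType) (f : {rmorphism A -> B}) (a : set A) y b :
  noetherian A -> frel f -> ideal a -> (forall u, a (y * u) -> a u) ->
  ideal_gen (f @` a) (f y * b) -> ideal_gen (f @` a) b.
Proof.
move=> nA ff ia hy; have [s hs] := nA a ia.
have iG := ideal_ideal_gen (f @` a).
have -> : ideal_gen (f @` a) = ideal_gen [set` map f s].
  apply/seteqP; split; apply: ideal_gen_sub; try exact: ideal_ideal_gen.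
    move=> _ [u + <-]; rewrite hs => /ideal_gen_seq[c ->].
    rewrite rmorph_sum; apply: (@idl_sum _ _ _ _ _ _ (ideal_ideal_gen _)) => i _.
    rewrite rmorphM; apply: (idlM _ (ideal_ideal_gen _)); apply: idl_gen_mem.
    by apply: map_f; exact: mem_nth.
  move=> _ /mapP[u us ->]; apply: idl_gen_in; exists u => //.
  by rewrite hs; exact: idl_gen_mem.
set T := ideal_gen _; have iT : ideal T by exact: ideal_ideal_gen.
have fT u : a u -> T (f u).
  rewrite hs => /ideal_gen_seq[c ->]; rewrite rmorph_sum.
  apply: (@idl_sum _ _ _ _ _ _ iT) => i _; rewrite rmorphM; apply: (idlM _ iT).
  by apply: idl_gen_mem; apply: map_f; exact: mem_nth.
move=> /ideal_gen_seq[c]; rewrite size_map => e.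
pose aa (i : 'I_(size s).+1) := if unlift ord0 i is Some j then s`_j else y.
pose rr (i : 'I_(size s).+1) := if unlift ord0 i is Some j then - c j else b.
have := ff _ aa rr; rewrite big_ord_recl /aa /rr unlift_none.
rewrite (eq_bigr (fun j : 'I_(size s) => - (c j * (map f s)`_j))); last first.
  by move=> j _; rewrite liftK (nth_map 0) // mulrN mulrC.
rewrite sumrN -e subrr => /(_ erefl).
suff sub : mspan [set ((fun i => f (rho i)) : 'I_(size s).+1 -> B^o) |
    rho in [set rho : 'I_(size s).+1 -> A | \sum_i aa i * rho i = 0]] `<=`
    [set r : 'I_(size s).+1 -> B^o | T (r ord0)].
  by move=> /sub /=; rewrite unlift_none.
apply: mspan_sub.
  split; first exact: (idl0 iT).
  by move=> d u v hu hv; apply: (idlD iT) => //; exact: (idlM _ iT).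
move=> _ [rho hr <-] /=; apply: fT; apply: hy.
move: hr; rewrite /= big_ord_recl /aa unlift_none => /eqP; rewrite addr_eq0 => /eqP ->.
apply: (idlN ia); apply: (@idl_sum _ _ _ _ _ _ ia) => j _; rewrite liftK; apply: (idlMr _ ia).
by rewrite hs; apply: idl_gen_mem; exact: mem_nth.
Qed.

(** * Chains of prime ideals *)

Section Chains.
Variable L : comNzRingType.
Hypothesis nL : noetherian L.
Implicit Types (K : set L) (s : seq L).

Definition regular_over K s : Prop := forall j y, (j < size s)%N ->
  ideal_gen (K `|` [set` take j s]) (s`_j * y) -> ideal_gen (K `|` [set` take j s]) y.

Lemma regular_over_rcons K s a : regular_over K (rcons s a) -> regular_over K s /\
  forall y, ideal_gen (K `|` [set` s]) (a * y) -> ideal_gen (K `|` [set` s]) y.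
Proof.
move=> h; split=> [j y js|y].
  have := h j y; rewrite size_rcons ltnS (ltnW js) nth_rcons js -cats1 takel_cat ?(ltnW js) //.
  exact.
have := h (size s) y; rewrite size_rcons ltnSn nth_rcons ltnn eqxx -cats1 take_size_cat //.
exact.
Qed.

Lemma pchain_rcons n (P : nat -> set L) (Q : set L) : pchain n P -> prime_ideal Q -> P n `<` Q ->
  pchain n.+1 (fun i => if (i <= n)%N then P i else Q).
Proof.
move=> [h1 h2] pQ PQ; split=> i.
  by rewrite leq_eqVlt => /orP[/eqP ->|]; [rewrite ltnn|rewrite ltnS => hi; rewrite hi; exact: h1].
by rewrite ltnS => hi; rewrite hi; case: ltnP => hi'; [exact: h2|have -> : i = n by apply/eqP; rewrite eqn_leq hi].
Qed.

(* A regular element avoids the minimal primes, which consist of zero         *)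
(* divisors, so that each member of s lengthens the chain.                    *)
Lemma regular_chain K s (Q : set L) : prime_ideal Q -> K `|` [set` s] `<=` Q -> regular_over K s ->
  exists P : nat -> set L, [/\ pchain (size s) P, P (size s) = Q & K `<=` P 0%N].
Proof.
elim/last_ind: s Q => [|s a IH] Q pQ KQ hreg.
  by exists (fun=> Q); split=> // u Ku; apply: KQ; left.
have [hreg' ha] := regular_over_rcons hreg.
have KQ' : K `|` [set` s] `<=` Q.
  by move=> u [Ku|/= us]; apply: KQ; [left|right; rewrite /= mem_rcons inE us orbT].
have [Q' mQ' Q'Q] := minover_ex pQ KQ'.
have [pQ' KQ'' _] := mQ'.
have naQ' : ~ Q' a.
  move=> /(minover_nilp nL mQ')[k [b [nb]]]; elim: k b nb => [|k IHk] b nb.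
    rewrite expr0 mul1r => hb; apply: nb; move: hb; apply: ideal_gen_sub => //.
    by have [] := pQ'.
  by rewrite exprS -mulrA => /ha; exact: IHk.
have [P [cP eP KP]] := IH Q' pQ' KQ'' hreg'.
exists (fun i => if (i <= size s)%N then P i else Q); split=> //; rewrite size_rcons.
  apply: pchain_rcons => //; rewrite eP; split=> // h; apply: naQ'; apply: h.
  by apply: KQ; right; rewrite /= mem_rcons mem_head.
by rewrite ltnn.
Qed.

Lemma local_prime (m : set L) : noetherian_local m -> prime_ideal m.
Proof.
move=> lm; have [_ [im n1 _] _] := lm; split=> // x y mxy.
have [mx|nx] := pselect (m x); first by left.
have [u hu] := noetherian_local_unit lm nx; right.
by rewrite -[y]mul1r -hu -mulrA mulrCA; exact: (idlM _ im).
Qed.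

Lemma proper_sub_local (m I : set L) : noetherian_local m -> ideal I -> ~ I 1 -> I `<=` m.
Proof.
move=> lm iI n1 x Ix; apply: contrapT => nx; have [u hu] := noetherian_local_unit lm nx.
by apply: n1; rewrite -hu; exact: (idlMr _ iI).
Qed.

(** The last prime of the chain is replaced by m, to which the height theorem applies. *)
Lemma local_chain_le (m : set L) s n (P : nat -> set L) : noetherian_local m -> minover [set` s] m ->
  pchain n P -> (n <= size s)%N.
Proof.
move=> lm ms cP; have [h1 h2] := cP; have pm := local_prime lm.
have subm i : (i <= n)%N -> P i `<=` m.
  by move=> /h1[iP n1 _]; exact: proper_sub_local lm iP n1.
case: n => // n in cP h1 h2 subm *.
have ms' : minover (set0 `|` [set` s]) m by rewrite set0U.
apply: (krull_height (P := fun i => if (i <= n)%N then P i else m) nL ms') => //; last by rewrite ltnn.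
apply: pchain_rcons => //.
  by split=> i hi; [apply: h1; exact: leqW|apply: h2; exact: leqW].
have [h3 h4] := h2 n (ltnSn n); split; first exact: (subm n).
by move=> mP; apply: h4; apply: subset_trans mP; exact: subm.
Qed.

End Chains.

(** Going down for flat extensions. A minimal prime Q over the extension of the next lower prime,
    chosen below P' 0, contracts to that prime: elements outside it remain regular modulo the
    extension by [frel_colon], whereas Q consists of zero divisors. *)
Lemma going_down (R L : comNzRingType) (f : {rmorphism R -> L}) n (P : nat -> set R) k (P' : nat -> set L) :
  noetherian R -> noetherian L -> frel f -> pchain n P -> pchain k P' ->
  (forall a, P' 0%N (f a) <-> P n a) ->
  exists P'', pchain (n + k) P'' /\ P'' (n + k)%N = P' k.
Proof.
move=> nR nL ff; elim: n P k P' => [|n IH] P k P' [h1 h2] cP' hP'; first by exists P'.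
have [pP' hs] := cP'; have pP0 := pP' 0%N (leq0n k).
have [pPn nPn pPnm] := h1 n (leqnSn n); have [sPn nsPn] := h2 n (ltnSn n).
have [|Q mQ QP] := @minover_ex L (f @` P n) (P' 0%N) pP0.
  by move=> _ [a /sPn ha <-]; apply/hP'.
have [pQ fQ _] := mQ.
have cQ a : Q (f a) <-> P n a.
  split=> [Qa|ha]; last by apply: fQ; exists a.
  apply: contrapT => na; have [j [b [nb hb]]] := minover_nilp nL mQ Qa.
  apply: nb; have : ideal_gen (f @` P n) b.
    apply: (frel_colon (y := a ^+ j) nR ff pPn); last by rewrite rmorphXn.
    by move=> u /pPnm[/(prime_ideal_exp (h1 n (leqnSn n)))|].
  by apply: ideal_gen_sub => //; have [] := pQ.
have [|||P'' [cP'' eP'']] := IH P k.+1 (fun i => if i is j.+1 then P' j else Q).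
- by split=> i hi; [apply: h1; exact: leqW|apply: h2; exact: leqW].
- split=> [[|i]|[|i]] //= hi; [exact: pP'| |exact: hs].
  split=> // hQ; apply: nsPn => a /hP' /hQ; exact: (cQ a).1.
- exact: cQ.
by exists P''; rewrite addSnnS.
Qed.

(** * Exactness of the Koszul complex *)

Section KoszulExact.
Variable L : comNzRingType.
Hypothesis nL : noetherian L.
Implicit Types (z s : seq L) (phi psi om : seq bool -> L^o) (K I : set L).

Lemma kos_ideal I z phi b : ideal I -> size b = size z ->
  (forall c, size c = size b -> (deg c).+1 = deg b -> I (phi c)) -> I (kos z phi b).
Proof.
move=> iI; elim: z phi b => [|x z IH] phi [|[] b] //= sb h; try exact: (idl0 iI).
  rewrite kos_true; apply: (idlB iI).
    by apply: (idlM _ iI); apply: h; rewrite /= ?add0n ?add1n.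
  by apply: IH => [|c sc dc]; [case: sb|apply: h; rewrite /= ?sc // !add1n dc].
by rewrite kos_false; apply: IH => [|c sc dc]; [case: sb|apply: h; rewrite /= ?sc // !add0n].
Qed.

Lemma con_ideal I s phi b : ideal I ->
  (forall c, size c = size b -> deg c = (deg b).+1 -> I (phi c)) -> I (con s phi b).
Proof.
move=> iI; elim: s phi b => [|x s IH] phi [|[] b] //= h; try exact: (idl0 iI).
  by apply: (idlN iI); apply: IH => c sc dc; apply: h; rewrite /= ?sc // !add1n dc.
apply: (idlD iI); first by apply: (idlM _ iI); apply: h; rewrite /= ?add1n ?add0n.
by apply: IH => c sc dc; apply: h; rewrite /= ?sc // !add0n.
Qed.

(* A regular sequence in the radical of (z) makes the Koszul cohomology       *)
(* vanish below its length: each member is injective and nilpotent on it.     *)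
Lemma koszul_vanish z ys K i phi : regular_over K ys ->
  (forall y, y \in ys -> exists N, ideal_gen [set` z] (y ^+ N)) -> (i < size ys)%N ->
  (forall b, size b = size z -> deg b = i.+1 -> ideal_gen K (kos z phi b)) ->
  exists om, forall b, size b = size z -> deg b = i -> ideal_gen K (phi b - kos z om b).
Proof.
elim: ys K i phi => [|y ys IH] K i phi // hreg hpow iys hphi.
have iK := ideal_ideal_gen K.
have regy u : ideal_gen K (y * u) -> ideal_gen K u.
  by have := hreg 0%N u isT; rewrite take0 /= (_ : [set` [::]] = set0) ?setU0 // -subset0.
have hreg' : regular_over (K `|` [set y]) ys.
  move=> j u js; have := hreg j.+1 u js; rewrite /=.
  have -> : K `|` [set` y :: take j ys] = K `|` [set y] `|` [set` take j ys].
    rewrite -setUA; congr (_ `|` _); apply/seteqP; split=> x /=.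
      by rewrite inE => /orP[/eqP|]; [left|right].
    by rewrite inE => -[->|->]; rewrite ?eqxx ?orbT.
  exact.
have hpow' u : u \in ys -> exists N, ideal_gen [set` z] (u ^+ N).
  by move=> us; apply: hpow; rewrite inE us orbT.
have inj ph psi : (forall b, size b = size z -> deg b = i -> ideal_gen K (y * ph b - kos z psi b)) ->
    exists om, forall b, size b = size z -> deg b = i -> ideal_gen K (ph b - kos z om b).
  case: i iys {hphi} => [|i] iys hps.
    exists (fun=> 0) => b sb db; have := hps b sb db.
    by rewrite !kos_deg0 // !subr0; exact: regy.
  have sub : ideal_gen K `<=` ideal_gen (K `|` [set y]).
    by apply: ideal_gen_sub; [exact: ideal_ideal_gen|move=> u Ku; apply: idl_gen_in; left].
  have iKy := ideal_ideal_gen (K `|` [set y]).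
  have [|chi hchi] := IH (K `|` [set y]) i psi hreg' hpow' iys.
    move=> b sb db; have h := sub _ (hps b sb db).
    rewrite -(subKr (y * ph b) (kos z psi b)); apply: (idlB iKy) => //.
    by apply: (idlMr _ iKy); apply: idl_gen_in; right.
  have ex b : exists w : L^o, size b = size z -> deg b = i -> ideal_gen K (psi b - kos z chi b - y * w).
    have [[sb db]|nb] := pselect (size b = size z /\ deg b = i); last first.
      by exists 0 => sb db; case: nb.
    suff [w hw] : exists w, ideal_gen K (psi b - kos z chi b - y * w) by exists (w : L^o).
    move: (hchi b sb db); apply: (@ideal_gen_sub L _ [set u | exists w, ideal_gen K (u - y * w)]).
      split; first by exists 0; rewrite mulr0 subrr; exact: (idl0 iK).
      move=> c u v [w hw] [w' hw']; exists (c * w + w'); rewrite -[c *: u]/(c * u).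
      have -> : c * u + v - y * (c * w + w') = c * (u - y * w) + (v - y * w') by ring.
      by apply: (idlD iK) => //; exact: (idlM _ iK).
    move=> u [Ku|->]; first by exists 0; rewrite mulr0 subr0; exact: idl_gen_in.
    by exists 1; rewrite mulr1 subrr; exact: (idl0 iK).
  have [w hw] := choice ex; exists w => b sb db; apply: regy.
  have e1 : kos z (fun c => psi c - kos z chi c - y *: (w c : L^o)) b =
      kos z psi b - y * kos z w b.
    by rewrite kosB kosB koskos subr0 kosZ.
  have h1 : ideal_gen K (kos z (fun c => psi c - kos z chi c - y *: (w c : L^o)) b).
    apply: kos_ideal => // c sc dc; apply: hw; first by rewrite sc.
    by apply: succn_inj; rewrite dc.
  have -> : y * (ph b - kos z w b) = (y * ph b - kos z psi b) + (kos z psi b - y * kos z w b) by ring.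
  by apply: (idlD iK); [exact: hps|rewrite -e1].
have [N hN] := hpow y (mem_head _ _).
have iz := ideal_ideal_gen [set` z].
have [s ss es] : exists2 s, size s = size z & y ^+ N = dot s z.
  by move/ideal_gen_seq: hN => [c ->]; exists (mkseq c (size z)); rewrite ?size_mkseq //
    dot_nth ?size_mkseq //; apply: eq_bigr => j _; rewrite nth_mkseq.
have : forall b, size b = size z -> deg b = i -> ideal_gen K (y ^+ N * phi b - kos z (con s phi) b).
  move=> b sb db; rewrite es -[dot s z * _]/(dot s z *: phi b) -(kos_con _ ss sb) addrAC subrr add0r.
  by apply: con_ideal => // c sc dc; apply: hphi; rewrite ?sc // dc db.
elim: N (con s phi) {hN es} => [|N IHN] psi h.
  by exists psi => b sb db; have := h b sb db; rewrite expr0 mul1r.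
have [|om hom] := inj (fun b => y ^+ N * phi b) psi.
  by move=> b sb db; rewrite mulrA -exprS; exact: h.
exact: IHN hom.
Qed.

Definition exact_at z i : Prop := forall phi,
  (forall b, size b = size z -> deg b = i.+1 -> kos z phi b = 0) ->
  exists om, forall b, size b = size z -> deg b = i -> phi b = kos z om b.

Lemma kos_top_ideal z om : ideal_gen [set` z] (kos z om (nseq (size z) true)).
Proof.
elim: z om => [|x z IH] om; first exact: (idl0 (ideal_ideal_gen _)).
have iz := ideal_ideal_gen [set` x :: z].
rewrite kos_true; apply: (idlB iz).
  by apply: (idlMr _ iz); apply: idl_gen_mem; exact: mem_head.
move: (IH (fun c => om (true :: c))); apply: (@ideal_gen_sub L _ (ideal_gen [set` x :: z])) => // u uz.
by apply: idl_gen_mem; rewrite inE uz orbT.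
Qed.

Lemma kos_top z u : ideal_gen [set` z] u -> exists om, kos z om (nseq (size z) true) = u.
Proof.
elim: z u => [|x z IH] u.
  by move=> /(@mspan_nil L L^o) ->; exists (fun=> 0).
move=> /ideal_gen_cons[r [v [/IH[om hom] ->]]].
exists (fun b => if b is true :: c then - om c else r).
rewrite kos_true kosN opprK hom; congr (_ + _).
exact: mulrC.
Qed.

Variable m : set L.
Hypothesis lL : noetherian_local m.

(** Exactness for x :: z in degree size z says that x is regular modulo (z), which explains the
    reversal. In lower degrees it makes x act surjectively on the cohomology of z; as x is in m,
    Krull's intersection theorem makes that cohomology vanish. *)
Lemma exact_regular z : (forall u, u \in z -> m u) -> (forall i, (i < size z)%N -> exact_at z i) ->
  weakly_regular (rev z).
Proof.
elim: z => [|x z IH] // zm hz; rewrite rev_cons; apply/weakly_regular_rcons.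
have revE : ideal_gen [set` rev z] = ideal_gen [set` z].
  by congr ideal_gen; apply/seteqP; split=> u /=; rewrite mem_rev.
split; last first.
  move=> y; rewrite revE => /kos_top[psi hpsi].
  have dT k : deg (nseq k true) = k by rewrite deg_nseq mul1n.
  have topE (b : seq bool) k : size b = k -> deg b = k -> b = nseq k true.
    elim: b k => [|b0 b IHb] [|k] //= [sb]; have := count_size id b.
    rewrite -/(deg b) sb; case: b0 => /= h; last by rewrite add0n => e; rewrite e ltnn in h.
    by rewrite add1n => -[db]; rewrite (IHb k sb db).
  have [|om hom] := hz (size z) (ltnSn _) (fun b => if b is true :: c then psi c else y).
    move=> b sb db; rewrite (topE b (size z).+1 sb db) /=.
    rewrite kos_true [X in _ - X]hpsi.
    by rewrite -[_ *: _]/(x * y) subrr.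
  have := hom (false :: nseq (size z) true); rewrite /= size_nseq => /(_ erefl).
  rewrite /deg /= -/(deg _) dT => /(_ (add0n _)) ->.
  by rewrite kos_false; exact: kos_top_ideal.
apply: IH => [u uz|i iz]; first by apply: zm; rewrite inE uz orbT.
have im := noetherian_local_ideal lL; have mx : m x by apply: zm; exact: mem_head.
pose n := size z; pose T : finType := (n.-tuple bool).
(* A cocycle phi for z in degree i, put behind a leading [true], is a cocycle for x :: z in degree i
   + 1; writing it as a coboundary divides phi by x up to coboundaries. *)
have step phi : (forall b, size b = size z -> deg b = i.+1 -> kos z phi b = 0) ->
   exists phi1 om, (forall b, size b = size z -> deg b = i.+1 -> kos z phi1 b = 0) /\
     forall b, size b = size z -> deg b = i -> phi b = x * phi1 b + kos z om b.
  move=> hphi.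
  have [||Om hOm] := hz i.+1 _ (fun b => if b is true :: c then phi c else 0) => //.
    case=> [|[] b] //= [sb].
      rewrite /deg /= add1n => -[db]; rewrite kos_true scaler0 sub0r.
      by rewrite (_ : kos z _ b = 0) ?oppr0 //; exact: hphi.
    by move=> _; rewrite kos_false; apply: kosg0 => c u; rewrite scaler0.
  exists (fun c => Om (false :: c)), (fun c => - Om (true :: c)); split=> b sb db.
    by have := hOm (false :: b); rewrite /= sb /deg /= -/(deg b) db add0n kos_false => /(_ erefl erefl) <-.
  have := hOm (true :: b); rewrite /= sb /deg /= -/(deg b) db add1n kos_true kosN => /(_ erefl erefl) ->.
  by [].
move=> phi hphi.
pose N : set (T -> L^o) := [set v | exists om, forall b : T, deg b = i -> v b = kos z om b].
have sN : submodule N.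
  split; first by exists (fun=> 0) => b _; rewrite /kos kosg0 // => c u; rewrite scaler0.
  move=> a u v [om1 h1] [om2 h2]; exists (fun c => a *: om1 c + om2 c) => b db.
  by rewrite kosD kosZ -h1 // -h2.
have nV : noeth_mod (T -> L^o).
  apply: fg_noeth => //; pose ee (t : T) : T -> L^o := fun k => (k == t)%:R.
  exists (map ee (enum T)); apply/seteqP; split=> // r _.
  have sT := submodule_mspan [set` map ee (enum T)].
  have -> : r = \sum_t r t *: ee t.
    apply/funext => k; rewrite fct_sumE (bigD1 k) //= big1 => [|t /negbTE ik].
      by rewrite addr0 -[RHS]/(r k * (k == k)%:R) eqxx mulr1.
    by rewrite -[LHS]/(r t * (k == t)%:R) eq_sym ik mulr0.
  apply: (@subm_sum _ _ _ _ _ _ _ sT) => t _; apply: (submZ _ sT); apply: mspan_mem.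
  by apply/mapP; exists t => //; rewrite mem_enum.
have : N (fun b : T => phi b).
  apply: (krull_intersection (I := m) nL nV im (noetherian_local_jac lL) sN) => k.
  have [phik [om [h1 h2]]] : exists (phik : seq bool -> L^o) om, (forall b, size b = size z -> deg b = i.+1 -> kos z phik b = 0) /\
      forall b, size b = size z -> deg b = i -> phi b = x ^+ k * phik b + kos z om b.
    elim: k => [|k [phik [om [h1 h2]]]].
      exists phi, (fun=> 0); split=> // b sb db.
      by rewrite expr0 mul1r /kos kosg0 ?addr0 // => c u; rewrite scaler0.
    have [phi1 [om1 [g1 g2]]] := step phik h1.
    exists phi1, (fun c => (x ^+ k) *: om1 c + om c); split=> // b sb db.
    rewrite h2 // g2 // kosD kosZ mulrDr mulrA -exprSr -addrA.
    by [].
  exists (fun b : T => if deg b == i then kos z om b else phi b).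
    by exists om => b ->; rewrite eqxx.
  exists (fun b : T => if deg b == i then x ^+ k * phik b else 0); last first.
    apply/funext => b; rewrite -[LHS]/((if _ then _ else _) + (if _ then _ else _)).
    by case: eqP => [db|_]; rewrite ?addr0 // addrC -h2 // size_tuple.
  have -> : (fun b : T => if deg b == i then x ^+ k * phik b else 0) =
      x ^+ k *: ((fun b : T => if deg b == i then phik b else 0) : T -> L^o).
    apply/funext => b; rewrite -[RHS]/(x ^+ k * (if deg b == i then phik b else 0)).
    by case: ifP => _ //; rewrite mulr0.
  by apply: imul_in => //; exact: ideal_pow_exp.
move=> [om hom]; exists om => b sb db.
have bT : size b == n by rewrite sb.
by have := hom (Tuple bT) db.
Qed.

End KoszulExact.

(** * Cohen presentations *)

Section Images.
Variables (L Q : comNzRingType) (p : {rmorphism L -> Q}).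

Lemma preimage_ideal (I : set Q) : ideal I -> ideal [set u : L | I (p u)].
Proof.
move=> iI; split; first by rewrite /= rmorph0; exact: (idl0 iI).
move=> c u v /= hu hv; rewrite -[c *: u]/(c * u) rmorphD rmorphM.
by apply: (idlD iI) => //; exact: (idlM _ iI).
Qed.

Lemma ideal_gen_map (A : set L) u : ideal_gen A u -> ideal_gen (p @` A) (p u).
Proof.
apply: (@ideal_gen_sub L A [set u | ideal_gen (p @` A) (p u)]).
  exact: (preimage_ideal (ideal_ideal_gen _)).
by move=> v Av; apply: idl_gen_in; exists v.
Qed.

Lemma ideal_gen_image_gen (A : set L) : ideal_gen (p @` ideal_gen A) = ideal_gen (p @` A).
Proof.
apply/seteqP; split; last first.
  apply: (ideal_gen_sub (ideal_ideal_gen _)) => _ [u Au <-].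
  by apply: idl_gen_in; exists u => //; exact: idl_gen_in.
apply: (ideal_gen_sub (ideal_ideal_gen _)) => _ [u Au <-].
exact: ideal_gen_map.
Qed.

Lemma image_seq (s : seq L) : p @` [set` s] = [set` map p s].
Proof.
apply/seteqP; split=> [_ [u us <-]|_ /= /mapP[u us ->]]; first exact: map_f.
by exists u.
Qed.

Hypothesis sp : forall y, exists x, p x = y.

Lemma image_ideal (I : set L) : ideal I -> ideal (p @` I).
Proof.
move=> iI; split; first by exists 0; rewrite ?rmorph0 //; exact: (idl0 iI).
move=> c _ _ [u Iu <-] [v Iv <-]; have [c' <-] := sp c.
exists (c' * u + v); last by rewrite rmorphD rmorphM.
by apply: (idlD iI) => //; exact: (idlM _ iI).
Qed.

Lemma image_gen (A : set L) : p @` ideal_gen A = ideal_gen (p @` A).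
Proof.
apply/seteqP; split=> [_ [u Au <-]|]; first exact: ideal_gen_map.
apply: (ideal_gen_sub (image_ideal (ideal_ideal_gen _))) => _ [u Au <-].
by exists u => //; exact: idl_gen_in.
Qed.

Lemma noetherian_image : noetherian L -> noetherian Q.
Proof.
move=> nL I iI; have [s hs] := nL _ (preimage_ideal iI).
exists (map p s); rewrite -image_seq -image_gen -hs.
apply/seteqP; split=> [y Iy|_ [u Iu <-] //]; have [u hu] := sp y.
by exists u => //=; rewrite hu.
Qed.

Lemma image_mem (I : set L) u : ideal I -> (forall x, p x = 0 -> I x) ->
  (p @` I) (p u) -> I u.
Proof.
move=> iI kI [v Iv e]; rewrite -(subrK v u); apply: (idlD iI) => //.
by apply: kI; rewrite rmorphB e subrr.
Qed.

Lemma noetherian_local_image (m : set L) : noetherian_local m -> (forall x, p x = 0 -> m x) ->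
  noetherian_local (p @` m).
Proof.
move=> lm km; have [nL [im n1 mm] _] := lm; have ip := image_ideal im.
have np : ~ (p @` m) 1.
  by move=> h; apply: n1; apply: (image_mem im km); rewrite rmorph1.
have sub J : ideal J -> ~ J 1 -> J `<=` p @` m.
  move=> iJ J1 y Jy; have [u hu] := sp y; exists u => //.
  apply: (proper_sub_local lm (preimage_ideal iJ)); first by rewrite /= rmorph1.
  by rewrite /= hu.
split; first exact: noetherian_image.
  by split=> // J iJ J1 mJ; apply/seteqP; split=> //; exact: sub.
by move=> I [iI I1 hI]; rewrite (hI _ ip np) //; exact: sub.
Qed.

Lemma image_prime (P : set L) : prime_ideal P -> (forall x, p x = 0 -> P x) ->
  prime_ideal (p @` P).
Proof.
move=> [iP P1 hP] kP; split; first exact: image_ideal.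
  by move=> h; apply: P1; apply: (image_mem iP kP); rewrite rmorph1.
move=> y1 y2; have [u1 <-] := sp y1; have [u2 <-] := sp y2.
rewrite -rmorphM => /(image_mem iP kP)/hP[h|h]; [left|right]; by apply: imageP.
Qed.

Lemma image_pchain k (P : nat -> set L) : pchain k P -> (forall x, p x = 0 -> P 0%N x) ->
  pchain k (fun j => p @` P j).
Proof.
move=> cP k0; have [h1 h2] := cP.
have kP j : (j <= k)%N -> forall x, p x = 0 -> P j x.
  by move=> jk x /k0; apply: (pchain_sub cP); rewrite jk.
split=> j jk; first by apply: image_prime; [exact: h1|exact: kP].
have [s1 s2] := h2 j jk; split; first exact: image_subset.
move=> h; apply: s2 => u Pu; have [iP _ _] := h1 j (ltnW jk).
by apply: (image_mem iP (kP _ (ltnW jk))); apply: h; exists u.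
Qed.

End Images.

Section RegularOver.

Lemma regular_over_gen (L : comNzRingType) (K K' : set L) s :
  ideal_gen K = ideal_gen K' -> regular_over K s -> regular_over K' s.
Proof.
move=> KK h j y js.
have genU T : ideal_gen (K' `|` T) = ideal_gen (K `|` T).
  have sub (X Y : set L) : ideal_gen X = ideal_gen Y -> ideal_gen (X `|` T) `<=` ideal_gen (Y `|` T).
    move=> XY; apply: (ideal_gen_sub (ideal_ideal_gen _)) => u [Xu|Tu].
      2: by apply: idl_gen_in; right.
    have : ideal_gen Y u by rewrite -XY; exact: idl_gen_in.
    by apply: (ideal_gen_sub (ideal_ideal_gen _)) => v Yv; apply: idl_gen_in; left.
  by apply/seteqP; split; apply: sub.
by rewrite genU; exact: h.
Qed.

Lemma regular_over_cat (L : comNzRingType) (K : set L) s t :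
  regular_over K s -> regular_over (K `|` [set` s]) t -> regular_over K (s ++ t).
Proof.
move=> hs ht j y; rewrite size_cat nth_cat take_cat => jst; case: ltnP => js.
  exact: (hs _ _ js).
have jt : (j - size s < size t)%N by rewrite ltn_subLR.
have := ht _ y jt; rewrite -setUA (_ : _ `|` [set` take _ t] = [set` s ++ take (j - size s) t]) //.
by apply/seteqP; split=> u /=; rewrite mem_cat => /orP.
Qed.

Lemma regular_over_map (A L : comNzRingType) (h : {rmorphism A -> L}) K s :
  noetherian A -> frel h -> regular_over K s -> regular_over (h @` K) (map h s).
Proof.
move=> nA fh hs j y; rewrite size_map => js.
have genE : ideal_gen (h @` K `|` [set` take j (map h s)]) =
    ideal_gen (h @` ideal_gen (K `|` [set` take j s])).
  by rewrite ideal_gen_image_gen image_setU image_seq map_take.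
rewrite genE (nth_map 0) //; apply: (frel_colon nA fh (ideal_ideal_gen _)) => u.
exact: hs.
Qed.

End RegularOver.

(** * Dimension counts for the presentation *)

Section Dimensions.
Variables (R L : comNzRingType) (m : set R) (mL : set L) (f1 : {rmorphism R -> L}).
Hypotheses (lR : noetherian_local m) (lL : noetherian_local mL).
Hypotheses (fm : f1 @` m `<=` mL) (f1r : frel f1).
Variables (gs : seq R) (W z : seq L) (N : nat).
Hypotheses (gm : forall u, u \in gs -> m u) (gr : weakly_regular gs).
Hypotheses (mLE : mL = ideal_gen (f1 @` m `|` [set` W])) (Wr : regular_over (f1 @` m) W).
Hypotheses (zm : forall u, u \in z -> mL u) (zN : ideal_pow mL N `<=` ideal_gen [set` z]).
Hypothesis sz : size z = (size gs + size W)%N.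

Lemma gen_minover (Q : comNzRingType) (q : set Q) (s : seq Q) :
  noetherian_local q -> q = ideal_gen [set` s] -> minover [set` s] q.
Proof.
move=> lq qs; split; [exact: local_prime|by move=> u us; rewrite qs; exact: idl_gen_in|].
by move=> P [iP _ _] sP _; rewrite qs; exact: (ideal_gen_sub iP).
Qed.

Lemma fiber_chain : exists P : nat -> set L,
  [/\ pchain (size W) P, P (size W) = mL & f1 @` m `<=` P 0%N].
Proof.
have [nL _ _] := lL; apply: (regular_chain nL) => //; first exact: local_prime.
by rewrite mLE; exact: sub_ideal_gen.
Qed.

(** W generates the maximal ideal of the fibre and, being regular over mL, produces a chain of
    primes of length size W. The height theorem then makes both edim and dim equal to size W. *)
Lemma fiber_regular : exists (Q : comNzRingType) (p : {rmorphism L -> Q}) (mQ : set Q),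
  is_quotient (ideal_gen (f1 @` m)) p /\ regular_local mQ.
Proof.
have [nL [iL n1 _] _] := lL.
have sub : ideal_gen (f1 @` m) `<=` mL by apply: (ideal_gen_sub iL).
have [Q [p qp]] := ring_quot_ex (ideal_ideal_gen (f1 @` m)) (fun h => n1 (sub _ h)).
have [sp kp] := qp; have kE x : p x = 0 <-> ideal_gen (f1 @` m) x by rewrite -kp.
have lQ : noetherian_local (p @` mL).
  by apply: (noetherian_local_image sp lL) => x /kE/sub.
have nQ := noetherian_image sp nL.
have gQ : p @` mL = ideal_gen [set` map p W].
  rewrite mLE (image_gen sp) image_setU image_seq; apply/seteqP; split.
    apply: (ideal_gen_sub (ideal_ideal_gen _)) => u [[v hv <-]|us]; last exact: idl_gen_in.
    have -> : p v = 0 by apply/kE; exact: idl_gen_in.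
    exact: (idl0 (ideal_ideal_gen _)).
  by apply: (ideal_gen_sub (ideal_ideal_gen _)) => u us; apply: idl_gen_in; right.
have [P [cP PW P0]] := fiber_chain.
have [h1 _] := cP; have [iP0 _ _] := h1 0%N isT.
have cQ : pchain (size W) (fun j => p @` P j).
  by apply: (image_pchain sp cP) => x /kE; exact: (ideal_gen_sub iP0).
have le s k (P' : nat -> set Q) : p @` mL = ideal_gen [set` s] -> pchain k P' -> (k <= size s)%N.
  by move=> hs; apply: (local_chain_le nQ lQ); exact: gen_minover.
exists Q, p, (p @` mL); split=> //; split=> //.
rewrite /edim /krull_dim (@nat_inf_min _ (size W)) ?(@nat_sup_max _ (size W)) //.
- by exists (fun j => p @` P j).
- by move=> j [P' cP']; rewrite -(size_map p W); exact: (le _ _ P').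
- by exists (map p W); rewrite size_map.
- by move=> j [s [<- hs]]; exact: (le s _ _ hs cQ).
Qed.

(** The regular sequence gs gives one inequality. Conversely a chain of length j in R, its top
    replaced by m, lifts by going down below a fibre chain to length j + size W in L, whose maximal
    ideal is minimal over size gs + size W elements. *)
Lemma krull_dim_base : krull_dim R = (size gs)%:Z%:E.
Proof.
have [nR [iR m1 _] _] := lR; have [nL [iL n1 _] _] := lL.
apply: nat_sup_max.
  have [||P [cP _ _]] := regular_chain nR (K := set0) (s := gs) (local_prime lR).
  - by rewrite set0U => u; exact: gm.
  - by move=> j y js; rewrite set0U; exact: gr.
  by exists P.
move=> j [P cP]; pose P' k := if (k == j)%N then m else P k.
have [h1 h2] := cP.
have subm k : (k <= j)%N -> P k `<=` m.
  by move=> kj; have [iP P1 _] := h1 k kj; exact: (proper_sub_local lR).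
have cP' : pchain j P'.
  split=> k kj; rewrite /P'; first by case: eqP => // _; [exact: local_prime|exact: h1].
  rewrite (ltn_eqF kj); case: eqP => [kj'|_]; last exact: h2.
  have [s1 s2] := h2 k kj; split; first exact: (subm _ (ltnW kj)).
  by move=> h; apply: s2; apply: subset_trans (subm _ _) h.
have [W' [cW WW W0]] := fiber_chain; have [pW0 _] := cW; have [iW0 nW0 _] := pW0 0%N isT.
have eqW a : W' 0%N (f1 a) <-> P' j a.
  rewrite /P' eqxx; split=> [h|ma]; last by apply: W0; exists a.
  apply: contrapT => nma; have [b ab] := noetherian_local_unit lR nma.
  by apply: nW0; rewrite -(rmorph1 f1) -ab rmorphM; exact: (idlMr _ iW0).
have [P'' [cP'' _]] := going_down nR nL f1r cP' cW eqW.
have mz : minover [set` z] mL.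
  split; [exact: local_prime|by move=> u; exact: zm|move=> X [iX X1 pX] zX _ u mu].
  have : X (u ^+ N) by apply: (ideal_gen_sub iX zX); apply: zN; exact: ideal_pow_exp.
  elim: N => [|k IH]; first by rewrite expr0 => /X1.
  by rewrite exprS => /pX[|/IH].
by have := local_chain_le nL lL mz cP''; rewrite sz leq_add2r.
Qed.

(** Every member of T has a power in (z), so [koszul_vanish] makes the Koszul complex of z exact
    below degree size T = size z. *)
Lemma koszul_regular (T : seq L) : regular_over set0 T -> (forall u, u \in T -> mL u) ->
  size T = size z -> regular_sequence (rev z).
Proof.
move=> rT Tm sT; have [nL [iL n1 _] _] := lL; split.
  move=> h; apply: n1; move: h; apply: (ideal_gen_sub iL) => u; rewrite /= mem_rev.
  exact: zm.
have gen0 u : ideal_gen (set0 : set L) u -> u = 0.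
  by move=> h; apply: (@mspan_nil L L^o); rewrite (_ : [set` [::]] = set0) // -subset0.
apply: (exact_regular nL lL zm) => i iz phi hphi.
have [|||om hom] := @koszul_vanish L z T set0 i phi rT.
- by move=> u /Tm mu; exists N; apply: zN; exact: ideal_pow_exp.
- by rewrite sT.
- by move=> b sb db; rewrite hphi //; exact: (idl0 (ideal_ideal_gen _)).
by exists om => b sb db; apply/eqP; rewrite -subr_eq0; apply/eqP/gen0; exact: hom.
Qed.

End Dimensions.

(** * Nilpotent maximal ideal: dimension and completion *)

Section ZeroDimensional.
Variables (S : comNzRingType) (n : set S) (N : nat).
Hypotheses (lS : noetherian_local n) (nN : ideal_pow n N `<=` [set 0]).

Lemma krull_dim_nilpotent : krull_dim S = 0%:E.
Proof.
apply: (@nat_sup_max _ 0%N).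
  by exists (fun=> n); split=> // i _; exact: local_prime.
case=> [//|j] [P [h1 h2]]; exfalso.
have nP k : (k <= j.+1)%N -> n `<=` P k.
  move=> kj u nu; have [iP P1 pP] := h1 k kj.
  have : P k (u ^+ N) by rewrite (nN (ideal_pow_exp N nu)); exact: (idl0 iP).
  elim: (N) => [|i IH]; first by rewrite expr0 => /P1.
  by rewrite exprS => /pP[|/IH].
have [_ s] := h2 0%N isT; apply: s; have [iP P1 _] := h1 1%N isT.
by apply: subset_trans (proper_sub_local lS iP P1) (nP 0%N _).
Qed.

(** From index N on the quotients S/n^(i+1) are S itself, and so is the limit. *)
Lemma completion_nilpotent : is_completion n (idfun : {rmorphism S -> S}).
Proof.
have [_ [iN n1 _] _] := lS.
have sub i : ideal_pow n i.+1 `<=` n.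
  by move=> u /(ideal_pow_mono (ltn0Sn i)) /(ideal_pow1 _ iN).
have ex i : exists T : {Q : comNzRingType & {rmorphism S -> Q}},
    is_quotient (ideal_pow n i.+1) (projT2 T).
  have [Q [p hp]] := ring_quot_ex (ideal_pow_ideal n i.+1) (fun h => n1 (sub _ _ h)).
  by exists (existT _ Q p).
have [T hT] := choice ex; pose Q i := projT1 (T i); pose p i := projT2 (T i).
have kE i x : p i x = 0 <-> ideal_pow n i.+1 x by have [_ <-] := hT i.
have sp i : forall y, exists x, p i x = y by case: (hT i).
have ext i : exists t : {rmorphism Q i.+1 -> Q i}, forall x, t (p i.+1 x) = p i x.
  apply: ring_fact => [y|x /kE h]; first exact: sp.
  by apply/kE; apply: (ideal_pow_mono _ h).
pose t i := projT1 (cid (ext i)).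
have tE i x : t i (p i.+1 x) = p i x := projT2 (cid (ext i)) x.
exists Q, p, t, p; split=> // y hy.
have pinj x x' : p N x = p N x' -> x = x'.
  move=> e; apply/eqP; rewrite -subr_eq0; apply/eqP; apply: nN.
  by apply: (ideal_pow_mono (leqnSn N)); apply/kE; rewrite rmorphB e subrr.
have desc i k x : p (i + k)%N x = y (i + k)%N -> p i x = y i.
  elim: k => [|k IH]; first by rewrite addn0.
  by rewrite addnS => e; apply: IH; rewrite -tE e hy.
have [x hx] := sp N (y N); exists x; split=> [i|x' hx']; last first.
  by apply: pinj; rewrite hx hx'.
have [x' hx'] := sp (i + N)%N (y (i + N)%N).
rewrite (_ : x = x'); first exact: (desc i N).
by apply: pinj; rewrite hx; symmetry; apply: (desc N i); rewrite addnC.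
Qed.

End ZeroDimensional.

Section Presentation.
Variables (R S : comNzRingType) (m : set R) (n : set S) (f : {rmorphism R -> S}).
Hypotheses (lR : noetherian_local m) (lS : noetherian_local n) (fmn : local_hom m n f).
Variables (x : seq R) (ys : seq S) (d : nat).
Hypotheses (mx : min_gens m x) (ny : n = ideal_gen [set` ys]).
Hypothesis rde : size x = (d + size ys)%N.
Variable M : lmodType S.
Hypotheses (M0 : nonzero_module M) (fM : fin_gen M) (hM : idle d (restrict f M)).
Variables (L : comNzRingType) (mL : set L) (f1 : {rmorphism R -> L}) (pi : {rmorphism L -> S}).
Hypotheses (lL : noetherian_local mL) (spi : forall y, exists u, pi u = y).
Hypothesis pif : forall a, pi (f1 a) = f a.
Variable W : seq L.
Hypotheses (mLE : mL = ideal_gen (f1 @` m `|` [set` W])) (piW : map pi W = ys).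

(* The relations expressing f(x_a) through the generators of n already cut    *)
(* out the kernel, since M is faithful over the quotient by them as well.     *)
Lemma kernel_presentation :
  exists z, [/\ size z = size x, kernel pi = ideal_gen [set` z] & forall u, u \in z -> mL u].
Proof.
have iL := noetherian_local_ideal lL.
have mxE : m = ideal_gen [set` x] by case: mx.
have wP a : exists w, m a -> ideal_gen [set` W] w /\ pi w = f a.
  have [ma|na] := pselect (m a); last by exists 0.
  have : n (f a) by apply: fmn; exists a.
  by rewrite ny -piW -image_seq -(image_gen spi) => -[w h1 h2]; exists w.
have [w hw] := choice wP.
pose z := [seq f1 a - w a | a <- x].
have zx u : u \in z -> exists2 a, m a & u = f1 a - w a.
  by move=> /mapP[a ax ->]; exists a => //; rewrite mxE; exact: idl_gen_mem.
have WmL : ideal_gen [set` W] `<=` mL.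
  by apply: (ideal_gen_sub iL) => u hu; rewrite mLE; apply: idl_gen_in; right.
have f1m a : m a -> mL (f1 a) by move=> ma; rewrite mLE; apply: idl_gen_in; left; exists a.
have zm u : u \in z -> mL u.
  by move=> /zx[a ma ->]; apply: (idlB iL); [exact: f1m|apply: WmL; case: (hw a ma)].
have zk u : ideal_gen [set` z] u -> pi u = 0.
  apply: (@ideal_gen_sub L _ [set u | pi u = 0]).
    split; first exact: rmorph0.
    by move=> c s t /= hs ht; rewrite -[c *: s]/(c * s) rmorphD rmorphM hs ht mulr0 addr0.
  by move=> v /zx[a ma ->]; rewrite /= rmorphB pif (hw a ma).2 subrr.
have z1 : ~ ideal_gen [set` z] 1 by move=> /zk; rewrite rmorph1 => /eqP; rewrite oner_eq0.
have [S' [p [sp kp]]] := ring_quot_ex (ideal_ideal_gen _) z1.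
have kE u : p u = 0 <-> ideal_gen [set` z] u by rewrite -kp.
have [sg hsg] : exists h : {rmorphism S' -> S}, forall u, h (p u) = pi u.
  by apply: ring_fact => [y|u /kE/zk //]; exact: sp.
have lS' : noetherian_local (p @` mL).
  by apply: (noetherian_local_image sp lL) => u /kE; apply: (ideal_gen_sub iL) => v; exact: zm.
pose f' : {rmorphism R -> S'} := p \o f1.
have genW u : ideal_gen [set` W] u -> ideal_gen [set` map p W] (p u).
  by move=> /(@ideal_gen_map _ _ p); rewrite image_seq.
have f1W a : m a -> ideal_gen [set` map p W] (p (f1 a)).
  rewrite mxE; apply: (ideal_gen_sub (@preimage_ideal _ _ f' _ (ideal_ideal_gen [set` map p W]))) => b bx.
  have mb : m b by rewrite mxE; exact: idl_gen_mem.
  have e : p (f1 b) = p (w b).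
    apply/eqP; rewrite -subr_eq0 -rmorphB; apply/eqP/kE; apply: idl_gen_mem.
    exact: (map_f (fun a => f1 a - w a)).
  change (ideal_gen [set` map p W] (p (f1 b))); rewrite e.
  by apply: genW; case: (hw b mb).
have ny' : p @` mL = ideal_gen [set` map p W].
  apply/seteqP; split.
    rewrite {1}mLE (image_gen sp); apply: (ideal_gen_sub (ideal_ideal_gen _)) => _ [u [[a ma <-]|us] <-].
      exact: f1W.
    by apply: genW; exact: idl_gen_in.
  apply: (ideal_gen_sub (image_ideal sp iL)) => u /= /mapP[v vW ->].
  by exists v => //; apply: WmL; exact: idl_gen_mem.
have fmn' : local_hom m (p @` mL) f'.
  by move=> _ [a ma <-]; exists (f1 a) => //; exact: f1m.
pose M' : lmodType S' := restrict sg M.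
have hl a (u v : restrict f' M') : ((a *: u + v : restrict f' M') : restrict f M) =
    a *: (u : restrict f M) + (v : restrict f M).
  rewrite -[LHS]/(sg (p (f1 a)) *: (u : M) + (v : M)).
  by rewrite -[RHS]/(f a *: (u : M) + (v : M)) hsg pif.
have hM' : idle d (restrict f' M').
  apply: (@ext_le_iso R set0 0 d _ _ (linof hl)) => // u; exists u; exact: erefl.
have M0' : nonzero_module M' by case: M0 => v v0; exists v.
have fM' : fin_gen M'.
  have [s hs] := fM; exists s; apply/seteqP; split=> // u _.
  have [t0 tD] := @submodule_mspan S' M' [set` s].
  have : @mspan S M [set` s] u by rewrite hs.
  apply: (@mspan_sub S M _ (@mspan S' M' [set` s])) => [|v vs]; last exact: mspan_mem.
  split=> // c v1 v2 h1 h2; have [c' hc'] := spi c.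
  by have := tD (p c') v1 v2 h1 h2; rewrite -[p c' *: _]/(sg (p c') *: (v1 : M)) hsg hc'.
have rde' : size x = (d + size (map p W))%N by rewrite rde -piW !size_map.
(* S' = L/(z) with its e generators of the maximal ideal satisfies the hypotheses made on S. So M is
   faithful over S', and an element of L acting as 0 on M lies in (z). *)
have faith := faithful_over_S lR lS' fmn' mx ny' rde' M0' fM' hM'.
exists z; split=> //; first by rewrite size_map.
apply/seteqP; split=> u; last exact: zk.
move=> hu; apply/kE; apply: faith => v.
by rewrite -[LHS]/(sg (p u) *: (v : M)) hsg hu scale0r.
Qed.

End Presentation.

Lemma ideal_pow_map (L S : comNzRingType) (pi : {rmorphism L -> S}) (I : set L) (J : set S) N u :
  (forall v, I v -> J (pi v)) -> ideal_pow I N u -> ideal_pow J N (pi u).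
Proof.
move=> h; elim: N u => [//|N IH] u.
apply: (ideal_gen_sub (@preimage_ideal _ _ pi _ (ideal_pow_ideal J N.+1))) => _ [a Ia [b Ib <-]].
by rewrite /= rmorphM; apply: ideal_powS_in; [exact: h|exact: IH].
Qed.

(** * The exceptional complete intersection property *)

Section Exceptional.
Variables (R S : comNzRingType) (m : set R) (n : set S) (l : fieldType).
Variables (pl : {rmorphism S -> l}) (f : {rmorphism R -> S}).
Hypotheses (lR : noetherian_local m) (lS : noetherian_local n) (fmn : local_hom m n f).
Hypothesis ql : is_quotient n pl.
Variables (x : seq R) (ys : seq S) (d : nat).
Hypotheses (mx : min_gens m x) (my : min_gens n ys).
Hypothesis rde : size x = (d + size ys)%N.
Variable M : lmodType S.
Hypotheses (M0 : nonzero_module M) (fM : fin_gen M) (hM : idle d (restrict f M)).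

(** S is its own completion and R -> L -> S is a Cohen factorization. The images of the regular
    sequence of R, followed by W, have length d + e = r, as [koszul_regular] requires. Both edim R -
    dim R = r - d and edim S - dim S = e - 0 are e. *)
Lemma exceptional_of_idle : exceptional_ci_map m n f.
Proof.
have ny : n = ideal_gen [set` ys] by case: my.
have [nR _ _] := lR; have iR := noetherian_local_ideal lR; have iN := noetherian_local_ideal lS.
have [_ [_ n1 _] _] := lS.
have [N nN] := nilpotent_max_ideal lR lS fmn mx ny rde M0 fM hM.
have [v0 hv0] := M0; have [c [cv0 csoc]] := socle_ex nN hv0.
have [gs [sgs gm gr]] := regular_sequence_ex lR lS fmn mx ny rde hM cv0 csoc.
have [J [Ji Jc]] := injective_cogenerator_ex lR fmn hM cv0 csoc.
have [A [i [g [q [Y tw]]]]] := tower_ex f iR ys.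
have nA := tw_noeth tw nR; have iq := tw_q tw.
(* A is not assumed local; A/q is a field because each element is congruent modulo q to one of R,
   which is a unit or in m. *)
have residue u : exists c b, q (u - i c) /\ (q u \/ c * b = 1).
  have [a ha] := tw_res tw u; have [ma|nma] := pselect (m a).
    exists a, 0; split=> //; left; rewrite -(subrK (i a) u); apply: (idlD iq) => //.
    by apply/(tw_qi tw).
  by have [b ab] := noetherian_local_unit lR nma; exists a, b; split=> //; right.
have qn u : q u <-> n (g u).
  split=> [|nu]; first exact: (tower_local iN fmn ny tw).
  have [a [b [h1 [//|ab]]]] := residue u; exfalso; apply: n1.
  rewrite -(rmorph1 f) -ab rmorphM; apply: (idlMr _ iN).
  rewrite -(tw_comp tw) -(subKr (g u) (g (i a))) -rmorphB; apply: (idlB iN) => //.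
  exact: (tower_local iN fmn ny tw).
have fq u : ~ q u -> exists v, q (u * v - 1).
  have [a [b [h1 [//|ab]]]] := residue u; exists (i b).
  rewrite -(rmorph1 i) -ab rmorphM -mulrBl; exact: (idlMr _ iq).
have nq : n = ideal_gen (g @` q).
  apply/seteqP; split; last by apply: (ideal_gen_sub iN) => _ [u qu <-]; apply/qn.
  rewrite {1}ny -(tw_Y tw) -image_seq; apply: (ideal_gen_sub (ideal_ideal_gen _)) => _ [u uY <-].
  by apply: idl_gen_in; exists u => //; exact: (tw_Yq tw).
have [L [h [pi [mL [lL mLq hr pig spi]]]]] := gonflement nA iq qn fq lS ql nq nN.
pose f1 : {rmorphism R -> L} := h \o i; pose W := map h Y.
have qE : q = ideal_gen (i @` m `|` [set` Y]).
  apply/seteqP; split.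
    apply: (tw_gen tw (ideal_ideal_gen _)) => [a ma|u uY]; apply: idl_gen_in; last by right.
    by left; exists a.
  apply: (ideal_gen_sub iq) => u [[a ma <-]|uY]; first by apply/(tw_qi tw).
  exact: (tw_Yq tw).
have mLE : mL = ideal_gen (f1 @` m `|` [set` W]).
  by rewrite mLq qE ideal_gen_image_gen image_setU image_seq image_comp.
have f1m a : m a -> mL (f1 a) by move=> ma; rewrite mLE; apply: idl_gen_in; left; exists a.
have Wr : regular_over (f1 @` m) W.
  rewrite -[f1 @` m](image_comp i h); apply: (regular_over_map nA hr) => j y jY.
  exact: (tw_reg tw iR jY).
have Tr : regular_over set0 (map f1 gs ++ W).
  have := @regular_over_map A L h set0 (map i gs ++ Y) nA hr.
  rewrite image_set0 map_cat -map_comp; apply; apply: regular_over_cat.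
    have := @regular_over_map R A i set0 gs nR (tw_flat tw); rewrite image_set0; apply => j y js.
    by rewrite set0U; exact: gr.
  apply: (@regular_over_gen A (i @` ideal_gen [set` gs])).
    by rewrite ideal_gen_image_gen image_seq set0U.
  by move=> j y jY; apply: (tw_reg tw (ideal_ideal_gen _) jY).
have pif a : pi (f1 a) = f a by rewrite /= pig (tw_comp tw).
have piW : map pi W = ys.
  by rewrite -map_comp -(tw_Y tw); apply: eq_map => u; rewrite /= pig.
have [z [sz kz zm]] := kernel_presentation lR fmn mx ny rde M0 fM hM lL spi pif mLE piW.
have pim u : mL u -> n (pi u).
  rewrite mLE; apply: (ideal_gen_sub (@preimage_ideal _ _ pi _ iN)) => v [[a ma <-]|vW].
    by change (n (pi (f1 a))); rewrite pif; apply: fmn; exists a.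
  by change (n (pi v)); rewrite ny; apply: idl_gen_mem; rewrite -piW; exact: map_f.
have zN : ideal_pow mL N `<=` ideal_gen [set` z].
  by rewrite -kz => u /(ideal_pow_map pim)/nN.
have sW : size W = size ys by rewrite -piW [RHS]size_map.
have sz' : size z = (size gs + size W)%N by rewrite sz rde sgs sW.
have fm : f1 @` m `<=` mL by move=> _ [a ma <-]; exact: f1m.
have f1r : frel f1 by exact: (frel_comp (tw_flat tw) hr).
have Tm u : u \in map f1 gs ++ W -> mL u.
  rewrite mem_cat => /orP[/mapP[a ag ->]|uW]; first exact: (f1m _ (gm _ ag)).
  by rewrite mLE; apply: idl_gen_in; right.
split.
  exists S, n, idfun, L, mL, f1, pi; split=> //.
  - exact: (completion_nilpotent lS nN).
  - split=> //; first by split=> // _ [u mu <-]; exact: pim.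
    split; first exact: (frel_flat nR Ji Jc f1r).
    exact: (fiber_regular lL fm mLE Wr).
  exists (rev z); split.
    by apply: (koszul_regular lL zm zN Tr Tm); rewrite size_cat size_map sz'.
  by rewrite kz; congr ideal_gen; apply/seteqP; split=> u /=; rewrite mem_rev.
have -> : edim m = (size x)%:Z%:E by case: mx => _ [].
have -> : edim n = (size ys)%:Z%:E by case: my => _ [].
rewrite (krull_dim_base lR lL f1r gm gr mLE Wr zm zN sz') (krull_dim_nilpotent lS nN).
by rewrite sgs rde -!EFinB subr0 PoszD addrC addKr.
Qed.

End Exceptional.

Theorem theorem3p12 (R S : comNzRingType) (m : set R) (n : set S)
    (k l : fieldType) (pk : {rmorphism R -> k}) (pl : {rmorphism S -> l})
    (f : {rmorphism R -> S}) (M : lmodType S) :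
  noetherian_local m -> is_quotient m pk ->
  noetherian_local n -> is_quotient n pl ->
  local_hom m n f ->
  nonzero_module M -> fin_gen M ->
  (inj_dim (restrict f M) <= edim m - edim n)%E ->
  [/\ injective_module M /\
        (exists (r : nat) (E : lmodType S)
           (j : {linear residue_module pl -> E}),
           [/\ has_type pl M r, injective_envelope j &
               mod_iso M {ffun 'I_r -> E}]),
      exceptional_ci_map m n f,
      inj_dim (restrict f M) = (edim m - edim n)%E /\
        (edim m - edim n)%E = flat_dim (restrict f S^o) &
      injective_module (restrict f M) ->
        edim m = edim n /\ flat (restrict f S^o)].
Proof.
move=> lR _ lS ql fmn M0 fM hid.
have [x mx] := min_gens_ex lR; have [ys my] := min_gens_ex lS.
have ny : n = ideal_gen [set` ys] by case: my.
have ex : edim m = (size x)%:Z%:E by case: mx => _ [].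
have ey : edim n = (size ys)%:Z%:E by case: my => _ [].
(* The right-hand side of the hypothesis is finite, so the injective dimension is attained by a
   resolution of some length j; in particular edim S <= edim R, and the truncated subtraction
   defining d is exact. *)
have [j [[I [e [dI [res van]]]] jle]] : exists j, (exists (I : nat -> lmodType R)
    (e : {linear restrict f M -> I 0%N}) (d : forall i, {linear I i -> I i.+1}),
    injective_resolution e d /\ forall i, (j < i)%N -> forall x : I i, x = 0) /\
    (j + size ys <= size x)%N.
  move: hid; rewrite ex ey -EFinB /inj_dim; set B := (X in nat_inf X).
  case: (nat_infP B) => [[j [Bj [_ ->]]]|->].
    by rewrite lee_fin lerBrDr -PoszD lez_nat; exists j.
  by [].
pose d := (size x - size ys)%N.
have rde : size x = (d + size ys)%N by rewrite subnK //; apply: leq_trans jle; exact: leq_addl.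
have jd : (j <= d)%N by rewrite leq_subRL ?rde ?leq_addl // addnC -rde.
have hM : idle d (restrict f M) := idle_mono jd (idle_resolution res van).
have ed : (edim m - edim n)%E = d%:Z%:E by rewrite ex ey rde -EFinB PoszD addrK.
have iM := injective_over_S lR lS fmn mx ny rde M0 fM hM.
have [N nN] := nilpotent_max_ideal lR lS fmn mx ny rde M0 fM hM.
have [v0 hv0] := M0; have [c [cv0 csoc]] := socle_ex nN hv0.
split.
- by split=> //; exact: (matlis_structure lS ql M0 fM iM nN).
- exact: (exceptional_of_idle lR lS fmn ql mx my rde M0 fM hM).
- rewrite ed (flat_dimE lR lS fmn ql hM iM cv0 csoc mx ny rde); split=> //.
  by apply: (inj_dimE lR lS fmn cv0 csoc mx ny rde); rewrite -ed.
move=> iRM; split.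
  have d0 : d = 0%N by apply/eqP; rewrite -leqn0; exact: (idle_lower lR lS fmn cv0 csoc mx ny rde).
  by rewrite ex ey rde d0.
by have [_ [_]] := fdle_iff lR lS fmn ql hM iM cv0 csoc; apply.
Qed.
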